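(* Let $u=(u_i)_i\in\mathbb{L}^\infty$ and $\rho^0=(\rho_i^0)_i\in\mathbb{L}^2$. Then there exists a unique weak solution $\rho=(\rho_i)_i\in\mathbb{W}(0,T)$ of the (homogeneous) Fokker--Planck state equation on the star graph with drift $u$ and initial datum $\rho^0$. In addition, there exists a constant $C>0$ depending on $T$, $\underline{D}$, $\bar D$ and continuously on $\|u\|_{\mathbb{L}^\infty}$ such that $$\|\rho\|_{\mathcal{C}([0,T];\mathbb{L}^2)}+\|\rho\|_{L^2(0,T;\mathbb{V})}\le C\|\rho^0\|_{\mathbb{L}^2},\qquad \|\rho\|_{\mathbb{W}(0,T)}\le C\|\rho^0\|_{\mathbb{L}^2}.$$
   Context: Fix $N\ge 1$, $T>0$, lengths $l_i>0$ and constants $D_i>0$, $i=1,\dots,N$; set $\bar D=\max_i D_i$, $\underline{D}=\min_i D_i$, $Q_i=(0,l_i)\times(0,T)$. The star graph has $N$ edges $(0,l_i)$ joined at the common vertex $x=0$. Spaces: $\mathbb{L}^2=\prod_{i=1}^N L^2(0,l_i)$ with $\|v\|_{\mathbb{L}^2}^2=\sum_i\|v_i\|_{L^2(0,l_i)}^2$; $\mathbb{L}^\infty=\prod_{i=1}^N L^\infty(Q_i)$ with $\|u\|_{\mathbb{L}^\infty}=\sum_i\|u_i\|_{L^\infty(Q_i)}$; $\mathbb{H}^1=\prod_{i=1}^N H^1(0,l_i)$ with $\|v\|_{\mathbb{H}^1}^2=\sum_i\|v_i\|_{H^1(0,l_i)}^2$; $$\mathbb{V}=\{\varphi\in\mathbb{H}^1:\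 \varphi_i(0)=\varphi_j(0)\ (i\ne j),\ \varphi_i(l_i)=0,\ i,j=1,\dots,N\}$$ with the $\mathbb{H}^1$ norm, a Hilbert space. $\mathbb{V}^\star$ is its dual, and $\mathbb{L}^2$ is identified with its dual so that $\mathbb{V}\hookrightarrow\mathbb{L}^2\hookrightarrow\mathbb{V}^\star$. $\mathbb{W}(0,T)=\{\rho\in L^2(0,T;\mathbb{V}):\rho_t\in L^2(0,T;\mathbb{V}^\star)\}$ with $\|\rho\|_{\mathbb{W}(0,T)}^2=\|\rho\|_{L^2(0,T;\mathbb{V})}^2+\|\rho_t\|_{L^2(0,T;\mathbb{V}^\star)}^2$; it embeds continuously in $\mathcal{C}([0,T];\mathbb{L}^2)$. The state equation is, formally, for $i,j=1,\dots,N$ and $t\in(0,T)$: $\partial_t\rho_i-D_i\partial_x^2\rho_i-\partial_x(u_i\rho_i)=0$ in $Q_i$; $\rho_i(x,0)=\rho_i^0(x)$; $\sum_{i=1}^N[D_i\partial_x\rho_i(0,t)+u_i(0,t)\rho_i(0,t)]=0$; $\rho_i(0,t)=\rho_j(0,t)$ for $i\neq j$; $\rho_i(l_i,t)=0$. A weak solution is a function $\rho\in\mathbb{W}(0,T)$ such that $\rho(\cdot,0)=\rho^0$ in $\mathbb{L}^2$ and, for all $\varphi=(\varphi_i)_i\in\mathbb{V}$, $$\sum_{i=1}^N\frac{d}{dt}(\rho_i(\cdot),\varphi_i)_{L^2(0,l_i)}+\mathcal{F}[u](\rho(\cdot),\varphi)=0\quad\text{in }\mathcal{D}'(0,T),$$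 where at (a.e.) time $t$ $$\mathcal{F}[u](\rho,\varphi)=\sum_{i=1}^N\int_0^{l_i}\left(D_i\frac{\partial\rho_i}{\partial x}+u_i\rho_i\right)\frac{\partial\varphi_i}{\partial x}\,dx.$$ ''$C$ depends on $T,\underline D,\bar D$ and continuously on $\|u\|_{\mathbb{L}^\infty}$'' means that $C$ is the value of a function of $(T,\underline D,\bar D,\|u\|_{\mathbb{L}^\infty})$, continuous in the last argument, and does not depend on $\rho^0$. *)

(* Defs.v *)
(* MathComp-Analysis.  Elements of Lebesgue and Sobolev spaces are handled as
   functions up to almost-everywhere equality: the spaces below are sets of
   representatives, and the norms are extended-real valued seminorms that do
   not depend on the representative. *)
From HB Require Import structures.
From mathcomp Require Import all_boot all_order all_algebra.
From mathcomp Require Import all_classical all_reals all_analysis.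

Set Implicit Arguments.
Unset Strict Implicit.
Unset Printing Implicit Defensive.
Import Order.TTheory GRing.Theory Num.Theory.
Import numFieldNormedType.Exports.
Local Open Scope ring_scope.
Local Open Scope classical_set_scope.

Section one_dimension.
Variable R : realType.
Notation mu := (@lebesgue_measure R).

(* C^oo_c(]a, b[) *)
Definition test_fun (a b : R) : set (R -> R) := [set psi |
  (forall n x, derivable (derive1n n psi) x 1) /\
  (let supp := closure [set x | psi x != 0] in
   compact supp /\ supp `<=` `]a, b[)].

Definition L2 (l : R) : set (R -> R) :=
  [set f | f \_ `]0, l[ \in Lfun mu 2%:E].

Definition L2norm (l : R) (f : R -> R) : \bar R :=
  'N[mu]_2%:E[EFin \o (f \_ `]0, l[)].

Definition is_weak_deriv (l : R) (f w : R -> R) :=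
  L2 l w /\ forall psi, test_fun 0 l psi ->
    \int[mu]_(x in `]0, l[) (f x * derive1 psi x) =
    - \int[mu]_(x in `]0, l[) (w x * psi x).

Definition H1 (l : R) : set (R -> R) :=
  [set f | L2 l f /\ exists w, is_weak_deriv l f w].

(* The weak derivative of f when f is in H1 (unique up to a.e. equality). *)
Definition weak_deriv (l : R) (f : R -> R) : R -> R :=
  xget (fun=> 0) [set w | is_weak_deriv l f w].

Definition H1norm (l : R) (f : R -> R) : \bar R :=
  sqrte (L2norm l f ^+ 2 + L2norm l (weak_deriv l f) ^+ 2)%E.

(* g is the representative of f that is continuous on [0, l]; the boundary
   values of f in H1(0, l) are those of g. *)
Definition is_cont_rep (l : R) (f g : R -> R) :=
  {within `[0, l], continuous g} /\ g = f %[ae mu in `]0, l[].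

End one_dimension.

(* L^2(0, T; E), for E the subset S of X with norm p. *)
Section Bochner.
Variables (R : realType) (X : zmodType) (S : set X) (p : X -> \bar R) (T : R).
Notation mu := (@lebesgue_measure R).

Definition simple_fun (s : R -> X) :=
  exists n (A : 'I_n -> set R) (c : 'I_n -> X),
    [/\ forall k, measurable (A k), forall k, S (c k) &
        forall t, s t = \sum_(k < n | t \in A k) c k].

Definition strongly_measurable (f : R -> X) :=
  exists s : nat -> R -> X, (forall n, simple_fun (s n)) /\
    \forall t \ae mu, `]0, T[ t -> (p (f t - s n t) @[n --> \oo] --> 0%E).

Definition L2_Bochner_norm (f : R -> X) : \bar R :=
  sqrte (\int[mu]_(t in `]0%R, T[) (p (f t) ^+ 2))%E.

Definition L2_Bochner : set (R -> X) := [set f |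
  [/\ \forall t \ae mu, `]0, T[ t -> S (f t), strongly_measurable f &
      (L2_Bochner_norm f < +oo)%E]].

End Bochner.

Section star_graph.
Variables (R : realType) (N : nat) (T : R) (l : 'I_N -> R).
Notation mu := (@lebesgue_measure R).
Notation mu2 := (@lebesgue_measure R \x @lebesgue_measure R)%E.
Notation edge_fun := ('I_N -> R -> R).
Implicit Types (v phi : edge_fun) (rho r : R -> edge_fun).

Definition LL2 : set edge_fun := [set v | forall i, L2 (l i) (v i)].

Definition LL2norm v : \bar R := sqrte (\sum_i L2norm (l i) (v i) ^+ 2)%E.

Definition LL2_eq v w := forall i, v i = w i %[ae mu in `]0, l i[].

Definition LL2_dot v phi : R :=
  \sum_i \int[mu]_(x in `]0, l i[) (v i x * phi i x).

Definition HH1norm v : \bar R := sqrte (\sum_i H1norm (l i) (v i) ^+ 2)%E.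

Definition V : set edge_fun := [set phi |
  (forall i, H1 (l i) (phi i)) /\
  exists g : edge_fun, [/\ forall i, is_cont_rep (l i) (phi i) (g i),
    forall i j, g i 0 = g j 0 & forall i, g i (l i) = 0]].

(* The dual of V: an element is a map on edge_fun of which only the
   restriction to V matters. *)
Definition dual_norm (F : edge_fun -> R) : \bar R :=
  ereal_sup [set (`|F phi|)%:E | phi in [set phi | V phi /\ (HH1norm phi <= 1)%E]].

Definition Vdual : set (edge_fun -> R) := [set F |
  (forall a v w, V v -> V w ->
     F (fun i x => a * v i x + w i x) = a * F v + F w) /\
  (dual_norm F < +oo)%E].

Definition Vdual_eq (F G : edge_fun -> R) := forall phi, V phi -> F phi = G phi.

(* Integral over ]0, T[ of a function with values in V^*. *)
Definition dual_integral (F : R -> edge_fun -> R) : edge_fun -> R :=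
  fun phi => \int[mu]_(t in `]0, T[) F t phi.

(* g = rho_t in L^2(0, T; V^* ); the inclusion of L^2 in V^* maps v to
   LL2_dot v. *)
Definition is_time_deriv rho (g : R -> edge_fun -> R) :=
  L2_Bochner Vdual dual_norm T g /\
  forall psi, test_fun 0 T psi ->
    Vdual_eq (dual_integral (fun t phi => derive1 psi t * LL2_dot (rho t) phi))
             (fun phi => - dual_integral (fun t phi => psi t * g t phi) phi).

Definition L2V_norm rho : \bar R := L2_Bochner_norm HH1norm T rho.

Definition W : set (R -> edge_fun) := [set rho |
  L2_Bochner V HH1norm T rho /\ exists g, is_time_deriv rho g].

Definition time_deriv rho : R -> edge_fun -> R :=
  xget (fun _ _ => 0) [set g | is_time_deriv rho g].

Definition Wnorm rho : \bar R :=
  sqrte (L2V_norm rho ^+ 2 +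
         L2_Bochner_norm dual_norm T (time_deriv rho) ^+ 2)%E.

(* r is the representative of rho in C([0, T]; L^2). *)
Definition is_CL2_rep rho r :=
  [/\ forall t, `[0, T] t -> LL2 (r t),
      forall t, `[0, T] t ->
        LL2norm (r s - r t) @[s --> within `[0, T] (nbhs t)] --> 0%E &
      \forall t \ae mu, `]0, T[ t -> LL2_eq (r t) (rho t)].

Definition CL2_rep rho : R -> edge_fun :=
  xget (fun _ _ _ => 0) [set r | is_CL2_rep rho r].

Definition CL2_norm rho : \bar R :=
  ereal_sup [set LL2norm (CL2_rep rho t) | t in `[0, T]].

Definition Q (i : 'I_N) : set (R * R) := `]0, l i[ `*` `]0, T[.

Definition LLinf : set ('I_N -> R * R -> R) :=
  [set u | forall i, (u i \_ (Q i)) \in Lfun mu2 +oo%E].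

Definition LLinf_norm (u : 'I_N -> R * R -> R) : \bar R :=
  (\sum_i 'N[mu2]_+oo[EFin \o (u i \_ (Q i))])%E.

Variables (D : 'I_N -> R) (u : 'I_N -> R * R -> R).

Definition Dmax : R := \big[Num.max/0]_i D i.

(* Starting from Dmax, which leaves the minimum unchanged when 0 < N. *)
Definition Dmin : R := \big[Num.min/Dmax]_i D i.

(* F[u](v, phi) at time t. *)
Definition FPform (t : R) v phi : R :=
  \sum_i \int[mu]_(x in `]0, l i[)
    ((D i * weak_deriv (l i) (v i) x + u i (x, t) * v i x) *
     weak_deriv (l i) (phi i) x).

(* \sum_i d/dt (rho_i, phi_i) + F[u](rho, phi) = 0 in D'(0, T) is tested
   against psi. *)
Definition weak_solution (rho0 : edge_fun) rho :=
  [/\ W rho,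
      exists2 r, is_CL2_rep rho r & LL2_eq (r 0) rho0 &
      forall phi, V phi -> forall psi, test_fun 0 T psi ->
        \sum_i - (\int[mu]_(t in `]0, T[)
          ((\int[mu]_(x in `]0, l i[) (rho t i x * phi i x)) * derive1 psi t)) +
        \int[mu]_(t in `]0, T[) (FPform t (rho t) phi * psi t) = 0].

End star_graph.

(* Main.v *)
(** Laying the edges out as disjoint intervals of the real line turns L^2 of the
    graph into a subspace of L^2(R).  An element of V is encoded as the pair
    (v, w) of a function and its derivative, and belonging to V amounts to
    linear orthogonality constraints on the pair; since L^2(R) is separable,
    countably many suffice.  A solution becomes a pair (rho, sigma) of square
    integrable functions on R x (0, T) whose slices satisfy the constraints.

    Existence is Lions' projection argument: the adjoint problem satisfies
    |phi(0)|^2 <= C |L^* phi|^2 for test curves phi that are smooth in time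
    (energy estimate with an exponential weight), and Riesz representation
    gives the solution.  For the energy identity, the equation between the
    times t and t + h is tested against rho(t) + rho(t + h), whose derivative is
    sigma(t) + sigma(t + h); one integrates in t, divides by h and lets h tend to
    0, using the continuity of translations in L^2 and Lebesgue points.
    Gronwall's lemma then gives the bounds, the continuity in time and the
    uniqueness.  A weak solution in the Bochner sense is represented by such a
    pair, again by Riesz, so that uniqueness carries over to it. *)
Require Import Defs.
From HB Require Import structures.
From mathcomp Require Import all_boot all_order all_algebra.
From mathcomp Require Import all_classical all_reals all_analysis.
From mathcomp Require Import measurable_realfun ess_sup_inf ring lra.

Set Implicit Arguments.
Unset Strict Implicit.
Unset Printing Implicit Defensive.
Import Order.TTheory GRing.Theory Num.Theory.
Import numFieldNormedType.Exports.
Local Open Scope ring_scope.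
Local Open Scope classical_set_scope.

(** * Semi-inner products *)

(** Functions equal almost everywhere are not identified, so there is no quotient Hilbert space:
    Riesz representation is proved for semi-inner products, and functionals enter through their
    graphs. The recurring obstacle is that an identity holds at almost every time with a null set
    that depends on the test function, whereas the solution itself, which moves with time, has to be
    inserted as test function; dense sequences merge these null sets into one. In Lions' argument
    Riesz representation alone yields a pair $(\rho,\sigma)$ with no relation between its
    components; enlarging the range of the adjoint by the annihilator of the constraints restores
    $\sigma=\partial_x\rho$, the vertex condition and the boundary condition. No Poincare inequality
    enters, so the constants do not see the lengths: half of the diffusion absorbs the drift, at the
    price $m^2/\underline D$ in Gronwall's lemma, with $m=\|u\|_{\mathbb{L}^\infty}$. Norms along
    Bochner functions are not known to be measurable in time; they are compared with measurable
    majorants or minorants. *)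

Section semi_inner_product.
Variables (R : realType) (E : lmodType R) (S : set E) (dot : E -> E -> R).

(** Definiteness is left out, because functions that agree almost everywhere stay distinct.
    Linearity is asked on [S] only: the integral behind [dot] is additive on square-integrable
    functions, whereas its symmetry and the sign of [dot x x] hold for all functions. *)
Definition semi_ip :=
  [/\ forall a x y, S x -> S y -> S (a *: x + y), S 0,
      forall x y, dot x y = dot y x,
      forall a x y z, S x -> S y -> S z ->
        dot (a *: x + y) z = a * dot x z + dot y z &
      forall x, 0 <= dot x x].

Definition complete_ip := forall v : nat -> E, (forall n, S (v n)) ->
  (forall e : R, 0 < e -> exists n0, forall m n, (n0 <= m)%N -> (n0 <= n)%N ->
     dot (v m - v n) (v m - v n) <= e) ->
  exists2 z, S z & dot (v n - z) (v n - z) @[n --> \oo] --> (0 : R).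

Hypothesis ipS : semi_ip.

Lemma sip_comb a x y : S x -> S y -> S (a *: x + y).
Proof. by case: ipS => h *; exact: h. Qed.

Lemma sip_scale a x : S x -> S (a *: x).
Proof. by move=> Sx; rewrite -[_ *: _]addr0; apply: sip_comb => //; case: ipS. Qed.

Lemma sip_add x y : S x -> S y -> S (x + y).
Proof. by move=> Sx Sy; rewrite -[x]scale1r; exact: sip_comb. Qed.

Lemma sip_sub x y : S x -> S y -> S (x - y).
Proof. by move=> Sx Sy; rewrite addrC -scaleN1r; exact: sip_comb. Qed.

Lemma sipC x y : dot x y = dot y x.
Proof. by case: ipS. Qed.

Lemma sip_ge0 x : 0 <= dot x x.
Proof. by case: ipS. Qed.

Lemma sip_lin a x y z : S x -> S y -> S z ->
  dot (a *: x + y) z = a * dot x z + dot y z.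
Proof. by case: ipS => _ _ _ h _; exact: h. Qed.

Lemma sip_linr a x y z : S x -> S y -> S z ->
  dot z (a *: x + y) = a * dot z x + dot z y.
Proof. by move=> *; rewrite sipC sip_lin// !(sipC z). Qed.

Lemma sip_addl x y z : S x -> S y -> S z -> dot (x + y) z = dot x z + dot y z.
Proof. by move=> *; rewrite -[x]scale1r sip_lin// mul1r scale1r. Qed.

Lemma sip_subl x y z : S x -> S y -> S z -> dot (x - y) z = dot x z - dot y z.
Proof. by move=> *; rewrite addrC -scaleN1r sip_lin// mulN1r addrC. Qed.

Lemma sip_subr x y z : S x -> S y -> S z -> dot z (x - y) = dot z x - dot z y.
Proof. by move=> *; rewrite sipC sip_subl// !(sipC z). Qed.

Lemma sip0r z : S z -> dot z 0 = 0.
Proof.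
move=> Sz; have S0 : S 0 by case: ipS.
have := sip_linr 0 S0 S0 Sz; rewrite scaler0 addr0 mul0r add0r.
by have := sip_linr 1 S0 S0 Sz; rewrite scaler0 addr0 mul1r; lra.
Qed.

Lemma sip_expand a x y : S x -> S y ->
  dot (a *: x + y) (a *: x + y) = a ^+ 2 * dot x x + 2 * a * dot x y + dot y y.
Proof.
move=> Sx Sy; rewrite sip_lin ?sip_linr//; last exact: sip_comb.
by rewrite (sipC y x); ring.
Qed.

Lemma sip_CS x y : S x -> S y -> dot x y ^+ 2 <= dot x x * dot y y.
Proof.
move=> Sx Sy.
have H a : 0 <= a ^+ 2 * dot x x + 2 * a * dot x y + dot y y.
  by rewrite -sip_expand// sip_ge0.
have [x0|x0] := eqVneq (dot x x) 0; last first.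
  have xp : 0 < dot x x by rewrite lt_neqAle eq_sym x0 sip_ge0.
  have := H (- dot x y / dot x x).
  have -> : (- dot x y / dot x x) ^+ 2 * dot x x +
    2 * (- dot x y / dot x x) * dot x y + dot y y =
    (dot x x * dot y y - dot x y ^+ 2) / dot x x by field.
  by rewrite pmulr_lge0 ?invr_gt0// subr_ge0.
have [->|xy0] := eqVneq (dot x y) 0; first by rewrite expr0n/= mulr_ge0// sip_ge0.
(* With [dot x x] zero the quadratic is affine in its variable; this value of the variable makes it
   equal to $-1$. *)
exfalso; have := H (- (dot y y + 1) / (2 * dot x y)).
rewrite x0 mulr0 add0r.
have -> : 2 * (- (dot y y + 1) / (2 * dot x y)) * dot x y + dot y y = - 1.
  by field; rewrite xy0.
by lra.
Qed.

Definition snrm x := Num.sqrt (dot x x).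

Lemma snrm_ge0 x : 0 <= snrm x. Proof. exact: sqrtr_ge0. Qed.

Lemma snrm_sqr x : snrm x ^+ 2 = dot x x.
Proof. by rewrite sqr_sqrtr// sip_ge0. Qed.

Lemma snrm_CS x y : S x -> S y -> `|dot x y| <= snrm x * snrm y.
Proof.
move=> Sx Sy; rewrite -ler_sqr ?nnegrE ?mulr_ge0 ?snrm_ge0//.
by rewrite exprMn !snrm_sqr real_normK ?num_real// sip_CS.
Qed.

Lemma snrm_add x y : S x -> S y -> snrm (x + y) <= snrm x + snrm y.
Proof.
move=> Sx Sy; rewrite -ler_sqr ?nnegrE ?addr_ge0 ?snrm_ge0//.
rewrite snrm_sqr -[x in dot (x + _)]scale1r -[x in dot _ (x + _)]scale1r.
rewrite sip_expand// sqrrD !snrm_sqr expr1n mul1r mulr1 -!addrA lerD2l.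
by have := le_trans (ler_norm _) (snrm_CS Sx Sy); lra.
Qed.

Lemma snrm_scale a x : S x -> snrm (a *: x) = `|a| * snrm x.
Proof.
move=> Sx; rewrite /snrm; have := sip_expand a Sx (let: And5 _ h _ _ _ := ipS in h).
have S0 : S 0 by case: ipS.
have z0 z : S z -> dot z 0 = 0.
  by move=> Sz; have := sip_linr (-1) S0 S0 Sz; rewrite scaler0 addr0; lra.
rewrite addr0 => ->; rewrite !z0// mulr0 !addr0 sqrtrM ?sqr_ge0//.
by rewrite sqrtr_sqr.
Qed.

Lemma snrm_subC x y : S x -> S y -> snrm (x - y) = snrm (y - x).
Proof.
move=> Sx Sy; have -> : x - y = (-1) *: (y - x) by rewrite scaleN1r opprB.
by rewrite snrm_scale ?normrN1 ?mul1r//; exact: sip_sub.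
Qed.

Lemma snrm_sub_trans x y z : S x -> S y -> S z ->
  snrm (x - z) <= snrm (x - y) + snrm (y - z).
Proof.
move=> Sx Sy Sz; rewrite [x - z](_ : _ = (x - y) + (y - z)); last first.
  by rewrite addrA subrK.
by apply: snrm_add; exact: sip_sub.
Qed.

Lemma snrm_dist x y : S x -> S y -> `|snrm x - snrm y| <= snrm (x - y).
Proof.
move=> Sx Sy.
have h u v : S u -> S v -> snrm u <= snrm (u - v) + snrm v.
  by move=> Su Sv; rewrite -[in leLHS](subrK v u) snrm_add//; exact: sip_sub.
have := h _ _ Sx Sy; have := h _ _ Sy Sx; rewrite (snrm_subC Sy Sx).
by rewrite ler_norml; lra.
Qed.

(* The minimiser of [|x|^2 - 2 y] over the pairs [(x, y)] of [M] is sought in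
   the completion of the first projection of [M]. *)
Lemma riesz_subspace (M : set (E * R)) (C : R) : complete_ip -> 0 <= C ->
  M (0, 0) -> (forall p, M p -> S p.1) ->
  (forall a p q, M p -> M q -> M (a *: p.1 + q.1, a * p.2 + q.2)) ->
  (forall p, M p -> p.2 ^+ 2 <= C * dot p.1 p.1) ->
  exists z, [/\ S z, (forall p, M p -> dot z p.1 = p.2) &
    forall e : R, 0 < e -> exists2 p, M p & dot (z - p.1) (z - p.1) <= e].
Proof.
move=> cS C0 M0 MS Mlin Mb.
pose J (p : E * R) := dot p.1 p.1 - 2 * p.2.
have Jlb p : M p -> - C <= J p.
  move=> Mp; have := Mb _ Mp.
  rewrite /J; set x := dot _ _; set y := p.2 => h.
  have x0 : 0 <= x by exact: sip_ge0.
  by have := sqr_ge0 (x - C); nra.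
pose A := J @` M.
have hA : has_inf A.
  split; first by exists (J (0, 0)); exists (0, 0).
  by exists (- C) => _ [p Mp <-]; exact: Jlb.
pose j := inf A.
have jle p : M p -> j <= J p by move=> Mp; apply: ge_inf; [case: hA|exists p].
have /choice[p_ p_P] : forall n : nat, exists p, M p /\ J p < j + n.+1%:R^-1.
  move=> n.
  have [|_ [p Mp <-] ?] := @inf_adherent _ A n.+1%:R^-1 _ hA.
    by rewrite invr_gt0.
  by exists p.
have Mp_ n : M (p_ n) by case: (p_P n).
have Sp_ n : S (p_ n).1 by exact: MS.
have S0 : S 0 by case: ipS.
have Jp_ n : J (p_ n) < j + n.+1%:R^-1 by case: (p_P n).
have Mscale a p : M p -> M (a *: p.1, a * p.2).
  by move=> Mp; have := Mlin a _ _ Mp M0; rewrite /= !addr0.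
(* Parallelogram identity: half the sum of [p] and [q] lies in [M], so [J] is at least [j] there. *)
have par p q : M p -> M q ->
    dot (p.1 - q.1) (p.1 - q.1) <= 2 * (J p + J q - 2 * j).
  move=> Mp Mq; have := jle _ (Mlin 2^-1 _ _ Mp (Mscale 2^-1 _ Mq)).
  rewrite /J /= sip_expand ?[dot (_ *: q.1) _]sipC; [|exact: MS|].
  - have -> : p.1 - q.1 = (-1) *: q.1 + p.1 by rewrite scaleN1r addrC.
    rewrite sip_expand; [|exact: MS|exact: MS].
    have Sp := MS _ Mp; have Sq := MS _ Mq.
    have -> : dot (2^-1 *: q.1) (2^-1 *: q.1) = 4^-1 * dot q.1 q.1.
      have := sip_expand 2^-1 Sq S0; rewrite addr0 => ->.
      have -> : dot q.1 0 = 0.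
        have := sip_linr (-1) S0 S0 Sq; rewrite scaler0 addr0; lra.
      have -> : dot 0 0 = 0.
        have := sip_linr (-1) S0 S0 S0; rewrite scaler0 addr0; lra.
      by field.
    have -> : dot p.1 (2^-1 *: q.1) = 2^-1 * dot q.1 p.1.
      have := sip_linr 2^-1 Sq S0 Sp; rewrite addr0 => ->.
      have -> : dot p.1 0 = 0.
        have := sip_linr (-1) S0 S0 Sp; rewrite scaler0 addr0; lra.
      by rewrite sipC; field.
    by lra.
  - by apply: sip_scale; exact: MS.
have [z Sz z_cvg] : exists2 z, S z &
    dot ((p_ n).1 - z) ((p_ n).1 - z) @[n --> \oo] --> (0 : R).
  apply: (cS (fun n => (p_ n).1)) => // e e0.
  have [n0 n0P] : exists n0, n0.+1%:R^-1 <= e / 4 :> R.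
    have := @near_infty_natSinv_lt R (PosNum (divr_gt0 e0 (ltr0n R 4))).
    by case=> n0 _ /(_ n0 (leqnn _))/ltW; exists n0.
  exists n0 => m n mn0 nn0; apply: (le_trans (par _ _ (Mp_ m) (Mp_ n))).
  have h k : (n0 <= k)%N -> J (p_ k) <= j + e / 4.
    move=> n0k; rewrite (le_trans (ltW (Jp_ k)))// lerD2l.
    by apply: le_trans n0P; rewrite lef_pV2 ?posrE// ler_nat ltnS.
  by have := h _ mn0; have := h _ nn0; lra.
have near_z (e : R) : 0 < e -> exists n, n.+1%:R^-1 <= e /\
    dot (z - (p_ n).1) (z - (p_ n).1) <= e.
  move=> e0; near \oo => n; exists n; split.
    by near: n; have := @near_infty_natSinv_lt R (PosNum e0); apply: filterS => n /ltW.
  rewrite -snrm_sqr snrm_subC// snrm_sqr.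
  near: n; move: (z_cvg) => /cvgrPdist_le/(_ e e0); apply: filterS => n.
  by rewrite sub0r normrN; apply: le_trans; exact: ler_norm.
exists z; split => //; last first.
  by move=> e /near_z[n [_ ?]]; exists (p_ n).
move=> q Mq; have Sq := MS _ Mq.
pose dl := dot z q.1 - q.2; pose k := dot q.1 q.1.
have k0 : 0 <= k by exact: sip_ge0.
(* First variation: a minimising pair [p_ n] is compared with its perturbation by [s] times [q].
   Since [z] is only a limit of first components, this costs an error; [w] is chosen so that [w],
   from near-minimality, and $2|s|\,w\,\|q\|$, from replacing [p_ n] by [z], add up to [e]. *)
have H' (s e : R) : 0 < e -> 0 <= 2 * s * dl + s ^+ 2 * k + e.
  move=> e0; pose w : R := e / (1 + (2 * `|s| * snrm q.1)).
  have den : 0 < 1 + 2 * `|s| * snrm q.1.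
    by rewrite ltr_pwDl// !mulr_ge0// snrm_ge0.
  have w0 : 0 < w by rewrite divr_gt0.
  have wm : 0 < Num.min w (w ^+ 2) by rewrite lt_min w0 exprn_gt0.
  have [n [nw1 nw2]] := near_z _ wm.
  have nle : n.+1%:R^-1 <= w by rewrite (le_trans nw1)// ge_min lexx.
  have zle : snrm (z - (p_ n).1) <= w.
    rewrite -ler_sqr ?nnegrE ?snrm_ge0//; last exact: ltW.
    by rewrite snrm_sqr (le_trans nw2)// ge_min lexx orbT.
  have := jle _ (Mlin s _ _ Mq (Mp_ n)).
  have : J (p_ n) < j + w by rewrite (lt_le_trans (Jp_ n))// lerD2l.
  rewrite /J /= sip_expand//.
  have : `|dot z q.1 - dot (p_ n).1 q.1| <= w * snrm q.1.
    rewrite -sip_subl// (le_trans (snrm_CS _ _))//; first exact: sip_sub.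
    by rewrite ler_wpM2r// snrm_ge0.
  have ew : e = w + 2 * `|s| * (w * snrm q.1).
    by rewrite /w; field; rewrite gt_eqF.
  rewrite (sipC q.1) -/k ew /dl.
  set a := dot z q.1; set b := dot _ q.1; set P := dot _ _.
  set W : R := w * _ => abW h1 h2.
  have : s * (b - a) <= `|s| * W.
    rewrite (le_trans (ler_norm _))// normrM distrC ler_wpM2l//.
  by lra.
have H s : 0 <= 2 * s * dl + s ^+ 2 * k.
  by apply/ler_addgt0Pr => e /(H' s).
(* The quadratic is smallest at $-dl/k$; adding 1 to the denominator covers $k=0$ and still gives a
   negative value unless [dl] vanishes. *)
have := H (- dl / (k + 1)).
have -> : 2 * (- dl / (k + 1)) * dl + (- dl / (k + 1)) ^+ 2 * k =
  - (dl ^+ 2 * ((k + 2) / (k + 1) ^+ 2)) by field; rewrite gt_eqF// ltr_wpDl.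
rewrite oppr_ge0 pmulr_lle0; last first.
  by rewrite divr_gt0 ?exprn_gt0// ltr_wpDl.
move=> h; have : dl ^+ 2 == 0 by rewrite eq_le h sqr_ge0.
by rewrite sqrf_eq0 subr_eq0 => /eqP.
Unshelve. all: by end_near.
Qed.

End semi_inner_product.

(** * Square-integrable functions *)

Section square_integrable.
Context d (X : measurableType d) (R : realType).
Variable mu : {measure set X -> \bar R}.
Implicit Types f g : X -> R.

Definition sqint : set (X -> R) := [set f : X -> R | measurable_fun setT f /\
  mu.-integrable setT (EFin \o (fun x => f x ^+ 2))].

Definition ip f g : R := \int[mu]_x (f x * g x).

Lemma sqint_mul f g : sqint f -> sqint g ->
  mu.-integrable setT (EFin \o (fun x => f x * g x)).
Proof.
move=> [mf sf] [mg sg].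
apply: (@le_integrable _ _ _ mu setT measurableT _
    ((EFin \o (fun x => (f x ^+ 2)%R)) \+ (EFin \o (fun x => (g x ^+ 2)%R)))%E).
- by apply/measurable_EFinP; exact: measurable_funM.
- move=> x _ /=; rewrite lee_fin (@ger0_norm _ (_ + _)) ?addr_ge0 ?sqr_ge0//.
  rewrite normrM -(real_normK (num_real (f x))) -(real_normK (num_real (g x))).
  by have := sqr_ge0 (`|f x| - `|g x|); nra.
- exact: integrableD.
Qed.

Lemma sqint0 : sqint 0.
Proof.
split; first exact: measurable_cst.
rewrite (_ : _ \o _ = cst 0%E); first exact: integrable0.
by apply/funext => x /=; rewrite expr0n.
Qed.

Lemma sqint_lin a f g : sqint f -> sqint g -> sqint (a *: f + g).
Proof.
move=> sf sg; have [mf if2] := sf; have [mg ig2] := sg.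
split; first by apply: measurable_funD => //; exact: measurable_funM.
have i3 := sqint_mul sf sg.
rewrite (_ : _ \o _ = (fun x => (a ^+ 2)%R%:E * (f x ^+ 2)%R%:E) \+
  ((fun x => (2 * a)%R%:E * (f x * g x)%R%:E) \+ (fun x => (g x ^+ 2)%R%:E)))%E.
  apply: integrableD => //; first exact: integrableZl.
  by apply: integrableD => //; exact: integrableZl.
apply/funext => x /=; rewrite -!EFinM -!EFinD; congr EFin.
by rewrite (_ : (a *: f + g) x = a * f x + g x)//; ring.
Qed.

Lemma ip_lin a f g h : sqint f -> sqint g -> sqint h ->
  ip (a *: f + g) h = a * ip f h + ip g h.
Proof.
move=> sf sg sh; rewrite /ip -RintegralZl//; last exact: sqint_mul.
rewrite -RintegralD//; last 2 first.
- rewrite (_ : _ \o _ = fun x => a%:E * (f x * h x)%R%:E)%E//.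
  by apply: integrableZl => //; exact: sqint_mul.
- exact: sqint_mul.
apply: eq_Rintegral => x _.
by rewrite (_ : (a *: f + g) x = a * f x + g x)//; ring.
Qed.

Lemma ip_sip : semi_ip sqint ip.
Proof.
split; [exact: sqint_lin|exact: sqint0| |exact: ip_lin|].
- by move=> f g; apply: eq_Rintegral => x _; rewrite mulrC.
- by move=> f; apply: Rintegral_ge0 => x _; rewrite -expr2 sqr_ge0.
Qed.

Lemma ip_EFin f : sqint f -> (ip f f)%:E = (\int[mu]_x (f x ^+ 2)%:E)%E.
Proof.
move=> [_ sf]; rewrite /ip /Rintegral fineK.
  by apply: eq_integral => x _; rewrite expr2.
by have := integrable_fin_num measurableT sf.
Qed.

Lemma ip_eq0 f : sqint f -> ip f f = 0 -> {ae mu, forall x, f x = 0}.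
Proof.
move=> sf f0; have := ip_EFin sf; rewrite f0 => /esym i0.
have [_ /integrableP[mf2 _]] := sf.
have : (\int[mu]_x `|(f x ^+ 2)%:E| = 0)%E.
  by rewrite -[RHS]i0; apply: eq_integral => x _; rewrite gee0_abs// lee_fin sqr_ge0.
move=> /(ae_eq_integral_abs mu measurableT mf2).
apply: filterS => x /(_ I) /= [] /eqP.
by rewrite sqrf_eq0 => /eqP.
Qed.

Lemma ip_ae0 f g : measurable_fun setT f -> measurable_fun setT g ->
  {ae mu, forall x, f x = 0} -> ip f g = 0.
Proof.
move=> mf mg f0; rewrite /ip /Rintegral.
rewrite (@ae_eq_integral _ _ _ mu setT (cst 0%E))//.
- by rewrite integral0.
- by apply/measurable_EFinP; exact: measurable_funM.
- by move: f0; apply: filterS => x -> _; rewrite mul0r.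
Qed.

Lemma sqint_le f g : measurable_fun setT f -> sqint g ->
  (forall x, `|f x| <= `|g x|) -> sqint f.
Proof.
move=> mf [mg ig] fg; split => //.
apply: (le_integrable measurableT _ _ ig).
- by apply/measurable_EFinP; exact: measurable_funX.
- move=> x _ /=; rewrite lee_fin !normrX.
  by rewrite ler_sqr ?nnegrE.
Qed.

Lemma sqint_ae f g : measurable_fun setT g -> sqint f ->
  {ae mu, forall x, f x = g x} -> sqint g.
Proof.
move=> mg [mf /integrableP[_ if2]] fg; split => //; apply/integrableP; split.
  by apply/measurable_EFinP; exact: measurable_funX.
rewrite (@ae_eq_integral _ _ _ mu setT (fun x => `|(f x ^+ 2)%:E|)%E)//.
- by apply: measurableT_comp => //; apply/measurable_EFinP; exact: measurable_funX.
- by apply: measurableT_comp => //; apply/measurable_EFinP; exact: measurable_funX.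
- by move: fg; apply: filterS => x /= -> _.
Qed.

Lemma ge0_ip_le f (K : R) : measurable_fun setT f -> 0 <= K ->
  (\int[mu]_x (f x ^+ 2)%:E <= K%:E)%E -> sqint f /\ ip f f <= K.
Proof.
move=> mf K0 fK.
have sf : sqint f.
  split => //; apply/integrableP; split.
    by apply/measurable_EFinP; exact: measurable_funX.
  rewrite (eq_integral (fun x => (f x ^+ 2)%:E)); first exact: le_lt_trans (ltry K).
  by move=> x _; rewrite /= ger0_norm// sqr_ge0.
by split => //; rewrite -lee_fin ip_EFin.
Qed.

(** Riesz-Fischer. Along a subsequence with $\|w_{k+1}-w_k\|^2\le 8^{-k}$, the series $\sum_k
    4^k|w_{k+1}-w_k|^2$ has integral at most 2, hence is finite almost everywhere, and there the
    increments decrease like $2^{-k}$. *)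
Lemma ip_complete : complete_ip sqint ip.
Proof.
move=> v sv cv.
have /choice[N0 N0P] : forall k : nat, exists n0, forall m n, (n0 <= m)%N ->
    (n0 <= n)%N -> ip (v m - v n) (v m - v n) <= 8^-1 ^+ k.
  by move=> k; apply: cv; rewrite exprn_gt0// invr_gt0.
(* The maximum puts [phi k] beyond all thresholds up to [k]; the summand [k] makes it at least [k],
   which the comparison with the whole sequence uses. *)
pose phi k := (k + \max_(j < k.+1) N0 j)%N.
have phiN k m : (k <= m)%N -> (N0 k <= phi m)%N.
  move=> km; have km' : (k < m.+1)%N by [].
  apply: leq_trans (leq_addl _ _).
  exact: (leq_bigmax (Ordinal km')).
pose w (k : nat) : X -> R := v (phi k).
have mv n : measurable_fun setT (v n) by case: (sv n).
have mw k : measurable_fun setT (w k) by exact: mv.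
pose g (k : nat) (x : X) : \bar R := (4 ^+ k * (w k.+1 x - w k x) ^+ 2)%:E.
have mg k : measurable_fun setT (g k).
  apply/measurable_EFinP; apply: measurable_funM => //.
  by apply: measurable_funX; exact: measurable_funB.
have g0 k x : (0 <= g k x)%E by rewrite lee_fin mulr_ge0 ?sqr_ge0// exprn_ge0.
pose G x := (\sum_(k <oo) g k x)%E.
have mG : measurable_fun setT G by apply: ge0_emeasurable_sum.
have G0 x : (0 <= G x)%E by apply: nneseries_ge0.
have GE k x : ((w k.+1 x - w k x) ^+ 2)%R = ((w k.+1 - w k) x) ^+ 2 by [].
have iG : (\int[mu]_x G x <= 2%:E)%E.
  rewrite integral_nneseries//.
  have : (\sum_(k <oo) (\int[mu]_x g k x) <= \sum_(k <oo) (2^-1 ^+ k)%:E)%E.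
    apply: lee_nneseries => [k _ _|k _]; first by apply: integral_ge0 => x _.
    rewrite /g; under eq_integral do rewrite EFinM GE.
    rewrite ge0_integralZl//; last 2 first.
    - by apply/measurable_EFinP; apply: measurable_funX; exact: measurable_funB.
    - by move=> x _; rewrite lee_fin sqr_ge0.
    have swk : sqint (w k.+1 - w k) by apply: (sip_sub ip_sip); exact: sv.
    rewrite -(ip_EFin swk) -EFinM lee_fin.
    have -> : (2^-1 : R) ^+ k = 4 ^+ k * 8^-1 ^+ k.
      by rewrite -exprMn; congr (_ ^+ _); field.
    rewrite ler_wpM2l ?exprn_ge0//; apply: N0P; exact: phiN.
  move/le_trans; apply.
  apply: lime_le; first by apply: is_cvg_nneseries => k _ _; rewrite lee_fin exprn_ge0.
  apply: nearW => n; rewrite sumEFin lee_fin.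
  suff -> : \sum_(0 <= i < n) (2^-1 : R) ^+ i = 2 - 2 * 2^-1 ^+ n.
    by rewrite gerBl mulr_ge0// exprn_ge0.
  elim: n => [|n ih]; first by rewrite big_nil expr0; ring.
  by rewrite big_nat_recr//= ih exprS; field.
pose A := [set x | (G x < +oo)%E].
have mA : measurable A.
  by rewrite /A -[X in measurable X]setTI; apply: emeasurable_fun_infty_o.
have nA : mu (~` A) = 0%E.
  have : mu.-integrable setT G.
    apply/integrableP; split => //.
    rewrite (eq_integral G) => [|x _]; last by rewrite gee0_abs.
    exact: le_lt_trans iG (ltry _).
  move=> /(integrable_ae measurableT)[N [mN N00 AN]].
  apply: (subset_measure0 _ mN _ N00); first exact: measurableC.
  by move=> x /= /negP; rewrite -leNgt => Gy; apply: AN => /= /(_ I); rewrite ge0_fin_numE// ltNge Gy.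
have cA x : A x -> cvgn (w ^~ x).
  rewrite /A /= => Gx.
  pose K := fine (G x).
  have GK : G x = K%:E by rewrite fineK// ge0_fin_numE.
  have K0 : 0 <= K by rewrite fine_ge0.
  have gK k : 4 ^+ k * (w k.+1 x - w k x) ^+ 2 <= K.
    rewrite -lee_fin -GK -[leLHS]/(g k x) /G.
    apply: (@le_trans _ _ (\sum_(0 <= i < k.+1) g i x)%E); last first.
      exact: nneseries_lim_ge.
    by rewrite big_nat_recr//= leeDr// sume_ge0.
  have dK k : `|w k.+1 x - w k x| <= geometric (1 + K) 2^-1 k.
    rewrite -ler_sqr ?nnegrE ?geometric_ge0 ?addr_ge0// real_normK ?num_real//.
    rewrite /geometric /= exprMn -exprM mulnC exprM.
    have -> : (2^-1 ^+ 2 : R) = 4^-1 by field.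
    rewrite exprVn ler_pdivlMr ?exprn_gt0// mulrC (le_trans (gK k))//.
    by nra.
  have cs : cvgn (series (telescope (w ^~ x))).
    apply: normed_cvg; apply: series_le_cvg dK _ => //.
    - by move=> n; rewrite geometric_ge0// addr_ge0.
    - by apply: is_cvg_geometric_series; rewrite ger0_norm// invf_lt1// ltr1n.
  rewrite (_ : w ^~ x = fun n => w 0%N x + series (telescope (w ^~ x)) n).
    by apply: is_cvgD => //; exact: is_cvg_cst.
  by apply/funext => n; exact: (eq_sum_telescope (w ^~ x)).
(* The value 0 off [A] makes [f] the pointwise limit of [w k] times the indicator of [A], hence
   measurable. *)
pose f (x : X) : R := if x \in A then limn (w ^~ x) else 0.
have wf x : A x -> w k x @[k --> \oo] --> f x.
  by move=> Ax; rewrite /f mem_set//; exact: cA.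
have mf : measurable_fun setT f.
  apply: (@measurable_fun_cvg _ _ _ _ (fun k x => w k x * \1_A x)).
    by move=> k; apply: measurable_funM.
  move=> x _; rewrite indicE; have [Ax|Ax] := boolP (x \in A).
    by under eq_fun do rewrite mulr1; apply: wf; exact: set_mem.
  by under eq_fun do rewrite mulr0; rewrite /f (negbTE Ax); exact: cvg_cst.
(* Fatou's lemma along the subsequence with [n] fixed: the Cauchy bound on the tail passes to the
   limit [f]. *)
have key n e : 0 < e -> (forall m, (n <= m)%N -> ip (v n - v m) (v n - v m) <= e) ->
    sqint (v n - f) /\ ip (v n - f) (v n - f) <= e.
  move=> e0 vne.
  apply: ge0_ip_le; [exact: measurable_funB|exact: ltW|].
  have mB m : measurable_fun setT (fun x => ((v n x - w m x) ^+ 2)%:E).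
    by apply/measurable_EFinP; apply: measurable_funX; exact: measurable_funB.
  have mF : measurable_fun setT (fun x => ((v n x - f x) ^+ 2)%:E).
    by apply/measurable_EFinP; apply: measurable_funX; exact: measurable_funB.
  rewrite (@ge0_negligible_integral _ _ _ mu setT (~` A))//; last 2 first.
  - exact: measurableC.
  - by move=> x _; rewrite lee_fin sqr_ge0.
  rewrite setTD setCK.
  rewrite (eq_integral (fun x => limn_einf (fun m => ((v n x - w m x) ^+ 2)%:E))).
    apply: (le_trans (fatou mu mA _ _)).
    - by move=> m; exact: measurable_funTS.
    - by move=> m x _; rewrite lee_fin sqr_ge0.
    rewrite limn_einf_lim; apply: lime_le; first exact: is_cvg_einfs.
    exists n => // m /= nm.
    apply: (@le_trans _ _ (\int[mu]_(x in A) ((v n x - w m x) ^+ 2)%:E)%E).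
      by apply: ereal_inf_lbound; exists m => //=.
    apply: (@le_trans _ _ (\int[mu]_x ((v n x - w m x) ^+ 2)%:E)%E).
      by apply: ge0_subset_integral => // x _; rewrite lee_fin sqr_ge0.
    have svw : sqint (v n - w m) by apply: (sip_sub ip_sip); exact: sv.
    by rewrite -(ip_EFin svw) lee_fin; apply: vne; rewrite (leq_trans nm)// leq_addr.
  move=> x; rewrite inE => Ax; apply/esym.
  apply: (cvg_limn_einf_sup _).1.
  apply/fine_cvgP; split; first exact: nearW.
  rewrite /comp /=; under eq_fun do rewrite expr2; rewrite expr2.
  by apply: cvgM; apply: cvgB => //; [exact: cvg_cst|exact: wf|exact: cvg_cst|exact: wf].
have sf : sqint f.
  have [n0 n0P] := cv _ (@ltr01 R).
  have -> : f = v n0 - (v n0 - f) by rewrite opprB addrC subrK.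
  apply: (sip_sub ip_sip) => //; apply: (key _ _ ltr01 _).1 => m nm.
  exact: n0P.
exists f => //.
apply/cvgrPdist_le => e e0; have [n0 n0P] := cv _ e0.
exists n0 => // n /= n0n; rewrite sub0r normrN ger0_norm ?(sip_ge0 ip_sip)//.
apply: (key _ _ e0 _).2 => m nm.
by apply: n0P => //; exact: leq_trans nm.
Qed.
End square_integrable.

(** * Almost-everywhere reasoning and dominated convergence *)

Section almost_everywhere.
Context d (X : measurableType d) (R : realType) (m : {measure set X -> \bar R}).

Lemma aeS (P Q : X -> Prop) : (forall x, P x -> Q x) ->
  {ae m, forall x, P x} -> {ae m, forall x, Q x}.
Proof. by move=> PQ; apply: filterS. Qed.

Lemma aeT (P : X -> Prop) : (forall x, P x) -> {ae m, forall x, P x}.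
Proof. by move=> HP; apply: (aeS (fun x _ => HP x)); exact: filterT. Qed.

Lemma ae2 (P Q S : X -> Prop) : (forall x, P x -> Q x -> S x) ->
  {ae m, forall x, P x} -> {ae m, forall x, Q x} -> {ae m, forall x, S x}.
Proof. by move=> PQS; apply: filterS2. Qed.

Lemma ae_and (P Q : X -> Prop) : {ae m, forall x, P x} -> {ae m, forall x, Q x} ->
  {ae m, forall x, P x /\ Q x}.
Proof. by apply: ae2 => x ? ?; split. Qed.

Lemma ae_nat (P : nat -> X -> Prop) : (forall n, {ae m, forall x, P n x}) ->
  {ae m, forall x, forall n, P n x}.
Proof. by move=> h; apply: ae_foralln. Qed.

Lemma integrable_fine (g : X -> \bar R) : m.-integrable setT g ->
  m.-integrable setT (EFin \o (fine \o g)) /\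
  (\int[m]_y fine (g y) = fine (\int[m]_y g y)).
Proof.
move=> ig; have /integrableP[mg _] := ig.
have mfg : measurable_fun setT (fine \o g) by exact: measurableT_comp.
split.
  apply: (le_integrable measurableT _ _ ig); first exact/measurable_EFinP.
  by move=> y _ /=; case: (g y) => [r||] /=; rewrite ?normr0 ?leey ?lexx.
rewrite /Rintegral; congr fine; apply: ae_eq_integral => //.
- exact/measurable_EFinP.
- have := integrable_ae measurableT ig.
  by apply: filterS => y /(_ I) gy _ /=; rewrite fineK.
Qed.

Lemma Rintegral_ae (f g : X -> R) : measurable_fun setT f ->
  measurable_fun setT g -> {ae m, forall x, f x = g x} ->
  \int[m]_x f x = \int[m]_x g x.
Proof.
move=> mf mg fg; rewrite /Rintegral; congr fine; apply: ae_eq_integral => //.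
- exact/measurable_EFinP.
- exact/measurable_EFinP.
- by apply: aeS fg => x -> _.
Qed.

Lemma integrable_ae_eq (f g : X -> R) : m.-integrable setT (EFin \o f) ->
  measurable_fun setT g -> {ae m, forall x, f x = g x} ->
  m.-integrable setT (EFin \o g).
Proof.
move=> /integrableP[mf fi] mg fg; apply/integrableP; split.
  exact/measurable_EFinP.
rewrite (@ae_eq_integral _ _ _ m setT (abse \o (EFin \o f)))//.
- by apply: measurableT_comp => //; exact/measurable_EFinP.
- exact: measurableT_comp.
- by apply: aeS fg => x /= -> _.
Qed.

Lemma integrableRD (f g : X -> R) : m.-integrable setT (EFin \o f) ->
  m.-integrable setT (EFin \o g) ->
  m.-integrable setT (EFin \o (fun x => f x + g x)).
Proof. by move=> hf hg; exact: (integrableD measurableT hf hg). Qed.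

Lemma integrableRZ a (f : X -> R) : m.-integrable setT (EFin \o f) ->
  m.-integrable setT (EFin \o (fun x => a * f x)).
Proof. by move=> hf; exact: (integrableZl measurableT a hf). Qed.

Lemma integrableRB (f g : X -> R) : m.-integrable setT (EFin \o f) ->
  m.-integrable setT (EFin \o g) ->
  m.-integrable setT (EFin \o (fun x => f x - g x)).
Proof. by move=> hf hg; exact: (integrableB measurableT hf hg). Qed.

Lemma integrable_mul_bounded (f g : X -> R) (K : R) :
  m.-integrable setT (EFin \o f) -> measurable_fun setT g ->
  (forall x, `|g x| <= K) ->
  m.-integrable setT (EFin \o (fun x => f x * g x)).
Proof.
move=> hf mg gK; apply: (le_integrable measurableT _ _ (integrableRZ K hf)).
  apply/measurable_EFinP; apply: measurable_funM => //.
  by case/integrableP: hf => /measurable_EFinP.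
move=> x _ /=; rewrite lee_fin !normrM mulrC ler_wpM2r//.
by rewrite (le_trans (gK x))// ler_norm.
Qed.

Lemma measurable_of_integrable (f : X -> R) :
  m.-integrable setT (EFin \o f) -> measurable_fun setT f.
Proof. by move=> /integrableP[/measurable_EFinP]. Qed.

Lemma Rintegral_dominated (f_ : nat -> X -> R) (f G : X -> R) :
  (forall n, measurable_fun setT (f_ n)) ->
  m.-integrable setT (EFin \o G) ->
  (forall n x, `|f_ n x| <= G x) ->
  (forall x, f_ n x @[n --> \oo] --> f x) ->
  \int[m]_x f_ n x @[n --> \oo] --> \int[m]_x f x.
Proof.
move=> mf iG fG ff.
have mf' : measurable_fun setT f.
  by apply: (measurable_fun_cvg mf) => x _; exact: ff.
have mE (g : X -> R) : measurable_fun setT g -> measurable_fun setT (EFin \o g).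
  by move=> mg; exact/measurable_EFinP.
have [i1 _ i3] : [/\ m.-integrable setT (EFin \o f),
    (\int[m]_x `|(f_ n x)%:E - (f x)%:E|)%E @[n --> \oo] --> 0%E &
    (\int[m]_x (f_ n x)%:E)%E @[n --> \oo] --> (\int[m]_x (f x)%:E)%E].
  apply: (@dominated_convergence _ _ _ m setT measurableT
    (fun n => EFin \o f_ n) (EFin \o f) (EFin \o G)) => //.
  - by move=> n; exact: mE.
  - exact: mE.
  - apply: aeT => x _; apply/fine_cvgP; split; first exact: nearW.
    exact: ff.
  - by apply: aeT => x n _; rewrite lee_fin.
apply: fine_cvg.
rewrite [X in _ --> X](_ : _ = (\int[m]_x (f x)%:E)%E)//.
by rewrite /Rintegral fineK//; exact: integrable_fin_num.
Qed.
End almost_everywhere.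

(** * Slices of functions on a product: Fubini and Tonelli *)

Section slices.
Context d (X : measurableType d) d' (Y : measurableType d') (R : realType).
Variables (mu : {sigma_finite_measure set X -> \bar R}).
Variables (lam : {sigma_finite_measure set Y -> \bar R}).
Notation nu := (mu \x lam)%E.
Implicit Types (F G : X * Y -> R) (w : X -> R) (psi : Y -> R).

Definition sl F (t : Y) : X -> R := fun x => F (x, t).

Definition tens w (psi : Y -> R) : X * Y -> R := fun p => w p.1 * psi p.2.

Lemma measurable_sl F t : measurable_fun setT F -> measurable_fun setT (sl F t).
Proof. by move=> mF; apply: measurableT_comp => //; exact: measurable_pair2. Qed.

Lemma measurable_tens w psi : measurable_fun setT w -> measurable_fun setT psi ->
  measurable_fun setT (tens w psi).
Proof.
move=> mw mpsi; apply: measurable_funM.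
- exact: measurableT_comp.
- exact: measurableT_comp.
Qed.

Lemma ae_sl_sqint F : sqint nu F -> {ae lam, forall t, sqint mu (sl F t)}.
Proof.
move=> [mF iF]; have := ae_integrable2 iF.
by apply: filterS => t ?; split => //; exact: measurable_sl.
Qed.

Lemma integral_sl F : nu.-integrable setT (EFin \o F) ->
  lam.-integrable setT (EFin \o (fun t => \int[mu]_x F (x, t))) /\
  \int[nu]_z F z = \int[lam]_t \int[mu]_x F (x, t).
Proof.
move=> iF.
have iG : lam.-integrable setT (fun t => \int[mu]_x (F (x, t))%:E)%E.
  apply/integrableP; split; first exact: (measurable_fubini_G iF).
  have /integrableP[mF _] := iF.
  have /(integrable21ltyP mu lam mF) := iF.
  apply: le_lt_trans; apply: ge0_le_integral => //.
  - by apply: measurableT_comp => //; exact: (measurable_fubini_G iF).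
  - apply: (@measurable_fun_fubini_tonelli_G _ _ X Y R mu (fun z => `|(F z)%:E|%E)) => //.
    exact: measurableT_comp.
  - by move=> t _; apply: le_abse_integral => //; apply/measurable_EFinP; apply: (measurable_sl t); exact/measurable_EFinP.
have [h1 h2] := integrable_fine iG.
split => //; rewrite h2 /Rintegral; congr fine.
by rewrite -(integral21_prod_meas1 iF).
Qed.

Lemma integral_sl1 F : nu.-integrable setT (EFin \o F) ->
  mu.-integrable setT (EFin \o (fun x => \int[lam]_t F (x, t))) /\
  \int[nu]_z F z = \int[mu]_x \int[lam]_t F (x, t).
Proof.
move=> iF; have iG : mu.-integrable setT (fubini_F lam (EFin \o F)).
  exact: integrable_fubini_F.
have [h1 h2] := integrable_fine iG.
split => //; rewrite [RHS]h2 /Rintegral; congr fine.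
by rewrite -(integral12_prod_meas1 iF).
Qed.

Lemma ip_sl F G : sqint nu F -> sqint nu G ->
  lam.-integrable setT (EFin \o (fun t => ip mu (sl F t) (sl G t))) /\
  ip nu F G = \int[lam]_t ip mu (sl F t) (sl G t).
Proof. by move=> sF sG; apply: (integral_sl (sqint_mul sF sG)). Qed.

Lemma integrable_tens (w : X -> R) psi :
  mu.-integrable setT (EFin \o w) -> lam.-integrable setT (EFin \o psi) ->
  nu.-integrable setT (EFin \o tens w psi).
Proof.
move=> iw ip_; have /integrableP[mw iw'] := iw; have /integrableP[mp ip'] := ip_.
have mt : measurable_fun setT (EFin \o tens w psi).
  by apply/measurable_EFinP; apply: measurable_tens; exact/measurable_EFinP.
apply/(integrable21ltyP mu lam mt) => /=.
under eq_integral do under eq_integral do rewrite /tens /= normrM EFinM.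
rewrite (eq_integral (fun t => (\int[mu]_x `|(w x)%:E|) * `|(psi t)%:E|)%E); last first.
  move=> t _; rewrite ge0_integralZr//.
  by apply/measurable_EFinP; apply: measurableT_comp => //; exact/measurable_EFinP.
rewrite ge0_integralZl//; last by exact: integral_ge0.
- by apply: lte_mul_pinfty => //; [exact: integral_ge0|rewrite ge0_fin_numE// integral_ge0].
- by apply/measurable_EFinP; apply: measurableT_comp => //; exact/measurable_EFinP.
Qed.

Lemma sqint_tens w psi : sqint mu w -> sqint lam psi ->
  sqint nu (tens w psi).
Proof.
move=> [mw iw] [mp ip_]; split; first exact: measurable_tens.
rewrite (_ : _ \o _ = EFin \o tens (fun x => w x ^+ 2) (fun t => psi t ^+ 2)).
  exact: integrable_tens.
by apply/funext => -[x t] /=; rewrite /tens/= exprMn.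
Qed.

(** Tonelli gives the measurability of the integrals of the positive and negative parts separately;
    the integral is their difference by definition, whether or not it converges. *)
Lemma measurable_Rintegral_sl F : measurable_fun setT F ->
  measurable_fun setT (fun t => \int[mu]_x F (x, t)).
Proof.
move=> mF; apply: measurableT_comp => //.
under eq_fun do rewrite integralE.
have mE : measurable_fun setT (EFin \o F) by exact/measurable_EFinP.
have mp : measurable_fun setT (fubini_G mu (EFin \o F)^\+%E).
  by apply: measurable_fun_fubini_tonelli_G => //; exact: measurable_funepos.
have mn : measurable_fun setT (fubini_G mu (EFin \o F)^\-%E).
  by apply: measurable_fun_fubini_tonelli_G => //; exact: measurable_funeneg.
rewrite (_ : (fun t => _) = (fubini_G mu (EFin \o F)^\+ \- fubini_G mu (EFin \o F)^\-)%E).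
  exact: emeasurable_funB.
by apply/funext => t; rewrite /fubini_G funepos.unlock funeneg.unlock.
Qed.

(** Pairing with a product $w\otimes\psi$ becomes a scalar integral in time. The slices are square
    integrable at almost every time only, so the two integrands are compared almost everywhere. *)
Lemma ip_sl_tens F w psi : sqint nu F -> sqint mu w -> sqint lam psi ->
  ip nu F (tens w psi) = \int[lam]_t (psi t * ip mu (sl F t) w) /\
  lam.-integrable setT (EFin \o (fun t => psi t * ip mu (sl F t) w)).
Proof.
move=> sF sw sp; have [h1 h2] := ip_sl sF (sqint_tens sw sp).
have ae1 : {ae lam, forall t, ip mu (sl F t) (sl (tens w psi) t) =
    psi t * ip mu (sl F t) w}.
  have := ae_sl_sqint sF; apply: filterS => t sFt.
  rewrite /ip -RintegralZl//; last exact: sqint_mul.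
  by apply: eq_Rintegral => x _; rewrite /sl /tens/=; ring.
have mip : measurable_fun setT (fun t => psi t * ip mu (sl F t) w).
  apply: measurable_funM; first by case: sp.
  apply: (measurable_Rintegral_sl (F := fun z => F z * w z.1)).
  apply: measurable_funM; first by case: sF.
  by apply: measurableT_comp => //; case: sw.
have mip' : measurable_fun setT (fun t => ip mu (sl F t) (sl (tens w psi) t)).
  by case/integrableP: h1 => /measurable_EFinP.
by split; [rewrite h2; exact: Rintegral_ae|exact: integrable_ae_eq ae1].
Qed.

Lemma ip_tens w w' (psi psi' : Y -> R) : sqint mu w -> sqint mu w' ->
  sqint lam psi -> sqint lam psi' ->
  ip nu (tens w psi) (tens w' psi') = ip mu w w' * ip lam psi psi'.
Proof.
move=> sw sw' sp sp'.
rewrite (ip_sl_tens (sqint_tens sw sp) sw' sp').1.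
under eq_Rintegral => t _.
  rewrite /ip; under eq_Rintegral do rewrite /sl /tens /= mulrAC.
  rewrite RintegralZr//; last exact: sqint_mul.
  rewrite -/(ip mu w w') mulrCA [psi' t * _]mulrC; over.
by rewrite RintegralZl//; exact: sqint_mul.
Qed.

Lemma ip_sl_ge0_le F : sqint nu F ->
  lam.-integrable setT (EFin \o (fun t => ip mu (sl F t) (sl F t))).
Proof. by move=> sF; exact: (ip_sl sF sF).1. Qed.

Lemma sqint_sl_int F (g : Y -> R) : measurable_fun setT F ->
  {ae lam, forall t, sqint mu (sl F t) /\ ip mu (sl F t) (sl F t) <= g t} ->
  lam.-integrable setT (EFin \o g) -> sqint nu F.
Proof.
move=> mF Fg ig; split => //.
have mF2 : measurable_fun setT (EFin \o (fun z => F z ^+ 2)).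
  by apply/measurable_EFinP; exact: measurable_funX.
apply/(integrable21ltyP mu lam mF2).
have /integrableP[mg] := ig; apply: le_lt_trans.
apply: ae_ge0_le_integral => //.
- by move=> t _; exact: integral_ge0.
- apply: (@measurable_fun_fubini_tonelli_G _ _ X Y R mu (fun z => `|(F z ^+ 2)%:E|%E)) => //.
  exact: measurableT_comp.
- exact: measurableT_comp.
- apply: aeS Fg => t [sF le] _.
  rewrite (eq_integral (fun x => (sl F t x ^+ 2)%:E)); last first.
    by move=> x _ /=; rewrite ger0_norm// sqr_ge0.
  by rewrite -ip_EFin// lee_fin (le_trans le)// ler_norm.
Qed.

(** Tonelli for the indicator of a null set [N] that contains the exceptional points: the
    nonnegative function $t\mapsto\mu(N_t)$ has zero integral, so almost every slice of [N] is
    null. *)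
Lemma ae_sl (P : X * Y -> Prop) : {ae nu, forall z, P z} ->
  {ae lam, forall t, {ae mu, forall x, P (x, t)}}.
Proof.
move=> [N [mN N0 PN]].
have i0 : (\int[nu]_z (\1_N z)%:E = 0)%E by rewrite integral_indic// setIT.
have mI : measurable_fun setT (EFin \o (\1_N : X * Y -> R)).
  exact/measurable_EFinP.
have I0 z : (0 <= (EFin \o (\1_N : X * Y -> R)) z)%E by rewrite lee_fin.
have G0 y : (0 <= fubini_G mu (EFin \o (\1_N : X * Y -> R)) y)%E.
  by apply: integral_ge0.
have mG : measurable_fun setT (fubini_G mu (EFin \o (\1_N : X * Y -> R))).
  exact: measurable_fun_fubini_tonelli_G.
have : (\int[lam]_y `|fubini_G mu (EFin \o (\1_N : X * Y -> R)) y| = 0)%E.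
  rewrite -[RHS]i0 (@fubini_tonelli2 _ _ X Y R mu lam (EFin \o (\1_N : X * Y -> R)) mI I0).
  by apply: eq_integral => y _; rewrite gee0_abs.
move=> /(ae_eq_integral_abs lam measurableT mG); apply: aeS => t /(_ I) /= ft0.
exists (ysection N t); split.
- exact: measurable_ysection.
- move: ft0; rewrite /fubini_G /=.
  under eq_integral => x _.
    rewrite (_ : \1_N (x, t) = \1_(ysection N t) x); last first.
      by rewrite !indicE mem_ysection.
    over.
  by rewrite integral_indic ?setIT//; exact: measurable_ysection.
- by move=> x /= nP; rewrite /ysection /= inE; exact: PN.
Qed.
End slices.

(** * The real line *)

Section real_line.
Variable R : realType.
Notation lam := (@lebesgue_measure R).

Lemma integrable_locT (h : R -> R) : lam.-integrable setT (EFin \o h) ->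
  locally_integrable [set: R] h.
Proof. by move=> ih; exact: (open_integrable_locally openT ih). Qed.

Lemma integrable_itv (h : R -> R) (i : interval R) :
  lam.-integrable setT (EFin \o h) -> lam.-integrable [set` i] (EFin \o h).
Proof. by move=> ih; apply: integrableS ih. Qed.

Lemma integrable_patch (h : R -> R) (i : interval R) :
  lam.-integrable setT (EFin \o h) -> lam.-integrable setT (EFin \o (h \_ [set` i])).
Proof.
move=> /(integrable_itv i) ih.
by have := (@integrable_mkcond _ _ _ lam _ _ (measurable_itv _)).1 ih; rewrite restrict_EFin.
Qed.

(** Starting at $-\infty$ avoids oriented integrals; for a function that vanishes on the negative
    half-line it is the integral from 0. *)
Definition primitive (h : R -> R) (x : R) : R := \int[lam]_(t in `]-oo, x]) h t.

Lemma primitiveB (h : R -> R) a b : lam.-integrable setT (EFin \o h) -> a <= b ->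
  primitive h b - primitive h a = \int[lam]_(t in `]a, b]) h t.
Proof.
by move=> ih ab; rewrite /primitive Rintegral_itvB// ?bnd_simp//; exact: integrable_itv.
Qed.

Lemma primitive_derive (h : R -> R) : lam.-integrable setT (EFin \o h) ->
  {ae lam, forall x, derivable (primitive h) x 1 /\ (primitive h)^`() x = h x}.
Proof.
move=> ih; apply: FTC1Ny; last exact: integrable_locT.
by move=> y; exact: integrable_itv.
Qed.

(** The primitive is constant, and by Lebesgue's differentiation theorem its derivative is [h]
    almost everywhere. *)
Lemma ae0_Rintegral_itv (h : R -> R) : lam.-integrable setT (EFin \o h) ->
  (forall a b, a < b -> \int[lam]_(t in `]a, b]) h t = 0) ->
  {ae lam, forall t, h t = 0}.
Proof.
move=> ih h0; have := primitive_derive ih; apply: aeS => x [_ <-].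
have -> : primitive h = cst (primitive h 0).
  apply/funext => y /=.
  have [y0|y0|->//] := ltgtP y 0.
  - by have := primitiveB ih (ltW y0); rewrite h0// => /subr0_eq.
  - by have := primitiveB ih (ltW y0); rewrite h0// => /subr0_eq.
by rewrite derive1_cst.
Qed.

Lemma primitive_continuous (h : R -> R) : lam.-integrable setT (EFin \o h) ->
  continuous (primitive h).
Proof.
move=> ih x.
apply/cvgrPdist_lt => e e0.
have [d [d0 dP]] := integral_normr_continuous ih e0.
have key a b : a <= b -> b - a < d -> `|primitive h b - primitive h a| < e.
  move=> ab bad; rewrite primitiveB//.
  apply: (le_lt_trans (le_normr_Rintegral _ _)) => //; first exact: integrable_itv.
  apply: (dP `]a, b]%classic) => //=; rewrite lebesgue_measure_itv/= lte_fin.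
  by case: ifPn => _; rewrite -?EFinD lte_fin.
near=> y.
have yx : `|x - y| < d by near: y; exists d.
have [xy|/ltW xy] := leP x y.
  by rewrite distrC; apply: key => //; rewrite -normrN opprB ger0_norm ?subr_ge0// in yx.
by apply: key => //; rewrite ger0_norm ?subr_ge0// in yx.
Unshelve. all: by end_near.
Qed.

Lemma primitive_bound (h : R -> R) x : lam.-integrable setT (EFin \o h) ->
  `|primitive h x| <= \int[lam]_t `|h t|.
Proof.
move=> ih; rewrite /primitive.
apply: (le_trans (le_normr_Rintegral _ _)) => //; first exact: integrable_itv.
rewrite Rintegral_mkcond; have ina := integrable_norm ih.
apply: le_Rintegral => //.
  exact: (@integrable_patch (fun t => `|h t|)).
by move=> t _; rewrite patchE; case: ifP => _; [exact: lexx|exact: normr_ge0].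
Qed.

Lemma ae_itv_nonempty (P : R -> Prop) a b : a < b -> {ae lam, forall t, P t} ->
  exists t, a < t < b /\ P t.
Proof.
move=> ab [N [mN N0 PN]]; apply: contrapT => nP.
have : (lam `]a, b[%classic <= lam N)%E.
  apply: le_measure; rewrite ?inE//.
  by move=> t /=; rewrite in_itv/= => tab; apply: PN => /= Pt; apply: nP; exists t.
rewrite N0 lebesgue_measure_itv/= lte_fin ab.
by rewrite -EFinD lee_fin leNgt subr_gt0 ab.
Qed.
End real_line.

(** * Translation invariance of Lebesgue measure *)

Section shift.
Variable R : realType.
Notation lam := (@lebesgue_measure R).

Definition shiftR (a : R) : measurableTypeR R -> measurableTypeR R := +%R^~ a.

Lemma measurable_shiftR (a : R) : measurable_fun setT (shiftR a).
Proof. by apply: measurable_funD => //; exact: measurable_cst. Qed.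

HB.instance Definition _ (a : R) :=
  isMeasurableFun.Build _ _ _ _ (shiftR a) (measurable_shiftR a).

Lemma lebesgue_measure_shift (a : R) (A : set R) : measurable A ->
  pushforward lam (shiftR a) A = lam A.
Proof.
move=> mA; apply/esym/lebesgue_measure_unique => //= _ [[b c]] _ <-.
have -> : pushforward lam (shiftR a) `]b, c]%classic = lam `](b - a), (c - a)]%classic.
  rewrite /pushforward; congr (lam _); apply/seteqP; split => x /=;
    by rewrite /shiftR !in_itv/= ltrBlDr lerBrDr.
rewrite !lebesgue_measure_itv/= !lte_fin ltrD2r.
by case: ifP => // _; rewrite -!EFinD; congr EFin; ring.
Qed.

Lemma ge0_integral_shift (a : R) (f : R -> \bar R) : measurable_fun setT f ->
  (forall x, (0 <= f x)%E) ->
  (\int[lam]_x f (x + a)%R = \int[lam]_x f x)%E.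
Proof.
move=> mf f0; transitivity (\int[pushforward lam (shiftR a)]_x f x)%E.
  by rewrite ge0_integral_pushforward//= => x _; exact: f0.
by apply: eq_measure_integral => //= A mA _; exact: lebesgue_measure_shift.
Qed.

End shift.

Section shift_integral.
Variable R : realType.
Notation lam := (@lebesgue_measure R).

Lemma Rintegral_shift (a : R) (f : R -> R) :
  measurable_fun setT (f : measurableTypeR R -> R) ->
  \int[lam]_x f (x + a) = \int[lam]_x f x.
Proof.
move=> mf; rewrite /Rintegral; congr fine.
have mE : measurable_fun setT (EFin \o f) by exact/measurable_EFinP.
rewrite [in RHS]integralE [in LHS]integralE; congr (_ - _)%E.
- rewrite -(ge0_integral_shift a (measurable_funepos mE)); last exact: funepos_ge0.
  by rewrite funepos.unlock.
- rewrite -(ge0_integral_shift a (measurable_funeneg mE)); last exact: funeneg_ge0.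
  by rewrite funeneg.unlock.
Qed.

Lemma ae_shift (a : R) (P : R -> Prop) : {ae lam, forall t, P t} ->
  {ae lam, forall t, P (t + a)}.
Proof.
move=> [N [mN N0 PN]]; exists (shiftR a @^-1` N); split.
- by rewrite -[X in measurable X]setTI; exact: measurable_shiftR.
- by rewrite -[RHS]N0; exact: (lebesgue_measure_shift a mN).
- by move=> t /= h; apply: PN.
Qed.

(** The error is stated as a multiple of [h] rather than as a limit of quotients, so that it can be
    added to the other errors of the energy balance before dividing by [h]. *)
Lemma derivable_right (P : R -> R) (a l : R) : derivable P a 1 -> derive1 P a = l ->
  forall eps : R, 0 < eps -> exists2 de : R, 0 < de &
    forall h : R, 0 < h < de -> `|(P (a + h) - P a) - h * l| <= h * eps.
Proof.
move=> dP <- eps eps0.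
have /cvgrPdist_le/(_ _ eps0) [de /= de0 H] := dP.
exists de => // h /andP[h0 hde].
have := H h; rewrite /ball_/= sub0r normrN gtr0_norm// => /(_ hde).
rewrite gt_eqF// => /(_ isT); rewrite -/(derive P a 1) -derive1E.
rewrite /GRing.scale/= mulr1 (addrC h).
set d : R := derive1 P a; set p := P (a + h) - P a => hh.
have -> : p - h * d = - h * (d - h^-1 * p) by field; rewrite gt_eqF.
have e : `|- h * (d - h^-1 * p)| = h * `|d - h^-1 * p|.
  by rewrite (normrM (- h)) (normrN h) (gtr0_norm h0).
by rewrite e; exact: (ler_wpM2l (ltW h0) hh).
Qed.
End shift_integral.

(** * Sigma-finiteness of product measures *)

Section sigma_finite_product.
Context d (X : measurableType d) d' (Y : measurableType d') (R : realType).
Variables (mu : {sigma_finite_measure set X -> \bar R}).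
Variables (lam : {sigma_finite_measure set Y -> \bar R}).
Notation nu := (mu \x lam)%E.
Lemma sigma_finite_prod : sigma_finite setT nu.
Proof.
have /sigma_finiteP[F [UF incF finF]] := sigma_finiteT mu.
have /sigma_finiteP[G [UG incG finG]] := sigma_finiteT lam.
exists (fun n => F n `*` G n); last first.
  move=> n; have [mF Foo] := finF n; have [mG Goo] := finG n.
  by split; [exact: measurableX|rewrite product_measure1E// lte_mul_pinfty// ge0_fin_numE].
apply/esym/seteqP; split => // -[x y] _.
have [n _ Fx] : (\bigcup_n F n) x by rewrite -UF.
have [k _ Gy] : (\bigcup_n G n) y by rewrite -UG.
exists (maxn n k) => //; split.
  by move: x Fx; apply/subsetPset/incF; exact: leq_maxl.
by move: y Gy; apply/subsetPset/incG; exact: leq_maxr.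
Qed.

(** Packs the product as a sigma-finite measure, so that Fubini applies once more to a product with
    a third factor. *)
Definition sfprod : {sigma_finite_measure set (X * Y)%type -> \bar R} :=
  HB.pack nu (Measure_isSigmaFinite.Build _ _ _ nu sigma_finite_prod).
End sigma_finite_product.

(** * Indicators of half-open intervals *)

Section indicators.
Variable R : realType.
Notation lam := (@lebesgue_measure R).

(** Half-open intervals are stable under intersection, and adjacent ones subtract without leaving a
    point behind. *)
Definition ind (a b : R) : R -> R := \1_(`]a, b]%classic : set R).

Lemma indE a b t : ind a b t = ((a < t) && (t <= b))%:R.
Proof. by rewrite /ind indicE mem_setE in_itv. Qed.

Lemma measurable_ind a b : measurable_fun setT (ind a b : measurableTypeR R -> R).
Proof. exact: measurable_indic. Qed.

Lemma integrable_ind a b : lam.-integrable setT (EFin \o ind a b).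
Proof. exact: integrable_indic_itv. Qed.

Lemma ind_sqr a b t : ind a b t ^+ 2 = ind a b t.
Proof. by rewrite indE; case: (_ && _); rewrite ?expr1n ?expr0n. Qed.

Lemma ind_ge0 a b t : 0 <= ind a b t.
Proof. by rewrite indE. Qed.

Lemma sqint_ind a b : sqint lam (ind a b).
Proof.
split; first exact: measurable_ind.
by under eq_fun do rewrite ind_sqr; exact: integrable_ind.
Qed.

Lemma Rintegral_ind a b : a <= b -> \int[lam]_t ind a b t = b - a.
Proof.
move=> ab; rewrite /Rintegral /ind integral_indic// setIT/= lebesgue_measure_itv/=.
rewrite lte_fin; move: ab; rewrite le_eqVlt => /predU1P[->|->] /=; last by [].
by rewrite ltxx subrr.
Qed.

Lemma ip_ind a b : a <= b -> ip lam (ind a b) (ind a b) = b - a.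
Proof.
move=> ab; rewrite -Rintegral_ind//; apply: eq_Rintegral => t _.
by rewrite -expr2 ind_sqr.
Qed.

Lemma Rintegral_indE a b (h : R -> R) :
  \int[lam]_(t in `]a, b]) h t = \int[lam]_t (ind a b t * h t).
Proof.
rewrite Rintegral_mkcond; apply: eq_Rintegral => t _.
by rewrite /ind indicE patchE; case: ifP; rewrite ?mul1r ?mul0r.
Qed.

Lemma ind_mul a b a' b' t :
  ind a b t * ind a' b' t = ind (Num.max a a') (Num.min b b') t.
Proof.
rewrite !indE -natrM mulnb gt_max le_min; congr (_%:R).
by case: (a < t); case: (t <= b); case: (a' < t); case: (t <= b').
Qed.

Lemma ind_empty a b t : b <= a -> ind a b t = 0.
Proof. by move=> ba; rewrite indE; case: ltP => //= at_; rewrite leNgt (le_lt_trans ba). Qed.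

Lemma ind_in a b t : a < t <= b -> ind a b t = 1.
Proof. by rewrite indE => ->. Qed.

Lemma ind_le1 a b t : ind a b t <= 1.
Proof. by rewrite indE lern1 leq_b1. Qed.

Lemma integrable_ind_mul a b (h : R -> R) : lam.-integrable setT (EFin \o h) ->
  lam.-integrable setT (EFin \o (fun t => ind a b t * h t)).
Proof.
move=> ih; apply: (le_integrable _ _ _ ih) => //.
  apply/measurable_EFinP; apply: measurable_funM; first exact: measurable_ind.
  by case/integrableP: ih => /measurable_EFinP.
move=> t _ /=; rewrite lee_fin normrM ger0_norm ?ind_ge0//.
by rewrite ler_piMl// ind_le1.
Qed.

(** Shifting by [th] changes the indicator only within distance $|th|$ of one of the two ends. *)
Lemma ind_shift_le a b th s : (ind a b (s + th) - ind a b s) ^+ 2 <=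
  ind (a - `|th|) (a + `|th|) s + ind (b - `|th|) (b + `|th|) s.
Proof.
have := ler_norm th; have := ler_norm (- th); rewrite normrN.
set t := `|th| => t1 t2; rewrite !indE.
case: (ltP a (s + th)) => h1; case: (leP (s + th) b) => h2;
  case: (ltP a s) => h3; case: (leP s b) => h4;
  rewrite /= ?subrr ?expr0n/= ?addr_ge0//.
all: rewrite ?subr0 ?sub0r ?sqrrN ?expr1n.
all: first [have -> : b - t < s <= b + t by [apply/andP; split; lra]
           |have -> : a - t < s <= a + t by [apply/andP; split; lra]].
all: by rewrite /= ?lerDl ?lerDr.
Qed.
End indicators.

(** * Continuity of time translations in L2 *)

Section translation.
Context d (X : measurableType d) (R : realType).
Variable mu : {sigma_finite_measure set X -> \bar R}.
Notation lam := (@lebesgue_measure R).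
Notation nu := (mu \x lam)%E.
Implicit Types (F G : X * R -> R) (w : X -> R).

(** Separability of $L^2(X)$, with a dense sequence as witness; the distances are squared. *)
Definition separated_by (e : nat -> X -> R) := (forall k, sqint mu (e k)) /\
  forall w (eps : R), sqint mu w -> 0 < eps ->
    exists k, ip mu (w - e k) (w - e k) <= eps.

Lemma separated_orth e w : separated_by e -> sqint mu w ->
  (forall k, ip mu w (e k) = 0) -> ip mu w w = 0.
Proof.
move=> [se de] sw we; apply/eqP; rewrite eq_le (sip_ge0 (ip_sip mu)) andbT.
apply/ler_addgt0Pr => eps eps0; have [k wk] := de w eps sw eps0.
rewrite add0r (le_trans _ wk)//.
have -> : w - e k = (-1) *: e k + w by rewrite scaleN1r addrC.
rewrite (sip_expand (ip_sip mu))// (sipC (ip_sip mu) (e k)) we mulr0 addr0.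
by rewrite sqrrN expr1n mul1r lerDr (sip_ge0 (ip_sip mu)).
Qed.

Variable e_ : nat -> X -> R.
Hypothesis sep : separated_by e_.

(** For each member $e_k$ of the dense sequence, $t\mapsto(F(t),e_k)$ has zero integral over every
    interval and so vanishes almost everywhere. The union over $k$ of the exceptional sets is null,
    and density concludes slice by slice. *)
Lemma tens_ind_orth F : sqint nu F ->
  (forall w a b, sqint mu w -> a < b -> ip nu F (tens w (ind a b)) = 0) ->
  ip nu F F = 0.
Proof.
move=> sF F0; have [se de] := sep.
have h k : {ae lam, forall t, ip mu (sl F t) (e_ k) = 0}.
  (* The bounded time window makes the pairing integrable, so that it has a primitive. *)
  have hn n : {ae lam, forall t, ind (- n%:R) n%:R t * ip mu (sl F t) (e_ k) = 0}.
    have [_ ig] := ip_sl_tens sF (se k) (sqint_ind (- n%:R) n%:R).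
    apply: ae0_Rintegral_itv => // a b ab.
    rewrite Rintegral_indE.
    under eq_Rintegral do rewrite mulrA ind_mul.
    have [ab'|ab'] := ltP (Num.max a (- n%:R)) (Num.min b n%:R).
      by rewrite -(ip_sl_tens sF (se k) (sqint_ind _ _)).1 F0.
    under eq_Rintegral do rewrite ind_empty// mul0r.
    by rewrite Rintegral_cst// mul0r.
  apply: aeS (ae_nat hn) => t ht.
  have := ht (Num.truncn `|t|).+1; rewrite indE.
  have := truncnS_gt `|t|; rewrite ltr_norml => /andP[-> /ltW ->].
  by rewrite mul1r.
rewrite (ip_sl sF sF).2.
rewrite (@Rintegral_ae _ _ _ _ _ (cst 0)).
- by rewrite Rintegral_cst// mul0r.
- by have /integrableP[/measurable_EFinP] := (ip_sl sF sF).1.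
- exact: measurable_cst.
- apply: ae2 (ae_nat h) (ae_sl_sqint sF) => t ht sFt /=.
  exact: (separated_orth sep).
Qed.

(** The Riesz projection of [F] on the closed subspace [P] leaves a remainder orthogonal to all
    generators $w\otimes 1_{]a,b]}$, hence of norm zero. This serves as an induction principle on
    square-integrable functions of $(x,t)$. *)
Lemma span_tens (P : (X * R -> R) -> Prop) :
  (forall F, P F -> sqint nu F) ->
  (forall a F G, P F -> P G -> P (a *: F + G)) ->
  (forall F, sqint nu F -> (forall eps : R, 0 < eps ->
     exists2 G, P G & ip nu (F - G) (F - G) <= eps) -> P F) ->
  (forall w a b, sqint mu w -> a < b -> P (tens w (ind a b))) ->
  forall F, sqint nu F -> P F.
Proof.
move=> Psq Plin Pcl Pt F sF.
have ipn := ip_sip nu.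
have P0 : P 0.
  have := Pt 0 0 1 (sqint0 mu) ltr01 => P1.
  have := Plin (-1) _ _ P1 P1; rewrite scaleN1r addrC subrr.
  by [].
pose M : set ((X * R -> R) * R) := [set p | P p.1 /\ p.2 = ip nu F p.1].
have [z [sz zM zcl]] : exists z, [/\ sqint nu z,
    (forall p, M p -> ip nu z p.1 = p.2) &
    forall e : R, 0 < e -> exists2 p, M p & ip nu (z - p.1) (z - p.1) <= e].
  apply: (@riesz_subspace _ _ _ _ ipn M (ip nu F F)).
  - exact: ip_complete.
  - exact: (sip_ge0 ipn).
  - by split => //=; rewrite (sip0r ipn).
  - by move=> p [/Psq].
  - move=> a p q [Pp ->] [Pq ->]; split; first exact: Plin.
    by rewrite /= (sip_linr ipn)//; exact: Psq.
  - move=> p [Pp ->]; apply: (sip_CS ipn) => //; exact: Psq.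
have Fz : ip nu (F - z) (F - z) = 0.
  apply: tens_ind_orth; first exact: (sip_sub ipn).
  move=> w a b sw ab; have Pw := Pt w a b sw ab.
  rewrite (sip_subl ipn)//; last exact: Psq.
  by rewrite (zM (tens w (ind a b), ip nu F (tens w (ind a b))))// subrr.
apply: Pcl => // eps eps0; have [[m ?] [Pm _] /= zm] := zcl eps eps0.
exists m => //; have sm := Psq _ Pm.
have nz : snrm (ip nu) (F - z) = 0 by rewrite /snrm Fz sqrtr0.
rewrite -(snrm_sqr ipn) (le_trans _ zm)// -(snrm_sqr ipn).
rewrite ler_sqr ?nnegrE ?snrm_ge0//.
by rewrite (le_trans (snrm_sub_trans ipn sF sz sm))// nz add0r.
Qed.

Definition tr (th : R) F : X * R -> R := fun p => F (p.1, p.2 + th).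

Lemma measurable_tr th F : measurable_fun setT (F : X * measurableTypeR R -> R) ->
  measurable_fun setT (tr th F : X * measurableTypeR R -> R).
Proof.
move=> mF; apply: (measurableT_comp mF).
apply/measurable_fun_pairP; split; first exact: measurable_fst.
exact: (measurableT_comp (measurable_shiftR th) measurable_snd).
Qed.

Lemma sqint_tr th F : sqint nu F ->
  sqint nu (tr th F) /\ ip nu (tr th F) (tr th F) = ip nu F F.
Proof.
move=> sF; have [mF _] := sF.
have mE G : measurable_fun setT (G : X * measurableTypeR R -> R) ->
   measurable_fun setT (fun z => (G z ^+ 2)%:E).
  by move=> mG; apply/measurable_EFinP; exact: measurable_funX.
have mT := measurable_tr th mF.
have H : (\int[nu]_z (tr th F z ^+ 2)%:E = (ip nu F F)%:E)%E.
  rewrite ip_EFin//.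
  rewrite (@fubini_tonelli1 _ _ _ _ R mu lam _ (mE _ mT)); last first.
    by move=> z; rewrite lee_fin sqr_ge0.
  rewrite (@fubini_tonelli1 _ _ _ _ R mu lam _ (mE _ mF)); last first.
    by move=> z; rewrite lee_fin sqr_ge0.
  apply: eq_integral => x _; rewrite /fubini_F /tr /=.
  apply: (@ge0_integral_shift _ th (fun t => (F (x, t) ^+ 2)%:E)).
  - apply/measurable_EFinP; apply: measurable_funX.
    by apply: (measurableT_comp mF); exact: measurable_pair1.
  - by move=> t; rewrite lee_fin sqr_ge0.
have [sT _] : sqint nu (tr th F) /\ ip nu (tr th F) (tr th F) <= ip nu F F.
  by apply: ge0_ip_le => //; rewrite ?H// (sip_ge0 (ip_sip nu)).
by split => //; apply: EFin_inj; rewrite -H ip_EFin.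
Qed.

(** Translations are linear isometries, so the property is stable under combinations and limits, and
    [span_tens] reduces it to $w\otimes1_{]a,b]}$. There the squared norm of the difference is at
    most $4|th|\,\|w\|^2$. *)
Lemma translation_continuous F : sqint nu F -> forall eps : R, 0 < eps ->
  exists2 de : R, 0 < de & forall th, `|th| < de ->
    snrm (ip nu) (tr th F - F) <= eps.
Proof.
have ipn := ip_sip nu.
pose P F := sqint nu F /\ forall eps : R, 0 < eps ->
  exists2 de : R, 0 < de & forall th, `|th| < de ->
    snrm (ip nu) (tr th F - F) <= eps.
suff: forall F, sqint nu F -> P F by move=> h sF; case: (h F sF).
apply: span_tens.
- by move=> {}F [].
- move=> a {}F G [sF cF] [sG cG]; split; first exact: sqint_lin.
  move=> eps eps0.
  have e1 : 0 < eps / (2 * (1 + `|a|)) by rewrite divr_gt0// mulr_gt0// ltr_pwDl.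
  have e2 : 0 < eps / 2 by rewrite divr_gt0.
  have [d1 d10 D1] := cF _ e1; have [d2 d20 D2] := cG _ e2.
  exists (Num.min d1 d2); first by rewrite lt_min d10.
  move=> th; rewrite lt_min => /andP[t1 t2].
  have -> : tr th (a *: F + G) - (a *: F + G) =
      a *: (tr th F - F) + (tr th G - G).
    rewrite opprD addrACA scalerBr; congr (_ + _).
  have sdF := sip_sub ipn (sqint_tr th sF).1 sF.
  have sdG := sip_sub ipn (sqint_tr th sG).1 sG.
  apply: (le_trans (snrm_add ipn (sip_scale ipn a sdF) sdG)).
  rewrite (snrm_scale ipn)//.
  have := D2 _ t2; have : `|a| * snrm (ip nu) (tr th F - F) <= eps / 2.
    apply: (@le_trans _ _ (`|a| * (eps / (2 * (1 + `|a|))))).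
      by rewrite ler_wpM2l// D1.
    rewrite -[leRHS]mulr1 [leLHS](_ : _ = eps / 2 * (`|a| / (1 + `|a|))).
      apply: ler_wpM2l; first exact: ltW.
      by rewrite ler_pdivrMr ?mul1r ?lerDr// ltr_pwDl.
    by field; rewrite gt_eqF// ltr_pwDl.
  by move=> h1 h2; have := lerD h1 h2; rewrite -splitr.
- move=> {}F sF cF; split => // eps eps0.
  have e3 : 0 < eps / 3 by rewrite divr_gt0.
  have [G [sG cG] FG] := cF _ (exprn_gt0 2 e3).
  have [de de0 D] := cG _ e3; exists de => // th /D tG.
  have sdF := sip_sub ipn sF sG.
  have nFG : snrm (ip nu) (F - G) <= eps / 3.
    by rewrite -ler_sqr ?nnegrE ?snrm_ge0// ?(ltW e3)// (snrm_sqr ipn).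
  have ntr : snrm (ip nu) (tr th F - tr th G) = snrm (ip nu) (F - G).
    by rewrite /snrm -(sqint_tr th sdF).2.
  have sTF := (sqint_tr th sF).1; have sTG := (sqint_tr th sG).1.
  apply: (le_trans (snrm_sub_trans ipn sTF sTG sF)).
  rewrite ntr.
  have := snrm_sub_trans ipn sTG sG sF; rewrite [snrm _ (G - F)](snrm_subC ipn)//.
  move: tG nFG; clear; set A := snrm _ _; set B := snrm _ _; set C := snrm _ _.
  by lra.
- move=> w a b sw ab; split; first by apply: sqint_tens => //; exact: sqint_ind.
  move=> eps eps0.
  pose K := 1 + ip mu w w.
  have K0 : 0 < K by rewrite ltr_pwDl// (sip_ge0 (ip_sip mu)).
  exists (eps ^+ 2 / (4 * K)); first by rewrite divr_gt0 ?mulr_gt0// exprn_gt0.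
  move=> th; set t := `|th| => thd.
  pose dl s := ind a b (s + th) - ind a b s.
  have E : tr th (tens w (ind a b)) - tens w (ind a b) = tens w dl.
    apply/funext => -[x s]; rewrite /tens /dl mulrBr.
    by [].
  have mdl : measurable_fun setT (dl : measurableTypeR R -> R).
    apply: measurable_funB; last exact: measurable_ind.
    by apply: (measurableT_comp (@measurable_ind R a b)); exact: measurable_shiftR.
  pose bd s := ind (a - t) (a + t) s + ind (b - t) (b + t) s.
  have dbd s : dl s ^+ 2 <= bd s.
    exact: ind_shift_le.
  have t0 : 0 <= t by exact: normr_ge0.
  have at' : a - t <= a + t by lra.
  have bt' : b - t <= b + t by lra.
  have ibd : lam.-integrable setT (EFin \o bd).
    by apply: integrableRD; exact: integrable_ind.
  have [sdl dle] : sqint lam dl /\ ip lam dl dl <= 4 * t.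
    apply: ge0_ip_le => //; first by rewrite mulr_ge0.
    have -> : ((4 * t)%:E = \int[lam]_s (bd s)%:E)%E.
      have : \int[lam]_s bd s = 4 * t.
        rewrite /bd RintegralD//; try exact: integrable_ind.
        by rewrite !Rintegral_ind//; ring.
      rewrite /Rintegral => <-; rewrite fineK//.
      exact: integrable_fin_num.
    apply: ge0_le_integral => //.
    - by move=> s _; rewrite lee_fin sqr_ge0.
    - by apply/measurable_EFinP; exact: measurable_funX.
    - by case/integrableP: ibd.
    - by move=> s _; rewrite lee_fin dbd.
  rewrite E -ler_sqr ?nnegrE ?snrm_ge0//; last exact: ltW.
  rewrite (snrm_sqr ipn) ip_tens//.
  apply: (@le_trans _ _ (K * (4 * t))).
    apply: ler_pM => //; try exact: (sip_ge0 (ip_sip _)).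
    by rewrite /K lerDr.
  have := thd; rewrite ltr_pdivlMr ?mulr_gt0// => /ltW.
  by rewrite (_ : K * (4 * t) = t * (4 * K))//; ring.
Qed.
End translation.

(** * Test functions and weak derivatives *)

Section smooth_bumps.
Variable R : realType.
Notation lam := (@lebesgue_measure R).

(** Quadratic flatness; it is applied at the two ends of the support of a bump. *)
Lemma is_derive0_sqr (f : R -> R) x (K : R) :
  (forall t, `|f t| <= K * (t - x) ^+ 2) -> is_derive x 1 f 0.
Proof.
move=> fK.
have fx : f x = 0.
  by apply/eqP; rewrite -normr_le0 (le_trans (fK x))// subrr expr0n mulr0.
have K0 : 0 <= K.
  by have := le_trans (normr_ge0 _) (fK (x + 1)); rewrite addrAC subrr add0r expr1n mulr1.
have h : h^-1 *: (f (h *: 1 + x) - f x) @[h --> (0 : R)^'] --> (0 : R).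
  apply/cvgr0Pnorm_le => e e0; near=> h.
  rewrite fx subr0 normrZ normfV.
  have h0 : h != 0 by near: h; exact: nbhs_dnbhs_neq.
  rewrite ler_pdivrMl ?normr_gt0//.
  rewrite (le_trans (fK _))// addrK -[h *: 1]/(h * 1) mulr1 -real_normK ?num_real//.
  rewrite expr2 mulrCA ler_wpM2l//.
  have : `|h| <= e / (K + 1).
    near: h; apply: dnbhs0_le.
    by rewrite divr_gt0// ltr_wpDl.
  rewrite ler_pdivlMr ?ltr_wpDl// mulrDr mulr1; apply: le_trans.
  by rewrite mulrC lerDl.
split; first by apply/cvg_ex; exists 0.
exact: cvg_lim.
Unshelve. all: by end_near. Qed.

Lemma poly_bounded (p : {poly R}) (a b : R) :
  exists2 K : R, 0 <= K & forall t : R, a <= t <= b -> `|p.[t]| <= K.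
Proof.
elim/poly_ind: p => [|p c [K K0 pK]].
  by exists 0 => // t _; rewrite horner0 normr0.
exists (K * (`|a| + `|b|) + `|c|); first by rewrite addr_ge0// mulr_ge0// addr_ge0.
move=> t /andP[at_ tb]; rewrite hornerMXaddC (le_trans (ler_normD _ _))// lerD2r.
rewrite normrM ler_pM ?pK ?at_//.
have := ler_norm b; have := ler_norm (- a); rewrite normrN.
have := normr_ge0 a; have := normr_ge0 b.
by rewrite ler_norml; lra.
Qed.

Section bump.
Variables (a b c : R).
Hypotheses (ab : a < b) (c0 : 0 < c).

Let q : {poly R} := ('X - a%:P) * (b%:P - 'X).

Let qE t : q.[t] = (t - a) * (b - t).
Proof. by rewrite /q !hornerE. Qed.

Let q_gt0 t : a < t < b -> 0 < q.[t].
Proof. by move=> /andP[? ?]; rewrite qE mulr_gt0 ?subr_gt0. Qed.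

(** The factor $p\,q^{-k}$, with $q=(t-a)(b-t)$, makes the family stable under differentiation, so
    that smoothness follows by one induction. With $p=1$ and $k=0$ it is the classical bump, which
    tends to the indicator of $]a,b[$ as $c\to0$. *)
Definition bump (p : {poly R}) (k : nat) (t : R) : R :=
  if a < t < b then p.[t] * q.[t]^-1 ^+ k * expR (- c * q.[t]^-1) else 0.

(** With $s=c/q$, the inequality $e^{-s}\le(k+2)!/s^{k+2}$ absorbs $q^{-k}$ and leaves $q^2$, which
    is quadratically small at both ends. *)
Lemma bump_sqr_bound p k : exists K : R, forall t : R,
  `|bump p k t| <= K * (t - a) ^+ 2 /\ `|bump p k t| <= K * (t - b) ^+ 2.
Proof.
have [Kp Kp0 pK] := poly_bounded p a b.
pose F : R := (k.+2)`!%:R / c ^+ k.+2.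
have F0 : 0 <= F by rewrite divr_ge0// exprn_ge0// ltW.
exists (Kp * F * (b - a) ^+ 2) => t; rewrite /bump.
have KK : 0 <= Kp * F * (b - a) ^+ 2 by rewrite mulr_ge0 ?sqr_ge0// mulr_ge0.
case: ifPn => [tab|_]; last by rewrite normr0; split; apply: mulr_ge0; rewrite ?sqr_ge0.
have q0 := q_gt0 tab; have /andP[at_ tb] := tab.
have E : q.[t]^-1 ^+ k * expR (- c * q.[t]^-1) <= F * q.[t] ^+ 2.
  have s0 : 0 < c * q.[t]^-1 by rewrite mulr_gt0// invr_gt0.
  have h : (c * q.[t]^-1) ^+ k.+2 / (k.+2)`!%:R <= expR (c * q.[t]^-1).
    by have := expR_ge1Dxn k.+1 (ltW s0); apply: le_trans; rewrite lerDr.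
  rewrite mulNr expRN.
  have h2 : (expR (c * q.[t]^-1))^-1 <= F * q.[t] ^+ k.+2.
    rewrite -[leRHS]invrK lef_pV2 ?posrE ?expR_gt0//; last first.
      by rewrite invr_gt0 mulr_gt0 ?exprn_gt0// divr_gt0 ?ltr0n ?fact_gt0// exprn_gt0.
    apply: le_trans h; rewrite le_eqVlt; apply/orP; left; apply/eqP.
    rewrite /F exprMn exprVn; field.
    by rewrite !expf_neq0 ?gt_eqF//= gt_eqF// ltr0n fact_gt0.
  apply: (@le_trans _ _ (q.[t]^-1 ^+ k * (F * q.[t] ^+ k.+2))).
    by rewrite ler_wpM2l// exprn_ge0// invr_ge0 ltW.
  rewrite mulrCA ler_wpM2l// exprVn -addn2 exprD mulKf//.
  by rewrite expf_neq0// gt_eqF.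
have E0 : 0 <= q.[t]^-1 ^+ k * expR (- c * q.[t]^-1).
  by rewrite mulr_ge0 ?expR_ge0// exprn_ge0// invr_ge0 ltW.
rewrite -mulrA normrM (ger0_norm E0).
have h : `|p.[t]| * (q.[t]^-1 ^+ k * expR (- c * q.[t]^-1)) <= Kp * (F * q.[t] ^+ 2).
  by rewrite ler_pM// pK// !ltW.
have t1 : (t - a) ^+ 2 <= (b - a) ^+ 2 by rewrite ler_sqr ?nnegrE ?subr_ge0 ?lerD2r ltW.
have t2 : (b - t) ^+ 2 <= (b - a) ^+ 2.
  by rewrite ler_sqr ?nnegrE; lra.
have q2 : q.[t] ^+ 2 = (t - a) ^+ 2 * (b - t) ^+ 2 by rewrite qE exprMn.
rewrite q2 in h.
have W0 : 0 <= Kp * F by rewrite mulr_ge0.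
rewrite mulrA in h.
split; apply: (le_trans h); rewrite -[leRHS]mulrA; apply: ler_wpM2l => //.
  by rewrite mulrC; apply: ler_wpM2r => //; exact: sqr_ge0.
rewrite -[(t - b) ^+ 2]sqrrN opprB.
by apply: ler_wpM2r => //; exact: sqr_ge0.
Qed.

(** Numerator of the derivative of $p\,q^{-k}e^{-c/q}$ once it is written over $q^{k+2}$. *)
Definition bump_next (p : {poly R}) (k : nat) : {poly R} :=
  p^`() * q ^+ 2 - k%:R *: (p * q^`() * q) + c *: (p * q^`()).

(** Inside the interval this is the product rule; at the two ends the quadratic bound gives the
    derivative 0; elsewhere the function vanishes nearby. *)
Lemma is_derive_bump (p : {poly R}) (k : nat) (t : R) :
  is_derive t (1 : R) (bump p k) (bump (bump_next p k) k.+2 t).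
Proof.
have [tab|tab] := boolP (a < t < b); last first.
  rewrite {2}/bump (negbTE tab).
  have [K bK] := bump_sqr_bound p k.
  have [-> |ta] := eqVneq t a; first by apply: (@is_derive0_sqr _ _ K) => s; case: (bK s).
  have [-> |tb] := eqVneq t b; first by apply: (@is_derive0_sqr _ _ K) => s; case: (bK s).
  have : is_derive t 1 (cst 0 : R -> R) 0 by exact: is_derive_cst.
  apply: near_eq_is_derive.
  have : (t < a) \/ (b < t).
    move: tab; rewrite negb_and -!leNgt => /orP[h|h].
      by left; rewrite lt_neqAle ta.
    by right; rewrite lt_neqAle eq_sym tb.
  case=> h.
  - near=> s; rewrite /= /bump ltNge (_ : s <= a)//.
    by near: s; apply: filterS (lt_nbhsl h) => s /ltW.
  - near=> s; rewrite /= /bump andbC ltNge (_ : b <= s)//.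
    by near: s; apply: filterS (lt_nbhsr h) => s /ltW.
have q0 := q_gt0 tab; have qn0 : q.[t] != 0 by rewrite gt_eqF.
have hP := is_derive_poly p t.
have hV := is_deriveV qn0 (is_derive_poly q t).
have hX := is_deriveX k hV.
have hZ := is_deriveM (is_derive_cst (- c) t 1) hV.
have hE := is_derive1_comp (is_derive_expR _) hZ.
have hM := is_deriveM (is_deriveM hP hX) hE.
have hM' : is_derive t 1 (fun s => p.[s] * q.[s]^-1 ^+ k * expR (- c * q.[s]^-1))
    (bump (bump_next p k) k.+2 t).
  apply: is_derive_eq.
    rewrite (_ : (fun s => _) = horner p * (fun s => q.[s]^-1) ^+ k *
       (expR \o (cst (- c) * (fun s => q.[s]^-1)))); first exact: hM.
    by apply/funext => s /=; rewrite !fctE.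
  have sc (x y : R) : x *: y = x * y by [].
  rewrite /bump tab /bump_next !fctE !sc mulr0 addr0.
  move: (expR _) => e.
  clear hM hE hZ hX hV hP q0 qE q_gt0; clearbody q.
  rewrite !(hornerD, hornerN, hornerZ, hornerM, horner_exp).
  move: (q.[t]) (p.[t]) (p^`().[t]) (q^`().[t]) qn0 => Q P P' Q' Q0.
  case: k => [|k'].
    by rewrite !expr0 !mul0r mulr0 expr2; field.
  rewrite -[k'.+1.-1]/k' !(exprSr _ k'.+2) !(exprSr _ k'.+1) !(exprSr _ k').
  by move: (Q^-1 ^+ k') => W; field.
move: hM'; apply: near_eq_is_derive; near=> s.
rewrite /bump (_ : a < s < b)//; apply/andP; split; near: s.
  by apply: lt_nbhsr; case/andP: tab.
by apply: lt_nbhsl; case/andP: tab.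
Unshelve. all: by end_near. Qed.

Lemma derive1_bump p k : (bump p k)^`() = bump (bump_next p k) k.+2.
Proof. by apply/funext => t; rewrite derive1E; exact: (derive_val (is_derive := is_derive_bump p k t)). Qed.

Lemma derive1n_bump n p k : exists p' k', derive1n n (bump p k) = bump p' k'.
Proof.
elim: n => [|n [p' [k' ih]]]; first by exists p, k.
by exists (bump_next p' k'), k'.+2; rewrite derive1nS ih derive1_bump.
Qed.

Lemma test_fun_bump p k A B : A < a -> b < B -> test_fun A B (bump p k).
Proof.
move=> Aa bB; split.
  move=> n x; have [p' [k' ->]] := derive1n_bump n p k.
  by have [] := is_derive_bump p' k' x.
have sub : closure [set x | bump p k x != 0] `<=` `[a, b]%classic.
  have /closure_id -> : closed (`[a, b]%classic : set R) by exact: itv_closed.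
  apply: closure_subset => x /=; rewrite /bump in_itv/=.
  by case: ifPn => [/andP[/ltW-> /ltW->]//|_]; rewrite eqxx.
split; last first.
  by move=> x /sub /=; rewrite !in_itv/= => /andP[h1 h2]; lra.
apply: (subclosed_compact _ (@segment_compact _ a b)) => //.
exact: closed_closure.
Qed.
End bump.

Lemma FTC2_everywhere (F f : R -> R) a b : a <= b ->
  (forall t : R, is_derive t (1 : R) F (f t)) -> continuous f ->
  \int[lam]_(t in `]a, b]) f t = F b - F a.
Proof.
rewrite le_eqVlt => /predU1P[->|ab] dF cf.
  by rewrite set_itv_ge ?bnd_simp ?ltxx// Rintegral_set0 subrr.
have cF : continuous F.
  by move=> t; apply: differentiable_continuous; apply/derivable1_diffP; case: (dF t).
have cf' : {within `[a, b], continuous f} by exact: continuous_subspaceT.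
rewrite Rintegral_itv_obnd_cbnd; last first.
  apply: (@integrableS _ _ _ lam `[a, b]%classic) => //.
    by move=> t /=; rewrite !in_itv/= => /andP[/ltW-> ->].
  exact: (continuous_compact_integrable (@segment_compact _ a b) cf').
rewrite /Rintegral (continuous_FTC2 (F := F) ab cf')//.
- split => [t _| |]; first by case: (dF t).
  + by apply: cvg_at_right_filter; exact: cF.
  + by apply: cvg_at_left_filter; exact: cF.
- by move=> t _; rewrite derive1E; exact: (derive_val (is_derive := dF t)).
Qed.

Lemma continuous_support (f : R -> R) a b : a < b -> continuous f ->
  (forall x, ~~ (a < x < b) -> f x = 0) ->
  lam.-integrable setT (EFin \o f) /\ exists K, forall x, `|f x| <= K.
Proof.
move=> ab cf f0; have cf' : {within `[a, b], continuous f} by exact: continuous_subspaceT.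
split.
  have := continuous_compact_integrable (@segment_compact _ a b) cf'.
  move/integrable_mkcond => /(_ (measurable_itv _)).
  rewrite (_ : _ \_ _ = EFin \o f)//; apply/funext => x; rewrite patchE.
  case: ifPn => //; rewrite notin_setE/= in_itv/= => /negP h.
  by rewrite f0//; apply: contra h => /andP[/ltW-> /ltW->].
have [c cab cP] := EVT_max (ltW ab)
  (continuous_subspaceT (fun x => cvg_norm (cf x)) : {within `[a, b], continuous (fun x => `|f x|)}).
exists `|f c| => x; have [xab|/f0 ->] := boolP (a < x < b); last by rewrite normr0.
by apply: cP; rewrite in_itv/=; case/andP: xab => /ltW-> /ltW->.
Qed.

Lemma test_fun_continuous A B psi : test_fun A B psi ->
  [/\ forall t : R, is_derive t (1 : R) psi (psi^`() t), continuous psi,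
      continuous psi^`(), (forall x, ~~ (A < x < B) -> psi x = 0) &
      forall x, ~~ (A < x < B) -> psi^`() x = 0].
Proof.
move=> [/= dpsi [cpt sub]].
have hd (t : R) : is_derive t (1 : R) psi (psi^`() t).
  by have := dpsi 0%N t; rewrite derive1n0 derive1E => h; exact: derivableP.
split => //.
- by move=> t; apply: differentiable_continuous; apply/derivable1_diffP; case: (hd t).
- move=> t; apply: differentiable_continuous; apply/derivable1_diffP.
  by have := dpsi 1%N t; rewrite derive1n1.
- move=> x xAB; apply/eqP; apply: contraNT xAB => px.
  have := sub x (@subset_closure _ [set x | psi x != 0] _ px).
  by rewrite /= in_itv.
- move=> x xAB.
  have nx : ~ closure [set x | psi x != 0] x.
    by move=> /sub/=; rewrite in_itv/=; exact/negP.
  have : nbhs x (~` closure [set x | psi x != 0]).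
    by apply: open_nbhs_nbhs; split => //; apply: closed_openC; exact: closed_closure.
  move=> nb; rewrite derive1E.
  have : is_derive x (1 : R) psi 0.
    have h0 : is_derive x (1 : R) (cst 0 : R -> R) 0 by exact: is_derive_cst.
    move: h0; apply: near_eq_is_derive.
    apply: filterS nb => y ny /=; apply/esym/eqP; apply: contrapT => py; apply: ny.
    by apply: (@subset_closure _ [set x | psi x != 0]); exact/negP.
  by move=> h; exact: (derive_val (is_derive := h)).
Qed.

Lemma bump_cvg a b t : a < t < b ->
  bump a b n.+1%:R^-1 1 0 t @[n --> \oo] --> (1 : R).
Proof.
move=> tab; rewrite /bump tab.
rewrite [X in _ --> X](_ : 1 = (1%:P : {poly R}).[t] * 1 * expR (- 0 * (('X - a%:P) * (b%:P - 'X)).[t]^-1)); last first.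
  by rewrite hornerC oppr0 mul0r expR0 !mulr1.
under eq_fun do rewrite expr0.
apply: cvgM; first exact: cvg_cst.
apply: continuous_cvg; first exact: continuous_expR.
apply: cvgMl; apply: cvgN; exact: cvg_harmonic.
Qed.

Lemma bump_ge0_le1 a b c t : 0 < c -> 0 <= bump a b c 1 0 t <= 1.
Proof.
move=> c0; rewrite /bump; case: ifPn => [/andP[at_ tb]|_]; last by rewrite lexx ler01.
rewrite hornerC expr0 !mul1r expR_ge0/= -[leRHS]expR0 ler_expR mulNr oppr_le0.
by rewrite mulr_ge0 ?invr_ge0 ?(ltW c0)// !hornerE mulr_ge0 ?subr_ge0 ?ltW.
Qed.

Lemma continuous_measurable (f : R -> R) : continuous f ->
  measurable_fun setT (f : measurableTypeR R -> R).
Proof. exact: continuous_measurable_fun. Qed.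

(** Fundamental lemma of the calculus of variations, with bumps as the only test functions: by
    dominated convergence $c\to0$ replaces a bump by the indicator of its interval, and a function
    whose integrals over intervals all vanish is null. *)
Lemma ae0_test (A B : R) (g : R -> R) : lam.-integrable setT (EFin \o g) ->
  (forall a b c : R, A < a -> a < b -> b < B -> 0 < c ->
     \int[lam]_x (g x * bump a b c 1 0 x) = 0) ->
  {ae lam, forall x, A < x < B -> g x = 0}.
Proof.
move=> ig g0; have mg := measurable_of_integrable ig.
have key a b : A < a -> a < b -> b < B -> \int[lam]_x (ind a b x * g x) = 0.
  move=> Aa ab bB.
  pose f_ n x := g x * bump a b n.+1%:R^-1 1 0 x.
  have c0 n : 0 < n.+1%:R^-1 :> R by rewrite invr_gt0.
  have tb n := test_fun_bump ab (c0 n) 1 0 Aa bB.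
  have : (\int[lam]_x f_ n x @[n --> \oo] --> \int[lam]_x (ind a b x * g x)).
    have -> : \int[lam]_x (ind a b x * g x) = \int[lam]_x (if a < x < b then g x else 0).
      apply: Rintegral_ae.
      - by apply: measurable_funM => //; exact: measurable_ind.
      - rewrite (_ : (fun x => _) = g \_ `]a, b[).
          exact/(measurable_restrictT _ _).1/measurable_funTS.
        apply/funext => x; rewrite patchE mem_setE in_itv/=.
        by case: (_ && _).
      exists [set b]; split; [exact: measurable_set1|exact: lebesgue_measure_set1|].
      move=> x /= nx; apply: contrapT => xb; apply: nx.
      rewrite indE le_eqVlt; case: eqP => //= _.
      by case: (a < x) => /=; case: (x < b); rewrite ?mul1r ?mul0r.
    apply: (@Rintegral_dominated _ _ R lam f_ (fun x => if a < x < b then g x else 0) (fun x => `|g x|)).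
    - move=> n; apply: measurable_funM => //.
      by apply: continuous_measurable; have [] := test_fun_continuous (tb n).
    - exact: integrable_norm.
    - move=> n x; rewrite /f_ normrM ler_piMr//.
      by have /andP[h1 h2] := bump_ge0_le1 a b x (c0 n); rewrite ger0_norm.
    - move=> x; rewrite /f_; case: ifPn => [axb|nx].
        by rewrite -[X in _ --> X]mulr1; apply: cvgMr; exact: bump_cvg.
      rewrite (_ : (fun n => _) = cst 0); first exact: cvg_cst.
      by apply/funext => n; rewrite /bump (negbTE nx) mulr0.
  rewrite (_ : (fun n => _) = cst 0); last first.
    by apply/funext => n; rewrite /f_ g0.
  by move=> /cvg_lim <-//; rewrite lim_cst.
(* The interval is shrunk by $1/(n+1)$ on both sides, because a bump needs its closed support inside
   $]A,B[$; the union over [n] recovers all of $]A,B[$. *)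
have h n : {ae lam, forall x, ind (A + n.+1%:R^-1) (B - n.+1%:R^-1) x * g x = 0}.
  set a := A + _; set b := B - _.
  apply: ae0_Rintegral_itv => [|a' b' ab']; first exact: integrable_ind_mul.
  rewrite Rintegral_indE; under eq_Rintegral do rewrite mulrA ind_mul.
  have [lt|ge] := ltP (Num.max a' a) (Num.min b' b); last first.
    under eq_Rintegral do rewrite ind_empty// mul0r.
    by rewrite Rintegral_cst// mul0r.
  have n0 : 0 < n.+1%:R^-1 :> R by rewrite invr_gt0.
  apply: key => //.
    by rewrite lt_max /a ltrDl n0 orbT.
  by rewrite gt_min /b ltrBlDr ltrDl n0 orbT.
apply: aeS (ae_nat h) => x hx /andP[Ax xB].
have [n nP] : exists n, n.+1%:R^-1 < Num.min (x - A) (B - x).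
  have m0 : 0 < Num.min (x - A) (B - x) by rewrite lt_min !subr_gt0 Ax.
  have [n _ /(_ n (leqnn _)) ?] := @near_infty_natSinv_lt R (PosNum m0).
  by exists n.
move: nP; rewrite lt_min => /andP[n1 n2]; have := hx n.
by rewrite ind_in ?mul1r// -ltrBrDl n1/= lerBrDr -lerBrDl ltW.
Qed.

(** Fubini on the half-plane $y\le x$; it stands in for integration by parts. *)
Lemma Rintegral_primitive (g k : R -> R) : lam.-integrable setT (EFin \o g) ->
  lam.-integrable setT (EFin \o k) ->
  \int[lam]_x (g x * primitive k x) =
  \int[lam]_y (k y * \int[lam]_(x in `[y, +oo[) g x).
Proof.
move=> ig ik.
have mg := measurable_of_integrable ig; have mk := measurable_of_integrable ik.
pose lev : measurableTypeR R * measurableTypeR R -> R := fun p => ((p.2 : R) <= (p.1 : R))%R%:R.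
have mlev : measurable_fun setT lev.
  apply: (measurableT_comp (f := fun b : bool => b%:R : R)); first by move=> _ Y _.
  by apply: measurable_fun_ler; [exact: measurable_snd|exact: measurable_fst].
pose F : measurableTypeR R * measurableTypeR R -> R := fun p => tens g k p * lev p.
have iF : (lam \x lam)%E.-integrable setT (EFin \o F).
  apply: (le_integrable _ _ _ (integrable_tens ig ik)) => //.
    by apply/measurable_EFinP; apply: measurable_funM => //; exact: measurable_tens.
  move=> p _ /=; rewrite lee_fin normrM ler_piMr// /lev.
  by rewrite ger0_norm ?ler0n// lern1 leq_b1.
transitivity (\int[lam]_x \int[lam]_y F (x, y)).
  apply: eq_Rintegral => x _; rewrite /primitive -RintegralZl//; last exact: integrable_itv.
  rewrite Rintegral_mkcond; apply: eq_Rintegral => y _.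
  rewrite patchE mem_setE in_itv/= /F /tens /lev /=.
  by case: (_ <= _); rewrite ?mulr1 ?mulr0.
rewrite -(integral_sl1 iF).2 (integral_sl iF).2; apply: eq_Rintegral => y _.
rewrite -RintegralZl//; last exact: integrable_itv.
rewrite [RHS]Rintegral_mkcond; apply: eq_Rintegral => x _.
rewrite patchE mem_setE in_itv/= andbT /F /tens /lev /=.
by case: (_ <= _); rewrite ?mulr1 ?mulr0 1?mulrC.
Qed.

Lemma derive1n_lin (f g : R -> R) (c : R) n :
  (forall n x, derivable (derive1n n f) x 1) ->
  (forall n x, derivable (derive1n n g) x 1) ->
  derive1n n (fun x => f x - c * g x) =
    (fun x => derive1n n f x - c * derive1n n g x) /\
  forall x, derivable (fun x => derive1n n f x - c * derive1n n g x) x 1.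
Proof.
move=> df dg.
have der k x : is_derive x (1 : R) (fun x => derive1n k f x - c * derive1n k g x)
    (derive1n k.+1 f x - c * derive1n k.+1 g x).
  have hf : is_derive x (1 : R) (derive1n k f) (derive1n k.+1 f x).
    by rewrite derive1nS derive1E; exact: derivableP.
  have hg : is_derive x (1 : R) (derive1n k g) (derive1n k.+1 g x).
    by rewrite derive1nS derive1E; exact: derivableP.
  exact: is_deriveB hf (is_deriveZ c hg).
split; last by move=> x; case: (der n x).
elim: n => [//|n ih]; rewrite derive1nS ih; apply/funext => x.
by rewrite derive1E; exact: (derive_val (is_derive := der n x)).
Qed.

Lemma primitive_is_derive (k : R -> R) (x : R) : continuous k ->
  lam.-integrable setT (EFin \o k) -> is_derive x (1 : R) (primitive k) (k x).
Proof.
move=> ck ik; have xu : x < x + 1 by rewrite ltrDl.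
have := @continuous_FTC1 R k -oo%O x (x + 1) xu (integrable_itv _ ik) (ltNyr _) (ck _).
by move=> [dk <-]; rewrite derive1E; exact: derivableP.
Qed.

(** The zero mean of [chi] is what makes its primitive vanish again to the right of [b], hence have
    compact support. *)
Lemma test_fun_primitive (a b A B : R) (chi : R -> R) : A < a -> a < b -> b < B ->
  (forall n x, derivable (derive1n n chi) x 1) ->
  (forall x, ~~ (a < x < b) -> chi x = 0) ->
  \int[lam]_x chi x = 0 ->
  test_fun A B (primitive chi) /\ (primitive chi)^`() = chi.
Proof.
move=> Aa ab bB dchi chi_out chi0.
have cchi : continuous chi.
  move=> t; apply: differentiable_continuous; apply/derivable1_diffP.
  by have := dchi 0%N t; rewrite derive1n0.
have [ichi _] := continuous_support ab cchi chi_out.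
have dd x : derivable (primitive chi) x 1 /\ (primitive chi)^`() x = chi x.
  by have [? e] := primitive_is_derive x cchi ichi; rewrite derive1E e.
have d1 : (primitive chi)^`() = chi by apply/funext => x; case: (dd x).
split => //; split.
  move=> [|n] x; first by rewrite derive1n0; case: (dd x).
  by rewrite derive1Sn d1; exact: dchi.
have p_out x : ~~ (a <= x <= b) -> primitive chi x = 0.
  rewrite negb_and -!ltNge => /orP[xa|bx].
    rewrite /primitive Rintegral_mkcond.
    under eq_Rintegral => y _.
      rewrite patchE mem_setE in_itv/=.
      rewrite (_ : (if _ then _ else _) = 0); last first.
        case: leP => // yx; apply: chi_out.
        by rewrite negb_and -leNgt (le_trans yx)// ltW.
      over.
    by rewrite Rintegral_cst// mul0r.
  rewrite -[RHS]chi0 /primitive Rintegral_mkcond; apply: eq_Rintegral => y _.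
  rewrite patchE mem_setE in_itv/=; case: leP => // xy.
  by rewrite chi_out// negb_and -!leNgt (le_trans (ltW bx) (ltW xy)) orbT.
have sub : closure [set x | primitive chi x != 0] `<=` `[a, b]%classic.
  have /closure_id -> : closed (`[a, b]%classic : set R) by exact: itv_closed.
  apply: closure_subset => x /=; rewrite in_itv/=; apply: contraNT.
  by move=> /p_out ->.
split; last by move=> x /sub /=; rewrite !in_itv/= => /andP[h1 h2]; lra.
apply: (subclosed_compact _ (@segment_compact _ a b)) => //.
exact: closed_closure.
Qed.

Lemma bump_out (a b c t : R) : ~~ (a < t < b) -> bump a b c 1 0 t = 0.
Proof. by rewrite /bump => /negbTE ->. Qed.

Lemma bump_derivable (a b c : R) n (x : R) : a < b -> 0 < c ->
  derivable (derive1n n (bump a b c 1 0)) x 1.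
Proof.
move=> ab c0; have [] := @test_fun_bump _ _ _ ab c0 1 0 (a - 1) (b + 1) _ _.
- by rewrite ltrBlDr ltrDl.
- by rewrite ltrDl.
by move=> h _; exact: h.
Qed.

Lemma bump_continuous (a b c : R) : a < b -> 0 < c -> continuous (bump a b c 1 0).
Proof.
move=> ab c0 t; apply: differentiable_continuous; apply/derivable1_diffP.
by have := @bump_derivable a b c 0%N t ab c0; rewrite derive1n0.
Qed.

Lemma bump_integrable (a b c : R) : a < b -> 0 < c ->
  lam.-integrable setT (EFin \o bump a b c 1 0).
Proof.
move=> ab c0; have [] := continuous_support ab (bump_continuous ab c0).
  by move=> x /bump_out.
by [].
Qed.

Lemma bump_int_neq0 (a b c : R) : a < b -> 0 < c -> \int[lam]_x bump a b c 1 0 x != 0.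
Proof.
move=> ab c0; apply/negP => /eqP b0.
have ib := bump_integrable ab c0.
have /integrableP[mb _] := ib.
have bge x : 0 <= bump a b c 1 0 x by case/andP: (bump_ge0_le1 a b x c0).
have : (\int[lam]_x `|(bump a b c 1 0 x)%:E| = 0)%E.
  under eq_integral do rewrite gee0_abs ?lee_fin//.
  move: b0; rewrite /Rintegral => b0.
  by rewrite -[LHS]fineK ?b0//; exact: integrable_fin_num.
move=> /(ae_eq_integral_abs lam measurableT mb) h.
have h' : {ae lam, forall x, bump a b c 1 0 x = 0}.
  by apply: aeS h => x /(_ I) [].
have [t [tab]] := ae_itv_nonempty ab h'.
rewrite /bump tab hornerC expr0 !mul1r => /eqP.
by rewrite gt_eqF// expR_gt0.
Qed.

(** Integration by parts against a primitive that is differentiable almost everywhere only: after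
    Fubini the inner integral of $\psi'$ over $[y,+\infty[$ is $-\psi(y)$. *)
Lemma primitive_test (A B : R) (w psi : R -> R) : A < B ->
  lam.-integrable setT (EFin \o w) -> test_fun A B psi ->
  \int[lam]_x (derive1 psi x * primitive w x) = - \int[lam]_x (w x * psi x).
Proof.
move=> AB iw tpsi; have [dpsi cpsi cpsi' psi_out psi'_out] := test_fun_continuous tpsi.
have [ipsi' _] := continuous_support AB cpsi' psi'_out.
rewrite Rintegral_primitive//.
have [_ [K0 psiK]] := continuous_support AB cpsi psi_out.
have iwp : lam.-integrable setT (EFin \o (fun x => w x * psi x)).
  by apply: (integrable_mul_bounded (K := K0)) => //; exact: continuous_measurable.
rewrite -mulN1r -RintegralZl//.
apply: eq_Rintegral => y _.
rewrite mulN1r -mulrN; congr (_ * _).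
rewrite -Rintegral_itv_obnd_cbnd; last exact: integrable_itv.
(* A point beyond both the support of [psi] and [y], where [psi] vanishes and the fundamental
   theorem applies on $]y,b']$. *)
pose b' := Num.max B y.
have Bb : B <= b' by rewrite le_max lexx.
have yb : y <= b' by rewrite le_max lexx orbT.
rewrite Rintegral_mkcond -[RHS](_ : psi b' - psi y = _); last first.
  by rewrite (psi_out b') ?sub0r// negb_and -!leNgt Bb orbT.
rewrite -(FTC2_everywhere yb dpsi cpsi') [RHS]Rintegral_mkcond.
apply: eq_Rintegral => x _; rewrite !patchE !mem_setE !in_itv/= andbT.
case: (ltP y x) => //= yx; case: leP => // bx; rewrite psi'_out//.
by rewrite negb_and -!leNgt (le_trans Bb (ltW bx)) orbT.
Qed.

(** Du Bois-Reymond's lemma. The difference between [f] and the primitive of [w] is orthogonal to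
    all derivatives of test functions, that is to all smooth functions of compact support with zero
    mean; a bump is brought to zero mean by subtracting a multiple of a fixed bump. *)
Lemma weak_deriv_primitive (A B : R) (f w : R -> R) : A < B ->
  lam.-integrable setT (EFin \o f) -> lam.-integrable setT (EFin \o w) ->
  (forall psi : R -> R, test_fun A B psi ->
     \int[lam]_x (f x * derive1 psi x) = - \int[lam]_x (w x * psi x)) ->
  exists k, {ae lam, forall x, A < x < B -> f x = k + primitive w x}.
Proof.
move=> AB if_ iw fw.
have mf := measurable_of_integrable if_.
pose W := primitive w.
have cW : continuous W by exact: primitive_continuous.
have mW : measurable_fun setT (W : measurableTypeR R -> R).
  exact: continuous_measurable.
pose h x := ind A B x * (f x - W x).
have iW : lam.-integrable setT (EFin \o (fun x => ind A B x * W x)).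
  apply: (integrable_mul_bounded (K := \int[lam]_t `|w t|) (integrable_ind A B)) => //.
  by move=> x; exact: primitive_bound.
have ih : lam.-integrable setT (EFin \o h).
  rewrite (_ : h = fun x => ind A B x * f x - ind A B x * W x).
    by apply: integrableRB => //; exact: integrable_ind_mul.
  by apply/funext => x; rewrite /h mulrBr.
have h0 psi : test_fun A B psi -> \int[lam]_x (h x * derive1 psi x) = 0.
  move=> tpsi; have [dpsi cpsi cpsi' psi_out psi'_out] := test_fun_continuous tpsi.
  have [ipsi' [K psi'K]] := continuous_support AB cpsi' psi'_out.
  have mpsi' : measurable_fun setT (derive1 psi : measurableTypeR R -> R).
    exact: continuous_measurable.
  have i1 : lam.-integrable setT (EFin \o (fun x => f x * derive1 psi x)).
    exact: (integrable_mul_bounded (K := K)).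
  have i2 : lam.-integrable setT (EFin \o (fun x => derive1 psi x * W x)).
    apply: (integrable_mul_bounded (K := \int[lam]_t `|w t|)) => // x.
    exact: primitive_bound.
  transitivity (\int[lam]_x (f x * derive1 psi x - derive1 psi x * W x)).
    apply: eq_Rintegral => x _; have [xAB|xAB] := boolP (A < x < B); last first.
      by rewrite psi'_out// !mulr0 mul0r subrr.
    rewrite /h ind_in; first by ring.
    by case/andP: xAB => -> /ltW->.
  by rewrite RintegralB// fw// (primitive_test AB iw tpsi) subrr.
pose a0 := A + (B - A) / 3; pose b0 := A + (B - A) / 3 * 2.
have Aa0 : A < a0 by rewrite /a0; lra.
have ab0 : a0 < b0 by rewrite /a0 /b0; lra.
have b0B : b0 < B by rewrite /b0; lra.
pose th := bump a0 b0 1 1 0.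
have th0 : \int[lam]_x th x != 0 by exact: bump_int_neq0.
(* Average of [h] weighted by the fixed bump [th]: the only constant that [h] can equal. *)
pose k := (\int[lam]_x (h x * th x)) / \int[lam]_x th x.
exists k.
have : {ae lam, forall x, A < x < B -> h x - ind A B x * k = 0}.
  have ihk : lam.-integrable setT (EFin \o (fun x => h x - ind A B x * k)).
    apply: integrableRB => //; rewrite (_ : (fun x => _) = (fun x => k * ind A B x)).
      by apply: integrableRZ; exact: integrable_ind.
    by apply/funext => x; rewrite mulrC.
  apply: ae0_test => // a b c Aa ab bB c0.
  pose chi := bump a b c 1 0.
  (* [chi] minus [s] times [th] has zero mean, so it is the derivative of a test function. *)
  pose s := (\int[lam]_x chi x) / \int[lam]_x th x.
  have ichi := bump_integrable ab c0; have ith := bump_integrable ab0 (@ltr01 R).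
  pose a1 := Num.min a a0; pose b1 := Num.max b b0.
  have [|||n x|x||tP dP] := @test_fun_primitive a1 b1 A B (fun x => chi x - s * th x).
  - by rewrite lt_min Aa.
  - by rewrite gt_min lt_max ab.
  - by rewrite gt_max bB.
  - have [-> d] := @derive1n_lin chi th s n
      (fun n x => @bump_derivable a b c n x ab c0)
      (fun n x => @bump_derivable a0 b0 1 n x ab0 ltr01).
    exact: d.
  - move=> xout; rewrite /chi /th !bump_out ?mulr0 ?subrr//; apply: contra xout => /andP[h1 h2].
      by rewrite gt_min lt_max h1 h2 !orbT.
    by rewrite gt_min lt_max h1 h2.
  - rewrite RintegralB//; last exact: integrableRZ.
    by rewrite RintegralZl// /s divfK// subrr.
  have ihc : lam.-integrable setT (EFin \o (fun x => h x * chi x)).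
    apply: (integrable_mul_bounded (K := 1)) => //.
      exact: (measurable_of_integrable ichi).
    by move=> x; have /andP[? ?] := bump_ge0_le1 a b x c0; rewrite ger0_norm.
  have iht : lam.-integrable setT (EFin \o (fun x => h x * th x)).
    apply: (integrable_mul_bounded (K := 1)) => //.
      exact: (measurable_of_integrable ith).
    by move=> x; have /andP[? ?] := bump_ge0_le1 a0 b0 x ltr01; rewrite ger0_norm.
  transitivity (\int[lam]_x (h x * chi x - k * chi x)).
    apply: eq_Rintegral => x _; have [xab|xab] := boolP (a < x < b); last first.
      by rewrite /chi bump_out// !mulr0 subrr.
    rewrite /chi ind_in ?mul1r; first by ring.
    by case/andP: xab => h1 h2; apply/andP; split; [exact: lt_trans h1|apply/ltW; exact: lt_trans bB].
  rewrite RintegralB//; last exact: integrableRZ.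
  rewrite RintegralZl//.
  rewrite /k; move: (h0 _ tP); rewrite dP.
  rewrite (_ : (fun x => _) = (fun x => h x * chi x - s * (h x * th x))); last first.
    by apply/funext => x; ring.
  rewrite RintegralB//; last exact: integrableRZ.
  rewrite RintegralZl// => /subr0_eq ->.
  by rewrite /s mulrAC [X in _ - X]mulrAC [\int[lam]_x (h x * th x) * _]mulrC subrr.
apply: aeS => x hx /[dup] xAB /hx; rewrite /h ind_in ?mul1r; first by move/subr0_eq/eqP; rewrite subr_eq => /eqP.
by case/andP: xAB => -> /ltW->.
Qed.
End smooth_bumps.

(** * Product of two semi-inner product spaces *)

Section pairs.
Variables (R : realType) (E : lmodType R) (S : set E) (dot : E -> E -> R).

Definition pair_dot (p q : E * E) := dot p.1 q.1 + dot p.2 q.2.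

Definition pair_set : set (E * E) := [set p | S p.1 /\ S p.2].

Lemma pair_semi_ip : semi_ip S dot -> semi_ip pair_set pair_dot.
Proof.
move=> ipS; split.
- by move=> a x y [? ?] [? ?]; split => /=; exact: (sip_comb ipS).
- by split => /=; case: ipS.
- by move=> x y; rewrite /pair_dot !(sipC ipS y.1) !(sipC ipS y.2).
- move=> a x y z [? ?] [? ?] [? ?]; rewrite /pair_dot /= !(sip_lin ipS)//.
  by ring.
- by move=> x; rewrite addr_ge0// (sip_ge0 ipS).
Qed.

Lemma pair_complete : semi_ip S dot -> complete_ip S dot ->
  complete_ip pair_set pair_dot.
Proof.
move=> ipS cS v Sv cv.
have [|e e0|z1 Sz1 z1P] := cS (fun n => (v n).1).
- by move=> n; case: (Sv n).
- have [n0 n0P] := cv e e0; exists n0 => m n hm hn.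
  by apply: le_trans (n0P _ _ hm hn); rewrite /pair_dot/= lerDl (sip_ge0 ipS).
have [|e e0|z2 Sz2 z2P] := cS (fun n => (v n).2).
- by move=> n; case: (Sv n).
- have [n0 n0P] := cv e e0; exists n0 => m n hm hn.
  by apply: le_trans (n0P _ _ hm hn); rewrite /pair_dot/= lerDr (sip_ge0 ipS).
exists (z1, z2) => //; rewrite [X in _ --> X](_ : 0 = 0 + 0); last by rewrite addr0.
exact: cvgD.
Qed.
End pairs.

(** * Separability of subsets and of products *)

Section separability.
Variables (R : realType) (E : lmodType R) (S : set E) (dot : E -> E -> R).
Hypothesis ipS : semi_ip S dot.

Lemma sip_sub_le x y : S x -> S y ->
  dot (x - y) (x - y) <= 2 * dot x x + 2 * dot y y.
Proof.
move=> Sx Sy; have -> : x - y = (-1) *: y + x by rewrite scaleN1r addrC.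
have := sip_ge0 ipS (1 *: y + x); rewrite !(sip_expand ipS)//; lra.
Qed.

Lemma snd_small (c : R) : 0 < c -> exists n : nat, n.+1%:R^-1 <= c.
Proof.
move=> c0; have := @near_infty_natSinv_lt R (PosNum c0).
by case=> n _ /(_ n (leqnn _))/ltW; exists n.
Qed.

(** The dense sequence of the ambient space may miss [P] altogether. For each pair $(k,j)$ a point
    of [P] whose squared distance to $e_k$ is at most $1/(j+1)$ is chosen, if there is one, and an
    arbitrary point of [P] otherwise. *)
Lemma subset_separable (e : nat -> E) (P : set E) : (forall k, S (e k)) ->
  (forall x (eps : R), S x -> 0 < eps -> exists k, dot (x - e k) (x - e k) <= eps) ->
  P `<=` S -> P !=set0 ->
  exists p : nat -> E, (forall n, P (p n)) /\
    forall x (eps : R), P x -> 0 < eps -> exists n, dot (x - p n) (x - p n) <= eps.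
Proof.
move=> Se de PS [x0 Px0].
pose near k j x := dot (x - e k) (x - e k) <= j.+1%:R^-1.
pose dec n : nat * nat := odflt (0%N, 0%N) (unpickle n).
have /choice[p pP] : forall n, exists x, P x /\
    ((exists2 y, P y & near (dec n).1 (dec n).2 y) -> near (dec n).1 (dec n).2 x).
  move=> n; have [[y Py ny]|nP] := pselect (exists2 y, P y & near (dec n).1 (dec n).2 y).
    by exists y.
  by exists x0; split => // h; case: nP.
exists p; split=> [n|x eps Px eps0]; first by case: (pP n).
(* Two errors of at most a quarter, each doubled by [sip_sub_le]. *)
have eps4 : 0 < eps / 4 by rewrite divr_gt0.
have [j jeps] := snd_small eps4.
have j0 : 0 < j.+1%:R^-1 :> R by rewrite invr_gt0.
have [k kx] := de x _ (PS _ Px) j0.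
pose n := pickle (k, j); exists n.
have en : dec n = (k, j) by rewrite /dec pickleK.
have [Ppn] := pP n; rewrite en /= => /(_ (ex_intro2 _ _ x Px kx)) npn.
have -> : x - p n = (x - e k) - (p n - e k) by rewrite opprB addrA subrK.
have Sx := PS _ Px; have Spn := PS _ Ppn.
have := sip_sub_le (sip_sub ipS Sx (Se k)) (sip_sub ipS Spn (Se k)).
move: npn kx jeps; rewrite /near.
move: (dot (_ - (p n - e k)) _) (dot (x - e k) _) (dot (p n - e k) _) => c a b.
by move: (j.+1%:R^-1) => y; lra.
Qed.

Lemma pair_separable (e : nat -> E) : (forall k, S (e k)) ->
  (forall x (eps : R), S x -> 0 < eps -> exists k, dot (x - e k) (x - e k) <= eps) ->
  exists e2 : nat -> E * E, (forall k, pair_set S (e2 k)) /\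
  forall x (eps : R), pair_set S x -> 0 < eps ->
    exists k, pair_dot dot (x - e2 k) (x - e2 k) <= eps.
Proof.
move=> Se de; pose dec n : nat * nat := odflt (0%N, 0%N) (unpickle n).
exists (fun n => (e (dec n).1, e (dec n).2)); split=> [k|[x y] eps [Sx Sy] eps0]; first by split; exact: Se.
have eps2 : 0 < eps / 2 by rewrite divr_gt0.
have [k hk] := de x _ Sx eps2; have [j hj] := de y _ Sy eps2.
exists (pickle (k, j)); rewrite /dec pickleK /pair_dot/=.
by move: hk hj; move: (dot _ _) (dot _ _) => a b; lra.
Qed.
End separability.

Lemma integrable_shift (R : realType) (a : R) (f : R -> R) :
  (@lebesgue_measure R).-integrable setT (EFin \o f) ->
  (@lebesgue_measure R).-integrable setT (EFin \o (fun t => f (t + a))).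
Proof.
move=> /integrableP[mf if_]; apply/integrableP; split.
  exact: (measurableT_comp mf (measurable_shiftR a)).
by rewrite (ge0_integral_shift a (f := fun t => `|(EFin \o f) t|%E))//; exact: measurableT_comp.
Qed.

(** * Gronwall's lemma for an inequality that holds almost everywhere *)

Section gronwall.
Variable R : realType.
Notation lam := (@lebesgue_measure R).

Lemma ae_le_Rintegral (f g : R -> R) : lam.-integrable setT (EFin \o f) ->
  lam.-integrable setT (EFin \o g) -> {ae lam, forall t, f t <= g t} ->
  \int[lam]_t f t <= \int[lam]_t g t.
Proof.
move=> hf hg fg; rewrite -subr_ge0 -RintegralB//.
have ifg := integrableRB hg hf; have mfg := measurable_of_integrable ifg.
rewrite (@Rintegral_ae _ _ _ lam _ (fun t => `|g t - f t|))//; last 2 first.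
- exact: measurableT_comp.
- by apply: aeS fg => t h; rewrite ger0_norm// subr_ge0.
exact: Rintegral_ge0.
Qed.

(** With $Y=\int_0 y$, the function $g=A+bY$ is continuous but $Y$ is not differentiable everywhere.
    It is replaced by $Z=\int_0 g$, which is differentiable and dominates $Y$ on $[0,T]$; then
    $e^{-bs}(A+bZ)$ has derivative $e^{-bs}b^2(Y-Z)\le0$. *)
Lemma gronwall (y : R -> R) (T A b : R) : 0 < T -> 0 <= A -> 0 <= b ->
  lam.-integrable setT (EFin \o y) -> (forall t : R, t <= 0 -> y t = 0) ->
  {ae lam, forall t, 0 < t < T -> y t <= A + b * primitive y t} ->
  forall t : R, 0 <= t <= T -> A + b * primitive y t <= A * expR (b * T).
Proof.
move=> T0 A0 b0 iy y0 yP t /andP[t0 tT].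
have cY := primitive_continuous iy.
pose g (s : R) : R := A + b * primitive y s.
have cg : continuous g.
  by move=> s; apply: cvgD; [exact: cvg_cst|apply: cvgM; [exact: cvg_cst|exact: cY]].
(* The cut-off makes [g] integrable over the line; its margin of 1 on each side keeps 0 and [T]
   interior, so that two-sided derivatives exist there. *)
pose h (s : R) : R := ind (-1) (T + 1) s * g s.
have ih : lam.-integrable setT (EFin \o h).
  apply: (integrable_mul_bounded (K := A + b * \int[lam]_t `|y t|)).
  - exact: integrable_ind.
  - exact: continuous_measurable.
  move=> s; rewrite (le_trans (ler_normD _ _))// ger0_norm// lerD2l normrM ger0_norm//.
  by rewrite ler_wpM2l// primitive_bound.
have dh (s : R) : -1 < s < T + 1 -> is_derive s (1 : R) (primitive h) (g s).
  move=> /andP[s1 s2]; have su : s < s + 1 by rewrite ltrDl.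
  have gs : g s = h s by rewrite /h ind_in ?mul1r// s1 ltW.
  have [||dk e] := @continuous_FTC1 R h -oo%O s (s + 1) su (integrable_itv _ ih).
  - exact: ltNyr.
  - suff : h @ s --> h s by [].
    rewrite -gs; have : g @ s --> g s by exact: cg.
    apply: cvg_trans; apply: near_eq_cvg; near=> z.
    rewrite /h ind_in ?mul1r//; apply/andP; split; last apply/ltW; near: z.
      exact: lt_nbhsr.
    exact: lt_nbhsl.
  by rewrite gs -e derive1E; exact: derivableP.
have YZ (s : R) : 0 <= s <= T -> primitive y s <= primitive h s - primitive h 0.
  move=> /andP[s0 sT]; rewrite primitiveB//.
  have -> : primitive y s = \int[lam]_(x in `]0, s]) y x.
    rewrite -primitiveB// (_ : primitive y 0 = 0) ?subr0// /primitive Rintegral_mkcond.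
    transitivity (\int[lam]_t (0 : R)); last by rewrite Rintegral_cst// mul0r.
    by apply: eq_Rintegral => x _; rewrite patchE mem_setE in_itv/=; case: leP => // /y0.
  rewrite !Rintegral_indE; apply: ae_le_Rintegral; [exact: integrable_ind_mul|exact: integrable_ind_mul|].
  have : {ae lam, forall t, t != T}.
    exists [set T]; split => //; first exact: lebesgue_measure_set1.
    by move=> z /= /negP; rewrite negbK => /eqP.
  apply: ae2 yP => z yz zT; have [/andP[z0 zs]|zn] := boolP (0 < z <= s); last first.
    by rewrite indE (negbTE zn) !mul0r.
  have zT' : z < T by rewrite lt_neqAle zT (le_trans zs sT).
  have z1 : -1 < z <= T + 1.
    by rewrite (lt_trans _ z0) ?ltrN10//= ltW// (lt_trans zT')// ltrDl.
  by rewrite /h (@ind_in R 0 s) ?z0// (@ind_in R (-1)) ?z1// !mul1r; apply: yz; rewrite z0.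
pose phi (s : R) : R := expR (- b * s) * (A + b * (primitive h s - primitive h 0)).
have dphi (s : R) : -1 < s < T + 1 -> is_derive s (1 : R) phi
    (expR (- b * s) * (b * (b * (primitive y s - (primitive h s - primitive h 0))))).
  move=> hs; have d1 := dh s hs.
  have he := is_derive1_comp (is_derive_expR _) (is_deriveM (is_derive_cst (- b) s 1) (is_derive_id s (1 : R))).
  have d2 := is_deriveD (is_derive_cst A s 1)
    (is_deriveM (is_derive_cst b s 1) (is_deriveB d1 (is_derive_cst (primitive h 0) s 1))).
  have hM := is_deriveM he d2.
  rewrite (_ : phi = (expR \o (cst (- b) * id)) * (cst A + cst b * (primitive h - cst (primitive h 0))))//.
  by apply: (is_derive_eq hM); rewrite !fctE /g /GRing.scale/=; ring.
have phi0 : phi 0 = A by rewrite /phi subrr mulr0 expR0 mulr0 addr0 mul1r.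
have phiT : phi t <= A.
  move: t0; rewrite le_eqVlt => /predU1P[<-|t0]; first by rewrite phi0.
  have inT (x : R) : 0 <= x -> x <= t -> -1 < x < T + 1.
    by move=> x0 xt; rewrite (lt_le_trans _ x0) ?ltrN10//= (le_lt_trans (le_trans xt tT))// ltrDl.
  have [||c /=] := @MVT R phi (fun s => expR (- b * s) * (b * (b * (primitive y s - (primitive h s - primitive h 0))))) 0 t t0.
  - by move=> x /=; rewrite in_itv/= => /andP[x0 xt]; apply: dphi; apply: inT; exact: ltW.
  - apply: derivable_within_continuous => x /=; rewrite in_itv/= => /andP[x0 xt].
    by have [] := dphi x (inT x x0 xt).
  rewrite in_itv/= => /andP[c0 ct] e; rewrite -subr_le0 -[X in _ - X]phi0 e.
  rewrite mulr_le0_ge0 ?subr_ge0 ?(ltW t0)//.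
  rewrite mulr_ge0_le0 ?expR_ge0// mulr_ge0_le0// mulr_ge0_le0// subr_le0.
  by apply: YZ; rewrite (ltW c0) (le_trans (ltW ct) tT).
apply: (@le_trans _ _ (A + b * (primitive h t - primitive h 0))).
  by rewrite lerD2l ler_wpM2l// YZ// t0 tT.
have -> : A + b * (primitive h t - primitive h 0) = expR (b * t) * phi t.
  by rewrite /phi mulrA -expRD mulNr subrr expR0 mul1r.
apply: (le_trans (ler_wpM2l (expR_ge0 _) phiT)).
by rewrite mulrC ler_wpM2l// ler_expR ler_wpM2l.
Unshelve. all: by end_near.
Qed.
End gronwall.

(** * Multiplication by bounded functions *)

Section bounded_multiplier.
Context d (X : measurableType d) (R : realType) (m : {measure set X -> \bar R}).

Lemma sqint_bounded (F G : X -> R) (K : R) : sqint m F ->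
  measurable_fun setT G -> (forall x, `|G x| <= K) ->
  sqint m (fun x => G x * F x).
Proof.
move=> sF mG GK; have [mF _] := sF.
apply: (sqint_le (g := K *: F)); first exact: measurable_funM.
  exact: (sip_scale (ip_sip m)).
move=> x; rewrite (_ : (K *: F) x = K * F x)// !normrM ler_wpM2r//.
by rewrite (le_trans (GK x))// ler_norm.
Qed.

Lemma le_Rintegral_int (f g : X -> R) : m.-integrable setT (EFin \o f) ->
  m.-integrable setT (EFin \o g) -> (forall x, f x <= g x) ->
  \int[m]_x f x <= \int[m]_x g x.
Proof. by move=> hf hg fg; apply: le_Rintegral. Qed.
End bounded_multiplier.

(** * The abstract evolution problem *)

Section evolution.
Context d (X : measurableType d) (R : realType).
Variable mu : {sigma_finite_measure set X -> \bar R}.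
Notation lam := (@lebesgue_measure R).
Notation nu := (mu \x lam)%E.
Variables (T : R) (D : X -> R) (U : X * R -> R) (dm dM m : R).
Variables (Na Nb : nat -> X -> R).
Hypotheses (T0 : 0 < T) (dm0 : 0 < dm).
Hypothesis mD : measurable_fun setT D.
Hypothesis D_bound : forall x, dm <= D x <= dM.
Hypothesis mU : measurable_fun setT (U : X * measurableTypeR R -> R).
Hypothesis U_bound : forall z, `|U z| <= m.
Hypothesis sNa : forall k, sqint mu (Na k).
Hypothesis sNb : forall k, sqint mu (Nb k).
Implicit Types (F G : X * R -> R) (v w : X -> R).

(* The closed subspace that plays the role of V: v is the function, w its derivative. *)
Definition VV v w := [/\ sqint mu v, sqint mu w &
  forall k, ip mu v (Na k) + ip mu w (Nb k) = 0].

Definition cut F : X * R -> R := fun z => ind 0 T z.2 * F z.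

Definition flux (rho sigma : X * R -> R) : X * R -> R :=
  fun z => D z.1 * sigma z + U z * rho z.

(** The equation integrated from 0 to [t]: it involves no time derivative and already contains the
    initial datum. Both components vanish outside $]0,T]$, which lets time integrals run over the
    whole line; at the times outside, the constraints of [VV] hold trivially. *)
Definition sol rho0 (rho sigma : X * R -> R) :=
  [/\ sqint nu rho /\ sqint nu sigma,
      (forall z, ~~ (0 < z.2 <= T) -> rho z = 0 /\ sigma z = 0),
      {ae lam, forall t, VV (sl rho t) (sl sigma t)} &
      forall v w, VV v w -> {ae lam, forall t, 0 < t < T ->
        ip mu (sl rho t) v = ip mu rho0 v -
          ip nu (flux rho sigma) (tens w (ind 0 t))}].

Let H := ip_sip mu.
Let HQ := ip_sip nu.

Lemma VV_lin a v w v' w' : VV v w -> VV v' w' -> VV (a *: v + v') (a *: w + w').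
Proof.
move=> [sv sw vw] [sv' sw' vw']; split; [exact: (sip_comb H)|exact: (sip_comb H)|].
move=> k; rewrite !ip_lin// addrACA -mulrDr vw vw' mulr0 addr0//.
Qed.

Lemma VV0 : VV 0 0.
Proof.
split; [exact: sqint0|exact: sqint0|] => k.
by rewrite ![ip mu 0 _](sipC H) !(sip0r H)// addr0.
Qed.

Lemma VV_scale a v w : VV v w -> VV (a *: v) (a *: w).
Proof. by move=> h; have := VV_lin a h VV0; rewrite !addr0. Qed.

Lemma measurable_ind2 a b : measurable_fun setT
  (fun z : X * measurableTypeR R => ind a b z.2 : R).
Proof. by apply: (measurableT_comp (measurable_ind a b)). Qed.

Lemma sqint_cut F : sqint nu F -> sqint nu (cut F).
Proof.
move=> sF; apply: (sqint_bounded (K := 1) sF); first exact: measurable_ind2.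
by move=> z; rewrite ger0_norm ?ind_ge0// ind_le1.
Qed.

Lemma measurable_D1 : measurable_fun setT (fun z : X * measurableTypeR R => D z.1 : R).
Proof. by apply: (measurableT_comp mD). Qed.

Lemma D_norm x : `|D x| <= dM.
Proof.
have /andP[h1 h2] := D_bound x; rewrite ger0_norm//.
exact: le_trans (ltW dm0) h1.
Qed.

Lemma sqint_flux rho sigma : sqint nu rho -> sqint nu sigma ->
  sqint nu (flux rho sigma).
Proof.
move=> sr ss; apply: (sip_add HQ).
  by apply: (sqint_bounded ss measurable_D1) => z; exact: D_norm.
exact: (sqint_bounded sr mU).
Qed.

(* Admissible test curves of the adjoint problem: tau is the space derivative of phi
   and zeta is minus its time derivative. *)
Definition trial (phi tau zeta : X * R -> R) :=
  [/\ [/\ sqint nu (cut phi), sqint nu (cut tau) & sqint nu (cut zeta)],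
      (forall x (t : R), is_derive t (1 : R) (fun s => phi (x, s)) (- zeta (x, t))) /\
        (forall x, continuous (fun s => zeta (x, s) : R)),
      forall x, phi (x, T) = 0 &
      forall t, VV (sl phi t) (sl tau t)].

(** The null set of times precedes the quantifier over [VV], because the elements inserted later are
    slices of a curve that moves with time. *)
Definition ann (chi eta : X * R -> R) :=
  [/\ sqint nu chi, sqint nu eta &
      {ae lam, forall t, forall v w, VV v w ->
        ip mu v (sl chi t) + ip mu w (sl eta t) = 0}].

Lemma trial_lin a p t z p' t' z' : trial p t z -> trial p' t' z' ->
  trial (a *: p + p') (a *: t + t') (a *: z + z').
Proof.
have cut_lin (F G : X * R -> R) : cut (a *: F + G) = a *: cut F + cut G.
  apply/funext => y; rewrite /cut.
  rewrite (_ : (a *: F + G) y = a * F y + G y)//.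
  by rewrite (_ : (_ + _ : X * R -> R) y = a * (ind 0 T y.2 * F y) + ind 0 T y.2 * G y)//; ring.
move=> [[s1 s2 s3] [d1 c1] z1 v1] [[s1' s2' s3'] [d1' c1'] z1' v1']; split.
- by rewrite !cut_lin; split; exact: (sip_comb HQ).
- split=> [x s|x].
    have h := d1 x s; have h' := d1' x s.
    have -> : - (a *: z + z') (x, s) = a *: (- z (x, s)) + (- z' (x, s)) :> R.
      by rewrite (_ : (a *: z + z') (x, s) = a * z (x, s) + z' (x, s))// opprD scalerN.
    exact: is_deriveD.
  by move=> s; apply: cvgD; [apply: cvgZr; exact: c1|exact: c1'].
- by move=> x; rewrite (_ : (a *: p + p') (x, T) = a * p (x, T) + p' (x, T))// z1 z1' mulr0 addr0.
- by move=> s; apply: (VV_lin a (v1 s) (v1' s)).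
Qed.

Lemma ann_lin a c e c' e' : ann c e -> ann c' e' -> ann (a *: c + c') (a *: e + e').
Proof.
move=> [s1 s2 h] [s1' s2' h']; split; [exact: (sip_comb HQ)|exact: (sip_comb HQ)|].
have := ae_and (ae_and (ae_sl_sqint s1) (ae_sl_sqint s2))
  (ae_and (ae_sl_sqint s1') (ae_sl_sqint s2')).
move: (ae_and h h'); apply: ae2 => t [ht ht'] [[q1 q2] [q1' q2']] v w vw.
have [sv sw _] := vw.
have e1 : sl (a *: c + c') t = a *: sl c t + sl c' t by [].
have e2 : sl (a *: e + e') t = a *: sl e t + sl e' t by [].
rewrite e1 e2 !(sip_linr H)// addrACA -mulrDr ht// ht'// mulr0 addr0//.
Qed.

(** By Young's inequality half of the lower bound [dm] absorbs the drift, at the cost $m^2/(2d_m)$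
    in the coefficient of $p^2$; the extra $d_m/2$ keeps a positive margin in $p$ as well. [Q] is
    the largest value on $[0,T]$ of the weight $e^{2\lambda t}$, where $\lambda$ is [lda]. *)
Let lda : R := m ^+ 2 / (2 * dm) + dm / 2.
Let Q := expR (2 * lda * T).

(** The integrand is the derivative of $-\frac12e^{2\lambda t}\phi^2$, as $\phi'=-\zeta$; the final
    condition $\phi(T)=0$ leaves the value at 0 alone. *)
Lemma weighted_energy (phi zeta : R -> R) :
  (forall t : R, is_derive t (1 : R) phi (- zeta t)) -> continuous zeta ->
  phi T = 0 ->
  \int[lam]_t (ind 0 T t * (expR (2 * lda * t) * (phi t * zeta t - lda * phi t ^+ 2))) =
  phi 0 ^+ 2 / 2.
Proof.
move=> dphi czeta phiT.
have cphi : continuous phi.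
  by move=> t; apply: differentiable_continuous; apply/derivable1_diffP; case: (dphi t).
pose F t : R := - (expR (2 * lda * t) * phi t ^+ 2 / 2).
pose f t : R := expR (2 * lda * t) * (phi t * zeta t - lda * phi t ^+ 2).
have dF t : is_derive t (1 : R) F (f t).
  have h := dphi t.
  have he := is_derive1_comp (is_derive_expR _) (is_deriveM (is_derive_cst (2 * lda) t 1) (is_derive_id t (1 : R))).
  have hM := is_deriveM (is_derive_cst (- 2^-1 : R) t (1 : R)) (is_deriveM he (is_deriveM h h)).
  rewrite (_ : F = cst (- 2^-1) * ((expR \o (cst (2 * lda) * id)) * (phi * phi))); last first.
    by apply/funext => s; rewrite /F !fctE /= expr2; field.
  apply: (is_derive_eq hM).
  by rewrite !fctE /f /GRing.scale/=; field.
have cf : continuous f.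
  move=> t; apply: cvgM.
    apply: continuous_comp; last exact: continuous_expR.
    by apply: cvgM; [exact: cvg_cst|exact: cvg_id].
  apply: cvgB; first by apply: cvgM; [exact: cphi|exact: czeta].
  apply: cvgM; first exact: cvg_cst.
  by under eq_fun do rewrite expr2; rewrite expr2; apply: cvgM; exact: cphi.
rewrite -Rintegral_indE (FTC2_everywhere (ltW T0) dF cf) /F phiT mulr0 expR0.
by rewrite expr0n/=; ring.
Qed.

(** The bound $e\le Q$ is spent on the first term only; the second term keeps the weight, so that
    the weighted form of [coercive] can absorb it. *)
Lemma young (e a p : R) : 0 <= e <= Q ->
  a * (e * p) <= Q / (2 * dm) * a ^+ 2 + dm / 2 * (e * p ^+ 2).
Proof.
move=> /andP[e0 eQ].
have -> : Q / (2 * dm) * a ^+ 2 + dm / 2 * (e * p ^+ 2) =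
  a * (e * p) + ((Q - e) * a ^+ 2 + e * (a - dm * p) ^+ 2) / (2 * dm).
  by field; rewrite gt_eqF.
rewrite lerDl divr_ge0 ?mulr_ge0 ?(ltW dm0)//.
by rewrite addr_ge0// mulr_ge0 ?sqr_ge0// subr_ge0.
Qed.

Lemma coercive (Dx u p t : R) : dm <= Dx -> `|u| <= m ->
  dm / 2 * (p ^+ 2 + t ^+ 2) <= lda * p ^+ 2 + u * t * p + Dx * t ^+ 2.
Proof.
move=> hD hu.
have h1 : dm * t ^+ 2 <= Dx * t ^+ 2 by rewrite ler_wpM2r// sqr_ge0.
have h2 : - (m * `|t * p|) <= u * t * p.
  rewrite lerNl (le_trans (ler_norm _))// normrN -mulrA normrM ler_wpM2r//.
have h3 : m * `|t * p| <= m ^+ 2 / (2 * dm) * p ^+ 2 + dm / 2 * t ^+ 2.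
  rewrite normrM -(real_normK (num_real p)) -(real_normK (num_real t)).
  have -> : m ^+ 2 / (2 * dm) * `|p| ^+ 2 + dm / 2 * `|t| ^+ 2 =
    m * (`|t| * `|p|) + (m * `|p| - dm * `|t|) ^+ 2 / (2 * dm).
    by field; rewrite gt_eqF.
  by rewrite lerDl divr_ge0 ?sqr_ge0// mulr_ge0// ltW.
rewrite /lda; move: h1 h2 h3; set A := m * _; set B := u * t * p; set C := Dx * _.
set K := m ^+ 2 / _; lra.
Qed.

(* (M1, M2) is the adjoint operator applied to a test curve, up to an element of
   the annihilator of VV, which makes the solution satisfy the constraints. *)
Definition M1 (tau zeta chi : X * R -> R) : X * R -> R :=
  cut (fun z => zeta z + U z * tau z) + chi.

Definition M2 (tau eta : X * R -> R) : X * R -> R :=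
  cut (fun z => D z.1 * tau z) + eta.

Lemma sqint_M1 tau zeta chi : sqint nu (cut tau) -> sqint nu (cut zeta) ->
  sqint nu chi -> sqint nu (M1 tau zeta chi).
Proof.
move=> st sz sc; apply: (sip_add HQ) => //.
rewrite (_ : cut _ = cut zeta + (fun z => U z * cut tau z)); last first.
  by apply/funext => z; rewrite /cut fctE/=; ring.
by apply: (sip_add HQ) => //; exact: sqint_bounded mU _.
Qed.

Lemma sqint_M2 tau eta : sqint nu (cut tau) -> sqint nu eta -> sqint nu (M2 tau eta).
Proof.
move=> st sc; apply: (sip_add HQ) => //.
rewrite (_ : cut _ = (fun z => D z.1 * cut tau z)); last first.
  by apply/funext => z; rewrite /cut/=; ring.
by apply: (sqint_bounded st measurable_D1) => z; exact: D_norm.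
Qed.

Let wt (t : R) := ind 0 T t * expR (2 * lda * t).

Let lda_ge0 : 0 <= lda.
Proof. by rewrite addr_ge0// divr_ge0 ?sqr_ge0 ?mulr_ge0// ltW. Qed.

Let wt_bound t : 0 <= wt t <= Q.
Proof.
rewrite /wt indE; have [/andP[h1 h2]|_] := boolP (0 < t <= T).
  by rewrite mul1r expR_ge0 ler_expR ler_wpM2l// mulr_ge0.
by rewrite mul0r lexx expR_ge0.
Qed.

Let measurable_wt : measurable_fun setT (fun z : X * measurableTypeR R => wt z.2 : R).
Proof.
have mw : measurable_fun setT (wt : measurableTypeR R -> R).
  apply: measurable_funM; first exact: measurable_ind.
  by apply: measurableT_comp => //; apply: measurable_funM => //; exact: measurable_cst.
by apply: (measurableT_comp mw).
Qed.

(** The weight and the cut-off depend on time only, so the weighted slices of the curve stay in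
    [VV]. *)
Lemma ann_wt phi tau chi eta : sqint nu (cut phi) -> sqint nu (cut tau) ->
  (forall t, VV (sl phi t) (sl tau t)) -> ann chi eta ->
  ip nu (fun z => wt z.2 * cut phi z) chi + ip nu (fun z => wt z.2 * cut tau z) eta = 0.
Proof.
move=> sp st vv [sc se ce].
have wQ (z : X * R) : `|wt z.2| <= Q by have /andP[h1 h2] := wt_bound z.2; rewrite ger0_norm.
have sgp := sqint_bounded sp measurable_wt wQ.
have sgt := sqint_bounded st measurable_wt wQ.
have [i1 ->] := ip_sl sgp sc; have [i2 ->] := ip_sl sgt se.
rewrite -RintegralD//; transitivity (\int[lam]_t (0 : R)); last first.
  by rewrite Rintegral_cst// mul0r.
apply: Rintegral_ae; [|exact: measurable_cst|].
  by apply: measurable_funD; [exact: measurable_of_integrable i1|exact: measurable_of_integrable i2].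
apply: aeS ce => t ct.
have := ct _ _ (VV_scale (wt t * ind 0 T t) (vv t)).
by move=> <-; congr (_ + _); apply: eq_Rintegral => x _; congr (_ * _);
  rewrite /sl /cut /= mulrA.
Qed.

(** The adjoint operator is paired with the weighted curve. Its annihilator part drops out by
    [ann_wt], the part in [zeta] gives half of $|\phi(0)|^2$ by [weighted_energy], and the squares
    of [phi] and [tau] produced by [young] are absorbed by [coercive]. Everything is first proved
    pointwise, as [L] below [RR], and then integrated. *)
Lemma trial_bound phi tau zeta chi eta : trial phi tau zeta -> ann chi eta ->
  ip mu (sl phi 0) (sl phi 0) <=
  Q / dm * (ip nu (M1 tau zeta chi) (M1 tau zeta chi) + ip nu (M2 tau eta) (M2 tau eta)).
Proof.
move=> [[sp st sz] [dphi czeta] phiT vv] ac; have [sc se _] := ac.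
have wQ (z : X * R) : `|wt z.2| <= Q by have /andP[h1 h2] := wt_bound z.2; rewrite ger0_norm.
have sgp := sqint_bounded sp measurable_wt wQ.
have sgt := sqint_bounded st measurable_wt wQ.
have s1 := sqint_M1 st sz sc; have s2 := sqint_M2 st se.
set m1 := M1 _ _ _ in s1 *; set m2 := M2 _ _ in s2 *.
pose gp z : R := wt z.2 * cut phi z; pose gt z : R := wt z.2 * cut tau z.
pose L z := gp z * cut zeta z - lda * (gp z * cut phi z).
pose RR z := Q / (2 * dm) * (m1 z * m1 z + m2 z * m2 z) - (gp z * chi z + gt z * eta z).
have iL : nu.-integrable setT (EFin \o L).
  apply: integrableRB; first exact: sqint_mul.
  by apply: integrableRZ; exact: sqint_mul.
have iR1 : nu.-integrable setT (EFin \o (fun z => Q / (2 * dm) * (m1 z * m1 z + m2 z * m2 z))).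
  by apply: integrableRZ; apply: integrableRD; exact: sqint_mul.
have iR2 : nu.-integrable setT (EFin \o (fun z => gp z * chi z + gt z * eta z)).
  by apply: integrableRD; exact: sqint_mul.
have iRR : nu.-integrable setT (EFin \o RR) by exact: integrableRB.
have LRR z : L z <= RR z.
  rewrite /L /RR /gp /gt /m1 /m2 /M1 /M2 !fctE /cut /wt indE.
  case: andP => [[h1 h2]|_] /=; rewrite ?mul1r ?mul0r ?add0r.
    have e0Q : 0 <= expR (2 * lda * z.2) <= Q.
      by rewrite expR_ge0 ler_expR ler_wpM2l// mulr_ge0.
    have /andP[hD _] := D_bound z.1.
    have := ler_wpM2l (let: conj h _ := andP e0Q in h) (coercive (phi z) (tau z) hD (U_bound z)).
    have := young (zeta z + U z * tau z + chi z) (phi z) e0Q.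
    have := young (D z.1 * tau z + eta z) (tau z) e0Q.
    move: lda (expR _) (phi z) (tau z) (zeta z) (chi z) (eta z) (D z.1) (U z) (Q / _) (dm / 2).
    by move=> l e p t ze c et Dz Uz K k; lra.
  rewrite !(mul0r, mulr0, add0r, addr0, subr0, oppr0).
  by rewrite mulr_ge0 ?divr_ge0 ?expR_ge0 ?mulr_ge0 ?(ltW dm0)// addr_ge0// -expr2 sqr_ge0.
have : \int[nu]_z L z <= \int[nu]_z RR z by exact: le_Rintegral_int.
have e0 : \int[nu]_z (gp z * chi z + gt z * eta z) = 0.
  rewrite RintegralD; [|exact: measurableT|exact: sqint_mul|exact: sqint_mul].
  exact: (ann_wt sp st vv ac).
have e1 : \int[nu]_z RR z = Q / (2 * dm) * (ip nu m1 m1 + ip nu m2 m2).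
  transitivity (\int[nu]_z (Q / (2 * dm) * (m1 z * m1 z + m2 z * m2 z)) -
    \int[nu]_z (gp z * chi z + gt z * eta z)); first exact: RintegralB.
  rewrite e0 subr0; transitivity (Q / (2 * dm) * \int[nu]_z (m1 z * m1 z + m2 z * m2 z)).
    by apply: RintegralZl => //; apply: integrableRD; exact: sqint_mul.
  by congr (_ * _); apply: RintegralD => //; exact: sqint_mul.
rewrite {}e1.
have [_ ->] := integral_sl1 iL.
have -> : \int[mu]_x \int[lam]_t L (x, t) = 2^-1 * ip mu (sl phi 0) (sl phi 0).
  have [sp0 _ _] := vv 0.
  rewrite /ip -RintegralZl//; last exact: sqint_mul.
  apply: eq_Rintegral => x _.
  transitivity (phi (x, 0) ^+ 2 / 2); last by rewrite /sl; ring.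
  rewrite -(weighted_energy (dphi x) (czeta x) (phiT x)).
  apply: eq_Rintegral => t _.
  rewrite /L /gp /cut /wt /= indE.
  by case: (_ && _) => /=; rewrite ?mul1r ?mul0r ?subrr//; ring.
move: (ip nu m1 m1 + _) (ip mu _ _) => B a.
have -> : Q / dm * B = 2 * (Q / (2 * dm) * B) by field; rewrite gt_eqF.
lra.
Qed.

(** * Existence by Riesz representation *)

Lemma sl0 t : sl (0 : X * R -> R) t = (0 : X -> R).
Proof. by []. Qed.

Lemma ann_tens k (psi : R -> R) : sqint lam psi -> ann (tens (Na k) psi) (tens (Nb k) psi).
Proof.
move=> sp; split; [exact: sqint_tens|exact: sqint_tens|].
apply: aeT => t v w [sv sw vw].
have e (N : X -> R) : sl (tens N psi) t = psi t *: N.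
  by apply/funext => x; rewrite /sl /tens /= mulrC.
have s0 := sqint0 mu.
have es u N : sqint mu u -> sqint mu N -> ip mu u (psi t *: N) = psi t * ip mu u N.
  by move=> su sN; have := sip_linr H (psi t) sN s0 su; rewrite addr0 (sip0r H)// addr0.
by rewrite !e !es// -mulrDr vw mulr0.
Qed.

Lemma trial_tens v w (psi Psi : R -> R) : VV v w -> continuous psi ->
  (forall t : R, is_derive t (1 : R) Psi (- psi t)) -> Psi T = 0 ->
  sqint lam (fun t => ind 0 T t * Psi t) -> sqint lam (fun t => ind 0 T t * psi t) ->
  trial (tens v Psi) (tens w Psi) (tens v psi).
Proof.
move=> vw cpsi dPsi PsiT sP sp; have [sv sw _] := vw.
have e u (p : R -> R) : cut (tens u p) = tens u (fun t => ind 0 T t * p t).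
  by apply/funext => z; rewrite /cut /tens mulrCA.
split.
- by rewrite !e; split; exact: sqint_tens.
- split=> [x t|x t].
    have h := dPsi t; apply: is_derive_eq; first exact: (is_deriveZ (v x) h).
    by rewrite /tens /GRing.scale/= mulrN.
  exact: (cvgM (cvg_cst (v x)) (cpsi t)).
- by move=> x; rewrite /tens PsiT mulr0.
- move=> t; have := VV_scale (Psi t) vw.
  by congr VV; apply/funext => x; rewrite /sl /tens /= mulrC.
Qed.

Lemma trial0 : trial 0 0 0.
Proof.
have c0 : cut 0 = 0 by apply/funext => z; rewrite /cut mulr0.
split; first by rewrite c0; split; exact: sqint0.
- split=> [x t|x t]; last exact: cvg_cst.
  by rewrite oppr0; exact: is_derive_cst.
- by [].
- by move=> t; exact: VV0.
Qed.

Lemma ann0 : ann 0 0.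
Proof.
split; [exact: sqint0|exact: sqint0|].
apply: aeT => t v w [sv sw _].
by rewrite sl0 !(sip0r H)// addr0.
Qed.

Lemma M1_lin a t z c t' z' c' :
  M1 (a *: t + t') (a *: z + z') (a *: c + c') = a *: M1 t z c + M1 t' z' c'.
Proof.
apply/funext => y.
rewrite -[LHS]/(ind 0 T y.2 * (a * z y + z' y + U y * (a * t y + t' y)) + (a * c y + c' y)).
rewrite -[RHS]/(a * (ind 0 T y.2 * (z y + U y * t y) + c y) +
  (ind 0 T y.2 * (z' y + U y * t' y) + c' y)).
by ring.
Qed.

Lemma M2_lin a t e t' e' :
  M2 (a *: t + t') (a *: e + e') = a *: M2 t e + M2 t' e'.
Proof.
apply/funext => y.
rewrite -[LHS]/(ind 0 T y.2 * (D y.1 * (a * t y + t' y)) + (a * e y + e' y)).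
rewrite -[RHS]/(a * (ind 0 T y.2 * (D y.1 * t y) + e y) +
  (ind 0 T y.2 * (D y.1 * t' y) + e' y)).
by ring.
Qed.

Lemma projection rho0 : sqint mu rho0 -> exists rho sigma,
  [/\ sqint nu rho, sqint nu sigma &
   forall phi tau zeta chi eta, trial phi tau zeta -> ann chi eta ->
     ip nu rho (M1 tau zeta chi) + ip nu sigma (M2 tau eta) = ip mu rho0 (sl phi 0)].
Proof.
move=> s0.
pose M : set (((X * R -> R) * (X * R -> R)) * R) := [set p |
  exists phi tau zeta chi eta, [/\ trial phi tau zeta, ann chi eta,
    p.1 = (M1 tau zeta chi, M2 tau eta) & p.2 = ip mu rho0 (sl phi 0)]].
have [|||||z [[s1 s2] zP _]] := @riesz_subspace _ _ _ _ (pair_semi_ip HQ) M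
  (ip mu rho0 rho0 * (Q / dm)) (pair_complete HQ (@ip_complete _ _ _ nu)).
- by rewrite mulr_ge0 ?(sip_ge0 H)// divr_ge0 ?expR_ge0// ltW.
- exists 0, 0, 0, 0, 0; split; [exact: trial0|exact: ann0| |].
    congr pair; apply/funext => z.
      rewrite -[LHS]/(0 : R).
      by transitivity (ind 0 T z.2 * (0 + U z * 0) + 0) => //; ring.
    rewrite -[LHS]/(0 : R).
    by transitivity (ind 0 T z.2 * (D z.1 * 0) + 0) => //; ring.
  by rewrite sl0 (sip0r H).
- move=> p [phi [tau [zeta [chi [eta [[[? ? ?] _ _ _] [? ? _] -> _]]]]]].
  by split; [exact: sqint_M1|exact: sqint_M2].
- move=> a p q [phi [tau [zeta [chi [eta [h1 h2 -> ->]]]]]].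
  move=> [phi' [tau' [zeta' [chi' [eta' [h1' h2' -> ->]]]]]].
  exists (a *: phi + phi'), (a *: tau + tau'), (a *: zeta + zeta'), (a *: chi + chi'), (a *: eta + eta').
  split; [exact: trial_lin|exact: ann_lin| |].
    by rewrite M1_lin M2_lin.
  have [_ _ _ /(_ 0)[sp _ _]] := h1; have [_ _ _ /(_ 0)[sp' _ _]] := h1'.
  by rewrite /= -(sip_linr H).
- move=> p [phi [tau [zeta [chi [eta [h1 h2 -> ->]]]]]].
  have [_ _ _ /(_ 0)[sp _ _]] := h1.
  rewrite (le_trans (sip_CS H s0 sp))// -mulrA ler_wpM2l ?(sip_ge0 H)//.
  exact: trial_bound.
exists z.1, z.2; split => // phi tau zeta chi eta h1 h2.
by apply: (zP ((M1 tau zeta chi, M2 tau eta), _)); exists phi, tau, zeta, chi, eta.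
Qed.

Lemma ip_scaler a u w : sqint mu u -> sqint mu w -> ip mu (a *: u) w = a * ip mu u w.
Proof.
move=> su sw; have s0 := sqint0 mu.
by have := sip_lin H a su s0 sw; rewrite addr0 (sipC H 0) (sip0r H)// addr0.
Qed.

Lemma sl_cut F t : sl (cut F) t = ind 0 T t *: sl F t.
Proof. by []. Qed.

(** Two choices of test data are enough: the zero curve with an annihilator concentrated on one
    constraint, and curves with separated variables $v\otimes\Psi$. *)
Lemma exists_sol rho0 : sqint mu rho0 -> exists rho sigma, sol rho0 rho sigma.
Proof.
move=> s0; have [rho [sigma [sr ss orth]]] := projection s0.
have scr := sqint_cut sr; have scs := sqint_cut ss.
exists (cut rho), (cut sigma); split => //.
- by move=> z hz; rewrite /cut indE (negbTE hz) !mul0r.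
- have h k : {ae lam, forall t, ind 0 T t * (ip mu (sl rho t) (Na k) + ip mu (sl sigma t) (Nb k)) = 0}.
    have [_ i1] := ip_sl_tens sr (sNa k) (sqint_ind 0 T).
    have [_ i2] := ip_sl_tens ss (sNb k) (sqint_ind 0 T).
    apply: ae0_Rintegral_itv.
      under eq_fun do rewrite mulrDr.
      exact: integrableRD.
    move=> a b ab; rewrite Rintegral_indE.
    pose a' := Num.max a 0; pose b' := Num.min b T.
    have [ba'|ab'] := leP b' a'.
      transitivity (\int[lam]_t (0 : R)); last by rewrite Rintegral_cst// mul0r.
      apply: eq_Rintegral => t _.
      by rewrite mulrA ind_mul ind_empty// mul0r.
    (* With the zero curve only the annihilator part survives: the [k]-th constraint integrated over
       a time interval. *)
    have := orth 0 0 0 _ _ trial0 (ann_tens k (sqint_ind a' b')).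
    rewrite sl0 (sip0r H)//.
    have -> : M1 0 0 (tens (Na k) (ind a' b')) = tens (Na k) (ind a' b').
      apply/funext => z; transitivity (ind 0 T z.2 * (0 + U z * 0) + tens (Na k) (ind a' b') z) => //.
      by ring.
    have -> : M2 0 (tens (Nb k) (ind a' b')) = tens (Nb k) (ind a' b').
      apply/funext => z; transitivity (ind 0 T z.2 * (D z.1 * 0) + tens (Nb k) (ind a' b') z) => //.
      by ring.
    have [-> j1] := ip_sl_tens sr (sNa k) (sqint_ind a' b').
    have [-> j2] := ip_sl_tens ss (sNb k) (sqint_ind a' b').
    rewrite -RintegralD// => e; rewrite -[RHS]e; apply: eq_Rintegral => t _.
    by rewrite mulrA ind_mul mulrDr.
  have := ae_and (ae_nat h) (ae_and (ae_sl_sqint sr) (ae_sl_sqint ss)).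
  apply: aeS => t [ht [h1 h2]]; rewrite !sl_cut; split.
  + exact: (sip_scale H).
  + exact: (sip_scale H).
  + by move=> k; rewrite !ip_scaler// -mulrDr ht.
- move=> v w vw; have [sv sw _] := vw.
  have sf := sqint_flux scr scs; set f := flux _ _ in sf *.
  have [_ iG] := ip_sl_tens sf sw (sqint_ind 0 T).
  pose G t := ind 0 T t * ip mu (sl f t) w.
  have [_ ir] := ip_sl_tens scr sv (sqint_ind 0 T).
  (* Residual of the integrated equation at time [t]; it is shown to be orthogonal to bumps. *)
  pose g t := ind 0 T t * ip mu (sl (cut rho) t) v + ind 0 T t * primitive G t
    - ip mu rho0 v * ind 0 T t.
  have ig : lam.-integrable setT (EFin \o g).
    apply: integrableRB; last by apply: integrableRZ; exact: integrable_ind.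
    apply: integrableRD => //.
    apply: (integrable_mul_bounded (K := \int[lam]_t `|G t|)); first exact: integrable_ind.
      by apply: continuous_measurable; exact: primitive_continuous.
    by move=> t; exact: primitive_bound.
  have g0 : {ae lam, forall t, 0 < t < T -> g t = 0}.
    apply: ae0_test => // a b c a0 ab bT c0.
    (* [Psi] vanishes at [T] and minus its derivative is [psi], as a test curve requires. Fubini
       then moves the tail integral from [psi] to the flux, where it becomes the primitive [G] of
       the integrated equation. *)
    pose psi := bump a b c 1 0; pose Psi y := \int[lam]_(x in `[y, +oo[) psi x.
    have cpsi : continuous psi by exact: bump_continuous.
    have ipsi : lam.-integrable setT (EFin \o psi) by exact: bump_integrable.
    have psi_out x : ~~ (0 < x < T) -> psi x = 0.
      move=> hx; apply: bump_out; apply: contra hx => /andP[h1 h2].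
      by rewrite (lt_trans a0 h1) (lt_trans h2 bT).
    have PsiE y : Psi y = \int[lam]_x psi x - primitive psi y.
      rewrite /Psi -Rintegral_itv_obnd_cbnd; last exact: integrable_itv.
      rewrite /primitive Rintegral_mkcond [X in _ - X]Rintegral_mkcond -RintegralB//.
        apply: eq_Rintegral => x _; rewrite !patchE !mem_setE !in_itv/= andbT.
        by case: (leP x y) => _; rewrite ?subrr ?subr0.
      exact: integrable_patch.
    have dPsi t : is_derive t (1 : R) Psi (- psi t).
      rewrite (_ : Psi = cst (\int[lam]_x psi x) - primitive psi); last by apply/funext => y; rewrite PsiE.
      have h := is_deriveB (is_derive_cst (\int[lam]_x psi x) t (1 : R)) (primitive_is_derive t cpsi ipsi).
      by apply: (is_derive_eq h); rewrite sub0r.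
    have PsiT : Psi T = 0.
      rewrite /Psi Rintegral_mkcond; transitivity (\int[lam]_t (0 : R)); last by rewrite Rintegral_cst// mul0r.
      apply: eq_Rintegral => x _; rewrite patchE mem_setE in_itv/= andbT.
      by case: leP => // Tx; rewrite psi_out// negb_and -!leNgt Tx orbT.
    have sP : sqint lam (fun t => ind 0 T t * Psi t).
      under eq_fun do rewrite mulrC.
      apply: (sqint_bounded (K := `|\int[lam]_x psi x| + \int[lam]_x `|psi x|)); first exact: sqint_ind.
        apply: continuous_measurable => t; apply: differentiable_continuous.
        by apply/derivable1_diffP; case: (dPsi t).
      move=> y; rewrite PsiE (le_trans (ler_normB _ _))// lerD2l.
      exact: primitive_bound.
    have sp : sqint lam psi.
      rewrite (_ : psi = fun t => psi t * ind 0 T t).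
        apply: (sqint_bounded (K := 1)); [exact: sqint_ind|exact: continuous_measurable|].
        by move=> t; have /andP[? ?] := bump_ge0_le1 a b t c0; rewrite ger0_norm.
      apply/funext => t; have [/andP[h1 h2]|h] := boolP (0 < t < T).
        by rewrite ind_in ?mulr1// h1 ltW.
      by rewrite psi_out// mul0r.
    have indpsi t : ind 0 T t * psi t = psi t.
      have [/andP[h1 h2]|h] := boolP (0 < t < T); first by rewrite ind_in ?mul1r// h1 ltW.
      by rewrite psi_out// mulr0.
    have sp' : sqint lam (fun t => ind 0 T t * psi t) by under eq_fun do rewrite indpsi.
    have tr := trial_tens vw cpsi dPsi PsiT sP sp'.
    have [[_ st sz] _ _ _] := tr.
    have s1 := sqint_M1 st sz (sqint0 nu); have s2 := sqint_M2 st (sqint0 nu).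
    have := orth _ _ _ _ _ tr ann0.
    have -> : ip nu rho (M1 (tens w Psi) (tens v psi) 0) + ip nu sigma (M2 (tens w Psi) 0) =
       ip nu (cut rho) (tens v psi) + ip nu f (tens w (fun t => ind 0 T t * Psi t)).
      have st1 := sqint_tens sv sp; have st2 := sqint_tens sw sP.
      transitivity (\int[nu]_z (rho z * M1 (tens w Psi) (tens v psi) 0 z + sigma z * M2 (tens w Psi) 0 z)).
        by apply/esym; apply: RintegralD => //; exact: sqint_mul.
      transitivity (\int[nu]_z (cut rho z * tens v psi z + f z * tens w (fun t => ind 0 T t * Psi t) z)).
        apply: eq_Rintegral => z _.
        transitivity (rho z * (ind 0 T z.2 * (v z.1 * psi z.2 + U z * (w z.1 * Psi z.2)) + 0) +
          sigma z * (ind 0 T z.2 * (D z.1 * (w z.1 * Psi z.2)) + 0)) => //.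
        by rewrite /f /flux /cut /tens indE; case: (_ && _) => /=; ring.
      by apply: RintegralD => //; exact: sqint_mul.
    have [-> i1] := ip_sl_tens scr sv sp.
    have [-> _] := ip_sl_tens sf sw sP.
    have -> : \int[lam]_t (ind 0 T t * Psi t * ip mu (sl f t) w) = \int[lam]_t (psi t * primitive G t).
      by rewrite Rintegral_primitive//; apply: eq_Rintegral => t _; rewrite /G mulrAC.
    rewrite (_ : sl (tens v Psi) 0 = Psi 0 *: v); last by apply/funext => x; rewrite /sl/tens/= mulrC.
    rewrite (sipC H) ip_scaler// (_ : Psi 0 = \int[lam]_x psi x); last first.
      rewrite PsiE (_ : primitive psi 0 = 0) ?subr0// /primitive Rintegral_mkcond.
      transitivity (\int[lam]_t (0 : R)); last by rewrite Rintegral_cst// mul0r.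
      apply: eq_Rintegral => x _; rewrite patchE mem_setE in_itv/=.
      by case: leP => // Tx; rewrite psi_out// negb_and -!leNgt Tx.
    have i2 : lam.-integrable setT (EFin \o (fun t => psi t * primitive G t)).
      apply: (integrable_mul_bounded (K := \int[lam]_t `|G t|)) => //.
        by apply: continuous_measurable; exact: primitive_continuous.
      by move=> t; exact: primitive_bound.
    move=> e; transitivity (\int[lam]_t (psi t * ip mu (sl (cut rho) t) v + psi t * primitive G t - ip mu rho0 v * psi t)).
      apply: eq_Rintegral => t _; rewrite -/psi /g.
      by rewrite -{2 3 4}indpsi; ring.
    rewrite RintegralB//; [|exact: integrableRD|exact: integrableRZ].
    by rewrite RintegralD// e RintegralZl// (sipC H) mulrC subrr.
  apply: aeS g0 => t gt /[dup] t0T /gt.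
  have t0T' : 0 < t <= T by case/andP: t0T => -> /ltW.
  rewrite /g ind_in// !mul1r mulr1 => /eqP; rewrite subr_eq0 => /eqP <-.
  rewrite (ip_sl_tens sf sw (sqint_ind 0 t)).1.
  rewrite (_ : primitive G t = \int[lam]_s (ind 0 t s * ip mu (sl f s) w)) ?addrK//.
  rewrite /primitive Rintegral_mkcond; apply: eq_Rintegral => s _.
  rewrite patchE mem_setE in_itv/= /G !indE.
  case: (leP s t) => st; last by rewrite andbF mul0r.
  by rewrite andbT (le_trans st) ?andbT//; case/andP: t0T'.
Qed.

(** Fubini in three variables with $s=t+\theta$:
    $\int\int_t^{t+h}(F(s),G(t))\,ds\,dt=\int_0^h\int(F(t+\theta),G(t))\,dt\,d\theta$. The inner
    integral on the left is identified at almost every $t$ only, hence the auxiliary [k]. *)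
Lemma integrable_avg F G h : 0 < h -> sqint nu F -> sqint nu G ->
  exists2 k : R -> R, lam.-integrable setT (EFin \o k) &
  {ae lam, forall t, k t = ip nu F (tens (sl G t) (ind t (t + h)))} /\
  lam.-integrable setT (EFin \o (fun th => ind 0 h th * ip nu (tr th F) G)) /\
  \int[lam]_t k t = \int[lam]_th (ind 0 h th * ip nu (tr th F) G).
Proof.
move=> h0 sF sG; have [mF _] := sF; have [mG _] := sG.
pose F3 (p : (X * measurableTypeR R) * measurableTypeR R) : R := ind 0 h p.2 * F (p.1.1, p.1.2 + p.2).
pose G3 : (X * R) * R -> R := tens G (ind 0 h).
pose nu1 := sfprod mu lam.
have ip1 (f g : X * R -> R) : ip nu1 f g = ip nu f g by [].
have sF1 : sqint nu1 F by exact: sF.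
have sG1 : sqint nu1 G by exact: sG.
have sG3 : sqint (nu1 \x lam)%E G3.
  exact: (@sqint_tens _ _ _ _ R nu1 lam G (ind 0 h) sG1 (sqint_ind 0 h)).
have mF3 : measurable_fun setT F3.
  apply: measurable_funM; first exact: (measurableT_comp (measurable_ind 0 h)).
  apply: (measurableT_comp mF).
  apply/measurable_fun_pairP; split.
    exact: (measurableT_comp measurable_fst measurable_fst).
  apply: measurable_funD; last exact: measurable_snd.
  exact: (measurableT_comp measurable_snd measurable_fst).
have slF3 th : sl F3 th = ind 0 h th *: tr th F by [].
have s0 := sqint0 nu1.
have ipZ a (u w : X * R -> R) : sqint nu1 u -> sqint nu1 w -> ip nu1 (a *: u) w = a * ip nu1 u w.
  move=> su sw; have H1 := ip_sip nu1.
  by have := sip_lin H1 a su s0 sw; rewrite addr0 (sipC H1 0) (sip0r H1)// addr0.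
have sF3 : sqint (nu1 \x lam)%E F3.
  apply: (@sqint_sl_int _ _ _ _ R nu1 lam F3 (fun th => ip nu F F * ind 0 h th) mF3); last first.
    by apply: integrableRZ; exact: integrable_ind.
  apply: aeT => th; rewrite slF3; have [st e] := sqint_tr th sF.
  have sth : sqint nu1 (ind 0 h th *: tr th F) by exact: (sip_scale HQ).
  split => //; rewrite ipZ// (sipC (ip_sip nu1)) ipZ// ip1 e mulrA -expr2 ind_sqr mulrC.
  exact: lexx.
have iK := sqint_mul sF3 sG3.
have [i1 e1] := @integral_sl _ _ _ _ R nu1 lam _ iK.
have [i2 e2] := @integral_sl1 _ _ _ _ R nu1 lam _ iK.
have [i3 e3] := @integral_sl _ _ _ _ R mu lam _ i2.
exists (fun t => \int[mu]_x \int[lam]_th (F3 ((x, t), th) * G3 ((x, t), th))); first exact: i3.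
have e5 th : \int[nu1]_x (F3 (x, th) * G3 (x, th)) = ind 0 h th * ip nu (tr th F) G.
  have [st _] := sqint_tr th sF.
  transitivity (ip nu1 (ind 0 h th *: tr th F) (ind 0 h th *: G)).
    by apply: eq_Rintegral => z _; congr (_ * _); rewrite /G3 /tens/= mulrC.
  have sZ : sqint nu1 (ind 0 h th *: G) by exact: (sip_scale HQ).
  by rewrite ipZ// (sipC (ip_sip nu1)) ipZ// mulrA -expr2 ind_sqr (sipC (ip_sip nu1)).
split; last first.
  rewrite -e3 -[X in _ /\ X = _]e2 e1; split; last by apply: eq_Rintegral => th _; exact: e5.
  by move: i1; under eq_fun do rewrite e5.
apply: aeS (ae_sl_sqint sG) => t st.
have sT := sqint_tens st (sqint_ind t (t + h)).
have [_ e4] := integral_sl1 (sqint_mul sF sT).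
rewrite [RHS]e4.
apply: eq_Rintegral => x _.
have mFx : measurable_fun setT (fun s : measurableTypeR R => F (x, s)).
  by apply: (measurableT_comp mF); exact: measurable_pair1.
have mx : measurable_fun setT ((fun s => F (x, s) * tens (sl G t) (ind t (t + h)) (x, s)) : measurableTypeR R -> R).
  apply: measurable_funM => //.
  exact: (measurable_funM (measurable_cst (sl G t x)) (measurable_ind t (t + h))).
rewrite -[RHS](Rintegral_shift t mx); apply: eq_Rintegral => th _.
rewrite /F3 /G3 /tens /sl/= [th + t]addrC.
have -> : ind t (t + h) (t + th) = ind 0 h th.
  by rewrite !indE ltrDl lerD2l.
by rewrite -[in LHS]ind_sqr; rewrite indE; case: (_ && _); rewrite /=; ring.
Qed.

Variable e_ : nat -> X -> R.
Hypothesis sep : separated_by mu e_.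
(** Density in $L^2$ of the first components of [VV]; it identifies the initial value, which the
    equation tests against [VV] only. *)
Hypothesis VV_dense : forall h, sqint mu h ->
  (forall v w, VV v w -> ip mu h v = 0) -> ip mu h h = 0.

Lemma VV_separable : exists p : nat -> (X -> R) * (X -> R),
  (forall n, VV (p n).1 (p n).2) /\
  forall v w (eps : R), VV v w -> 0 < eps -> exists n,
    ip mu (v - (p n).1) (v - (p n).1) + ip mu (w - (p n).2) (w - (p n).2) <= eps.
Proof.
have [se de] := sep.
have [e2 [se2 de2]] := pair_separable se de.
have [||p [pP pd]] := subset_separable (pair_semi_ip H) se2 de2 (P := [set q | VV q.1 q.2]).
- by move=> q [].
- by exists (0, 0); exact: VV0.
by exists p; split => // v w eps vw; exact: (pd (v, w)).
Qed.

Lemma tens_sub v w (psi : R -> R) : tens (v - w) psi = tens v psi - tens w psi.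
Proof. by apply/funext => z; exact: mulrBl. Qed.

(** Times at which the integrated equation holds against all of [VV] at once, in particular against
    slices of the solution itself. *)
Definition good rho0 (rho sigma : X * R -> R) t := [/\ 0 < t < T,
  VV (sl rho t) (sl sigma t), sqint mu (sl (flux rho sigma) t) &
  forall v w, VV v w -> ip mu (sl rho t) v = ip mu rho0 v -
    ip nu (flux rho sigma) (tens w (ind 0 t))].

(** In [sol] the exceptional set depends on the test pair. The sets of a dense sequence of [VV] have
    a null union, and outside it the equation extends to all pairs, both sides being continuous in
    $(v,w)$. *)
Lemma sol_good rho0 rho sigma : sqint mu rho0 -> sol rho0 rho sigma ->
  {ae lam, forall t, 0 < t < T -> good rho0 rho sigma t}.
Proof.
move=> s0 [[sr ss] _ vv weak]; have sf := sqint_flux sr ss.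
set f := flux _ _ in sf weak *.
have [p [vp dp]] := VV_separable.
have := ae_and (ae_and vv (ae_sl_sqint sf)) (ae_nat (fun n => weak _ _ (vp n))).
apply: aeS => t [[vvt sft] wkt] t0T; split => // v w vw.
have [srt _ _] := vvt; have [sv sw _] := vw.
have t0 : 0 <= t by case/andP: t0T => /ltW.
pose L u z := ip mu (sl rho t - rho0) u + ip nu f (tens z (ind 0 t)).
have Lz n : L (p n).1 (p n).2 = 0.
  have [sp1 sp2 _] := vp n.
  by rewrite /L (sip_subl H)// wkt//; ring.
suff : L v w = 0.
  by rewrite /L (sip_subl H)// => h; rewrite -/f; lra.
(* The residual [L] is linear and vanishes on the dense sequence, so its square is bounded by the
   squared distance to that sequence; the factor [t] in [B] is the squared norm of [ind 0 t]. *)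
pose A := ip mu (sl rho t - rho0) (sl rho t - rho0); pose B := ip nu f f * t.
have A0 : 0 <= A by exact: (sip_ge0 H).
have B0 : 0 <= B by rewrite mulr_ge0// (sip_ge0 HQ).
have sT z : sqint mu z -> sqint nu (tens z (ind 0 t)).
  by move=> sz; apply: sqint_tens => //; exact: sqint_ind.
have L2 (eps : R) : 0 < eps -> L v w ^+ 2 <= 2 * (A + B) * eps.
  move=> eps0; have [n hn] := dp v w eps vw eps0; have [sp1 sp2 _] := vp n.
  have svp := sip_sub H sv sp1; have swp := sip_sub H sw sp2.
  have -> : L v w = L (v - (p n).1) (w - (p n).2).
    rewrite -[LHS]subr0 -(Lz n) /L tens_sub (sip_subr H)//; last exact: (sip_sub H).
    by rewrite (sip_subr HQ (sT _ sw) (sT _ sp2) sf); ring.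
  have h1 := sip_CS H (sip_sub H srt s0) svp.
  have h2 := sip_CS HQ sf (sT _ swp).
  have e3 : ip nu (tens (w - (p n).2) (ind 0 t)) (tens (w - (p n).2) (ind 0 t)) =
      ip mu (w - (p n).2) (w - (p n).2) * t.
    by rewrite ip_tens ?ip_ind ?subr0//; exact: sqint_ind.
  rewrite e3 in h2; move: h1 h2 hn; rewrite /L -/A.
  have := sip_ge0 H (v - (p n).1); have := sip_ge0 H (w - (p n).2).
  set a := ip mu (sl rho t - rho0) _; set b := ip nu f (tens _ _).
  move: (ip mu (v - _) _) (ip mu (w - _) _) => V W W0 V0 h1 h2 h3.
  have h4 : (a + b) ^+ 2 <= 2 * a ^+ 2 + 2 * b ^+ 2 by have := sqr_ge0 (a - b); nra.
  have h5 : b ^+ 2 <= B * W by rewrite /B -mulrA (mulrC t).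
  have h6 : A * V + B * W <= (A + B) * eps by nra.
  by lra.
have L20 : L v w ^+ 2 <= 0.
  apply/ler_addgt0Pr => eps eps0; rewrite add0r.
  have k0 : 0 < 2 * (A + B) + 1 by lra.
  have q0 : 0 < eps / (2 * (A + B) + 1) by rewrite divr_gt0.
  apply: (le_trans (L2 _ q0)).
  rewrite mulrA ler_pdivrMr// mulrC ler_pM2l//; lra.
by apply/eqP; rewrite -sqrf_eq0 eq_le L20 sqr_ge0.
Qed.

Lemma ind_le_sqint a b F : sqint nu F ->
  sqint nu (fun z => ind a b z.2 * F z) /\
  snrm (ip nu) (fun z => ind a b z.2 * F z) <= snrm (ip nu) F.
Proof.
move=> sF; have sI : sqint nu (fun z => ind a b z.2 * F z).
  apply: (sqint_bounded (K := 1) sF); first exact: measurable_ind2.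
  by move=> z; rewrite ger0_norm ?ind_ge0// ind_le1.
split => //; rewrite ler_sqrt ?(sip_ge0 HQ)//.
apply: (le_Rintegral_int (sqint_mul sI sI) (sqint_mul sF sF)) => z.
rewrite mulrACA -expr2 ind_sqr ler_piMl ?ind_le1//.
by rewrite -expr2 sqr_ge0.
Qed.

Lemma half_lt (q : R) : 0 < q / 2 -> q / 2 < q.
Proof. lra. Qed.

Lemma sum_bound (h K e u v : R) : u <= h * e -> v <= h * e ->
  v + u + h * (K * e) <= h * ((K + 2) * e).
Proof. by move=> *; rewrite (mulrDl K) mulrDr; lra. Qed.

(** * The energy identity *)

Section energy.
Variables (rho0 : X -> R) (rho sigma : X * R -> R).
Hypotheses (s0 : sqint mu rho0) (rs : sol rho0 rho sigma).
Let f := flux rho sigma.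
Let sr : sqint nu rho. Proof. by case: rs => -[]. Qed.
Let ss : sqint nu sigma. Proof. by case: rs => -[]. Qed.
Let sf : sqint nu f. Proof. exact: sqint_flux. Qed.
Let egy t := ip mu (sl rho t) (sl rho t).
Let ie : lam.-integrable setT (EFin \o egy). Proof. exact: (ip_sl_ge0_le sr). Qed.
Notation gd := (good rho0 rho sigma).

Let ind_diff v (t t' : R) : 0 <= t -> t <= t' ->
  tens v (ind 0 t') - tens v (ind 0 t) = tens v (ind t t').
Proof.
move=> t0 tt'; apply/funext => z; rewrite -[LHS]/(v z.1 * ind 0 t' z.2 - v z.1 * ind 0 t z.2).
rewrite -mulrBr; congr (_ * _); rewrite !indE.
case: (ltP 0 z.2) => h1 /=; last by rewrite ltNge (le_trans h1 t0)/= subrr.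
case: (leP z.2 t) => h2 /=; last by rewrite subr0.
by rewrite (le_trans h2 tt') subrr.
Qed.

Lemma good_diff t t' v w : gd t -> gd t' -> t <= t' -> VV v w ->
  ip mu (sl rho t' - sl rho t) v = - ip nu f (tens w (ind t t')).
Proof.
move=> [/andP[t0 _] [srt _ _] _ wkt] [_ [srt' _ _] _ wkt'] tt' vw.
have [sv sw _] := vw.
rewrite (sip_subl H)// (wkt _ _ vw) (wkt' _ _ vw) -(ind_diff w (ltW t0) tt') (sip_subr HQ)//.
- by ring.
- by apply: sqint_tens => //; exact: sqint_ind.
- by apply: sqint_tens => //; exact: sqint_ind.
Qed.

Lemma energy_diff t t' : gd t -> gd t' -> t <= t' ->
  egy t' - egy t = - ip nu f (tens (sl sigma t + sl sigma t') (ind t t')).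
Proof.
move=> gt gt' tt'; have [_ vt _ _] := gt; have [_ vt' _ _] := gt'.
have [srt _ _] := vt; have [srt' _ _] := vt'.
have := VV_lin 1 vt vt'; rewrite !scale1r => vv.
have := good_diff gt gt' tt' vv; rewrite -/f => <-.
rewrite (sip_subl H)//; last exact: (sip_add H).
rewrite ![ip mu _ (_ + _)](sipC H) !(sip_addl H)// (sipC H (sl rho t) (sl rho t')).
by rewrite /egy; ring.
Qed.

Let good_ae : {ae lam, forall t, 0 < t < T -> gd t}.
Proof. exact: sol_good. Qed.

Let gh a b h : X * R -> R := fun z => ind a b z.2 * (sigma z + tr h sigma z).

Let sgh a b h : sqint nu (gh a b h).
Proof.
by apply: (ind_le_sqint a b (sip_add HQ ss _)).1; have [] := sqint_tr h ss.
Qed.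

(** The energy differences are integrated over $t\in]a,b]$ and written with primitives of the
    energy. The condition $b+h<T$ keeps $t+h$ in the time interval, where almost every time is
    good. *)
Lemma energy_avg a b h : 0 < a -> a < b -> 0 < h -> b + h < T ->
  lam.-integrable setT (EFin \o (fun th => ind 0 h th * ip nu (tr th f) (gh a b h))) /\
  (primitive egy (b + h) - primitive egy b) - (primitive egy (a + h) - primitive egy a) =
  - \int[lam]_th (ind 0 h th * ip nu (tr th f) (gh a b h)).
Proof.
move=> a0 ab h0 bhT; have [k ik [kE [ij <-]]] := integrable_avg h0 sf (sgh a b h).
split => //.
have me : measurable_fun setT (egy : measurableTypeR R -> R) by exact: measurable_of_integrable ie.
have e1 : primitive egy (b + h) - primitive egy (a + h) = \int[lam]_t (ind a b t * egy (t + h)).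
  rewrite primitiveB//; last by rewrite lerD2r ltW.
  rewrite Rintegral_indE -(Rintegral_shift h).
    by apply: eq_Rintegral => t _; rewrite !indE ltrD2r lerD2r.
  by apply: measurable_funM => //; exact: measurable_ind.
have e2 : primitive egy b - primitive egy a = \int[lam]_t (ind a b t * egy t).
  by rewrite primitiveB ?Rintegral_indE// ltW.
have i1 : lam.-integrable setT (EFin \o (fun t => ind a b t * egy t)).
  exact: integrable_ind_mul.
have i2 : lam.-integrable setT (EFin \o (fun t => ind a b t * egy (t + h))).
  rewrite (_ : (fun t => _) = (fun t => ind (a + h) (b + h) (t + h) * egy (t + h))).
    apply: (@integrable_shift R h (fun s => ind (a + h) (b + h) s * egy s)).
    exact: integrable_ind_mul.
  by apply/funext => t; rewrite !indE ltrD2r lerD2r.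
have -> : primitive egy (b + h) - primitive egy b - (primitive egy (a + h) - primitive egy a) =
  \int[lam]_t (ind a b t * egy (t + h) - ind a b t * egy t).
  by rewrite RintegralB// -e1 -e2; ring.
rewrite -mulN1r -RintegralZl//.
apply: Rintegral_ae.
- by apply: measurable_funB; [exact: (measurable_of_integrable i2)|exact: (measurable_of_integrable i1)].
- by apply: measurable_funM => //; exact: (measurable_of_integrable ik).
have := ae_and kE (ae_and good_ae (ae_shift h good_ae)).
apply: aeS => t [-> [g1 g2]].
have -> : tens (sl (gh a b h) t) (ind t (t + h)) =
  ind a b t *: tens (sl sigma t + sl sigma (t + h)) (ind t (t + h)).
  apply/funext => z; transitivity (ind a b t * (sigma (z.1, t) + sigma (z.1, t + h)) * ind t (t + h) z.2) => //.
  by rewrite -mulrA.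
have [/andP[at_ tb]|tab] := boolP (a < t <= b); last first.
  by rewrite indE (negbTE tab) !mul0r scale0r (sip0r HQ)// mulr0 subrr.
have gt : gd t by apply: g1; rewrite (lt_trans a0 at_) (le_lt_trans tb)// (lt_trans _ bhT)// ltrDl.
have gth : gd (t + h).
  by apply: g2; rewrite (lt_trans a0 (lt_trans at_ _)) ?ltrDl//= (le_lt_trans _ bhT)// lerD2r.
rewrite ind_in ?at_ ?tb// !mul1r scale1r energy_diff ?mulN1r//.
by rewrite lerDl ltW.
Qed.

Definition lebesgue_pt t := derivable (primitive egy) t 1 /\ derive1 (primitive egy) t = egy t.

Lemma lebesgue_pt_ae : {ae lam, forall t, lebesgue_pt t}.
Proof. exact: primitive_derive. Qed.

(** All errors are kept as multiples of [h] and divided only at the end: one and the same [h] has to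
    serve both Lebesgue points and both translation estimates. *)
Lemma energy_eq a b : 0 < a -> a < b -> b < T -> lebesgue_pt a -> lebesgue_pt b ->
  egy b - egy a = - (2 * ip nu f (fun z => ind a b z.2 * sigma z)).
Proof.
move=> a0 ab bT [da ea] [db eb].
pose chis (z : X * R) := ind a b z.2 * sigma z; rewrite -/chis.
have [schi chile] := ind_le_sqint a b ss; rewrite -/chis in schi chile.
set I0 := ip nu f chis.
pose Nf : R := snrm (ip nu) f; pose Ns : R := snrm (ip nu) sigma.
have Nf0 : 0 <= Nf by exact: snrm_ge0.
have Ns0 : 0 <= Ns by exact: snrm_ge0.
suff key (eps : R) : 0 < eps -> `|egy b - egy a + 2 * I0| <= eps.
  apply/eqP; rewrite -subr_eq0 opprK -normr_le0.
  by apply/ler_addgt0Pr => eps /key; rewrite add0r.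
(* Budget of errors in units of [h] times [e1]: $2\|\sigma\|$ for undoing the translation of the
   flux, $\|f\|$ for undoing that of [sigma], and 2 for the two Lebesgue points. *)
move=> eps0; pose K : R := 2 * Ns + Nf; pose e1 : R := eps / (K + 2).
have K2 : 0 < K + 2 by rewrite ltr_wpDl// addr_ge0// mulr_ge0.
have e10 : 0 < e1 by rewrite divr_gt0.
have [d1 d10 d1P] := translation_continuous sep sf e10.
have [d2 d20 d2P] := translation_continuous sep ss e10.
have [d3 d30 d3P] := derivable_right da ea e10.
have [d4 d40 d4P] := derivable_right db eb e10.
pose h := Num.min (Num.min d1 d2) (Num.min (Num.min d3 d4) (T - b)) / 2.
have h0 : 0 < h by rewrite divr_gt0// !lt_min d10 d20 d30 d40 subr_gt0 bT.
have hlt x : Num.min (Num.min d1 d2) (Num.min (Num.min d3 d4) (T - b)) <= x -> h < x.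
  by move=> hx; apply: (lt_le_trans _ hx); exact: half_lt.
have hd1 : h < d1 by apply: hlt; rewrite !ge_min lexx.
have hd2 : h < d2 by apply: hlt; rewrite !ge_min lexx orbT.
have hd3 : h < d3 by apply: hlt; rewrite !ge_min lexx !orbT.
have hd4 : h < d4 by apply: hlt; rewrite !ge_min lexx !orbT.
have hT : h < T - b by apply: hlt; rewrite !ge_min lexx !orbT.
have bhT : b + h < T by rewrite addrC -ltrBrDr.
have [ij eavg] := energy_avg a0 ab h0 bhT.
have := d3P h; rewrite h0 hd3 => /(_ isT) pa.
have := d4P h; rewrite h0 hd4 => /(_ isT) pb.
have [sth nth] := sqint_tr h ss.
have sdh : sqint nu (tr h sigma - sigma) by exact: (sip_sub HQ).
have ghE : gh a b h - 2 *: chis = fun z => ind a b z.2 * (tr h sigma - sigma) z.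
  apply/funext => z; transitivity (ind a b z.2 * (sigma z + tr h sigma z) - 2 * (ind a b z.2 * sigma z)) => //.
  by transitivity (ind a b z.2 * (tr h sigma z - sigma z)) => //; ring.
have s2chi : sqint nu (2 *: chis) by exact: (sip_scale HQ).
have J (th : R) : 0 < th <= h -> `|ip nu (tr th f) (gh a b h) - 2 * I0| <= K * e1.
  move=> /andP[th0 thh].
  have stf' : sqint nu (tr th f) by case: (sqint_tr th sf).
  have sdf : sqint nu (tr th f - f) by exact: (sip_sub HQ).
  have -> : ip nu (tr th f) (gh a b h) - 2 * I0 =
     ip nu (tr th f - f) (gh a b h) + ip nu f (gh a b h - 2 *: chis).
    rewrite (sip_subl HQ)// (sip_subr HQ)//.
    have -> : ip nu f (2 *: chis) = 2 * I0.
      by have := sip_linr HQ 2 schi (sqint0 nu) sf; rewrite addr0 (sip0r HQ)// addr0.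
    by ring.
  have n1 : snrm (ip nu) (gh a b h) <= 2 * Ns.
    apply: (le_trans (ind_le_sqint a b (sip_add HQ ss sth)).2).
    apply: (le_trans (snrm_add HQ ss sth)).
    by rewrite /Ns /snrm nth -mulr2n mulr_natl.
  have n2 : snrm (ip nu) (tr th f - f) <= e1.
    by apply: d1P; rewrite gtr0_norm// (le_lt_trans thh).
  have n3 : snrm (ip nu) (gh a b h - 2 *: chis) <= e1.
    rewrite ghE; apply: (le_trans (ind_le_sqint a b sdh).2).
    by apply: d2P; rewrite gtr0_norm.
  have sgd : sqint nu (gh a b h - 2 *: chis) by exact: (sip_sub HQ).
  have c1 := snrm_CS HQ sdf (sgh a b h); have c2 := snrm_CS HQ sf sgd.
  apply: (le_trans (ler_normD _ _)).
  have m1 : snrm (ip nu) (tr th f - f) * snrm (ip nu) (gh a b h) <= e1 * (2 * Ns).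
    by apply: ler_pM => //; exact: snrm_ge0.
  have m2 : snrm (ip nu) f * snrm (ip nu) (gh a b h - 2 *: chis) <= Nf * e1.
    by apply: ler_pM => //; exact: snrm_ge0.
  have -> : K * e1 = e1 * (2 * Ns) + Nf * e1 by rewrite /K mulrDl [2 * Ns * e1]mulrC.
  by apply: lerD; [exact: (le_trans c1 m1)|exact: (le_trans c2 m2)].
have int_J : `|\int[lam]_th (ind 0 h th * ip nu (tr th f) (gh a b h)) - h * (2 * I0)| <= h * (K * e1).
  have ii := @integrable_ind R 0 h.
  have -> : h * (2 * I0) = \int[lam]_th (2 * I0 * ind 0 h th).
    by rewrite RintegralZl// Rintegral_ind ?subr0 1?mulrC// ltW.
  have -> : h * (K * e1) = \int[lam]_th (K * e1 * ind 0 h th).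
    by rewrite RintegralZl// Rintegral_ind ?subr0 1?mulrC// ltW.
  rewrite -RintegralB//; last exact: integrableRZ.
  have i3 : lam.-integrable setT (EFin \o (fun th => ind 0 h th * ip nu (tr th f) (gh a b h) - 2 * I0 * ind 0 h th)).
    by apply: integrableRB => //; exact: integrableRZ.
  apply: (le_trans (le_normr_Rintegral _ i3)) => //.
  apply: le_Rintegral_int; [exact: (integrable_norm i3)|exact: integrableRZ|].
  move=> th; have [hth|hth] := boolP (0 < th <= h).
    by rewrite ind_in// mul1r !mulr1 J.
  by rewrite indE (negbTE hth) mul0r !mulr0 subrr normr0.
set Jh := \int[lam]_th _ in eavg int_J.
move: pa pb; set A := primitive egy (a + h) - _ in eavg *; set B := primitive egy (b + h) - _ in eavg *.
move=> pa pb.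
have hh : h * `|egy b - egy a + 2 * I0| <= h * ((K + 2) * e1).
  rewrite -[h in leLHS]gtr0_norm// -normrM.
  have -> : h * (egy b - egy a + 2 * I0) = - (B - h * egy b) + (A - h * egy a) - (Jh - h * (2 * I0)).
    have : B - A + Jh = 0 by rewrite eavg addNr.
    by move=> e; rewrite -[LHS]subr0 -e; ring.
  apply: (le_trans (ler_normB _ _)); apply: (le_trans (lerD (ler_normD _ _) int_J)).
  by rewrite normrN; exact: sum_bound.
move: hh; rewrite ler_pM2l// => /le_trans; apply.
by rewrite /e1 mulrC divfK// gt_eqF.
Qed.

(** * Continuity of the solution in time *)

Let qf t := ip mu (sl f t) (sl f t).
Let qs t := ip mu (sl sigma t) (sl sigma t).
Let iqf : lam.-integrable setT (EFin \o qf). Proof. exact: (ip_sl_ge0_le sf). Qed.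
Let iqs : lam.-integrable setT (EFin \o qs). Proof. exact: (ip_sl_ge0_le ss). Qed.
Let qf0 t : 0 <= qf t. Proof. exact: (sip_ge0 H). Qed.
Let qs0 t : 0 <= qs t. Proof. exact: (sip_ge0 H). Qed.

Lemma ip_chi F a b : sqint nu F ->
  ip nu (fun z => ind a b z.2 * F z) (fun z => ind a b z.2 * F z) =
  \int[lam]_t (ind a b t * ip mu (sl F t) (sl F t)).
Proof.
move=> sF; have [sI _] := ind_le_sqint a b sF.
have [i1 ->] := ip_sl sI sI.
have i2 := integrable_ind_mul a b (ip_sl_ge0_le sF).
apply: Rintegral_ae; [exact: (measurable_of_integrable i1)|exact: (measurable_of_integrable i2)|].
apply: aeS (ae_sl_sqint sF) => t st.
have sit : sqint mu (ind a b t *: sl F t) by exact: (sip_scale H).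
transitivity (ip mu (ind a b t *: sl F t) (ind a b t *: sl F t)) => //.
by rewrite ip_scaler// (sipC H) ip_scaler// mulrA -expr2 ind_sqr.
Qed.

Definition pt t := good rho0 rho sigma t /\ lebesgue_pt t.

Lemma pt_ae : {ae lam, forall t, 0 < t < T -> pt t}.
Proof.
by move: good_ae lebesgue_pt_ae; apply: ae2 => t gt lt /gt.
Qed.

Lemma ip_two_le F G : sqint nu F -> sqint nu G ->
  2 * `|ip nu F G| <= ip nu F F + ip nu G G.
Proof.
move=> sF sG.
have := sip_ge0 HQ (1 *: F + G); have := sip_ge0 HQ ((-1) *: F + G).
rewrite !(sip_expand HQ)//.
by case: (ger0P (ip nu F G)) => _; move: (ip nu F F) (ip nu G G) (ip nu F G) => a b c; lra.
Qed.

(** $|\rho(c)-\rho(s)|^2=|\rho(c)|^2-|\rho(s)|^2-2(\rho(c)-\rho(s),\rho(s))$. The difference of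
    squares is given by [energy_eq], the product by the equation tested against the fixed slice at
    [s], whose derivative $\sigma(s)$ is the source of the last term. *)
Lemma close_pt (a b s c : R) : pt a -> pt b -> a < b ->
  (s = a /\ c = b) \/ (s = b /\ c = a) ->
  ip mu (sl rho c - sl rho s) (sl rho c - sl rho s) <=
  \int[lam]_t (ind a b t * (2 * qf t + qs t)) + (b - a) * qs s.
Proof.
move=> [ga la] [gb lb] ab sab.
have [/andP[a0 _] va _ _] := ga; have [/andP[_ bT] vb _ _] := gb.
have [sra _ _] := va; have [srb _ _] := vb.
have eE := energy_eq a0 ab bT la lb.
have vs : VV (sl rho s) (sl sigma s) by case: sab => -[->].
have [srs sss _] := vs.
have gd' := good_diff ga gb (ltW ab) vs.
set T1 := ip nu f _ in gd'; set T2 := ip nu f _ in eE.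
have e0 : ip mu (sl rho c - sl rho s) (sl rho c - sl rho s) <= 2 * `|T1| + 2 * `|T2|.
  have := ler_norm T1; have := ler_norm T2; have := ler_norm (- T1); have := ler_norm (- T2).
  rewrite !normrN; move: eE gd'; rewrite /egy.
  have e1 u w : sqint mu u -> sqint mu w -> ip mu (u - w) (u - w) =
      ip mu u u - ip mu w w - 2 * ip mu (u - w) w.
    move=> su sw; have suw := sip_sub H su sw.
    by rewrite (sip_subr H su sw suw) !(sip_subl H)// (sipC H w u); ring.
  case: sab => -[-> ->].
    rewrite e1// => h1 ->; move: h1.
    move: `|T1| `|T2| (ip _ _ _) (ip _ _ _) => n1 n2 x y; lra.
  have e2 : sl rho a - sl rho b = (-1) *: (sl rho b - sl rho a) by rewrite scaleN1r opprB.
  rewrite e1// e2 ip_scaler//; last exact: (sip_sub H).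
  move=> h1 ->; move: h1.
  move: `|T1| `|T2| (ip _ _ _) (ip _ _ _) => n1 n2 x y; lra.
apply: (le_trans e0).
have [scf _] := ind_le_sqint a b sf; have [scs _] := ind_le_sqint a b ss.
have sT := sqint_tens sss (sqint_ind a b).
have E1 : T1 = ip nu (fun z => ind a b z.2 * f z) (tens (sl sigma s) (ind a b)).
  by apply: eq_Rintegral => z _; rewrite /tens indE; case: (_ && _) => /=; ring.
have E2 : T2 = ip nu (fun z => ind a b z.2 * f z) (fun z => ind a b z.2 * sigma z).
  by apply: eq_Rintegral => z _; rewrite indE; case: (_ && _) => /=; ring.
have h1 := ip_two_le scf sT; have h2 := ip_two_le scf scs.
rewrite -E1 in h1; rewrite -E2 in h2.
rewrite ip_tens ?ip_ind ?(ltW ab)// in h1; [|exact: sqint_ind|exact: sqint_ind].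
rewrite !ip_chi// in h1 h2.
have -> : \int[lam]_t (ind a b t * (2 * qf t + qs t)) =
   2 * \int[lam]_t (ind a b t * qf t) + \int[lam]_t (ind a b t * qs t).
  have i1 := integrable_ind_mul a b iqf; have i2 := integrable_ind_mul a b iqs.
  rewrite -RintegralZl// -RintegralD//; last exact: integrableRZ.
  by apply: eq_Rintegral => t _; ring.
move: h1 h2; rewrite -/(qs s).
move: `|T1| `|T2| (\int[lam]_t (_ * qf t)) (\int[lam]_t (_ * qs t)) => x y u v.
rewrite (mulrC (b - a)); move: (qs s * _) => w; lra.
Qed.

Let hh t := 2 * qf t + qs t.
Let ihh : lam.-integrable setT (EFin \o hh).
Proof. by apply: integrableRD => //; exact: integrableRZ. Qed.

Let prim_ind (h : R -> R) (a b : R) : lam.-integrable setT (EFin \o h) -> a <= b ->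
  \int[lam]_t (ind a b t * h t) = primitive h b - primitive h a.
Proof. by move=> ih ab; rewrite primitiveB// Rintegral_indE. Qed.

(** Density of the modulus of continuity. [close_pt] is used on both sides of an intermediate time
    [s] and doubled, which gives [hh]; [qs] and the indicator come from the bound of
    $(t'-t)|\sigma(s)|^2$ in [moderate_pt]. *)
Let kk t := 2 * (hh t + qs t + ind 0 T t).
Let ikk : lam.-integrable setT (EFin \o kk).
Proof.
apply: integrableRZ; apply: integrableRD; last exact: integrable_ind.
exact: integrableRD.
Qed.

Definition modulus := primitive kk.

Lemma modulus_cts : continuous modulus.
Proof. exact: primitive_continuous. Qed.

Let modulusB (t t' : R) : 0 < t -> t <= t' -> t' < T -> modulus t' - modulus t =
  2 * (primitive hh t' - primitive hh t) + 2 * (primitive qs t' - primitive qs t) + 2 * (t' - t).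
Proof.
move=> t0 tt' t'T; rewrite /modulus -!prim_ind//.
transitivity (\int[lam]_z (2 * (ind t t' z * hh z) + 2 * (ind t t' z * qs z) + 2 * ind t t' z)).
  apply: eq_Rintegral => z _; rewrite /kk.
  have [/andP[h1 h2]|h] := boolP (t < z <= t').
    by rewrite (@ind_in R 0 T) ?(ind_in h1 h2) ?ind_in ?h1//; [ring|rewrite (lt_trans t0 h1) (le_trans h2)// ltW].
  by rewrite (@indE R t t') (negbTE h) /=; ring.
have i1 := integrableRZ 2 (integrable_ind_mul t t' ihh).
have i2 := integrableRZ 2 (integrable_ind_mul t t' iqs).
have i3 := integrableRZ 2 (@integrable_ind R t t').
rewrite RintegralD//; last exact: integrableRD.
rewrite RintegralD// !RintegralZl//; try exact: integrable_ind_mul; try exact: integrable_ind.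
by rewrite Rintegral_ind.
Qed.

(** [close_pt] involves $|\sigma(s)|^2$ at a single time, over which there is no control. A
    square-integrable function cannot exceed its mean plus 1 almost everywhere on an interval, so a
    suitable [s] exists between [t] and [t']. *)
Lemma moderate_pt (t t' : R) : pt t -> pt t' -> t < t' -> exists s : R, [/\ t < s <= t', pt s &
  (t' - t) * qs s <= primitive qs t' - primitive qs t + (t' - t)].
Proof.
move=> [[/andP[t0 _] _ _ _] _] [[/andP[_ t'T] _ _ _] _] tt'; apply: contrapT => nE.
pose Dl : R := t' - t; pose I : R := primitive qs t' - primitive qs t.
have D0 : 0 < Dl by rewrite subr_gt0.
have : \int[lam]_z ((I + Dl) * ind t t' z) <= \int[lam]_z (Dl * (ind t t' z * qs z)).
  apply: ae_le_Rintegral.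
  - by apply: integrableRZ; exact: integrable_ind.
  - by apply: integrableRZ; exact: integrable_ind_mul.
  apply: aeS pt_ae => z hz; have [/andP[h1 h2]|h] := boolP (t < z <= t'); last first.
    by rewrite indE (negbTE h); rewrite mulr0 mul0r mulr0.
  rewrite ind_in ?h1// mulr1 mul1r leNgt; apply/negP => hlt; apply: nE; exists z.
  split; [by rewrite h1|apply: hz; rewrite (lt_trans t0 h1) (le_lt_trans h2)//|exact: ltW].
rewrite !RintegralZl//; [|exact: integrable_ind_mul|exact: integrable_ind].
rewrite (Rintegral_ind (ltW tt')) (prim_ind iqs (ltW tt')) -/I -/Dl mulrC ler_pM2l//.
by move: D0; rewrite gerDl leNgt => ->.
Qed.

Lemma modulus_le (t t' : R) : pt t -> pt t' -> t < t' ->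
  ip mu (sl rho t - sl rho t') (sl rho t - sl rho t') <= modulus t' - modulus t.
Proof.
move=> pt1 pt2 tt'; have [s [/andP[ts st'] ps hs]] := moderate_pt pt1 pt2 tt'.
have [[/andP[t0 _] [srt _ _] _ _] _] := pt1; have [[/andP[_ t'T] [srt' _ _] _ _] _] := pt2.
have [[_ [srs _ _] _ _] _] := ps.
rewrite modulusB ?(ltW tt')//.
have := close_pt pt1 ps ts (or_intror (conj erefl erefl)).
rewrite prim_ind ?(ltW ts)// -/(hh _).
move: st'; rewrite le_eqVlt => /predU1P[st'|st'].
  subst s; have h0 : 0 <= primitive hh t' - primitive hh t.
    rewrite -prim_ind ?(ltW ts)//; apply: Rintegral_ge0 => z _.
    by rewrite mulr_ge0 ?ind_ge0// addr_ge0// mulr_ge0.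
  have q0 : 0 <= primitive qs t' - primitive qs t.
    rewrite -prim_ind ?(ltW ts)//; apply: Rintegral_ge0 => z _.
    by rewrite mulr_ge0 ?ind_ge0.
  move=> h1; move: h1 h0 q0 hs tt'.
  move: (primitive hh t' - _) (primitive qs t' - _) (_ * qs t') (ip _ _ _) => x y z w.
  by lra.
have := close_pt ps pt2 st' (or_introl (conj erefl erefl)).
rewrite prim_ind ?(ltW st')// => h2 h1.
have -> : sl rho t - sl rho t' = (sl rho t - sl rho s) - (sl rho t' - sl rho s).
  by rewrite opprB addrA subrK.
apply: (le_trans (sip_sub_le H (sip_sub H srt srs) (sip_sub H srt' srs))).
move: h1 h2 hs.
move: (ip mu (sl rho t - _) _) (ip mu (sl rho t' - _) _) (qs s) => x y q.
move: (primitive hh t) (primitive hh t') (primitive hh s) (primitive qs t' - _) => a b c e.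
lra.
Qed.

Lemma modulus_pt (t t' : R) : pt t -> pt t' ->
  snrm (ip mu) (sl rho t - sl rho t') <= Num.sqrt `|modulus t - modulus t'|.
Proof.
move=> h h'; rewrite ler_sqrt//.
have [tt'|tt'|->] := ltgtP t t'.
- rewrite (le_trans (modulus_le h h' tt'))// distrC ler_norm//.
- have [[_ [srt _ _] _ _] _] := h; have [[_ [srt' _ _] _ _] _] := h'.
  rewrite -(snrm_sqr H) (snrm_subC H)// (snrm_sqr H).
  by rewrite (le_trans (modulus_le h' h tt'))// ler_norm.
- by rewrite !subrr normr0 (sip0r H)//; exact: sqint0.
Qed.

Lemma pt_seq (t : R) : 0 <= t <= T ->
  exists s_ : nat -> R, (forall n, pt (s_ n)) /\ s_ n @[n --> \oo] --> t.
Proof.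
move=> /andP[t0 tT].
have /choice[s_ s_P] : forall n : nat, exists s : R, pt s /\ `|t - s| <= n.+1%:R^-1.
  move=> n; pose de : R := n.+1%:R^-1.
  have de0 : 0 < de by rewrite invr_gt0.
  have lt1 : Num.max 0 (t - de) < Num.min T (t + de).
    by rewrite gt_max !lt_min T0 (ltr_wpDl t0 de0) ltrBlDr (le_lt_trans tT) ?ltrDl//= ltrBlDr -addrA ltrDl addr_gt0.
  have [s [/andP[]]] := ae_itv_nonempty lt1 pt_ae.
  rewrite gt_max lt_min => /andP[h1 h2] /andP[h3 h4] hs.
  exists s; split; first by apply: hs; rewrite h1.
  by rewrite ltW// ltr_distlC h2 h4.
exists s_; split=> [n|]; first by case: (s_P n).
apply/cvgrPdist_le => e e0; have [n0 hn0] := snd_small e0.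
exists n0 => // n /= n0n; have [_ h] := s_P n; rewrite (le_trans h)// (le_trans _ hn0)//.
by rewrite lef_pV2 ?posrE// ler_nat ltnS.
Qed.

Lemma cvg_sqrt_dist (u : nat -> R) (a b : R) : u n @[n --> \oo] --> b ->
  Num.sqrt `|a - u n| @[n --> \oo] --> Num.sqrt `|a - b|.
Proof.
move=> ub; apply: (cvg_comp (fun n => `|a - u n|)); last exact: sqrt_continuous.
by apply: cvg_norm; apply: cvgB => //; exact: cvg_cst.
Qed.

Lemma cvg_sqrt_dist0 (u : nat -> R) (a : R) : u n @[n --> \oo] --> a ->
  Num.sqrt `|a - u n| @[n --> \oo] --> (0 : R).
Proof. by move=> /(@cvg_sqrt_dist _ a); rewrite subrr normr0 sqrtr0. Qed.

(** The slices at regular times tending to [t] form a Cauchy sequence because [modulus] is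
    continuous. Describing the limit by its distance to all regular slices frees it from the chosen
    sequence and covers the end times 0 and [T]. *)
Lemma trace_ex (t : R) : 0 <= t <= T -> exists z, sqint mu z /\
  forall s, pt s -> snrm (ip mu) (sl rho s - z) <= Num.sqrt `|modulus s - modulus t|.
Proof.
move=> t0T; have [s_ [ps_ cs_]] := pt_seq t0T.
have cm : modulus (s_ n) @[n --> \oo] --> modulus t.
  by apply: (cvg_comp s_) cs_ _; exact: modulus_cts.
have sv n : sqint mu (sl rho (s_ n)) by have [[_ [] ? _] _] := ps_ n.
have [z sz cz] : exists2 z, sqint mu z &
    ip mu (sl rho (s_ n) - z) (sl rho (s_ n) - z) @[n --> \oo] --> (0 : R).
  apply: (ip_complete (v := fun n => sl rho (s_ n))) => // e e0.
  have e2 : 0 < e / 2 by rewrite divr_gt0.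
  move/cvgrPdist_le : (cm) => /(_ _ e2)[n0 _ h]; exists n0 => i j hi hj.
  rewrite -(snrm_sqr H).
  have h1 := modulus_pt (ps_ i) (ps_ j).
  apply: (@le_trans _ _ (Num.sqrt `|modulus (s_ i) - modulus (s_ j)| ^+ 2)).
    by rewrite ler_sqr ?nnegrE ?sqrtr_ge0// snrm_ge0.
  rewrite sqr_sqrtr//; have := h _ hi; have := h _ hj => /= {h}.
  move: (modulus (s_ i)) (modulus (s_ j)) (modulus t) => a b c.
  by rewrite !ler_norml => /andP[? ?] /andP[? ?]; apply/andP; split; lra.
exists z; split => // s ps; have ss' : sqint mu (sl rho s) by have [[_ [] ? _] _] := ps.
apply: (@ler_cvg_to _ \oo _ R (fun=> snrm (ip mu) (sl rho s - z))
  (fun n => Num.sqrt `|modulus s - modulus (s_ n)| + snrm (ip mu) (sl rho (s_ n) - z))).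
- exact: cvg_cst.
- rewrite -[X in _ --> X]addr0; apply: cvgD; first exact: cvg_sqrt_dist.
  by rewrite -(sqrtr0 R); apply: (cvg_comp _ _ cz); exact: sqrt_continuous.
- apply: nearW => n; apply: (le_trans (snrm_sub_trans H ss' (sv n) sz)).
  by rewrite lerD2r modulus_pt.
Qed.

Let rep t := xget (0 : X -> R) [set z | sqint mu z /\
  forall s, pt s -> snrm (ip mu) (sl rho s - z) <= Num.sqrt `|modulus s - modulus t|].

Let repP t : 0 <= t <= T -> sqint mu (rep t) /\
  forall s, pt s -> snrm (ip mu) (sl rho s - rep t) <= Num.sqrt `|modulus s - modulus t|.
Proof. by move=> /trace_ex h; exact: (xgetPex (0 : X -> R) h). Qed.

Let rep_dist t t' : 0 <= t <= T -> 0 <= t' <= T ->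
  snrm (ip mu) (rep t - rep t') <= Num.sqrt `|modulus t - modulus t'|.
Proof.
move=> ht ht'; have [srt h] := repP ht; have [srt' h'] := repP ht'.
have [s_ [ps_ cs_]] := pt_seq ht.
have cm : modulus (s_ n) @[n --> \oo] --> modulus t.
  by apply: (cvg_comp s_) cs_ _; exact: modulus_cts.
have sv n : sqint mu (sl rho (s_ n)) by have [[_ [] ? _] _] := ps_ n.
apply: (@ler_cvg_to _ \oo _ R (fun=> snrm (ip mu) (rep t - rep t'))
  (fun n => Num.sqrt `|modulus t - modulus (s_ n)| + Num.sqrt `|modulus t' - modulus (s_ n)|)).
- exact: cvg_cst.
- rewrite -[X in _ --> X]add0r [in X in _ --> X]distrC.
  by apply: cvgD; [exact: cvg_sqrt_dist0|exact: cvg_sqrt_dist].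
- apply: nearW => n; apply: (le_trans (snrm_sub_trans H srt (sv n) srt')).
  rewrite (snrm_subC H)// distrC (distrC (modulus t')).
  by apply: lerD; [exact: h|exact: h'].
Qed.

Lemma snrm_eq0 u w : sqint mu u -> sqint mu w -> snrm (ip mu) (u - w) = 0 ->
  snrm (ip mu) u = snrm (ip mu) w.
Proof.
move=> su sw h; apply/eqP; rewrite -subr_eq0 -normr_le0 -h.
exact: (snrm_dist H).
Qed.

Let in0T : 0 <= (0 : R) <= T. Proof. by rewrite lexx ltW. Qed.

(** Along regular times $s_n\to0$ the flux term is of order $\sqrt{s_n}$, so the difference is
    orthogonal to the first components of [VV]; their density concludes. *)
Lemma rep_initial : ip mu (rep 0 - rho0) (rep 0 - rho0) = 0.
Proof.
have [sr0 h0] := repP in0T.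
apply: VV_dense; first exact: (sip_sub H).
move=> v w vw; have [sv sw _] := vw.
have [s_ [ps_ cs_]] := pt_seq in0T.
have cm : modulus (s_ n) @[n --> \oo] --> modulus 0.
  by apply: (cvg_comp s_) cs_ _; exact: modulus_cts.
apply/eqP; rewrite -normr_le0.
pose Cf : R := Num.sqrt (ip nu f f * ip mu w w).
apply: (@ler_cvg_to _ \oo _ R (fun=> `|ip mu (rep 0 - rho0) v|)
  (fun n => Num.sqrt `|modulus 0 - modulus (s_ n)| * snrm (ip mu) v + Cf * Num.sqrt `|0 - s_ n|)).
- exact: cvg_cst.
- rewrite -[X in _ --> X]addr0; apply: cvgD.
    rewrite -[X in _ --> X](mul0r (snrm (ip mu) v)); apply: cvgM; last exact: cvg_cst.
    exact: cvg_sqrt_dist0.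
  rewrite -[X in _ --> X](mulr0 Cf); apply: cvgM; first exact: cvg_cst.
  exact: cvg_sqrt_dist0.
- apply: nearW => n; have [[/andP[p0 _] [srs _ _] _ wkt] _] := ps_ n.
  have -> : rep 0 - rho0 = (rep 0 - sl rho (s_ n)) + (sl rho (s_ n) - rho0) by rewrite addrA subrK.
  have d1 := sip_sub H sr0 srs; have d2 := sip_sub H srs s0.
  rewrite (sip_addl H)//; apply: (le_trans (ler_normD _ _)); apply: lerD.
    apply: (le_trans (snrm_CS H d1 sv)); apply: ler_wpM2r; first exact: snrm_ge0.
    by rewrite (snrm_subC H)// distrC; exact: h0.
  rewrite (sip_subl H)// (wkt _ _ vw) addrAC subrr sub0r normrN sub0r normrN (gtr0_norm p0).
  have sT := sqint_tens sw (sqint_ind 0 (s_ n)).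
  apply: (le_trans (snrm_CS HQ sf sT)).
  rewrite /snrm ip_tens ?ip_ind ?subr0 ?(ltW p0)//; [|exact: sqint_ind|exact: sqint_ind].
  by rewrite -!sqrtrM ?mulrA ?(sip_ge0 HQ)// mulr_ge0// ?(sip_ge0 HQ) ?(sip_ge0 H).
Qed.

(** Growth rate left by Young's inequality $2|U\rho\sigma|\le d_m\sigma^2+(m^2/d_m)\rho^2$, which
    uses up half of the dissipation $2d_m\sigma^2$. *)
Let bb : R := m ^+ 2 / dm.
Let bb0 : 0 <= bb. Proof. by rewrite divr_ge0 ?sqr_ge0// ltW. Qed.

Lemma energy_le a b : pt a -> pt b -> a < b ->
  egy b + dm * (primitive qs b - primitive qs a) <=
  egy a + bb * (primitive egy b - primitive egy a).
Proof.
move=> [ga la] [gb lb] ab.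
have [/andP[a0 _] _ _ _] := ga; have [/andP[_ bT] _ _ _] := gb.
have eE := energy_eq a0 ab bT la lb.
have [scr _] := ind_le_sqint a b sr; have [scs _] := ind_le_sqint a b ss.
rewrite -!prim_ind ?(ltW ab)// -!ip_chi//.
have : - (2 * ip nu f (fun z => ind a b z.2 * sigma z)) <=
  bb * ip nu (fun z => ind a b z.2 * rho z) (fun z => ind a b z.2 * rho z) -
  dm * ip nu (fun z => ind a b z.2 * sigma z) (fun z => ind a b z.2 * sigma z).
  rewrite -mulNr /ip -!RintegralZl//; try exact: sqint_mul.
  rewrite -RintegralB//; try by apply: integrableRZ; exact: sqint_mul.
  apply: le_Rintegral_int.
  - by apply: integrableRZ; exact: sqint_mul.
  - by apply: integrableRB; apply: integrableRZ; exact: sqint_mul.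
  move=> z; have /andP[hD _] := D_bound z.1; have := coercive (rho z) (sigma z) hD (U_bound z).
  rewrite /f /flux /lda /bb indE; case: (_ && _); rewrite /= ?mul1r ?mul0r; last by rewrite !mulr0 subr0.
  have -> : m ^+ 2 / (2 * dm) = m ^+ 2 / dm / 2 by field; rewrite gt_eqF.
  move: (rho z) (sigma z) (D z.1) (U z) (m ^+ 2 / dm) => x y dz uz k; lra.
rewrite -eE; move: (ip nu _ _) (ip nu _ _) => x y; lra.
Qed.

Let sl_out t : ~~ (0 < t <= T) -> sl rho t = 0 /\ sl sigma t = 0.
Proof.
by move=> ht; case: rs => _ supp _ _; split; apply/funext => x;
  have [h1 h2] := supp (x, t) ht.
Qed.

Let egy_out t : ~~ (0 < t <= T) -> egy t = 0.
Proof. by move=> /sl_out[e _]; rewrite /egy e (sip0r H)//; exact: sqint0. Qed.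

Let qs_out t : ~~ (0 < t <= T) -> qs t = 0.
Proof. by move=> /sl_out[_ e]; rewrite /qs e (sip0r H)//; exact: sqint0. Qed.

Let prim0 (h : R -> R) : (forall t, ~~ (0 < t <= T) -> h t = 0) -> primitive h 0 = 0.
Proof.
move=> h0; rewrite /primitive Rintegral_mkcond.
transitivity (\int[lam]_t (0 : R)); last by rewrite Rintegral_cst// mul0r.
apply: eq_Rintegral => t _; rewrite patchE mem_setE in_itv/=.
by case: leP => // t0; rewrite h0// negb_and -leNgt t0.
Qed.

Lemma snrm_initial : snrm (ip mu) (rep 0) = snrm (ip mu) rho0.
Proof.
have [sr0 _] := repP in0T; apply: snrm_eq0 => //.
by rewrite /snrm rep_initial sqrtr0.
Qed.

Let E0 := ip mu rho0 rho0.

(** The time 0 is not among the regular times; it is approached by them, and the energy converges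
    there because the representative [rep] is continuous with initial value [rho0]. *)
Lemma energy_le0 b : pt b -> egy b + dm * primitive qs b <= E0 + bb * primitive egy b.
Proof.
move=> pb; have [s_ [ps_ cs_]] := pt_seq in0T.
have cprim (h : R -> R) : lam.-integrable setT (EFin \o h) ->
    (forall t, ~~ (0 < t <= T) -> h t = 0) -> primitive h (s_ n) @[n --> \oo] --> (0 : R).
  move=> ih h0; rewrite -(prim0 h0).
  by apply: (cvg_comp s_) cs_ _; exact: primitive_continuous.
have cegy : egy (s_ n) @[n --> \oo] --> E0.
  have [sr0 h0] := repP in0T.
  have cm : modulus (s_ n) @[n --> \oo] --> modulus 0.
    by apply: (cvg_comp s_) cs_ _; exact: modulus_cts.
  have cn : snrm (ip mu) (sl rho (s_ n)) @[n --> \oo] --> snrm (ip mu) rho0.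
    rewrite -snrm_initial; apply/cvgrPdist_le => e e0.
    have := cvg_sqrt_dist0 cm => /cvgrPdist_le/(_ e e0).
    apply: filterS => n; rewrite sub0r normrN ger0_norm ?sqrtr_ge0// distrC => le.
    rewrite distrC; apply: (le_trans _ le); apply: (le_trans (snrm_dist H _ sr0)); last exact: h0.
    by have [[_ [] ? _] _] := ps_ n.
  rewrite /E0 -(snrm_sqr H) expr2.
  rewrite (_ : (fun n => egy (s_ n)) = (fun n => snrm (ip mu) (sl rho (s_ n)) * snrm (ip mu) (sl rho (s_ n)))).
    exact: cvgM.
  by apply/funext => n; rewrite -expr2 (snrm_sqr H).
apply: (@ler_cvg_to _ \oo _ R (fun n => egy b + dm * (primitive qs b - primitive qs (s_ n)))
  (fun n => egy (s_ n) + bb * (primitive egy b - primitive egy (s_ n)))).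
- apply: cvgD; first exact: cvg_cst.
  apply: cvgM; first exact: cvg_cst.
  by rewrite -[X in _ --> X]subr0; apply: cvgB; [exact: cvg_cst|exact: cprim].
- apply: cvgD => //; apply: cvgM; first exact: cvg_cst.
  by rewrite -[X in _ --> X]subr0; apply: cvgB; [exact: cvg_cst|exact: cprim].
have [[/andP[b0 _] _ _ _] _] := pb.
move/cvgrPdist_lt : cs_ => /(_ b b0); apply: filterS => n.
rewrite sub0r normrN => lt; apply: energy_le => //.
by apply: le_lt_trans lt; exact: ler_norm.
Qed.

Let AA := expR (bb * T).

Lemma energy_sup b : pt b -> egy b <= E0 * AA.
Proof.
have E00 : 0 <= E0 by exact: (sip_ge0 H).
have qsp t : 0 <= primitive qs t by apply: Rintegral_ge0.
have gr := gronwall T0 E00 bb0 ie.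
have key t : 0 <= t <= T -> E0 + bb * primitive egy t <= E0 * AA.
  apply: gr.
    by move=> s hs; rewrite egy_out// negb_and -leNgt hs.
  apply: aeS pt_ae => s hs /hs ps; apply: le_trans (energy_le0 ps).
  by rewrite lerDl mulr_ge0// ltW.
move=> pb; have [[/andP[b0 bT] _ _ _] _] := pb.
apply: le_trans (key b _); last by rewrite !ltW.
by apply: le_trans (energy_le0 pb); rewrite lerDl mulr_ge0// ltW.
Qed.

Lemma rho_bound : ip nu rho rho <= T * AA * E0.
Proof.
have [_ ->] := ip_sl sr sr; rewrite -/egy.
have -> : T * AA * E0 = \int[lam]_t (E0 * AA * ind 0 T t).
  rewrite RintegralZl//; last exact: integrable_ind.
  by rewrite Rintegral_ind ?ltW// subr0; ring.
apply: ae_le_Rintegral => //; first by apply: integrableRZ; exact: integrable_ind.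
have : {ae lam, forall t, t != T}.
  exists [set T]; split => //; first exact: lebesgue_measure_set1.
  by move=> z /= /negP; rewrite negbK => /eqP.
apply: ae2 pt_ae => t hp tT; rewrite indE.
have [/andP[t0 tT']|h] := boolP (0 < t <= T); last by rewrite mulr0 -/(egy t) egy_out.
rewrite mulr1; apply: energy_sup; apply: hp.
by rewrite t0 lt_neqAle tT.
Qed.

Lemma sigma_bound : dm * ip nu sigma sigma <= (1 + bb * (T * AA)) * E0.
Proof.
have inT : 0 <= T <= T by rewrite lexx ltW.
have [s_ [ps_ cs_]] := pt_seq inT.
have -> : ip nu sigma sigma = primitive qs T.
  have [_ ->] := ip_sl ss ss; rewrite /primitive [RHS]Rintegral_mkcond; apply: eq_Rintegral => t _.
  rewrite patchE mem_setE in_itv/=; case: leP => // tT.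
  by rewrite -/(qs t) qs_out// negb_and -ltNge tT orbT.
apply: (@ler_cvg_to _ \oo _ R (fun n => dm * primitive qs (s_ n)) (fun=> (1 + bb * (T * AA)) * E0)).
- apply: cvgM; first exact: cvg_cst.
  by apply: (cvg_comp s_) cs_ _; exact: primitive_continuous.
- exact: cvg_cst.
apply: nearW => n; have := energy_le0 (ps_ n).
have : primitive egy (s_ n) <= T * AA * E0.
  apply: le_trans rho_bound; have [_ ->] := ip_sl sr sr.
  apply: (le_trans (ler_norm _)); apply: (le_trans (primitive_bound _ ie)).
  rewrite le_eqVlt; apply/orP; left; apply/eqP; apply: eq_Rintegral => t _.
  by rewrite ger0_norm// (sip_ge0 H).
have e0 : 0 <= egy (s_ n) by exact: (sip_ge0 H).
move=> /(ler_wpM2l bb0) h1 h2; rewrite mulrDl mul1r.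
have -> : bb * (T * AA) * E0 = bb * (T * AA * E0) by ring.
apply: (@le_trans _ _ (E0 + bb * primitive egy (s_ n))); last by rewrite lerD2l.
by apply: le_trans h2; rewrite lerDr.
Qed.

Theorem energy_estimates : exists r : R -> X -> R,
  [/\ forall t, 0 <= t <= T -> sqint mu (r t) /\ ip mu (r t) (r t) <= AA * E0,
      {ae lam, forall t, 0 < t < T -> ip mu (r t - sl rho t) (r t - sl rho t) = 0},
      forall t, 0 <= t <= T -> forall eps : R, 0 < eps -> exists2 de : R, 0 < de &
        forall s, 0 <= s <= T -> `|s - t| < de -> ip mu (r s - r t) (r s - r t) <= eps,
      ip mu (r 0 - rho0) (r 0 - rho0) = 0 &
      ip nu rho rho <= T * AA * E0 /\ dm * ip nu sigma sigma <= (1 + bb * (T * AA)) * E0].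
Proof.
exists rep; split.
- move=> t tT; have [srt h] := repP tT; split => //.
  have [s_ [ps_ cs_]] := pt_seq tT.
  have cm : modulus (s_ n) @[n --> \oo] --> modulus t.
    by apply: (cvg_comp s_) cs_ _; exact: modulus_cts.
  have K0 : 0 <= AA * E0 by rewrite mulr_ge0 ?expR_ge0// (sip_ge0 H).
  rewrite -(snrm_sqr H) -(sqr_sqrtr K0) ler_sqr ?nnegrE ?sqrtr_ge0 ?snrm_ge0//.
  apply: (@ler_cvg_to _ \oo _ R (fun=> snrm (ip mu) (rep t))
    (fun n => Num.sqrt `|modulus t - modulus (s_ n)| + Num.sqrt (AA * E0))).
  + exact: cvg_cst.
  + by rewrite -[X in _ --> X]add0r; apply: cvgD; [exact: cvg_sqrt_dist0|exact: cvg_cst].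
  apply: nearW => n; have [[_ [srs _ _] _ _] _] := ps_ n.
  have -> : rep t = (rep t - sl rho (s_ n)) + sl rho (s_ n) by rewrite subrK.
  apply: (le_trans (snrm_add H (sip_sub H srt srs) srs)); apply: lerD.
    by rewrite (snrm_subC H)// distrC; exact: h.
  by rewrite ler_sqrt// mulrC; exact: energy_sup.
- apply: aeS pt_ae => t hp t0T; have pt' := hp t0T.
  have tT : 0 <= t <= T by case/andP: t0T => /ltW-> /ltW.
  have [srt h] := repP tT; have [[_ [srs _ _] _ _] _] := pt'.
  have := h _ pt'; rewrite subrr normr0 sqrtr0 => le0.
  rewrite -(snrm_sqr H) (snrm_subC H)//; apply/eqP.
  by rewrite sqrf_eq0 eq_le le0 snrm_ge0.
- move=> t tT eps eps0.
  have := @modulus_cts t => /cvgrPdist_le/(_ _ eps0)[de /= de0 hde].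
  exists de => // s sT st; rewrite -(snrm_sqr H).
  apply: (@le_trans _ _ (Num.sqrt `|modulus s - modulus t| ^+ 2)).
    by rewrite ler_sqr ?nnegrE ?sqrtr_ge0 ?snrm_ge0// rep_dist.
  by rewrite sqr_sqrtr// distrC; apply: hde; rewrite /ball_/= distrC.
- exact: rep_initial.
- by split; [exact: rho_bound|exact: sigma_bound].
Qed.
End energy.
End evolution.

Import HBNNSimple.

(** * Integrals of functions not known to be measurable *)

Section nonmeasurable.
Context d (X : measurableType d) (R : realType) (m : {measure set X -> \bar R}).
Implicit Types f g : X -> \bar R.

(** The integral of a nonnegative function, measurable or not, is the supremum of those of the
    simple functions below it, and each of these lies below [g] almost everywhere. This form serves
    the norms along Bochner functions. *)
Lemma ge0_ae_le_integral_r f g : (forall x, 0 <= f x)%E -> (forall x, 0 <= g x)%E ->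
  measurable_fun setT g -> {ae m, forall x, (f x <= g x)%E} ->
  (\int[m]_x f x <= \int[m]_x g x)%E.
Proof.
move=> f0 g0 mg fg; rewrite [leLHS]ge0_integralTE//; apply: ge_ereal_sup => _ [h hf <-].
have -> : sintegral m h = (\int[m]_x (h x)%:E)%E by rewrite integral_nnsfun// patch_setT.
apply: ae_ge0_le_integral => //.
- by move=> x _; rewrite lee_fin; exact: fun_ge0.
- by apply/measurable_EFinP.
by apply: aeS fg => x fx _; exact: le_trans (hf x) fx.
Qed.

(** Here the larger function may fail to be measurable. Setting [f] to 0 on the exceptional null set
    keeps its integral and makes the inequality hold everywhere. *)
Lemma ge0_ae_le_integral_l f g : (forall x, 0 <= f x)%E -> (forall x, 0 <= g x)%E ->
  measurable_fun setT f -> {ae m, forall x, (f x <= g x)%E} ->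
  (\int[m]_x f x <= \int[m]_x g x)%E.
Proof.
move=> f0 g0 mf [N [mN N0 fgN]].
rewrite (@ge0_negligible_integral _ _ _ m setT N f)//.
rewrite integral_mkcond setTD ge0_integralTE; last first.
  by move=> x; rewrite patchE; case: ifP.
rewrite [leRHS]ge0_integralTE//.
apply: ereal_sup_le => _ [h hf <-]; exists h => // x.
apply: (le_trans (hf x)); rewrite patchE; case: ifPn => [|_]; last exact: g0.
by rewrite inE => xN; apply: contrapT => nfg; apply: xN; apply: fgN.
Qed.

Lemma integral_ae_measurable_r f g : measurable_fun setT g ->
  {ae m, forall x, f x = g x} -> (\int[m]_x f x = \int[m]_x g x)%E.
Proof.
move=> mg fg; rewrite [LHS]integralE [RHS]integralE.
have h (u v : X -> \bar R) : (forall x, 0 <= u x)%E -> (forall x, 0 <= v x)%E ->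
    measurable_fun setT v -> {ae m, forall x, u x = v x} -> (\int[m]_x u x = \int[m]_x v x)%E.
  move=> u0 v0 mv uv; apply/eqP; rewrite eq_le; apply/andP; split.
    by apply: ge0_ae_le_integral_r => //; apply: aeS uv => x ->.
  by apply: ge0_ae_le_integral_l => //; apply: aeS uv => x ->.
congr (_ - _)%E; apply: h.
- exact: funepos_ge0.
- exact: funepos_ge0.
- exact: measurable_funepos.
- by apply: aeS fg => x fx; rewrite funepos.unlock fx.
- exact: funeneg_ge0.
- exact: funeneg_ge0.
- exact: measurable_funeneg.
- by apply: aeS fg => x fx; rewrite funeneg.unlock fx.
Qed.

Lemma Rintegral_ae_measurable_r (f g : X -> R) : measurable_fun setT g ->
  {ae m, forall x, f x = g x} -> \int[m]_x f x = \int[m]_x g x.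
Proof.
move=> mg fg; rewrite /Rintegral; congr fine; apply: integral_ae_measurable_r.
  exact/measurable_EFinP.
by apply: aeS fg => x ->.
Qed.
End nonmeasurable.

(** * The L2 norm and square integrability *)

Section square_norm.
Context d (X : measurableType d) (R : realType) (m : {measure set X -> \bar R}).

Lemma poweR2 (x : \bar R) : (0 <= x)%E -> (x `^ 2 = x ^+ 2)%E.
Proof.
case: x => [r|_|//]; last by rewrite poweRyr// expe2 mulyy.
by rewrite lee_fin => r0; rewrite poweR_EFin (@powR_mulrn R r 2 r0) expe2 -EFinM expr2.
Qed.

Lemma Lnorm2_sqr (f : X -> R) :
  ('N[m]_2%:E[EFin \o f] ^+ 2 = \int[m]_x (f x ^+ 2)%:E)%E.
Proof.
rewrite -poweR2 ?Lnorm_ge0// (@poweR_Lnorm _ _ _ m (EFin \o f) 2 (lt0r_neq0 (@ltr0n R 2))).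
apply: eq_integral => x _; rewrite poweR2// expe2 -EFinM -expr2.
by rewrite real_normK// num_real.
Qed.

Lemma Lfun2_sqint (f : X -> R) : f \in Lfun m 2%:E <-> sqint m f.
Proof.
split.
  rewrite inE => /andP[/[!inE] /= mf]; rewrite /finite_norm => fin; split => //.
  apply/integrableP; split; first by apply/measurable_EFinP; exact: measurable_funX.
  rewrite (eq_integral (fun x => (f x ^+ 2)%:E)); last by move=> x _ /=; rewrite ger0_norm// sqr_ge0.
  by rewrite -Lnorm2_sqr expe2 lte_mul_pinfty// ?Lnorm_ge0// ge0_fin_numE ?Lnorm_ge0.
move=> [mf /integrableP[_]].
rewrite (eq_integral (fun x => (f x ^+ 2)%:E)); last by move=> x _ /=; rewrite ger0_norm// sqr_ge0.
rewrite -Lnorm2_sqr => fin; rewrite inE; apply/andP; rewrite !inE/=; split => //.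
rewrite /finite_norm; move: fin; have := @Lnorm_ge0 _ _ _ m 2%:E (EFin \o f).
by case: (Lnorm m 2%:E (EFin \o f)) => [r|_|//]; rewrite ?ltry// expe2 mulyy.
Qed.

End square_norm.

(** * Separability of L2 of the real line *)

Section separable_L2.
Variable R : realType.
Notation lam := (@lebesgue_measure R).
Let H := ip_sip lam.

(** Each triple is a height followed by the two ends of an interval. Lists of rational triples are
    countable, and concatenation adds the step functions. *)
Definition rat_step (s : seq (rat * rat * rat)) : R -> R :=
  foldr (fun q f => ratr q.1.1 *: ind (ratr q.1.2) (ratr q.2) + f) 0 s.

Lemma sqint_rat_step s : sqint lam (rat_step s).
Proof.
elim: s => [|q s ih] /=; first exact: sqint0.
by apply: (sip_comb H) => //; exact: sqint_ind.
Qed.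

Lemma rat_step_cat s s' : rat_step (s ++ s') = rat_step s + rat_step s'.
Proof. by elim: s => [|q s ih] /=; rewrite ?add0r// ih addrA. Qed.

Lemma rat_step_scale (r : rat) s :
  rat_step [seq (r * q.1.1, q.1.2, q.2) | q <- s] = (ratr r : R) *: rat_step s.
Proof. by elim: s => [|q s ih] /=; rewrite ?scaler0// ih rmorphM/= scalerDr scalerA. Qed.

Definition steps_closure : set (R -> R) := [set w | sqint lam w /\
  forall eps : R, 0 < eps -> exists s, ip lam (w - rat_step s) (w - rat_step s) <= eps].

Lemma steps_closure_closed w : sqint lam w ->
  (forall eps : R, 0 < eps -> exists2 u, steps_closure u & ip lam (w - u) (w - u) <= eps) ->
  steps_closure w.
Proof.
move=> sw h; split => // eps eps0.
have e4 : 0 < eps / 4 by rewrite divr_gt0.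
have [u [su uP] wu] := h _ e4; have [s us] := uP _ e4; exists s.
have sS := sqint_rat_step s.
have -> : w - rat_step s = (w - u) - (rat_step s - u) by rewrite opprB addrA subrK.
apply: (le_trans (sip_sub_le H (sip_sub H sw su) (sip_sub H sS su))).
rewrite -(snrm_sqr H (rat_step s - u)) (snrm_subC H)// (snrm_sqr H).
by move: wu us; move: (ip _ _ _) (ip _ _ _) => x y; lra.
Qed.

Lemma steps_closure_add u w : steps_closure u -> steps_closure w -> steps_closure (u + w).
Proof.
move=> [su uP] [sw wP]; split; first exact: (sip_add H).
move=> eps eps0; have e4 : 0 < eps / 4 by rewrite divr_gt0.
have [s us] := uP _ e4; have [s' ws'] := wP _ e4; exists (s ++ s').
have sS := sqint_rat_step s; have sS' := sqint_rat_step s'.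
have -> : u + w - rat_step (s ++ s') = (u - rat_step s) - (rat_step s' - w).
  by rewrite rat_step_cat opprB opprD addrACA.
apply: (le_trans (sip_sub_le H (sip_sub H su sS) (sip_sub H sS' sw))).
rewrite -(snrm_sqr H (rat_step s' - w)) (snrm_subC H)// (snrm_sqr H).
by move: us ws'; move: (ip _ _ _) (ip _ _ _) => x y; lra.
Qed.

(** A rational step function stays one under rational factors only, so the real factor [a] is
    replaced by a nearby rational. *)
Lemma steps_closure_scale (a : R) w : steps_closure w -> steps_closure (a *: w).
Proof.
move=> [sw wP]; apply: steps_closure_closed; first exact: (sip_scale H).
move=> eps eps0; pose K : R := ip lam w w + 1.
have K0 : 0 < K by rewrite ltr_wpDl// (sip_ge0 H).
(* The bound by 1 allows the square of the error in [a] to be estimated by the error itself. *)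
pose de : R := Num.min 1 (eps / K).
have de0 : 0 < de by rewrite lt_min ltr01 divr_gt0.
have ade : a < a + de by rewrite ltrDl.
have [r] := rat_in_itvoo ade; rewrite in_itv/= => /andP[r1 r2].
exists (ratr r *: w).
  split; first exact: (sip_scale H).
  move=> e e0; pose C : R := (ratr r) ^+ 2 + 1.
  have C0 : 0 < C by rewrite ltr_wpDl// sqr_ge0.
  have [s hs] := wP _ (divr_gt0 e0 C0).
  exists [seq (r * q.1.1, q.1.2, q.2) | q <- s]; rewrite rat_step_scale -scalerBr.
  have sd := sip_sub H sw (sqint_rat_step s).
  have s0 := sqint0 lam.
  have := sip_expand H (ratr r) sd s0; rewrite !addr0 (sip0r H)// mulr0 (sip0r H)// !addr0 => ->.
  apply: (le_trans (ler_wpM2l (sqr_ge0 _) hs)).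
  rewrite mulrCA -[leRHS]mulr1 ler_pM2l// ler_pdivrMr// mul1r /C lerDl ler01//.
rewrite -scalerBl; have s0 := sqint0 lam.
have := sip_expand H (a - ratr r) sw s0; rewrite !addr0 (sip0r H)// mulr0 (sip0r H)// !addr0 => ->.
have ar : `|a - ratr r| <= de by rewrite distrC ltW// gtr0_norm ?subr_gt0// ltrBlDl.
have ar2 : (a - ratr r) ^+ 2 <= de.
  rewrite -real_normK ?num_real// expr2; apply: (@le_trans _ _ (1 * de)); last by rewrite mul1r.
  by apply: ler_pM => //; apply: (le_trans ar); rewrite ge_min lexx.
apply: (@le_trans _ _ (de * K)).
  apply: ler_pM => //; [exact: sqr_ge0|exact: (sip_ge0 H)|by rewrite /K lerDl].
by rewrite -ler_pdivlMr// ge_min lexx orbT.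
Qed.

Lemma steps_closure_ind (a b : R) : a < b -> steps_closure (ind a b).
Proof.
move=> ab; apply: steps_closure_closed; first exact: sqint_ind.
move=> eps eps0; pose de : R := eps / 4.
have de0 : 0 < de by rewrite divr_gt0.
have h1 : a < Num.min b (a + de) by rewrite lt_min ab ltrDl.
have h2 : b < b + de by rewrite ltrDl.
have [p] := rat_in_itvoo h1; rewrite in_itv/= lt_min => /andP[ap /andP[pb pd]].
have [q] := rat_in_itvoo h2; rewrite in_itv/= => /andP[bq qd].
(* Both ends move slightly to the right, so that the error is carried by two short intervals. *)
exists (ind (ratr p) (ratr q)).
  split; first exact: sqint_ind.
  move=> e e0; exists [:: (1, p, q)] => /=.
  by rewrite rmorph1 scale1r addr0 subrr (sip0r H) ?ltW//; exact: sqint0.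
have -> : ind a b - ind (ratr p) (ratr q) = ind a (ratr p) - ind b (ratr q).
  apply/funext => t; rewrite -[LHS]/(ind a b t - ind (ratr p) (ratr q) t).
  rewrite -[RHS]/(ind a (ratr p) t - ind b (ratr q) t) !indE.
  case: (ltP a t) => h3; case: (leP t b) => h4; case: (ltP (ratr p) t) => h5;
    case: (leP t (ratr q)) => h6; rewrite /= ?subrr//; exfalso; lra.
apply: (le_trans (sip_sub_le H (sqint_ind _ _) (sqint_ind _ _))).
rewrite !ip_ind ?ltW//; move: pd qd; rewrite /de; lra.
Qed.

Lemma ind_orth (h : R -> R) : sqint lam h ->
  (forall a b, a < b -> ip lam h (ind a b) = 0) -> ip lam h h = 0.
Proof.
move=> sh h0; have [mh _] := sh.
have hn (n : nat) : {ae lam, forall t, ind (- n%:R) n%:R t * h t = 0}.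
  have i1 : lam.-integrable setT (EFin \o (fun t => ind (- n%:R) n%:R t * h t)).
    by apply: sqint_mul => //; exact: sqint_ind.
  apply: ae0_Rintegral_itv => // a b ab; rewrite Rintegral_indE.
  pose a' : R := Num.max a (- n%:R); pose b' : R := Num.min b n%:R.
  transitivity (ip lam h (ind a' b')).
    by apply: eq_Rintegral => t _; rewrite mulrA ind_mul mulrC.
  have [ba'|/h0//] := leP b' a'.
  transitivity (\int[lam]_t (0 : R)); last by rewrite Rintegral_cst// mul0r.
  by apply: eq_Rintegral => t _; rewrite ind_empty// mulr0.
apply: ip_ae0 => //; apply: aeS (ae_nat hn) => t ht.
have [n hn'] : exists n : nat, `|t| < n%:R.
  by exists (Num.truncn `|t|).+1; exact: truncnS_gt.
have := ht n; rewrite ind_in ?mul1r//.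
by move: hn'; rewrite ltr_norml => /andP[-> /ltW ->].
Qed.

(** The projection of [w] on the closed span of rational steps leaves a remainder orthogonal to
    every indicator of an interval, which is null by [ind_orth]. *)
Lemma steps_dense w : sqint lam w -> steps_closure w.
Proof.
move=> sw; pose M : set ((R -> R) * R) := [set p | steps_closure p.1 /\ p.2 = ip lam w p.1].
have c0 : steps_closure 0.
  split; first exact: sqint0.
  by move=> eps eps0; exists [::]; rewrite /= subrr (sip0r H) ?ltW//; exact: sqint0.
have [|||||z [sz zP zM]] := @riesz_subspace _ _ _ _ H M (ip lam w w) (@ip_complete _ _ _ lam).
- exact: (sip_ge0 H).
- by split => //=; rewrite (sip0r H).
- by move=> p [[]].
- move=> a p q [cp ->] [cq ->]; split => /=.
    by apply: steps_closure_add => //; exact: steps_closure_scale.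
  by case: cp cq => sp _ [sq _]; rewrite (sip_linr H).
- by move=> p [[sp _] ->]; exact: (sip_CS H).
have cz : steps_closure z.
  apply: steps_closure_closed => // eps /zM[p [cp _] hp].
  by exists p.1.
apply: steps_closure_closed => // eps eps0; exists z => //.
rewrite ind_orth ?ltW//; first exact: (sip_sub H).
move=> a b ab; have sI := @sqint_ind R a b.
rewrite (sip_subl H)//.
by rewrite (zP (ind a b, ip lam w (ind a b))) ?subrr//; split => //; exact: steps_closure_ind.
Qed.

Definition steps (k : nat) : R -> R := rat_step (odflt [::] (unpickle k)).

Lemma steps_separate : separated_by lam steps.
Proof.
split=> [k|w eps sw eps0]; first exact: sqint_rat_step.
have [_ wP] := steps_dense sw; have [s hs] := wP _ eps0.
by exists (pickle s); rewrite /steps pickleK.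
Qed.
End separable_L2.

(** * Function spaces on the star graph *)

Section interval.
Variables (R : realType) (l : R).
Hypothesis l0 : 0 < l.
Notation lam := (@lebesgue_measure R).
Let H := ip_sip lam.
Implicit Types f g w : R -> R.

(** Extension by zero turns integrals over an edge into integrals over the line, where the preceding
    theory is stated. *)
Definition zext f : R -> R := f \_ `]0, l[.

Lemma zextE f x : zext f x = if 0 < x < l then f x else 0.
Proof. by rewrite /zext patchE mem_setE in_itv. Qed.

Lemma L2_sqint f : L2 l f <-> sqint lam (zext f).
Proof. exact: Lfun2_sqint. Qed.

Lemma L2norm_sqr f : L2 l f -> (L2norm l f ^+ 2 = (ip lam (zext f) (zext f))%:E)%E.
Proof. by move=> /L2_sqint sf; rewrite /L2norm Lnorm2_sqr ip_EFin. Qed.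

Lemma L2norm_ge0 f : (0 <= L2norm l f)%E.
Proof. exact: Lnorm_ge0. Qed.

Lemma Rintegral_oo (h : R -> R) : \int[lam]_(x in `]0, l[) h x = \int[lam]_x zext h x.
Proof. by rewrite Rintegral_mkcond. Qed.

Lemma zext_mul f g : zext (fun x => f x * g x) = fun x => zext f x * g x.
Proof. by apply/funext => x; rewrite !zextE; case: ifP; rewrite ?mul0r. Qed.

Lemma zext_mul2 f g : zext (fun x => f x * g x) = fun x => zext f x * zext g x.
Proof. by apply/funext => x; rewrite !zextE; case: ifP; rewrite ?mul0r. Qed.

Lemma sqint_zext_integrable f : sqint lam (zext f) -> lam.-integrable setT (EFin \o zext f).
Proof.
move=> sf; rewrite (_ : zext f = fun x => zext f x * ind 0 l x).
  by apply: sqint_mul => //; exact: sqint_ind.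
apply/funext => x; rewrite zextE; case: ifPn => [/andP[h1 h2]|_]; last by rewrite mul0r.
by rewrite ind_in ?mulr1// h1 ltW.
Qed.

Lemma sqint_zext_bounded f (K : R) : measurable_fun setT (f : measurableTypeR R -> R) ->
  (forall x, `|f x| <= K) -> sqint lam (zext f).
Proof.
move=> mf fK; apply: (@sqint_le _ _ _ lam (zext f) (K *: ind 0 l)).
- exact: (measurable_restrictT f (measurable_itv _)).1 (measurable_funTS mf).
- by apply: (sip_scale H); exact: sqint_ind.
move=> x; rewrite zextE (_ : (K *: ind 0 l) x = K * ind 0 l x)//.
case: ifPn => [/andP[h1 h2]|_]; last by rewrite normr0.
by rewrite (@ind_in R 0 l) ?h1 ?(ltW h2)// mulr1 (le_trans (fK x))// ler_norm.
Qed.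

Lemma is_weak_derivE f w : L2 l f -> is_weak_deriv l f w <-> L2 l w /\
  forall psi, test_fun 0 l psi ->
   \int[lam]_x (zext f x * derive1 psi x) = - \int[lam]_x (zext w x * psi x).
Proof.
move=> Lf; split=> -[Lw h]; split => // psi tpsi; have := h _ tpsi.
  by rewrite !Rintegral_oo !zext_mul.
by rewrite !Rintegral_oo !zext_mul.
Qed.

(** Both derivatives have the same integrals against bumps. Since [weak_deriv] is an arbitrary
    choice, this is what ties it to a derivative obtained by other means. *)
Lemma weak_deriv_unique f w w' : L2 l f -> is_weak_deriv l f w -> is_weak_deriv l f w' ->
  {ae lam, forall x, zext w x = zext w' x}.
Proof.
move=> Lf /(is_weak_derivE _ Lf)[/L2_sqint sw h] /(is_weak_derivE _ Lf)[/L2_sqint sw' h'].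
have iw := sqint_zext_integrable sw; have iw' := sqint_zext_integrable sw'.
have := @ae0_test R 0 l (fun x => zext w x - zext w' x) (integrableRB iw iw').
have [|h0 _] := pselect (forall a b c : R, 0 < a -> a < b -> b < l -> 0 < c ->
     \int[lam]_x ((zext w x - zext w' x) * bump a b c 1 0 x) = 0); last first.
  exfalso; apply: h0 => a b c a0 ab bl c0.
  have tb : test_fun 0 l (bump a b c 1 0) by exact: test_fun_bump.
  have bb (k : R -> R) : lam.-integrable setT (EFin \o k) ->
      lam.-integrable setT (EFin \o (fun x => k x * bump a b c 1 0 x)).
    move=> ik; apply: (integrable_mul_bounded (K := 1)) => //.
      by apply: continuous_measurable; exact: bump_continuous.
    by move=> x; have /andP[? ?] := bump_ge0_le1 a b x c0; rewrite ger0_norm.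
  transitivity (\int[lam]_x (zext w x * bump a b c 1 0 x - zext w' x * bump a b c 1 0 x)).
    by apply: eq_Rintegral => x _; rewrite mulrBl.
  rewrite RintegralB ?bb//.
  by apply/eqP; rewrite subr_eq0 -eqr_opp -h// -h'.
move=> h0 /(_ h0); apply: aeS => x hx; rewrite !zextE.
by case: ifPn => // x0l; have := hx x0l; rewrite !zextE x0l => /subr0_eq.
Qed.

Lemma ae_seq (P : R -> Prop) (A B x : R) : A < B -> A <= x <= B ->
  {ae lam, forall t, A < t < B -> P t} ->
  exists s_ : nat -> R, (forall n, A < s_ n < B /\ P (s_ n)) /\ s_ n @[n --> \oo] --> x.
Proof.
move=> AB /andP[Ax xB] aeP.
have /choice[s_ s_P] : forall n : nat, exists s : R, (A < s < B /\ P s) /\ `|x - s| <= n.+1%:R^-1.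
  move=> n; pose de : R := n.+1%:R^-1.
  have de0 : 0 < de by rewrite invr_gt0.
  have lt1 : Num.max A (x - de) < Num.min B (x + de).
    rewrite gt_max !lt_min AB (le_lt_trans Ax) ?ltrDl//=.
    by rewrite ltrBlDr (le_lt_trans xB) ?ltrDl//= ltrBlDr -addrA ltrDl addr_gt0.
  have [s [/andP[]]] := ae_itv_nonempty lt1 aeP.
  rewrite gt_max lt_min => /andP[h1 h2] /andP[h3 h4] hs.
  exists s; split; first by split; [rewrite h1|apply: hs; rewrite h1].
  by rewrite ltW// ltr_distlC h2 h4.
exists s_; split=> [n|]; first by case: (s_P n).
apply/cvgrPdist_le => e e0; have [n0 hn0] := snd_small e0.
exists n0 => // n /= n0n; have [_ h] := s_P n; rewrite (le_trans h)// (le_trans _ hn0)//.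
by rewrite lef_pV2 ?posrE// ler_nat ltnS.
Qed.

(** A set of full measure is dense, and continuity carries the identity to every point, the two ends
    included. *)
Lemma continuous_ae_eq (g h : R -> R) : {within `[0, l], continuous g} -> continuous h ->
  {ae lam, forall x, 0 < x < l -> g x = h x} -> forall x, 0 <= x <= l -> g x = h x.
Proof.
move=> cg ch gh x x0l; have [s_ [sP cs]] := ae_seq l0 x0l gh.
have c1 : h (s_ n) @[n --> \oo] --> h x by apply: (cvg_comp s_) cs _; exact: ch.
have c2 : g (s_ n) @[n --> \oo] --> g x.
  have x0l' : `[0, l]%classic x by rewrite /= in_itv.
  have gx := (subspace_continuousP _ g).1 cg x x0l'.
  apply: cvg_comp gx => //.
  move=> A /= [e e0 eA]; move/cvgrPdist_lt : cs => /(_ e e0); apply: filterS => n hn.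
  apply: eA => //=; have [/andP[h1 h2] _] := sP n.
  by rewrite in_itv/= !ltW.
have e : (fun n => g (s_ n)) = (fun n => h (s_ n)) by apply/funext => n; case: (sP n).
rewrite e in c2; exact: (cvg_unique _ c2 c1).
Qed.

(** Du Bois-Reymond's lemma gives [f] as a constant plus a primitive of [w] almost everywhere; by
    continuity this holds for [g] on the closed interval, and the constant is the value at 0. *)
Lemma cont_rep_primitive f w g : L2 l f -> is_weak_deriv l f w -> is_cont_rep l f g ->
  forall x, 0 <= x <= l -> g x = g 0 + primitive (zext w) x.
Proof.
move=> Lf /(is_weak_derivE _ Lf)[/L2_sqint sw h] [cg gf].
have /L2_sqint sf := Lf.
have iw := sqint_zext_integrable sw; have if_ := sqint_zext_integrable sf.
have [k kP] := weak_deriv_primitive l0 if_ iw h.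
have cp := primitive_continuous iw.
have gk : forall x, 0 <= x <= l -> g x = k + primitive (zext w) x.
  apply: continuous_ae_eq => //.
    by move=> x; apply: cvgD; [exact: cvg_cst|exact: cp].
  apply: ae2 gf kP => x gx fx x0l; rewrite -fx// zextE x0l; apply: gx.
  by rewrite /= in_itv.
have p0 : primitive (zext w) 0 = 0.
  rewrite /primitive Rintegral_mkcond; transitivity (\int[lam]_t (0 : R)); last first.
    by rewrite Rintegral_cst// mul0r.
  apply: eq_Rintegral => t _; rewrite patchE mem_setE in_itv/=.
  by case: leP => // t0; rewrite zextE ltNge t0.
move=> x x0l; rewrite (gk 0) ?lexx ?ltW// p0 addr0; exact: gk.
Qed.

Lemma primitive_cont_rep f w (c : R) : L2 l w ->
  measurable_fun setT (zext f : measurableTypeR R -> R) ->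
  {ae lam, forall x, 0 < x < l -> f x = c + primitive (zext w) x} ->
  [/\ L2 l f, is_weak_deriv l f w & is_cont_rep l f (fun x => c + primitive (zext w) x)].
Proof.
move=> /[dup] Lw /L2_sqint sw mf fE; have iw := sqint_zext_integrable sw.
have cp : continuous (fun x => c + primitive (zext w) x).
  by move=> x; apply: cvgD; [exact: cvg_cst|exact: primitive_continuous].
have mp : measurable_fun setT ((fun x => c + primitive (zext w) x) : measurableTypeR R -> R).
  exact: continuous_measurable.
have sg : sqint lam (zext (fun x => c + primitive (zext w) x)).
  apply: (sqint_zext_bounded (K := `|c| + \int[lam]_t `|zext w t|)) => // x.
  by rewrite (le_trans (ler_normD _ _))// lerD2l primitive_bound.
have fg : {ae lam, forall x, zext f x = zext (fun x => c + primitive (zext w) x) x}.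
  by apply: aeS fE => x hx; rewrite !zextE; case: ifP => // /hx.
have Lf : L2 l f.
  by apply/L2_sqint; apply: (sqint_ae mf sg); apply: aeS fg => x ->.
split => //; last first.
  split; first exact: continuous_subspaceT.
  by apply: aeS fE => x hx; rewrite /= in_itv/= => /hx ->.
apply/(is_weak_derivE _ Lf); split => // psi tpsi.
have [dpsi cpsi cpsi' psi_out psi'_out] := test_fun_continuous tpsi.
have [ipsi' [K psiK]] := continuous_support l0 cpsi' psi'_out.
have mpsi' := continuous_measurable cpsi'.
transitivity (\int[lam]_x (c * derive1 psi x + derive1 psi x * primitive (zext w) x)).
  apply: Rintegral_ae.
  - exact: measurable_funM.
  - apply: measurable_funD; first exact: measurable_funM.
    by apply: measurable_funM => //; apply: continuous_measurable; exact: primitive_continuous.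
  apply: aeS fE => x hx; rewrite zextE; case: ifPn => [/hx ->|x0l]; first by ring.
  by rewrite psi'_out// !mulr0 mul0r addr0.
rewrite RintegralD//; last 2 first.
- exact: integrableRZ.
- apply: (integrable_mul_bounded (K := \int[lam]_t `|zext w t|)) => //.
    by apply: continuous_measurable; exact: primitive_continuous.
  by move=> x; exact: primitive_bound.
rewrite (primitive_test l0 iw tpsi) RintegralZl//.
suff -> : \int[lam]_x derive1 psi x = 0 by rewrite mulr0 add0r.
transitivity (psi l - psi 0); last by rewrite !psi_out ?subrr// ?ltxx ?andbF.
rewrite -(FTC2_everywhere (ltW l0) dpsi cpsi') [RHS]Rintegral_mkcond; apply: eq_Rintegral => x _.
rewrite patchE mem_setE in_itv/=; case: ifPn => // xn; rewrite psi'_out//.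
by apply: contra xn => /andP[-> /ltW].
Qed.

End interval.

(** * Finite sums and finite families *)

Section finite_sums.
Context d (X : measurableType d) (R : realType) (m : {measure set X -> \bar R}).

Lemma integrable_bigsum (I : finType) (f : I -> X -> R) :
  (forall i, m.-integrable setT (EFin \o f i)) ->
  m.-integrable setT (EFin \o (fun x => \sum_i f i x)) /\
  \int[m]_x (\sum_i f i x) = \sum_i \int[m]_x f i x.
Proof.
move=> hf; elim: (index_enum I) => [|i s [ih1 ih2]] /=.
  have e : (fun x => \sum_(i <- [::]) f i x) = cst 0 by apply/funext => x; rewrite big_nil.
  rewrite e big_nil; split; last by rewrite Rintegral_cst// mul0r.
  by rewrite (_ : _ \o _ = cst 0%E)//; exact: integrable0.
have e : (fun x => \sum_(i <- i :: s) f i x) = fun x => f i x + \sum_(i <- s) f i x.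
  by apply/funext => x; rewrite big_cons.
by rewrite e big_cons; split; [exact: integrableRD|rewrite RintegralD// ih2].
Qed.

Lemma ae_fin (I : finType) (P : I -> X -> Prop) : (forall i, {ae m, forall x, P i x}) ->
  {ae m, forall x, forall i, P i x}.
Proof.
move=> h; have : {ae m, forall x, forall n : nat, forall i, enum_rank i = n :> nat -> P i x}.
  apply: ae_nat => n; have [[i ni]|nE] := pselect (exists i : I, enum_rank i = n :> nat).
    by apply: aeS (h i) => x px j nj; move: px; rewrite (enum_rank_inj (val_inj (etrans nj (esym ni)))).
  by apply: aeT => x i ni; case: nE; exists i.
by apply: aeS => x hx i; exact: (hx _ i erefl).
Qed.
End finite_sums.

(** * The edges of the graph as intervals of the line *)

Section embedding.
Variables (R : realType) (N : nat) (l : 'I_N -> R).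
Hypothesis l0 : forall i, 0 < l i.
Notation lam := (@lebesgue_measure R).
Notation edge_fun := ('I_N -> R -> R).
Implicit Types (v w phi : edge_fun) (f g : R -> R).
Let H := ip_sip lam.

(* The edge i is placed at ]off i, off i + l i[. *)
Definition off (i : 'I_N) : R := i%:R * \sum_j l j.

Definition on_edge (i : 'I_N) (y : R) := 0 < y - off i < l i.

Lemma l_le_sum i : l i <= \sum_j l j.
Proof.
by rewrite (bigD1 i)//= lerDl sumr_ge0// => j _; exact: ltW.
Qed.

(** Consecutive offsets differ by the total length, which is at least the length of each edge. *)
Lemma on_edge_inj i j y : on_edge i y -> on_edge j y -> i = j.
Proof.
have key (a b : 'I_N) : (a < b)%N -> on_edge a y -> on_edge b y -> False.
  move=> ab /andP[_ h1] /andP[h2 _]; move: h1 h2; rewrite ltrBlDr subr_gt0.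
  have := l_le_sum a; rewrite /off; set S := \sum_j l j => laS h1 h2.
  have S0 : 0 < S by exact: lt_le_trans laS.
  have : a.+1%:R * S <= b%:R * S by rewrite ler_pM2r// ler_nat.
  by rewrite -natr1; move: h1 h2 laS; lra.
move=> hi hj; apply/val_inj => /=.
by case: (ltngtP i j) => // [/key|/key]; [move=> /(_ hi hj)|move=> /(_ hj hi)].
Qed.

Definition emb v : R -> R := fun y => \sum_i zext (l i) (v i) (y - off i).

(** Recovers the components on the edges; [emb (res f)] is [f] with its values between the edges
    replaced by 0. *)
Definition res f : edge_fun := fun i x => f (x + off i).

Lemma emb_on v i y : on_edge i y -> emb v y = v i (y - off i).
Proof.
move=> hi; rewrite /emb (bigD1 i)//= zextE; rewrite /on_edge in hi; rewrite hi big1 ?addr0// => j ji.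
rewrite zextE ifN//; apply: contra ji => hj.
by apply/eqP; apply: (on_edge_inj (y := y)).
Qed.

Lemma emb_out v y : (forall i, ~~ on_edge i y) -> emb v y = 0.
Proof. by move=> h; rewrite /emb big1// => i _; rewrite zextE ifN//; exact: h. Qed.

Lemma on_edge_case y : (exists i, on_edge i y) \/ (forall i, ~~ on_edge i y).
Proof.
have [/existsP[i hi]|/negP h] := boolP [exists i, on_edge i y]; first by left; exists i.
by right => i; apply/negP => hi; apply: h; apply/existsP; exists i.
Qed.

Lemma on_edge_off i x : on_edge i (x + off i) = (0 < x < l i).
Proof. by rewrite /on_edge addrK. Qed.

Lemma res_emb v i x : 0 < x < l i -> res (emb v) i x = v i x.
Proof. by move=> hx; rewrite /res (@emb_on v i) ?on_edge_off// addrK. Qed.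

Lemma emb_mul v f y : emb v y * f y = emb (fun i x => v i x * res f i x) y.
Proof.
have [[i hi]|h] := on_edge_case y; last by rewrite !emb_out// mul0r.
by rewrite !(emb_on _ hi) /res subrK.
Qed.

Lemma emb_lin a v w : emb (fun i x => a * v i x + w i x) = a *: emb v + emb w.
Proof.
apply/funext => y; rewrite -[RHS]/(a * emb v y + emb w y).
have [[i hi]|h] := on_edge_case y; last by rewrite !emb_out// mulr0 addr0.
by rewrite !(emb_on _ hi).
Qed.

Lemma emb_sub v w : emb (v - w) = emb v - emb w.
Proof.
apply/funext => y; rewrite -[RHS]/(emb v y - emb w y).
have [[i hi]|h] := on_edge_case y; last by rewrite !emb_out// subr0.
by rewrite !(emb_on _ hi).
Qed.

Lemma res_sub f g : res (f - g) = res f - res g. Proof. by []. Qed.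

Lemma emb_res f y : emb (res f) y = if [exists i, on_edge i y] then f y else 0.
Proof.
have [/existsP[i hi]|/negP h] := boolP [exists i, on_edge i y].
  by rewrite (emb_on _ hi) /res subrK.
by rewrite emb_out// => i; apply/negP => hi; apply: h; apply/existsP; exists i.
Qed.

Lemma sqint_shift a f : sqint lam f -> sqint lam (fun y => f (y + a)).
Proof.
move=> [mf if_]; split; first exact: (measurableT_comp mf (measurable_shiftR a)).
exact: (integrable_shift a if_).
Qed.

Lemma sqint_sum (I : finType) (f : I -> R -> R) : (forall i, sqint lam (f i)) ->
  sqint lam (fun y => \sum_i f i y).
Proof.
move=> hf; rewrite unlock; elim: (index_enum I) => [|i s ih] /=; first exact: sqint0.
exact: (sip_add H).
Qed.

Lemma sqint_emb v : LL2 l v -> sqint lam (emb v).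
Proof.
move=> hv; apply: sqint_sum => i; apply: (sqint_shift (- off i)).
by apply/L2_sqint; exact: hv.
Qed.

Lemma LL2_res f : sqint lam f -> LL2 l (res f).
Proof.
move=> sf i; apply/L2_sqint; have [mf _] := sqint_shift (off i) sf.
apply: (@sqint_le _ _ _ lam _ (fun x => f (x + off i))); last first.
- by move=> x; rewrite zextE; case: ifP; rewrite ?normr0.
- exact: sqint_shift.
exact: (measurable_restrictT _ (measurable_itv _)).1 (measurable_funTS mf).
Qed.

Lemma Rintegral_emb v : (forall i, lam.-integrable setT (EFin \o zext (l i) (v i))) ->
  \int[lam]_y emb v y = \sum_i \int[lam]_(x in `]0, l i[) v i x.
Proof.
move=> hv; have [|_ ->] := @integrable_bigsum _ _ R lam _ (fun i y => zext (l i) (v i) (y - off i)).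
  by move=> i; exact: (integrable_shift (- off i)).
apply: eq_bigr => i _; rewrite Rintegral_oo.
by apply: (Rintegral_shift (- off i)); exact: measurable_of_integrable (hv i).
Qed.

Lemma ip_emb v f : LL2 l v -> sqint lam f ->
  ip lam (emb v) f = \sum_i \int[lam]_(x in `]0, l i[) (v i x * f (x + off i)).
Proof.
move=> hv sf; rewrite /ip; under eq_Rintegral do rewrite emb_mul.
apply: Rintegral_emb => i; rewrite zext_mul.
by apply: sqint_mul; [apply/L2_sqint; exact: hv|exact: sqint_shift].
Qed.

Lemma Rintegral_oo_eq (a : R) f g : (forall x, 0 < x < a -> f x = g x) ->
  \int[lam]_(x in `]0, a[) f x = \int[lam]_(x in `]0, a[) g x.
Proof.
by move=> fg; apply: eq_Rintegral => x; rewrite inE/= in_itv/= => /fg.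
Qed.

Lemma LL2_dot_emb v phi : LL2 l v -> LL2 l phi ->
  LL2_dot l v phi = ip lam (emb v) (emb phi).
Proof.
move=> hv hp; rewrite ip_emb//; last exact: sqint_emb.
apply: eq_bigr => i _; apply: Rintegral_oo_eq => x hx.
by rewrite -[emb phi _]/(res (emb phi) i x) res_emb.
Qed.

Lemma sum_L2norm_sqr v : LL2 l v ->
  (\sum_i L2norm (l i) (v i) ^+ 2 = (ip lam (emb v) (emb v))%:E)%E.
Proof.
move=> hv; rewrite -LL2_dot_emb// /LL2_dot -sumEFin; apply: eq_bigr => i _.
rewrite L2norm_sqr// /ip Rintegral_oo; congr EFin; apply: eq_Rintegral => x _.
by rewrite zext_mul2.
Qed.

Lemma LL2norm_emb v : LL2 l v -> LL2norm l v = (snrm (ip lam) (emb v))%:E.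
Proof. by move=> hv; rewrite /LL2norm sum_L2norm_sqr. Qed.

Lemma LL2_sub v w : LL2 l v -> LL2 l w -> LL2 l (v - w).
Proof.
move=> hv hw i; apply/L2_sqint.
rewrite (_ : zext _ _ = zext (l i) (v i) - zext (l i) (w i)).
  by apply: (sip_sub H); apply/L2_sqint; [exact: hv|exact: hw].
apply/funext => x; rewrite -[RHS]/(zext (l i) (v i) x - zext (l i) (w i) x) !zextE.
by case: ifP => // _; rewrite subr0.
Qed.

Lemma LL2_lin a v w : LL2 l v -> LL2 l w -> LL2 l (fun i x => a * v i x + w i x).
Proof.
move=> hv hw i; apply/L2_sqint.
rewrite (_ : zext _ _ = a *: zext (l i) (v i) + zext (l i) (w i)).
  by apply: (sip_comb H); apply/L2_sqint; [exact: hv|exact: hw].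
apply/funext => x; rewrite -[RHS]/(a * zext (l i) (v i) x + zext (l i) (w i) x) !zextE.
by case: ifP => // _; rewrite mulr0 addr0.
Qed.

Lemma LL2_eq_emb v w : LL2_eq l v w <-> {ae lam, forall y, emb v y = emb w y}.
Proof.
split=> [h|h i].
  have : {ae lam, forall y, forall i, on_edge i y -> v i (y - off i) = w i (y - off i)}.
    apply: ae_fin => i; apply: aeS (ae_shift (- off i) (h i)) => y hy oy; apply: hy.
    by rewrite /= in_itv.
  apply: aeS => y hy; have [[i hi]|ho] := on_edge_case y; last by rewrite !emb_out.
  by rewrite !(emb_on _ hi); exact: hy.
apply: aeS (ae_shift (off i) h) => x hx; rewrite /= in_itv/= => x0l.
by have := res_emb w x0l; have := res_emb v x0l; rewrite /res hx => -> ->.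
Qed.

Lemma snrm0_ae f g : sqint lam f -> sqint lam g -> ip lam (f - g) (f - g) = 0 ->
  {ae lam, forall y, f y = g y}.
Proof.
move=> sf sg /(ip_eq0 (sip_sub H sf sg)); apply: aeS => y.
by rewrite -[(f - g) y]/(f y - g y) => /subr0_eq.
Qed.

Lemma LL2_eq_ip v w : LL2 l v -> LL2 l w ->
  LL2_eq l v w <-> ip lam (emb v - emb w) (emb v - emb w) = 0.
Proof.
move=> hv hw; have sv := sqint_emb hv; have sw := sqint_emb hw.
split=> [/LL2_eq_emb h|h]; last by apply/LL2_eq_emb; exact: snrm0_ae.
have [md _] := sip_sub H sv sw.
apply: ip_ae0 => //; apply: aeS h => y hy.
by rewrite -[(_ - _) y]/(emb v y - emb w y) hy subrr.
Qed.

Lemma ip_emb_res_le f : sqint lam f ->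
  ip lam (emb (res f)) (emb (res f)) <= ip lam f f.
Proof.
move=> sf; have se := sqint_emb (LL2_res sf).
apply: (le_Rintegral_int (sqint_mul se se) (sqint_mul sf sf)) => y.
by rewrite emb_res; case: ifP => // _; rewrite mul0r -expr2 sqr_ge0.
Qed.

Definition one_edge i f : edge_fun := fun j => if j == i then f else fun=> 0.

Lemma LL2_one i f : L2 (l i) f -> LL2 l (one_edge i f).
Proof.
move=> hf j; rewrite /one_edge; case: eqP => [->//|_].
apply/L2_sqint; rewrite (_ : zext _ _ = 0); first exact: sqint0.
by apply/funext => x; rewrite zextE if_same.
Qed.

Lemma ip_one i f v : LL2 l v -> L2 (l i) f ->
  ip lam (emb v) (emb (one_edge i f)) = \int[lam]_x (zext (l i) (v i) x * f x).
Proof.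
move=> hv hf; rewrite -LL2_dot_emb//; last exact: LL2_one.
rewrite /LL2_dot (bigD1 i)//= big1 ?addr0.
  by rewrite /one_edge eqxx Rintegral_oo zext_mul.
move=> j ji; rewrite /one_edge (negbTE ji) Rintegral_oo.
transitivity (\int[lam]_t (0 : R)); last by rewrite Rintegral_cst// mul0r.
by apply: eq_Rintegral => x _; rewrite zextE mulr0 if_same.
Qed.
End embedding.

(** * Weights that encode a function as a primitive *)

Section tails.
Variable R : realType.
Notation lam := (@lebesgue_measure R).

Lemma Rintegral_tail (k : R -> R) (y : R) : lam.-integrable setT (EFin \o k) ->
  \int[lam]_(x in `[y, +oo[) k x = (\int[lam]_x k x) - primitive k y.
Proof.
move=> ik; rewrite -Rintegral_itv_obnd_cbnd; last exact: integrable_itv.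
rewrite /primitive Rintegral_mkcond [X in _ - X]Rintegral_mkcond -RintegralB//.
  apply: eq_Rintegral => x _; rewrite !patchE !mem_setE !in_itv/= andbT.
  by case: (leP x y) => _; rewrite ?subrr ?subr0.
exact: integrable_patch.
Qed.

Lemma primitive_zext_le0 (l : R) (w : R -> R) : primitive (zext l w) 0 = 0.
Proof.
rewrite /primitive Rintegral_mkcond; transitivity (\int[lam]_t (0 : R)); last first.
  by rewrite Rintegral_cst// mul0r.
apply: eq_Rintegral => t _; rewrite patchE mem_setE in_itv/=.
by case: leP => // t0; rewrite zextE ltNge t0.
Qed.

Lemma primitive_zext_ge (l : R) (w : R -> R) : primitive (zext l w) l = \int[lam]_x zext l w x.
Proof.
rewrite /primitive Rintegral_mkcond; apply: eq_Rintegral => t _; rewrite patchE mem_setE in_itv/=.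
by case: leP => // tl; rewrite zextE (ltNge t l) (ltW tl) andbF.
Qed.

(** For nonnegative [y] and [q] this is $(q-y)_+$, so $q$ minus it is $\min(y,q)$, the weight in
    $\int_0^q\int_x^l w(y)\,dy\,dx=\int_0^l\min(y,q)\,w(y)\,dy$ for $q\le l$. *)
Definition tail (q y : R) : R := \int[lam]_(x in `[y, +oo[) ind 0 q x.

Lemma L2_tail (l q : R) : 0 < l -> L2 l (fun y => q - tail q y).
Proof.
move=> l0; apply/L2_sqint; have iI := @integrable_ind R 0 q.
have tE : tail q = fun y => (\int[lam]_x ind 0 q x) - primitive (ind 0 q) y.
  by apply/funext => y; exact: Rintegral_tail.
rewrite tE; apply: (@sqint_zext_bounded R l _ (`|q| + (`|\int[lam]_x ind 0 q x| + \int[lam]_x `|ind 0 q x|))).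
  apply: continuous_measurable => y; apply: cvgB; first exact: cvg_cst.
  by apply: cvgB; [exact: cvg_cst|exact: primitive_continuous].
move=> y; rewrite (le_trans (ler_normB _ _))// lerD2l (le_trans (ler_normB _ _))// lerD2l.
exact: primitive_bound.
Qed.

Lemma L2_ind (l q : R) : 0 < l -> L2 l (ind 0 q).
Proof.
move=> l0; apply/L2_sqint; apply: (@sqint_zext_bounded R _ _ 1); first exact: measurable_ind.
by move=> x; rewrite ger0_norm ?ind_ge0// ind_le1.
Qed.

Lemma constraint_eval (l q : R) (f w : R -> R) : 0 < l -> 0 <= q <= l -> L2 l f -> L2 l w ->
  \int[lam]_x (zext l f x * ind 0 q x) + \int[lam]_x (zext l w x * (q - tail q x)) =
  \int[lam]_x (ind 0 q x * (zext l f x + (\int[lam]_x zext l w x) - primitive (zext l w) x)).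
Proof.
move=> l0 /andP[q0 ql] /L2_sqint sf /L2_sqint sw.
have iw := sqint_zext_integrable sw; have if_ := sqint_zext_integrable sf.
have iI := @integrable_ind R 0 q.
have cp := primitive_continuous iw.
have i1 : lam.-integrable setT (EFin \o (fun x => zext l f x * ind 0 q x)).
  by apply: sqint_mul => //; exact: sqint_ind.
have i2 : lam.-integrable setT (EFin \o (fun x => ind 0 q x * primitive (zext l w) x)).
  apply: (integrable_mul_bounded (K := \int[lam]_t `|zext l w t|)) => //.
    exact: continuous_measurable.
  by move=> x; exact: primitive_bound.
set I := \int[lam]_x zext l w x.
have i3 : lam.-integrable setT (EFin \o (fun x => zext l w x * tail q x)).
  have tE : tail q = fun y => (\int[lam]_x ind 0 q x) - primitive (ind 0 q) y.
    by apply/funext => y; exact: Rintegral_tail.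
  rewrite tE; apply: (integrable_mul_bounded (K := (`|\int[lam]_x ind 0 q x| + \int[lam]_x `|ind 0 q x|))) => //.
    apply: continuous_measurable => y; apply: cvgB; [exact: cvg_cst|exact: primitive_continuous].
  by move=> y; rewrite (le_trans (ler_normB _ _))// lerD2l primitive_bound.
have -> : \int[lam]_x (zext l w x * (q - tail q x)) =
    q * I - \int[lam]_x (ind 0 q x * primitive (zext l w) x).
  rewrite Rintegral_primitive// -/(tail q) -RintegralZl// -RintegralB//; last exact: integrableRZ.
  by apply: eq_Rintegral => x _; rewrite -/(tail q x); ring.
transitivity (\int[lam]_x (zext l f x * ind 0 q x + I * ind 0 q x - ind 0 q x * primitive (zext l w) x)).
  rewrite RintegralB//; last by apply: integrableRD => //; exact: integrableRZ.
  rewrite RintegralD//; last exact: integrableRZ.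
  by rewrite RintegralZl// Rintegral_ind// subr0; ring.
by apply: eq_Rintegral => x _; ring.
Qed.

(** By [constraint_eval], $f(x)+\int_x^l w$ has zero integral over every $]0,q]$, hence over every
    subinterval of $]0,l]$, and so it vanishes almost everywhere. *)
Lemma constraints_primitive (l : R) (f w : R -> R) : 0 < l -> L2 l f -> L2 l w ->
  (forall q, 0 <= q <= l -> \int[lam]_x (zext l f x * ind 0 q x) +
     \int[lam]_x (zext l w x * (q - tail q x)) = 0) ->
  {ae lam, forall x, 0 < x < l -> f x = - (\int[lam]_x zext l w x) + primitive (zext l w) x}.
Proof.
move=> l0 Lf Lw h; have /L2_sqint sf := Lf; have /L2_sqint sw := Lw.
have iw := sqint_zext_integrable sw; have if_ := sqint_zext_integrable sf.
pose k x := zext l f x + (\int[lam]_x zext l w x) - primitive (zext l w) x.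
have ik q : lam.-integrable setT (EFin \o (fun x => ind 0 q x * k x)).
  rewrite (_ : (fun x => _) = fun x => zext l f x * ind 0 q x +
    ind 0 q x * ((\int[lam]_x zext l w x) - primitive (zext l w) x)); last first.
    by apply/funext => x; rewrite /k; ring.
  apply: integrableRD; first by apply: sqint_mul => //; exact: sqint_ind.
  apply: (integrable_mul_bounded (K := (`|\int[lam]_x zext l w x| + \int[lam]_t `|zext l w t|))).
  - exact: integrable_ind.
  - by apply: continuous_measurable => y; apply: cvgB; [exact: cvg_cst|exact: primitive_continuous].
  - by move=> x; rewrite (le_trans (ler_normB _ _))// lerD2l primitive_bound.
have kq q : 0 <= q <= l -> \int[lam]_x (ind 0 q x * k x) = 0.
  by move=> hq; rewrite -(constraint_eval l0 hq Lf Lw); exact: h.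
have k0 : {ae lam, forall x, ind 0 l x * k x = 0}.
  apply: ae0_Rintegral_itv => // a b ab; rewrite Rintegral_indE.
  pose a' : R := Num.max a 0; pose b' : R := Num.min b l.
  have e x : ind a b x * (ind 0 l x * k x) = ind a' b' x * k x by rewrite mulrA ind_mul.
  under eq_Rintegral do rewrite e.
  have [ba'|ab'] := leP b' a'.
    transitivity (\int[lam]_t (0 : R)); last by rewrite Rintegral_cst// mul0r.
    by apply: eq_Rintegral => t _; rewrite ind_empty// mul0r.
  have a'0 : 0 <= a' by rewrite /a' le_max lexx orbT.
  have b'l : b' <= l by rewrite /b' ge_min lexx orbT.
  transitivity (\int[lam]_x (ind 0 b' x * k x - ind 0 a' x * k x)).
    apply: eq_Rintegral => x _; rewrite -mulrBl; congr (_ * _); rewrite !indE.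
    case: (ltP 0 x) => x0 /=; last by rewrite subrr ltNge (le_trans x0 a'0).
    case: (ltP a' x) => ax /=; first by rewrite subr0.
    by rewrite (le_trans ax (ltW ab')) subrr.
  rewrite RintegralB// !kq ?subrr// ?a'0 ?b'l ?(le_trans a'0 (ltW ab'))//=.
  exact: le_trans (ltW ab') b'l.
apply: aeS k0 => x hx /[dup] x0l /andP[x0 xl].
move: hx; rewrite ind_in ?x0 ?ltW// mul1r /k zextE x0l => e.
by rewrite -[LHS]subr0 -e; ring.
Qed.
End tails.

(** * The space V as a set of orthogonality constraints, its norm and its dual *)

Section V_characterization.
Variables (R : realType) (N : nat) (l : 'I_N -> R).
Hypothesis l0 : forall i, 0 < l i.
Notation lam := (@lebesgue_measure R).
Notation edge_fun := ('I_N -> R -> R).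
Implicit Types (v w phi : edge_fun) (f g : R -> R).
Let H := ip_sip lam.
Notation emb := (emb l).
Notation res := (res l).

(* The first constraint says that the integral over ]0, q] of phi_i + \int_x^(l i) w_i
   vanishes, i.e. phi_i(x) = - \int_x^(l i) w_i and phi_i(l i) = 0; the second one that the
   values at the vertex, - \int_0^(l i) w_i, do not depend on i. *)
Definition constraint_edges : set (edge_fun * edge_fun) := [set c |
  [\/ exists i q, 0 <= q <= l i /\ c = (one_edge i (ind 0 q), one_edge i (fun y => q - tail q y)),
      exists i j, c = (0, one_edge i (cst 1) - one_edge j (cst 1)) |
      c = (0, 0)]].

Lemma L2_cst1 i : L2 (l i) (cst (1 : R)).
Proof.
apply/L2_sqint; apply: (@sqint_zext_bounded R _ _ 1) => //.
by move=> x; rewrite /= normr1.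
Qed.

Lemma LL2_0 : LL2 l 0.
Proof.
move=> i; apply/L2_sqint; rewrite (_ : zext _ _ = 0); first exact: sqint0.
by apply/funext => x; rewrite zextE if_same.
Qed.

Lemma emb0 : emb 0 = 0.
Proof.
apply/funext => y; rewrite -[RHS]/(0 : R).
by have [[i hi]|h] := on_edge_case l y; rewrite ?(emb_on l0 _ hi)// emb_out.
Qed.

Lemma constraint_LL2 c : constraint_edges c -> LL2 l c.1 /\ LL2 l c.2.
Proof.
case=> [[i [q [hq ->]]]|[i [j ->]]|->] /=.
- by split; apply: LL2_one; [exact: L2_ind|exact: L2_tail].
- split; first exact: LL2_0.
  by apply: LL2_sub; apply: LL2_one; exact: L2_cst1.
- by split; exact: LL2_0.
Qed.

Definition annihilates f g := forall c, constraint_edges c ->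
  ip lam f (emb c.1) + ip lam g (emb c.2) = 0.

Lemma annihilates_V phi w : LL2 l phi -> LL2 l w -> annihilates (emb phi) (emb w) ->
  V l phi /\ forall i, is_weak_deriv (l i) (phi i) (w i).
Proof.
move=> hp hw an.
have hA i : {ae lam, forall x, 0 < x < l i ->
    phi i x = - (\int[lam]_x zext (l i) (w i) x) + primitive (zext (l i) (w i)) x}.
  apply: constraints_primitive => // q hq.
  have := an _ (Or31 _ _ (ex_intro _ i (ex_intro _ q (conj hq erefl)))) => /=.
  rewrite !ip_one//; [exact: L2_tail|exact: L2_ind].
have hB i j : \int[lam]_x zext (l i) (w i) x = \int[lam]_x zext (l j) (w j) x.
  have := an _ (Or32 _ _ (ex_intro _ i (ex_intro _ j erefl))) => /=.
  have L1 k : LL2 l (one_edge k (cst 1)) by apply: LL2_one; exact: L2_cst1.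
  rewrite emb0 (sip0r H) ?add0r; last exact: sqint_emb.
  rewrite emb_sub// (sip_subr H); [|exact: sqint_emb|exact: sqint_emb|exact: sqint_emb].
  rewrite !ip_one//; [|exact: L2_cst1|exact: L2_cst1] => /subr0_eq.
  by under eq_Rintegral do rewrite mulr1; under [RHS]eq_Rintegral do rewrite mulr1.
have hD i : [/\ L2 (l i) (phi i), is_weak_deriv (l i) (phi i) (w i) &
    is_cont_rep (l i) (phi i) (fun x => - (\int[lam]_x zext (l i) (w i) x) + primitive (zext (l i) (w i)) x)].
  have /L2_sqint[mz _] := hp i.
  exact: (@primitive_cont_rep R (l i) (l0 i) _ _ _ (hw i) mz (hA i)).
split; last by move=> i; case: (hD i).
split=> [i|]; first by have [? hw' _] := hD i; split => //; exists (w i).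
exists (fun i x => - (\int[lam]_x zext (l i) (w i) x) + primitive (zext (l i) (w i)) x); split.
- by move=> i; case: (hD i).
- by move=> i j; rewrite !primitive_zext_le0 !addr0 (hB i j).
- by move=> i; rewrite primitive_zext_ge addNr.
Qed.

Lemma V_LL2 phi : V l phi -> LL2 l phi.
Proof. by case=> h _ i; case: (h i). Qed.

Lemma is_weak_deriv_LL2 phi w : (forall i, is_weak_deriv (l i) (phi i) (w i)) -> LL2 l w.
Proof. by move=> h i; case: (h i). Qed.

Lemma V_annihilates phi w : V l phi -> (forall i, is_weak_deriv (l i) (phi i) (w i)) ->
  annihilates (emb phi) (emb w).
Proof.
move=> /[dup] /V_LL2 hp [_ [g [gc g0 gl]]] hd; have hw := is_weak_deriv_LL2 hd.
have hg i := cont_rep_primitive (l0 i) (hp i) (hd i) (gc i).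
have hI i : g i 0 = - \int[lam]_x zext (l i) (w i) x.
  have := hg i (l i); rewrite lexx ltW// => /(_ isT); rewrite gl primitive_zext_ge.
  by move/esym/eqP; rewrite addr_eq0 => /eqP.
move=> c [[i [q [hq ->]]]|[i [j ->]]|->] /=.
- rewrite !ip_one//; [|exact: L2_tail|exact: L2_ind].
  rewrite constraint_eval//; transitivity (\int[lam]_t (0 : R)); last by rewrite Rintegral_cst// mul0r.
  have /L2_sqint[mf _] := hp i; have /L2_sqint sw := hw i.
  apply: Rintegral_ae; [|exact: measurable_cst|].
    apply: measurable_funM; first exact: measurable_ind.
    apply: measurable_funB; first by apply: measurable_funD => //; exact: measurable_cst.
    by apply: continuous_measurable; apply: primitive_continuous; exact: sqint_zext_integrable.
  have [_ gf] := gc i.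
  have : {ae lam, forall t, t != l i}.
    exists [set l i]; split => //; first exact: lebesgue_measure_set1.
    by move=> z /= /negP; rewrite negbK => /eqP.
  apply: ae2 gf => x gx xl; rewrite indE.
  have [/andP[x0 xq]|_] := boolP (0 < x <= q); last by rewrite mul0r.
  have x0l : 0 < x < l i by rewrite x0 lt_neqAle xl (le_trans xq)//; case/andP: hq.
  rewrite mul1r zextE x0l -gx; last by rewrite /= in_itv.
  by rewrite hg ?hI; [ring|case/andP: x0l => /ltW-> /ltW->].
- rewrite emb0 (sip0r H) ?add0r; last exact: sqint_emb.
  have L1 k : LL2 l (one_edge k (cst 1)) by apply: LL2_one; exact: L2_cst1.
  rewrite emb_sub// (sip_subr H); [|exact: sqint_emb|exact: sqint_emb|exact: sqint_emb].
  rewrite !ip_one//; [|exact: L2_cst1|exact: L2_cst1].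
  under eq_Rintegral do rewrite mulr1; under [X in _ - X]eq_Rintegral do rewrite mulr1.
  by have := g0 i j; rewrite !hI => /oppr_inj ->; rewrite subrr.
- by rewrite emb0 !(sip0r H) ?addr0//; exact: sqint_emb.
Qed.

Let constraint_seq : exists p : nat -> (R -> R) * (R -> R),
  (forall n, exists2 c, constraint_edges c & p n = (emb c.1, emb c.2)) /\
  forall c (eps : R), constraint_edges c -> 0 < eps -> exists n,
    pair_dot (ip lam) ((emb c.1, emb c.2) - p n) ((emb c.1, emb c.2) - p n) <= eps.
Proof.
have [ss sd] := steps_separate R.
have [e2 [se2 de2]] := pair_separable ss sd.
have [||p [pP pd]] := subset_separable (pair_semi_ip H) se2 de2
  (P := [set q | exists2 c, constraint_edges c & q = (emb c.1, emb c.2)]).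
- move=> q [c /constraint_LL2[h1 h2] ->]; split; exact: sqint_emb.
(* The trivial constraint makes the family inhabited even for a graph without edges. *)
- by exists (emb 0, emb 0); exists (0, 0) => //; exact: Or33.
exists p; split => // c eps hc eps0; apply: pd => //; by exists c.
Qed.

Definition Na (n : nat) : R -> R := (sval (cid constraint_seq) n).1.
Definition Nb (n : nat) : R -> R := (sval (cid constraint_seq) n).2.

Lemma constraint_n n : exists2 c, constraint_edges c & Na n = emb c.1 /\ Nb n = emb c.2.
Proof.
have [pP _] := svalP (cid constraint_seq); have [c hc e] := pP n.
by exists c => //; rewrite /Na /Nb e.
Qed.

Lemma sqint_Na n : sqint lam (Na n).
Proof. by have [c /constraint_LL2[h _] [-> _]] := constraint_n n; exact: sqint_emb. Qed.

Lemma sqint_Nb n : sqint lam (Nb n).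
Proof. by have [c /constraint_LL2[_ h] [_ ->]] := constraint_n n; exact: sqint_emb. Qed.

(** By Cauchy-Schwarz the pairing is continuous in the constraint, so vanishing on the chosen dense
    sequence extends to all constraints. *)
Lemma VV_annihilates f g : VV lam Na Nb f g <-> [/\ sqint lam f, sqint lam g & annihilates f g].
Proof.
split=> -[sf sg h]; split => //; last first.
  by move=> n; have [c hc [-> ->]] := constraint_n n; exact: h.
move=> c hc; have [h1 h2] := constraint_LL2 hc.
have s1 := sqint_emb h1; have s2 := sqint_emb h2.
have [_ pd] := svalP (cid constraint_seq).
pose y := ip lam f (emb c.1) + ip lam g (emb c.2); rewrite -/y.
pose K : R := ip lam f f + ip lam g g.
have K0 : 0 <= K by rewrite addr_ge0// (sip_ge0 H).
have y2 (eps : R) : 0 < eps -> y ^+ 2 <= K * eps.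
  move=> eps0; have [n hn] := pd c eps hc eps0.
  have := h n; rewrite /Na /Nb; set p := sval _ n in hn *; move=> hp.
  have sp1 := sqint_Na n; have sp2 := sqint_Nb n; rewrite /Na /Nb -/p in sp1 sp2.
  have -> : y = pair_dot (ip lam) (f, g) ((emb c.1, emb c.2) - p).
    rewrite /pair_dot/= !(sip_subr H)// /y; move: hp => /= hp.
    by rewrite addrACA -opprD hp subr0.
  have := sip_CS (pair_semi_ip H) (x := (f, g)) (y := (emb c.1, emb c.2) - p).
  move=> /(_ (conj sf sg) (conj (sip_sub H s1 sp1) (sip_sub H s2 sp2))) hcs.
  by apply: (le_trans hcs); rewrite ler_wpM2l.
have y0 : y ^+ 2 <= 0.
  apply/ler_addgt0Pr => eps eps0; rewrite add0r.
  have K1 : 0 < K + 1 by rewrite ltr_wpDl.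
  apply: (le_trans (y2 _ (divr_gt0 eps0 K1))).
  by rewrite mulrA ler_pdivrMr// mulrC ler_pM2l// lerDl.
by apply/eqP; rewrite -sqrf_eq0 eq_le y0 sqr_ge0.
Qed.

Lemma ip_emb_res v f : LL2 l v -> sqint lam f -> ip lam (emb v) (emb (res f)) = ip lam (emb v) f.
Proof.
move=> hv sf; rewrite !ip_emb//; last by apply: sqint_emb => //; exact: LL2_res.
apply: eq_bigr => i _; apply: Rintegral_oo_eq => x x0l; congr (_ * _).
exact: (res_emb l0 (res f) x0l).
Qed.

Lemma V_VV phi w : V l phi -> (forall i, is_weak_deriv (l i) (phi i) (w i)) ->
  VV lam Na Nb (emb phi) (emb w).
Proof.
move=> Vp hd; apply/VV_annihilates; split; last exact: V_annihilates.
- by apply: sqint_emb => //; exact: V_LL2.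
- by apply: sqint_emb => //; exact: is_weak_deriv_LL2 hd.
Qed.

(** Between the edges all constraints vanish and a pair of [VV] is free; restriction to the edges
    discards that part. *)
Lemma VV_V f g : VV lam Na Nb f g ->
  V l (res f) /\ forall i, is_weak_deriv (l i) (res f i) (res g i).
Proof.
move=> /VV_annihilates[sf sg an]; apply: annihilates_V; [exact: LL2_res|exact: LL2_res|].
move=> c hc; have [h1 h2] := constraint_LL2 hc; rewrite -(an c hc).
by rewrite ![ip lam (emb (res _)) _](sipC H) !ip_emb_res// ![ip lam (emb _) _](sipC H).
Qed.

Lemma C1_weak_deriv (a : R) (psi dpsi : R -> R) : 0 < a ->
  (forall t : R, is_derive t (1 : R) psi (dpsi t)) -> continuous dpsi ->
  (exists K, forall x, `|dpsi x| <= K) ->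
  is_weak_deriv a psi dpsi /\ L2 a psi.
Proof.
move=> a0 hd cd [K hK].
have cp : continuous psi.
  by move=> t; apply: differentiable_continuous; apply/derivable1_diffP; case: (hd t).
have Ld : L2 a dpsi by apply/L2_sqint; apply: sqint_zext_bounded hK => //; exact: continuous_measurable.
have mz : measurable_fun setT (zext a psi : measurableTypeR R -> R).
  exact: (measurable_restrictT _ (measurable_itv _)).1 (measurable_funTS (continuous_measurable cp)).
have [|? ? _] := @primitive_cont_rep R a a0 psi dpsi (psi 0) Ld mz.
  apply: aeT => x /andP[x0 xa]; have /L2_sqint sd := Ld.
  have := primitiveB (sqint_zext_integrable sd) (ltW x0); rewrite primitive_zext_le0 subr0 => ->.
  have -> : \int[lam]_(t in `]0, x]) zext a dpsi t = \int[lam]_(t in `]0, x]) dpsi t.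
    apply: eq_Rintegral => t; rewrite inE/= in_itv/= => /andP[t0 tx].
    by rewrite zextE t0 (le_lt_trans tx).
  by rewrite (FTC2_everywhere (ltW x0) hd cd) addrC subrK.
by split.
Qed.

(** Bumps supported inside one edge belong to [V] and force [h] to vanish on the edges. Between the
    edges, [VV] contains every pair $(f,0)$ with [f] supported there. *)
Lemma V_dense h : sqint lam h -> (forall f g, VV lam Na Nb f g -> ip lam h f = 0) ->
  ip lam h h = 0.
Proof.
move=> sh hort; have Lrh := LL2_res l sh; have se := sqint_emb Lrh.
have e0 : {ae lam, forall y, emb (res h) y = 0}.
  suff : LL2_eq l (res h) 0 by move/(LL2_eq_emb l0); rewrite emb0.
  move=> i; have /L2_sqint si := Lrh i.
  have : {ae lam, forall x, 0 < x < l i -> zext (l i) (res h i) x = 0}.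
    apply: ae0_test => [|a b c a0 ab bl c0]; first exact: sqint_zext_integrable.
    pose psi := bump a b c 1 0.
    have tpsi : test_fun 0 (l i) psi by exact: test_fun_bump.
    have [dpsi cpsi cpsi' psi_out psi'_out] := test_fun_continuous tpsi.
    have [_ Kpsi] := continuous_support (l0 i) cpsi' psi'_out.
    have hd j : is_weak_deriv (l j) (one_edge i psi j) (one_edge i (derive1 psi) j) /\ L2 (l j) (one_edge i psi j).
      rewrite /one_edge; case: eqP => [->|_]; first exact: C1_weak_deriv.
      apply: C1_weak_deriv => //; first by move=> x; exact: cvg_cst.
      by exists 0 => x; rewrite normr0.
    have Vp : V l (one_edge i psi).
      split=> [j|]; first by have [? ?] := hd j; split => //; exists (one_edge i (derive1 psi) j).
      exists (one_edge i psi); split=> [j|j k|j].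
      - split; last by apply: aeT.
        apply: continuous_subspaceT; rewrite /one_edge; case: eqP => // _ x; exact: cvg_cst.
      - by rewrite /one_edge; case: eqP => _; case: eqP => _ //; rewrite psi_out// ltxx.
      - by rewrite /one_edge; case: eqP => // ->; rewrite psi_out// ltxx andbF.
    have := hort _ _ (V_VV Vp (fun j => (hd j).1)).
    have Li : L2 (l i) psi by have [_] := hd i; rewrite /one_edge eqxx.
    have Lo : LL2 l (one_edge i psi) by exact: V_LL2.
    have e1 : ip lam h (emb (one_edge i psi)) = ip lam (emb (one_edge i psi)) h := sipC H _ _.
    have e2 : ip lam (emb (one_edge i psi)) (emb (res h)) = ip lam (emb (res h)) (emb (one_edge i psi)) :=
      sipC H _ _.
    by rewrite e1 -(ip_emb_res Lo sh) e2 (ip_one l0 Lrh Li).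
  apply: aeS => x hx; rewrite /= in_itv/= => x0l.
  by have := hx x0l; rewrite zextE x0l.
pose f := h - emb (res h).
have sf : sqint lam f by exact: (sip_sub H).
have vf : VV lam Na Nb f 0.
  apply/VV_annihilates; split => //; first exact: sqint0.
  move=> c hc; have [h1 h2] := constraint_LL2 hc.
  have s1 := sqint_emb h1; have s2 := sqint_emb h2.
  by rewrite (sipC H 0) (sip0r H)// addr0 (sipC H f) (sip_subr H)// ip_emb_res// subrr.
have ff : ip lam f f = 0.
  rewrite {1}/f (sip_subl H)// (hort _ _ vf) (sip_subr H)// ip_emb_res//.
  by rewrite subrr subr0.
have [mh _] := sh; apply: ip_ae0 => //.
apply: ae2 (ip_eq0 sf ff) e0 => y; rewrite -[f y]/(h y - emb (res h) y) => fy ey.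
by move: fy; rewrite ey subr0.
Qed.

Definition Dx phi : edge_fun := fun i => weak_deriv (l i) (phi i).

Lemma is_weak_deriv_Dx phi : V l phi -> forall i, is_weak_deriv (l i) (phi i) (Dx phi i).
Proof. by move=> [h _] i; case: (h i) => _; exact: xgetPex. Qed.

Lemma V_VV_Dx phi : V l phi -> VV lam Na Nb (emb phi) (emb (Dx phi)).
Proof. by move=> /[dup] hp /is_weak_deriv_Dx; exact: V_VV. Qed.

Lemma emb_weak_deriv_ae phi w w' : LL2 l phi -> (forall i, is_weak_deriv (l i) (phi i) (w i)) ->
  (forall i, is_weak_deriv (l i) (phi i) (w' i)) -> {ae lam, forall y, emb w y = emb w' y}.
Proof.
move=> hp hw hw'; apply/(LL2_eq_emb l0) => i.
apply: aeS (weak_deriv_unique (hp i) (hw i) (hw' i)) => x; rewrite !zextE /= in_itv/=.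
by case: ifP.
Qed.

Lemma emb_Dx_res_ae f g : VV lam Na Nb f g ->
  {ae lam, forall y, emb (Dx (res f)) y = emb (res g) y}.
Proof.
move=> /VV_V[Vf dg]; apply: emb_weak_deriv_ae dg; first exact: V_LL2.
exact: is_weak_deriv_Dx.
Qed.

Lemma ip_ae_eq f g g' : sqint lam f -> sqint lam g -> sqint lam g' ->
  {ae lam, forall y, g y = g' y} -> ip lam f g = ip lam f g'.
Proof.
move=> [mf _] [mg _] [mg' _] gg'; apply: Rintegral_ae; [exact: measurable_funM|exact: measurable_funM|].
by apply: aeS gg' => y ->.
Qed.

Lemma sqint_Dx phi : V l phi -> sqint lam (emb (Dx phi)).
Proof. by move=> /V_VV_Dx[]. Qed.

Lemma sqint_V phi : V l phi -> sqint lam (emb phi).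
Proof. by move=> /V_VV_Dx[]. Qed.

Lemma ip_emb_Dx_res f g h : VV lam Na Nb f g -> LL2 l h ->
  ip lam (emb h) (emb (Dx (res f))) = ip lam (emb h) g.
Proof.
move=> hfg Lh; have [_ sg _] := hfg; rewrite -(ip_emb_res Lh sg).
apply: ip_ae_eq; [exact: sqint_emb|apply: sqint_Dx; exact: (VV_V hfg).1| |exact: emb_Dx_res_ae].
by apply: sqint_emb; exact: LL2_res.
Qed.

Lemma V_lin a v w : V l v -> V l w -> V l (fun i x => a * v i x + w i x) /\
  {ae lam, forall y, emb (Dx (fun i x => a * v i x + w i x)) y = a * emb (Dx v) y + emb (Dx w) y}.
Proof.
move=> Vv Vw; have h := VV_lin sqint_Na sqint_Nb a (V_VV_Dx Vv) (V_VV_Dx Vw).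
rewrite -emb_lin// -emb_lin// in h.
have [_ _ an] := (VV_annihilates _ _).1 h.
have [hV hd] := annihilates_V (LL2_lin a (V_LL2 Vv) (V_LL2 Vw))
  (LL2_lin a (is_weak_deriv_LL2 (is_weak_deriv_Dx Vv)) (is_weak_deriv_LL2 (is_weak_deriv_Dx Vw))) an.
split => //.
apply: aeS (emb_weak_deriv_ae (V_LL2 hV) (is_weak_deriv_Dx hV) hd) => y ->.
by rewrite emb_lin.
Qed.

Lemma V_0 : V l 0.
Proof.
have [h _] := VV_V (VV0 (mu := lam) sqint_Na sqint_Nb); exact: h.
Qed.

Lemma V_add v w : V l v -> V l w -> V l (v + w).
Proof.
move=> Vv Vw; have [h _] := V_lin 1 Vv Vw.
by rewrite (_ : v + w = fun i x => 1 * v i x + w i x)//; apply/funext => i; apply/funext => x; rewrite mul1r.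
Qed.

Lemma V_sub v w : V l v -> V l w -> V l (v - w) /\
  {ae lam, forall y, emb (Dx (v - w)) y = emb (Dx v) y - emb (Dx w) y}.
Proof.
move=> Vv Vw; have [h e] := V_lin (-1) Vw Vv.
rewrite (_ : v - w = fun i x => -1 * w i x + v i x); last first.
  by apply/funext => i; apply/funext => x; rewrite mulN1r addrC.
by split => //; apply: aeS e => y ->; rewrite mulN1r addrC.
Qed.

Definition vnrm phi : R :=
  Num.sqrt (ip lam (emb phi) (emb phi) + ip lam (emb (Dx phi)) (emb (Dx phi))).

Lemma ip_ge0 f : 0 <= ip lam f f.
Proof. exact: (sip_ge0 H). Qed.

Lemma HH1norm_emb phi : V l phi -> HH1norm l phi = (vnrm phi)%:E.
Proof.
move=> Vp; rewrite /HH1norm.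
have Lp := V_LL2 Vp; have Ld := is_weak_deriv_LL2 (is_weak_deriv_Dx Vp).
have -> : (\sum_i H1norm (l i) (phi i) ^+ 2 =
    \sum_i L2norm (l i) (phi i) ^+ 2 + \sum_i L2norm (l i) (Dx phi i) ^+ 2)%E.
  rewrite -big_split; apply: eq_bigr => i _; rewrite /H1norm sqr_sqrte//.
  by rewrite adde_ge0// expe2 mule_ge0// L2norm_ge0.
by rewrite !sum_L2norm_sqr.
Qed.

Lemma vnrm_ge0 phi : 0 <= vnrm phi. Proof. exact: sqrtr_ge0. Qed.

Lemma vnrm_sqr phi : vnrm phi ^+ 2 =
  ip lam (emb phi) (emb phi) + ip lam (emb (Dx phi)) (emb (Dx phi)).
Proof. by rewrite /vnrm sqr_sqrtr// addr_ge0// ip_ge0. Qed.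

Lemma vnrm_sqrE phi :
  vnrm phi ^+ 2 = snrm (ip lam) (emb phi) ^+ 2 + snrm (ip lam) (emb (Dx phi)) ^+ 2.
Proof. by rewrite vnrm_sqr !(snrm_sqr H). Qed.

Lemma snrm_emb_le phi : snrm (ip lam) (emb phi) <= vnrm phi.
Proof. by rewrite ler_wsqrtr// lerDl ip_ge0. Qed.

Lemma snrm_Dx_le phi : snrm (ip lam) (emb (Dx phi)) <= vnrm phi.
Proof. by rewrite ler_wsqrtr// lerDr ip_ge0. Qed.

Lemma HH1norm_ge0 phi : (0 <= HH1norm l phi)%E.
Proof. exact: sqrte_ge0. Qed.

Lemma snrm_ae_eq f g : sqint lam f -> sqint lam g -> {ae lam, forall y, f y = g y} ->
  snrm (ip lam) f = snrm (ip lam) g.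
Proof.
move=> sf sg fg; rewrite /snrm; congr Num.sqrt; rewrite (ip_ae_eq sf sf sg fg).
by rewrite (sipC H) (ip_ae_eq sg sf sg fg).
Qed.

Lemma vnrm_res_le f g : VV lam Na Nb f g ->
  vnrm (res f) ^+ 2 <= ip lam f f + ip lam g g.
Proof.
move=> h; have [sf sg _] := h; have [Vf dg] := VV_V h.
rewrite vnrm_sqr lerD ?ip_emb_res_le// -(snrm_sqr H).
have sr : sqint lam (emb (res g)) by apply: sqint_emb; exact: LL2_res.
by rewrite (snrm_ae_eq (sqint_Dx Vf) sr (emb_Dx_res_ae h)) (snrm_sqr H) ip_emb_res_le.
Qed.

Lemma vnrm_sub_emb v w : V l v -> V l w ->
  snrm (ip lam) (emb v - emb w) <= vnrm (v - w) /\
  snrm (ip lam) (emb (Dx v) - emb (Dx w)) <= vnrm (v - w).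
Proof.
move=> Vv Vw; have [Vs e] := V_sub Vv Vw; split.
  by rewrite -emb_sub//; exact: snrm_emb_le.
rewrite -(snrm_ae_eq (sqint_Dx Vs) _ e) ?snrm_Dx_le//.
by apply: (sip_sub H); exact: sqint_Dx.
Qed.

Lemma ip_le_snrm f g : sqint lam f -> sqint lam g -> `|ip lam f g| <= snrm (ip lam) f * snrm (ip lam) g.
Proof. exact: (snrm_CS H). Qed.

Lemma dual_norm_le (F : edge_fun -> R) (K : R) :
  (forall phi, V l phi -> vnrm phi <= 1 -> `|F phi| <= K) -> (dual_norm l F <= K%:E)%E.
Proof.
move=> h; apply: ge_ereal_sup => _ [phi [Vp hp] <-]; rewrite lee_fin; apply: h => //.
by move: hp; rewrite HH1norm_emb// lee_fin.
Qed.

Lemma dual_norm_ge0 (F : edge_fun -> R) : (0 <= dual_norm l F)%E.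
Proof.
apply: (le_trans (y := (`|F 0|)%:E)); first by rewrite lee_fin.
apply: ereal_sup_ubound; exists 0 => //; split; first exact: V_0.
rewrite HH1norm_emb; last exact: V_0.
have := vnrm_res_le (VV0 (mu := lam) sqint_Na sqint_Nb).
rewrite !(sip0r H) ?addr0; [|exact: sqint0..] => h.
rewrite lee_fin -(@ler_pXn2r _ 2) ?nnegrE ?vnrm_ge0// expr1n.
by apply: (le_trans h).
Qed.

(** Homogeneity, with one degenerate case: [phi] may have norm 0 without being the zero function.
    Then all its multiples lie in the unit ball, and finiteness of the dual norm forces [F phi] to
    vanish. *)
Lemma dual_norm_bound (F : edge_fun -> R) phi : Vdual l F -> V l phi ->
  `|F phi| <= fine (dual_norm l F) * vnrm phi.
Proof.
move=> [Flin Fb] Vp.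
have dfin : dual_norm l F \is a fin_num by rewrite ge0_fin_numE// dual_norm_ge0.
pose ap a : edge_fun := fun i x => a * phi i x + (0 : edge_fun) i x.
have scale a : V l (ap a) /\ F (ap a) = a * F phi.
  have F0 : F 0 = 0.
    have := Flin 1 0 0 V_0 V_0; rewrite (_ : (fun i x => _) = 0); last first.
      by apply/funext => i; apply/funext => x; rewrite mulr0 addr0.
    by move=> /eqP; rewrite mul1r -subr_eq0 opprD addNKr oppr_eq0 => /eqP.
  split; first exact: (V_lin a Vp V_0).1.
  by rewrite /ap (Flin a phi 0 Vp V_0) F0 addr0.
have vs a : vnrm (ap a) = `|a| * vnrm phi.
  have [Va e] := V_lin a Vp V_0.
  have z : emb (ap a) = a *: emb phi.
    by rewrite /ap emb_lin// emb0 addr0.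
  have e0 : {ae lam, forall y, emb (Dx 0) y = 0}.
    have := emb_Dx_res_ae (VV0 (mu := lam) sqint_Na sqint_Nb).
    rewrite -[res 0]/(0 : edge_fun).
    by apply: aeS => y ->; rewrite emb0.
  have ez : {ae lam, forall y, emb (Dx (ap a)) y = (a *: emb (Dx phi)) y}.
    by apply: ae2 e e0 => y -> ->; rewrite addr0.
  have sD := sqint_Dx Vp.
  have h1 := snrm_scale H a (sqint_V Vp); have h2 := snrm_scale H a sD.
  have h3 := snrm_ae_eq (sqint_Dx Va) (sip_scale H a sD) ez.
  apply/eqP; rewrite -(@eqrXn2 _ 2) ?vnrm_ge0 ?mulr_ge0 ?vnrm_ge0//; apply/eqP.
  rewrite -/(ap a) in h3; rewrite vnrm_sqrE h3 h2 z h1 [in RHS]exprMn (vnrm_sqrE phi).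
  by move: (snrm _ _) (snrm _ _) => p q; rewrite !exprMn mulrDr.
have [p0|p0] := eqVneq (vnrm phi) 0.
  rewrite p0 mulr0.
  have hb (n : R) : 0 <= n -> n * `|F phi| <= fine (dual_norm l F).
    move=> n0; have [Va Fa] := scale n.
    rewrite -lee_fin fineK//; apply: ereal_sup_ubound.
    exists (ap n); last by rewrite Fa normrM ger0_norm.
    by split => //; rewrite HH1norm_emb// vs p0 mulr0 lee_fin.
  have d0 : 0 <= fine (dual_norm l F) by rewrite fine_ge0// dual_norm_ge0.
  rewrite leNgt; apply/negP => F0.
  have := hb ((fine (dual_norm l F) + 1) / `|F phi|).
  rewrite divfK ?gt_eqF// divr_ge0 ?addr_ge0// => /(_ isT).
  by rewrite gerDl ler10.
have p1 : 0 < vnrm phi by rewrite lt_def p0 vnrm_ge0.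
have [Va Fa] := scale (vnrm phi)^-1.
rewrite -ler_pdivrMr// -lee_fin fineK//; apply: ereal_sup_ubound.
exists (ap (vnrm phi)^-1).
  by split => //; rewrite HH1norm_emb// vs ger0_norm ?invr_ge0 ?vnrm_ge0// mulVf// lexx.
by rewrite Fa normrM ger0_norm ?invr_ge0 ?vnrm_ge0// mulrC.
Qed.

(* The elements of V^* of the form - d/dx h, h in L^2. *)
Definition dual_dx (h : R -> R) : edge_fun -> R := fun phi => - ip lam h (emb (Dx phi)).

Lemma dual_dx_le h : sqint lam h -> (dual_norm l (dual_dx h) <= (snrm (ip lam) h)%:E)%E.
Proof.
move=> sh; apply: dual_norm_le => phi Vp p1; rewrite normrN.
apply: (le_trans (ip_le_snrm sh (sqint_Dx Vp))).
by rewrite ler_piMr ?snrm_ge0// (le_trans (snrm_Dx_le phi)).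
Qed.

Lemma dual_dx_Vdual h : sqint lam h -> Vdual l (dual_dx h).
Proof.
move=> sh; split; last by apply: (le_lt_trans (dual_dx_le sh)); rewrite ltry.
move=> a v w Vv Vw; have [Vs e] := V_lin a Vv Vw; rewrite /dual_dx.
have sv := sqint_Dx Vv; have sw := sqint_Dx Vw.
rewrite (ip_ae_eq (g' := a *: emb (Dx v) + emb (Dx w)) sh (sqint_Dx Vs))//; last exact: (sip_comb H).
by rewrite (sip_linr H)// opprD mulrN.
Qed.

Lemma dual_dx_sub h k : sqint lam h -> sqint lam k ->
  (dual_norm l (dual_dx h - dual_dx k)%R <= (snrm (ip lam) (h - k)%R)%:E)%E.
Proof.
move=> sh sk; apply: dual_norm_le => phi Vp p1.
have -> : (dual_dx h - dual_dx k) phi = dual_dx (h - k) phi.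
  rewrite -[LHS]/(dual_dx h phi - dual_dx k phi) /dual_dx (sip_subl H)//; first by ring.
  exact: sqint_Dx.
rewrite normrN; apply: (le_trans (ip_le_snrm (sip_sub H sh sk) (sqint_Dx Vp))).
by rewrite ler_piMr ?snrm_ge0// (le_trans (snrm_Dx_le phi)).
Qed.
End V_characterization.

Lemma cvge0P (R : realType) (I : Type) (F : set_system I) (FF : Filter F) (q : I -> \bar R) :
  (forall x, (0 <= q x)%E) ->
  (q @ F --> 0%E) <-> forall eps : R, 0 < eps -> \forall x \near F, (q x <= eps%:E)%E.
Proof.
move=> q0; split=> [/fine_cvgP[qfin /cvgrPdist_le h] eps e0|h].
  apply: filterS2 qfin (h _ e0) => x qx; rewrite sub0r normrN ger0_norm ?fine_ge0//= => hx.
  by rewrite -(fineK qx) lee_fin.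
apply/fine_cvgP; split.
  by apply: filterS (h 1 ltr01) => x hx; rewrite ge0_fin_numE// (le_lt_trans hx) ?ltry.
apply/cvgrPdist_le => eps e0; apply: filterS (h _ e0) => x hx /=.
rewrite sub0r normrN ger0_norm ?fine_ge0// -lee_fin fineK//.
by rewrite ge0_fin_numE// (le_lt_trans hx) ?ltry.
Qed.

(** * Bochner spaces *)

Section Bochner_measurability.
Variables (R : realType) (X : zmodType) (S : set X) (p : X -> \bar R) (T : R).
Notation lam := (@lebesgue_measure R).
Hypothesis p_ge0 : forall x, (0 <= p x)%E.

(** Among the first $n+1$ points [c k], the $n$-th simple function picks the one nearest to [f t].
    Nearness is judged by the measurable majorants [d k], since the distances themselves are not
    known to be measurable in time. *)
Lemma strongly_measurable_dense (f : R -> X) (c : nat -> X) (d : nat -> R -> R) :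
  (forall k, S (c k)) -> (forall k, measurable_fun setT (d k : measurableTypeR R -> R)) ->
  {ae lam, forall t, 0 < t < T -> forall k, (p (f t - c k) <= (d k t)%:E)%E} ->
  {ae lam, forall t, 0 < t < T -> forall eps : R, 0 < eps -> exists k, d k t <= eps} ->
  strongly_measurable S p T f.
Proof.
move=> Sc md fd d0.
(* The strict inequality against smaller indices resolves ties, so that exactly one index is
   selected. *)
pose best n t (k : nat) := (forall j, (j < k)%N -> d k t < d j t) /\
  forall j, (j < n.+1)%N -> d k t <= d j t.
pose A n (k : 'I_n.+1) := [set t : R | best n t k].
have mA n k : measurable (A n k).
  have -> : A n k = (\bigcap_(j in [set j | (j < k)%N]) [set t | d k t < d j t]) `&`
      (\bigcap_(j in [set j | (j < n.+1)%N]) [set t | d k t <= d j t]).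
    by [].
  have mB j : measurable_fun setT ((fun t => d j t - d k t) : measurableTypeR R -> R).
    exact: measurable_funB.
  apply: measurableI; apply: bigcap_measurableType => j _.
    have := mB j measurableT _ (measurable_itv `]0, +oo[%R); rewrite setTI.
    by congr (measurable _); apply/seteqP; split=> t /=; rewrite in_itv/= andbT subr_gt0.
  have := mB j measurableT _ (measurable_itv `[0, +oo[%R); rewrite setTI.
  by congr (measurable _); apply/seteqP; split=> t /=; rewrite in_itv/= andbT subr_ge0.
have bestE n t : exists2 k : 'I_n.+1, best n t k & forall j, best n t j -> (j < n.+1)%N -> j = k.
  have [k kmin] : exists k : 'I_n.+1, forall j : 'I_n.+1, d k t <= d j t.
    by have [i _ hi] := @Order.TotalTheory.arg_minP _ R _ ord0 xpredT (fun i : 'I_n.+1 => d i t) isT;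
      exists i => j; exact: hi.
  have ex : exists j : nat, (j < n.+1)%N && (d j t <= d k t) by exists k; rewrite ltn_ord lexx.
  have [j /andP[jn jk] jmin] := ex_minnP ex.
  exists (Ordinal jn) => /=.
    split=> i hi; last exact: le_trans jk (kmin (Ordinal hi)).
    rewrite ltNge; apply/negP => ij.
    have := jmin i; rewrite (ltn_trans hi jn) (le_trans ij jk) => /(_ isT).
    by rewrite leqNgt hi.
  have hj : forall i, (i < j)%N -> d j t < d i t.
    move=> i hi; rewrite ltNge; apply/negP => ij.
    have := jmin i; rewrite (ltn_trans hi jn) (le_trans ij jk) => /(_ isT).
    by rewrite leqNgt hi.
  move=> i [h1 h2] hin; case: (ltngtP i j) => // ij.
    by have := hj i ij; rewrite ltNge h2.
  have := h1 _ ij; rewrite ltNge => /negP[]; apply: (le_trans jk); exact: (kmin (Ordinal hin)).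
exists (fun n t => \sum_(k < n.+1 | t \in A n k) c k); split=> [n|].
  by exists n.+1, (A n), (fun k => c k).
have sE n t : exists2 k : 'I_n.+1, \sum_(k < n.+1 | t \in A n k) c k = c k &
    forall j, (j < n.+1)%N -> d k t <= d j t.
  have [k bk ku] := bestE n t; exists k; last by case: bk.
  rewrite (big_pred1 k)// => j; apply/idP/eqP => [|->]; last by rewrite inE.
  by rewrite inE => /ku/(_ (ltn_ord j))/val_inj.
apply: ae2 fd d0 => t ft dt; rewrite /= in_itv/= => /[dup] /ft {}ft /dt {}dt.
apply/cvge0P => // eps e0; have [k0 hk0] := dt eps e0.
exists k0 => // n /= k0n; have [k -> kmin] := sE n t.
by apply: (le_trans (ft k)); rewrite lee_fin (le_trans _ hk0)// kmin.
Qed.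

(** The value at [t] is determined by the finite list of sets that contain [t], so composition with
    any [G], however irregular, is a finite combination of measurable indicators. *)
Lemma simple_measurable (s : R -> X) (G : X -> R) : simple_fun S s ->
  measurable_fun setT (G \o s : measurableTypeR R -> R).
Proof.
move=> [n [A [c [mA _ sE]]]].
pose code t : {ffun 'I_n -> bool} := [ffun k => t \in A k].
pose g (a : {ffun 'I_n -> bool}) : R := G (\sum_(k < n | a k) c k).
have -> : G \o s = fun t => \sum_(a : {ffun 'I_n -> bool}) \1_[set t | code t = a] t * g a.
  apply/funext => t /=; rewrite (bigD1 (code t))//= big1 ?addr0.
    rewrite indicE mem_set// mul1r /g sE; congr G; apply: eq_bigl => k; by rewrite ffunE.
  move=> a /eqP ane; rewrite indicE memNset ?mul0r//= => e; exact: ane.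
apply: measurable_sum => a; apply: measurable_funM => //; apply: measurable_indic.
rewrite (_ : [set t | code t = a] = \bigcap_(k in [set: 'I_n]) (if a k then A k else ~` A k)).
  apply: fin_bigcap_measurable => [|k _]; first exact: finite_finset.
  by have := mA k; case: (a k) => // /measurableC.
apply/seteqP; split=> t /=.
  by move=> <- k _; rewrite ffunE; case: (boolP (t \in A k)) => [|/negP h]; rewrite ?inE// => hk; apply: h; rewrite inE.
move=> h; apply/ffunP => k; rewrite ffunE; have := h k I.
by case: (a k) => [hk|hk]; [rewrite mem_set|rewrite memNset].
Qed.

(** The upper limit of [G] along the approximating simple functions is measurable at every time, and
    the Lipschitz bound identifies it with the value at [f t] at almost every time. *)
Lemma strongly_measurable_lipschitz (f : R -> X) (G : X -> R) (K : R) :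
  strongly_measurable S p T f -> S 0 -> (forall x y, S x -> S y -> S (x + y)) -> 0 <= K ->
  {ae lam, forall t, 0 < t < T -> S (f t)} ->
  (forall x y, S x -> S y -> (`|G x - G y|%:E <= K%:E * p (x - y))%E) ->
  exists k : R -> R, measurable_fun setT (k : measurableTypeR R -> R) /\
    {ae lam, forall t, 0 < t < T -> k t = G (f t)}.
Proof.
move=> [s [ss fs]] S0 SD K0 Sf GL.
have Ss n t : S (s n t).
  have [m [A [c [_ Sc ->]]]] := ss n.
  by elim/big_ind: _ => //; exact: SD.
pose h n t : \bar R := (G (s n t))%:E.
exists (fun t => fine (limn_esup (h ^~ t))); split.
  apply: measurableT_comp => //; apply: measurable_fun_limn_esup => n.
  by apply/measurable_EFinP; exact: simple_measurable.
apply: ae2 fs Sf => t; rewrite /= in_itv/= => ft Sft t0T; have {}ft := ft t0T; have {}Sft := Sft t0T.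
have hc : h n t @[n --> \oo] --> (G (f t))%:E.
  apply: cvg_EFin; first exact: nearW.
  apply/cvgrPdist_le => eps e0 /=.
  have K1 : 0 < K + 1 by rewrite ltr_wpDl.
  have p0 n : (0 <= p (f t - s n t))%E by [].
  apply: filterS ((cvge0P _ p0).1 ft _ (divr_gt0 e0 K1)) => n hn.
  rewrite -lee_fin (le_trans (GL _ _ Sft (Ss n t)))//.
  apply: (@le_trans _ _ (K%:E * (eps / (K + 1))%:E)%E); first by rewrite lee_wpmul2l ?lee_fin.
  rewrite -EFinM lee_fin mulrCA ger_pMr// ler_pdivrMr// mul1r lerDl//.
by rewrite (is_cvg_limn_esupE (cvgP _ hc)) (cvg_lim _ hc).
Qed.
End Bochner_measurability.

(** * Bochner norms and scalar functions of time *)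

Section one_dimensional_integrals.
Variable R : realType.
Notation lam := (@lebesgue_measure R).

Lemma measurable_sqrt_comp (g : R -> R) : measurable_fun setT (g : measurableTypeR R -> R) ->
  measurable_fun setT ((fun t => Num.sqrt (g t)) : measurableTypeR R -> R).
Proof.
move=> mg; apply: (measurableT_comp (f := (Num.sqrt : measurableTypeR R -> R))) mg.
apply: continuous_measurable; exact: sqrt_continuous.
Qed.

Lemma Rintegral_oo_ae_r (a : R) (f g : R -> R) :
  measurable_fun setT (zext a g : measurableTypeR R -> R) ->
  {ae lam, forall t, 0 < t < a -> f t = g t} ->
  \int[lam]_(t in `]0, a[) f t = \int[lam]_(t in `]0, a[) g t.
Proof.
move=> mg fg; rewrite !Rintegral_oo; apply: Rintegral_ae_measurable_r => //.
by apply: aeS fg => t h; rewrite !zextE; case: ifP => // /h.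
Qed.

(** Measurability is carried by the majorant [g], so nothing is asked of the norm along the
    curve. *)
Lemma L2_Bochner_norm_le (X : zmodType) (p : X -> \bar R) (T : R) (f : R -> X) (g : R -> R) :
  (forall x, (0 <= p x)%E) -> lam.-integrable setT (EFin \o g) -> (forall t, 0 <= g t) ->
  {ae lam, forall t, 0 < t < T -> (p (f t) ^+ 2 <= (g t)%:E)%E} ->
  (L2_Bochner_norm p T f <= (Num.sqrt (\int[lam]_t g t))%:E)%E.
Proof.
move=> p0 ig g0 fg; rewrite /L2_Bochner_norm -[leRHS]/(sqrte (\int[lam]_t g t)%:E).
rewrite lee_sqrt; last by rewrite lee_fin Rintegral_ge0.
have -> : (\int[lam]_t g t)%R%:E = (\int[lam]_t (g t)%:E)%E.
  by rewrite /Rintegral fineK//; exact: integrable_fin_num.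
rewrite integral_mkcond; apply: ge0_ae_le_integral_r.
- by move=> t; rewrite patchE; case: ifP => // _; rewrite expe2 mule_ge0.
- by move=> t; rewrite lee_fin.
- by apply/measurable_EFinP; exact: measurable_of_integrable ig.
apply: aeS fg => t h; rewrite patchE mem_setE in_itv/=; case: ifP => [/h//|_].
by rewrite lee_fin.
Qed.

Lemma sqint_ae_le (g h : R -> R) : measurable_fun setT (g : measurableTypeR R -> R) ->
  lam.-integrable setT (EFin \o h) -> (forall t, 0 <= h t) ->
  {ae lam, forall t, g t ^+ 2 <= h t} -> sqint lam g.
Proof.
move=> mg ih h0 gh; have I0 : 0 <= \int[lam]_t h t by exact: Rintegral_ge0.
suff h1 : (\int[lam]_t (g t ^+ 2)%:E <= (\int[lam]_t h t)%:E)%E by case: (ge0_ip_le mg I0 h1).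
rewrite /Rintegral fineK; last exact: integrable_fin_num.
apply: ge0_ae_le_integral_r.
- by move=> t; rewrite lee_fin sqr_ge0.
- by move=> t; rewrite lee_fin.
- by apply/measurable_EFinP; exact: measurable_of_integrable ih.
by apply: aeS gh => t; rewrite lee_fin.
Qed.

(** Measurability is now carried by the minorant [k], whose square integral is bounded by the finite
    Bochner norm. *)
Lemma L2_Bochner_sqint (X : zmodType) (p : X -> \bar R) (T b : R) (f : R -> X) (k : R -> R) :
  (forall x, (0 <= p x)%E) -> (L2_Bochner_norm p T f < +oo)%E -> 0 < b ->
  measurable_fun setT (k : measurableTypeR R -> R) ->
  {ae lam, forall t, 0 < t < T -> (`|k t|%:E <= b%:E * p (f t))%E} -> sqint lam (zext T k).
Proof.
move=> p0 fn b0 mk kf.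
have mz : measurable_fun setT (zext T (fun t => b^-1 * k t) : measurableTypeR R -> R).
  apply: (measurable_restrictT _ (measurable_itv _)).1; apply: measurable_funTS.
  exact: measurable_funM.
pose I := (\int[lam]_(t in `]0%R, T[) (p (f t) ^+ 2))%E.
have Ifin : (I < +oo)%E.
  by move: fn; rewrite /L2_Bochner_norm -/I; case: I => [r||] /=; rewrite ?ltry.
have I0 : (0 <= I)%E by apply: integral_ge0 => t _; rewrite expe2 mule_ge0.
suff h : (\int[lam]_t (zext T (fun t => b^-1 * k t) t ^+ 2)%:E <= (fine I)%:E)%E.
  have [sk _] := ge0_ip_le mz (fine_ge0 I0) h.
  have := sip_scale (ip_sip lam) b sk; congr (sqint lam _); apply/funext => t.
  rewrite -[LHS]/(b * zext T (fun t => b^-1 * k t) t) !zextE; case: ifP => _; last by rewrite mulr0.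
  by rewrite mulVKf// gt_eqF.
have -> : ((fine I)%:E = \int[lam]_t (((fun t => p (f t) ^+ 2) \_ `]0%R, T[) t))%E.
  by rewrite fineK ?ge0_fin_numE// /I integral_mkcond.
apply: ge0_ae_le_integral_l.
- by move=> t; rewrite lee_fin sqr_ge0.
- by move=> t; rewrite patchE; case: ifP => // _; rewrite expe2 mule_ge0.
- by apply/measurable_EFinP; exact: measurable_funX.
apply: aeS kf => t h; rewrite zextE patchE mem_setE in_itv/=; case: ifP => [/h {}h|_]; last first.
  by rewrite expr0n.
have h2 : (`|b^-1 * k t|%:E <= p (f t))%E.
  rewrite normrM EFinM ger0_norm ?invr_ge0 ?(ltW b0)//.
  by rewrite lee_pdivrMl.
by rewrite -real_normK ?num_real// expr2 EFinM lee_pmul.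
Qed.
End one_dimensional_integrals.

(** * Distances between slices *)

Section slice_distance.
Context d (X : measurableType d) (R : realType).
Variable mu : {sigma_finite_measure set X -> \bar R}.
Notation lam := (@lebesgue_measure R).

Lemma measurable_slice_dist (F : X * R -> R) (v : X -> R) :
  measurable_fun setT (F : X * measurableTypeR R -> R) -> measurable_fun setT v ->
  measurable_fun setT ((fun t => ip mu (sl F t - v) (sl F t - v)) : measurableTypeR R -> R).
Proof.
move=> mF mv.
apply: (@measurable_Rintegral_sl _ X _ (measurableTypeR R) R mu
  (fun z : X * measurableTypeR R => (F z - v z.1) * (F z - v z.1))).
have mB : measurable_fun setT (fun z : X * measurableTypeR R => F z - v z.1).
  by apply: measurable_funB => //; exact: (measurableT_comp mv measurable_fst).
exact: measurable_funM.
Qed.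

Lemma ip_sl_integrable (F : X * R -> R) : sqint (mu \x lam)%E F ->
  lam.-integrable setT (EFin \o (fun t => ip mu (sl F t) (sl F t))) /\
  \int[lam]_t ip mu (sl F t) (sl F t) = ip (mu \x lam)%E F F.
Proof. by move=> sF; have [i ->] := ip_sl sF sF. Qed.
End slice_distance.

(** * Continuous representatives and time derivatives *)

Section time_regularity.
Variables (R : realType) (N : nat) (T : R) (l : 'I_N -> R).
Hypotheses (T0 : 0 < T) (l0 : forall i, 0 < l i).
Notation lam := (@lebesgue_measure R).
Notation edge_fun := ('I_N -> R -> R).
Notation emb := (emb l).
Notation res := (res l).
Let H := ip_sip lam.

Lemma LL2norm_sub v w : LL2 l v -> LL2 l w ->
  LL2norm l (v - w) = (snrm (ip lam) (emb v - emb w))%:E.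
Proof. by move=> hv hw; rewrite LL2norm_emb ?emb_sub//; exact: LL2_sub. Qed.

Lemma CL2_rep_continuous rho r t : is_CL2_rep T l rho r -> 0 <= t <= T ->
  forall eps : R, 0 < eps -> exists2 de : R, 0 < de & forall s, 0 <= s <= T ->
    `|s - t| < de -> snrm (ip lam) (emb (r s) - emb (r t)) <= eps.
Proof.
move=> [Lr cr _] t0T eps e0; have tI : `[0, T]%classic t by rewrite /= in_itv.
have p0 s : (0 <= LL2norm l (r s - r t)%R)%E by exact: sqrte_ge0.
have /nbhs_ballP[de /= de0 hde] : nbhs t [set s | `[0, T]%classic s ->
    (LL2norm l (r s - r t)%R <= eps%:E)%E] by exact: (cvge0P _ p0).1 (cr t tI) eps e0.
exists de => // s s0T st; have sI : `[0, T]%classic s by rewrite /= in_itv.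
have := hde s; rewrite /ball/= distrC => /(_ st sI).
by rewrite LL2norm_sub ?lee_fin; [|exact: Lr|exact: Lr].
Qed.

(** Two continuous curves equal at almost every time agree at every time, by approximation. As
    [CL2_norm] refers to a chosen representative, this allows it to be computed from any other. *)
Lemma CL2_rep_unique rho r r' t : is_CL2_rep T l rho r -> is_CL2_rep T l rho r' ->
  0 <= t <= T -> snrm (ip lam) (emb (r t) - emb (r' t)) = 0.
Proof.
move=> hr hr' t0T; have [Lr _ ar] := hr; have [Lr' _ ar'] := hr'.
have sq s : 0 <= s <= T -> sqint lam (emb (r s)) /\ sqint lam (emb (r' s)).
  by move=> s0T; split; apply: sqint_emb; [apply: Lr|apply: Lr']; rewrite /= in_itv.
have aee : {ae lam, forall s, 0 < s < T -> LL2_eq l (r s) (r' s)}.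
  apply: ae2 ar ar' => s h h' s0T i; have sI : `]0, T[%classic s by rewrite /= in_itv.
  by apply: ae2 (h sI i) (h' sI i) => x e e' xI; rewrite e// e'.
have [s_ [sP cs]] := ae_seq T0 t0T aee.
apply/eqP; rewrite eq_le snrm_ge0 andbT; apply/ler_addgt0Pr => eps e0; rewrite add0r.
have [de de0 hde] := CL2_rep_continuous hr t0T (divr_gt0 e0 (ltr0n R 2)).
have [de' de'0 hde'] := CL2_rep_continuous hr' t0T (divr_gt0 e0 (ltr0n R 2)).
have m0 : 0 < Num.min de de' by rewrite lt_min de0.
move/cvgrPdist_lt : cs => /(_ _ m0)[n0 _ /(_ n0 (leqnn n0))] /=.
have [/andP[s0 sT] e] := sP n0; move: (s_ n0) s0 sT e => s s0 sT e.
rewrite lt_min distrC => /andP[h1 h2].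
have sI : 0 <= s <= T by rewrite !ltW.
have [q1 q2] := sq s sI; have [q3 q4] := sq t t0T.
have ez : snrm (ip lam) (emb (r s) - emb (r' s)) = 0.
  rewrite /snrm (LL2_eq_ip l0 _ _).1 ?sqrtr0//; [apply: Lr|apply: Lr'];
  by rewrite /= in_itv.
have := snrm_sub_trans H q3 q1 q4; have := snrm_sub_trans H q1 q2 q4.
rewrite ez add0r (snrm_subC H q3 q1).
have := hde s sI h1; have := hde' s sI h2.
move: (snrm _ _) (snrm _ _) (snrm _ _) (snrm _ _) => a b c d; lra.
Qed.

Lemma CL2_norm_le rho r (K : R) : is_CL2_rep T l rho r ->
  (forall t, 0 <= t <= T -> snrm (ip lam) (emb (r t)) <= K) -> (CL2_norm T l rho <= K%:E)%E.
Proof.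
move=> hr hK; have hx : is_CL2_rep T l rho (CL2_rep T l rho).
  by apply: (@xgetPex _ (fun _ _ _ => 0) [set r | is_CL2_rep T l rho r]); exists r.
apply: ge_ereal_sup => _ [t + <-]; rewrite /= in_itv/= => t0T.
have tI : `[0, T]%classic t by rewrite /= in_itv.
have [Lx _ _] := hx; have [Lr _ _] := hr.
rewrite (LL2norm_emb l0); last exact: Lx.
rewrite lee_fin (le_trans _ (hK t t0T))//.
have qx := sqint_emb (Lx t tI); have qr := sqint_emb (Lr t tI).
have := snrm_dist H qx qr; rewrite (CL2_rep_unique hx hr t0T) normr_le0 subr_eq0.
by move/eqP->.
Qed.

Lemma V_separable : exists c : nat -> edge_fun, (forall k, V l (c k)) /\
  forall phi (eps : R), V l phi -> 0 < eps -> exists k, vnrm l (phi - c k) <= eps.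
Proof.
have [ss sd] := steps_separate R.
have [e2 [se2 de2]] := pair_separable ss sd.
have [||p [pP pd]] := subset_separable (pair_semi_ip H) se2 de2
  (P := [set q | exists2 phi, V l phi & q = (emb phi, emb (Dx l phi))]).
- by move=> q [phi Vp ->]; split; [exact: (sqint_V l0)|exact: (sqint_Dx l0)].
- by exists (emb 0, emb (Dx l 0)); exists 0 => //; exact: V_0.
have /choice[c cP] : forall k, exists phi, V l phi /\ p k = (emb phi, emb (Dx l phi)).
  by move=> k; have [phi ? ?] := pP k; exists phi.
exists c; split=> [k|phi eps Vp e0]; first by case: (cP k).
have [|k hk] := pd (emb phi, emb (Dx l phi)) (eps ^+ 2) _ (exprn_gt0 2 e0).
  by exists phi.
exists k; have [Vc pk] := cP k; rewrite pk in hk; have [Vs es] := V_sub l0 Vp Vc.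
rewrite -(@ler_pXn2r _ 2) ?nnegrE ?vnrm_ge0 ?(ltW e0)//.
have h3 := snrm_ae_eq (sqint_Dx l0 Vs) (sip_sub H (sqint_Dx l0 Vp) (sqint_Dx l0 Vc)) es.
by rewrite vnrm_sqrE h3 !(snrm_sqr H) emb_sub.
Qed.

Lemma Vdual_lin b F G : Vdual l F -> Vdual l G -> Vdual l (fun phi => b * F phi + G phi).
Proof.
move=> hF hG; have [lF _] := hF; have [lG _] := hG; split=> [a v w Vv Vw|].
  by rewrite lF// lG//; ring.
apply: (@le_lt_trans _ _ (`|b| * fine (dual_norm l F) + fine (dual_norm l G))%:E); last exact: ltry.
apply: (dual_norm_le l0) => phi Vp p1; rewrite (le_trans (ler_normD _ _))// normrM.
have dn F' : Vdual l F' -> `|F' phi| <= fine (dual_norm l F').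
  move=> hF'; apply: (le_trans (dual_norm_bound l0 hF' Vp)).
  by rewrite ler_piMr// fine_ge0// dual_norm_ge0.
by rewrite lerD ?dn// ler_wpM2l ?dn.
Qed.

Lemma Vdual0 : Vdual l 0.
Proof.
split=> [a v w _ _|]; first by rewrite -![0 _]/(0 : R) mulr0 addr0.
by apply: (@le_lt_trans _ _ 0%:E); [apply: (dual_norm_le l0) => phi _ _; rewrite normr0|exact: ltry].
Qed.

Lemma Vdual_sub F G : Vdual l F -> Vdual l G -> Vdual l (F - G).
Proof.
move=> hF hG; rewrite (_ : F - G = fun phi => -1 * G phi + F phi); first exact: Vdual_lin.
by apply/funext => phi; rewrite mulN1r addrC.
Qed.

Lemma Vdual_add F G : Vdual l F -> Vdual l G -> Vdual l (F + G).
Proof.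
move=> hF hG; rewrite (_ : F + G = fun phi => 1 * F phi + G phi); first exact: Vdual_lin.
by apply/funext => phi; rewrite mul1r.
Qed.

Lemma dual_norm_fin F : Vdual l F -> dual_norm l F \is a fin_num.
Proof. by move=> [_ h]; rewrite ge0_fin_numE// dual_norm_ge0. Qed.

Lemma dual_pairing_L2 g phi : L2_Bochner (Vdual l) (dual_norm l) T g -> V l phi ->
  exists k : R -> R, sqint lam (zext T k) /\ {ae lam, forall t, 0 < t < T -> k t = g t phi}.
Proof.
move=> [gV gm gn] Vp; have p0 := vnrm_ge0 l phi.
have aeV : {ae lam, forall t, 0 < t < T -> Vdual l (g t)}.
  by apply: aeS gV => t h t0; apply: h; rewrite /= in_itv.
have lip F G : Vdual l F -> Vdual l G ->
    (`|F phi - G phi|%:E <= (vnrm l phi)%:E * dual_norm l (F - G)%R)%E.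
  move=> hF hG; have hS := Vdual_sub hF hG.
  by rewrite -(fineK (dual_norm_fin hS)) -EFinM lee_fin mulrC; exact: (dual_norm_bound l0 hS Vp).
have [k [mk kE]] := strongly_measurable_lipschitz (@dual_norm_ge0 R N l l0) gm Vdual0
  Vdual_add p0 aeV lip.
exists k; split => //; apply: (L2_Bochner_sqint (@dual_norm_ge0 R N l l0) gn (ltr_wpDl p0 ltr01) mk).
apply: ae2 kE aeV => t h1 h2 t0T; have hV := h2 t0T; rewrite h1//.
rewrite -(fineK (dual_norm_fin hV)) -EFinM lee_fin mulrC.
apply: (le_trans (dual_norm_bound l0 hV Vp)); rewrite ler_wpM2l ?fine_ge0 ?dual_norm_ge0//.
by rewrite lerDl.
Qed.

(** For each member of a dense sequence of [V], the difference of the pairings is a weak derivative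
    of the zero function, hence null; finiteness of the dual norm extends this to all of [V] at
    almost every time. It ties the arbitrary choice in [time_deriv] to an explicit derivative. *)
Lemma time_deriv_unique rho g g' : is_time_deriv T l rho g -> is_time_deriv T l rho g' ->
  {ae lam, forall t, 0 < t < T -> Vdual_eq l (g t) (g' t)}.
Proof.
move=> [gB gE] [gB' gE']; have [c [Vc cd]] := V_separable.
have aeV h : L2_Bochner (Vdual l) (dual_norm l) T h -> {ae lam, forall t, 0 < t < T -> Vdual l (h t)}.
  by move=> [hV _ _]; apply: aeS hV => t ht t0; apply: ht; rewrite /= in_itv.
have key n : {ae lam, forall t, 0 < t < T -> g t (c n) = g' t (c n)}.
  have [k [sk kE]] := dual_pairing_L2 gB (Vc n).
  have [k' [sk' kE']] := dual_pairing_L2 gB' (Vc n).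
  have L0 : L2 T (fun=> 0 : R).
    apply/L2_sqint; rewrite (_ : zext _ _ = 0); first exact: sqint0.
    by apply/funext => x; rewrite zextE if_same.
  have z0 : \int[lam]_t (0 : R) = 0 by rewrite Rintegral_cst// mul0r.
  have w0 (w : R -> R) : L2 T w -> (forall psi, test_fun 0 T psi ->
      \int[lam]_(x in `]0, T[) (w x * psi x) = 0) -> is_weak_deriv T (fun=> 0 : R) w.
    move=> Lw hw; split => // psi tpsi; rewrite hw// oppr0 Rintegral_oo; rewrite -[RHS]z0.
    by apply: eq_Rintegral => t _; rewrite zextE mul0r if_same.
  have hk psi h h' : sqint lam (zext T h) -> {ae lam, forall t, 0 < t < T -> h t = h' t (c n)} ->
      test_fun 0 T psi -> \int[lam]_(x in `]0, T[) (psi x * h' x (c n)) =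
      \int[lam]_(x in `]0, T[) (h x * psi x).
    move=> [mh _] hh tpsi; have [_ cpsi _ _ _] := test_fun_continuous tpsi.
    apply: Rintegral_oo_ae_r.
      by rewrite zext_mul; apply: measurable_funM => //; exact: continuous_measurable.
    by apply: aeS hh => t ht /ht ->; rewrite mulrC.
  have wd : is_weak_deriv T (fun=> 0 : R) (fun t => k t - k' t).
    have zE : zext T (fun t => k t - k' t) = zext T k - zext T k'.
      apply/funext => t; rewrite -[RHS]/(zext T k t - zext T k' t) !zextE.
      by case: ifP => // _; rewrite subr0.
    apply: w0 => [|psi tpsi]; first by apply/L2_sqint; rewrite zE; exact: (sip_sub H).
    have [_ cpsi _ psi_out _] := test_fun_continuous tpsi.
    have [_ [K psiK]] := continuous_support T0 cpsi psi_out.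
    have ii h : sqint lam (zext T h) -> lam.-integrable setT (EFin \o (fun t => zext T h t * psi t)).
      move=> sh; apply: (integrable_mul_bounded (K := K)) => //.
        exact: sqint_zext_integrable.
      exact: continuous_measurable.
    have e : \int[lam]_(x in `]0, T[) (k x * psi x) = \int[lam]_(x in `]0, T[) (k' x * psi x).
      rewrite -(hk psi k g)// -(hk psi k' g')//; apply: oppr_inj.
      have := gE _ tpsi _ (Vc n); have := gE' _ tpsi _ (Vc n).
      by rewrite /dual_integral => -> ->.
    move: e; rewrite !Rintegral_oo !zext_mul => e.
    transitivity (\int[lam]_x (zext T k x * psi x - zext T k' x * psi x)).
      by apply: eq_Rintegral => t _; rewrite zE mulrBl.
    by rewrite RintegralB ?ii// e subrr.
  have wz : is_weak_deriv T (fun=> 0 : R) (fun=> 0 : R).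
    apply: w0 => // psi tpsi; rewrite Rintegral_oo -[RHS]z0.
    by apply: eq_Rintegral => t _; rewrite zextE mul0r if_same.
  have hE := ae_and kE kE'.
  apply: ae2 (weak_deriv_unique L0 wd wz) hE => t + [h1 h2] t0T.
  by rewrite !zextE t0T => /subr0_eq; rewrite h1// h2.
apply: ae2 (ae_nat key) (ae_and (aeV g gB) (aeV g' gB')) =>
  t hc [h1 h2] t0T phi Vp.
have hF := Vdual_sub (h1 t0T) (h2 t0T); have [Fl _] := hF.
set F := g t - g' t in hF Fl; apply/eqP; rewrite -subr_eq0 -[_ - _]/(F phi) -normr_le0.
apply/ler_addgt0Pr => eps e0; rewrite add0r.
have d0 : 0 <= fine (dual_norm l F) by rewrite fine_ge0// dual_norm_ge0.
have d1 : 0 < fine (dual_norm l F) + 1 by rewrite ltr_wpDl.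
have [k hk] := cd phi _ Vp (divr_gt0 e0 d1).
have Fc : F (c k) = 0 by rewrite -[F _]/(g t (c k) - g' t (c k)) hc// subrr.
have -> : F phi = F (phi - c k).
  rewrite (_ : phi - c k = fun i x => -1 * c k i x + phi i x) ?Fl// ?Fc ?mulr0 ?add0r//.
  by apply/funext => i; apply/funext => x; rewrite mulN1r addrC.
apply: (le_trans (dual_norm_bound l0 hF (V_sub l0 Vp (Vc k)).1)).
apply: (@le_trans _ _ (fine (dual_norm l F) * (eps / (fine (dual_norm l F) + 1)))).
  by rewrite ler_wpM2l.
by rewrite mulrCA ger_pMr// ler_pdivrMr// mul1r lerDl.
Qed.
End time_regularity.

(** * The Fokker--Planck equation on the star graph *)

Section coefficients.
Variables (R : realType) (N : nat) (T : R) (l D : 'I_N -> R) (u : 'I_N -> R * R -> R).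
Hypotheses (N0 : (0 < N)%N) (T0 : 0 < T) (l0 : forall i, 0 < l i) (D0 : forall i, 0 < D i).
Hypothesis Lu : LLinf T l u.
Notation lam := (@lebesgue_measure R).
Notation mu2 := (@lebesgue_measure R \x @lebesgue_measure R)%E.
Notation edge_fun := ('I_N -> R -> R).
Notation emb := (emb l).
Notation res := (res l).
Let H := ip_sip lam.

Lemma Dmax_ge i : D i <= Dmax D. Proof. exact: le_bigmax_cond. Qed.

Lemma Dmin_le i : Dmin D <= D i. Proof. exact: bigmin_le_cond. Qed.

Lemma Dmax_gt0 : 0 < Dmax D.
Proof. exact: lt_le_trans (D0 (Ordinal N0)) (Dmax_ge _). Qed.

Lemma Dmin_gt0 : 0 < Dmin D.
Proof. by apply: lt_bigmin => // ; exact: Dmax_gt0. Qed.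

Lemma Dmin_le_Dmax : Dmin D <= Dmax D.
Proof. exact: le_trans (Dmin_le (Ordinal N0)) (Dmax_ge _). Qed.

(** The value between the edges is [Dmin D], so that the lower bound is positive on the whole
    line. *)
Definition diffusion (y : R) : R := Dmin D + emb (fun i _ => D i - Dmin D) y.

Lemma diffusion_on i x : 0 < x < l i -> diffusion (x + off l i) = D i.
Proof.
move=> hx; rewrite /diffusion -[emb _ _]/(res (emb (fun i _ => D i - Dmin D)) i x).
by rewrite res_emb// addrC subrK.
Qed.

Lemma diffusion_bound y : Dmin D <= diffusion y <= Dmax D.
Proof.
rewrite /diffusion; have [[i hi]|h] := on_edge_case l y; last first.
  by rewrite emb_out// addr0 lexx Dmin_le_Dmax.
by rewrite (emb_on l0 _ hi) addrC subrK Dmin_le Dmax_ge.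
Qed.

Lemma measurable_diffusion : measurable_fun setT (diffusion : measurableTypeR R -> R).
Proof.
apply: measurable_funD => //.
have [//] : sqint lam (emb (fun i _ => D i - Dmin D)).
apply: sqint_emb => i; apply/L2_sqint.
by apply: (@sqint_zext_bounded R _ _ `|D i - Dmin D|).
Qed.

Definition drift_bound : R := fine (LLinf_norm T l u).
Notation m := drift_bound.

Lemma drift_bound_ge0 : 0 <= m.
Proof. by rewrite fine_ge0// sume_ge0// => i _; exact: Lnorm_ge0. Qed.

Let mfin i : ('N[mu2]_+oo[EFin \o (u i \_ (Q T l i))] < +oo)%E.
Proof. by have := Lu i; rewrite inE => /andP[_]; rewrite inE. Qed.

Lemma measurable_drift i :
  measurable_fun setT (u i \_ (Q T l i) : measurableTypeR R * measurableTypeR R -> R).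
Proof. by have := Lu i; rewrite inE => /andP[]; rewrite inE. Qed.

Lemma drift_ae : {ae mu2, forall z, forall i, `|(u i \_ (Q T l i)) z| <= m}.
Proof.
apply: ae_fin => i; have := mfin i; set n := Lnorm _ _ _ => nfin.
have n0 : (0 <= n)%E by exact: Lnorm_ge0.
have : {ae mu2, forall z, (`|(u i \_ (Q T l i)) z|%:E <= n)%E}.
  (* The definition of the infinity norm depends on whether the whole space has positive measure; in
     that case it is the essential supremum. *)
  have muT : (0 < mu2 setT)%E.
    rewrite (_ : setT = setT `*` setT); last by apply/seteqP; split.
    have lT : (0 < lam [set: R])%E.
      apply: (@lt_le_trans _ _ (lam `]0%R, 1%R])); first by rewrite lebesgue_measure_itv/= lte01 oppr0 adde0 lte01.
      by apply: le_measure; rewrite ?inE//; exact: measurable_itv.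
    by rewrite product_measure1E// mule_gt0.
  have -> : n = ess_sup mu2 (abse \o (EFin \o (u i \_ (Q T l i)))).
    by rewrite /n unlock muT.
  exact: ess_sup_ge.
apply: aeS => z hz; rewrite -lee_fin (le_trans hz)//.
rewrite /m fineK; last first.
  by rewrite ge0_fin_numE ?sume_ge0//; [apply: lte_sum_pinfty => j _; exact: mfin|move=> j _; exact: Lnorm_ge0].
rewrite /LLinf_norm (bigD1 i)//= leeDl// sume_ge0// => j _; exact: Lnorm_ge0.
Qed.

Definition clip (x : R) : R := Num.max (- m) (Num.min m x).

Lemma clip_bound x : `|clip x| <= m.
Proof.
rewrite ler_norml /clip le_max lexx/= ge_max ge_min lexx/= andbT.
by rewrite (le_trans _ drift_bound_ge0)// oppr_le0 drift_bound_ge0.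
Qed.

Lemma clip_id x : `|x| <= m -> clip x = x.
Proof.
rewrite ler_norml /clip => /andP[h1 h2].
by rewrite min_r// max_r.
Qed.

(* The values outside a null set are truncated so that the bound holds everywhere. *)
Definition drift (z : R * R) : R := clip (\sum_i (u i \_ (Q T l i)) (z.1 - off l i, z.2)).

Lemma drift_le z : `|drift z| <= m. Proof. exact: clip_bound. Qed.

Lemma measurable_drift_line :
  measurable_fun setT (drift : measurableTypeR R * measurableTypeR R -> R).
Proof.
apply: measurable_maxr => //; apply: measurable_minr => //.
apply: measurable_sum => i.
apply: (measurableT_comp (measurable_drift i)
  (g := fun z : measurableTypeR R * measurableTypeR R => (z.1 - off l i, z.2))).
apply: measurable_fun_pair; last exact: measurable_snd.
exact: (measurableT_comp (measurable_shiftR (- off l i)) measurable_fst).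
Qed.

Lemma drift_sum_on i x t : 0 < x < l i -> 0 < t < T ->
  \sum_j (u j \_ (Q T l j)) ((x + off l i) - off l j, t) = u i (x, t).
Proof.
move=> hx ht; rewrite (bigD1 i)//= big1 ?addr0 => [|j ji].
  by rewrite addrK patchE mem_set//= /Q/= !in_itv.
rewrite patchE memNset// => -[/=]; rewrite in_itv/= => hj _; move/eqP: ji; apply.
by apply: (@on_edge_inj R N l l0 _ _ (x + off l i)) => //; rewrite on_edge_off.
Qed.

Lemma drift_on_ae : {ae lam, forall t, 0 < t < T ->
  forall i, {ae lam, forall x, 0 < x < l i -> drift (x + off l i, t) = u i (x, t)}}.
Proof.
apply: aeS (ae_sl drift_ae) => t ht t0T i.
apply: aeS ht => x /(_ i) hx x0l.
rewrite /drift/= drift_sum_on// clip_id//.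
by move: hx; rewrite patchE mem_set//= /Q/= !in_itv.
Qed.

(** The exceptional times come from the bound of the drift alone, so one null set serves all
    functions at once, including a state that changes with time. *)
Lemma FPform_ip : {ae lam, forall t, 0 < t < T -> forall v phi f g,
  sqint lam f -> sqint lam g -> LL2_eq l v (res f) -> LL2_eq l (Dx l v) (res g) -> V l phi ->
  FPform l D u t v phi =
  ip lam (fun y => diffusion y * g y + drift (y, t) * f y) (emb (Dx l phi))}.
Proof.
apply: aeS drift_on_ae => t ht t0T v phi f g sf sg vf vg Vp; have {}ht := ht t0T.
have Ld := is_weak_deriv_LL2 (is_weak_deriv_Dx Vp).
set F := fun y => _.
have mdr : measurable_fun setT ((fun y => drift (y, t)) : measurableTypeR R -> R).
  exact: (measurable_sl t measurable_drift_line).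
have sF : sqint lam F.
  apply: (sip_add H).
    apply: (sqint_bounded (K := Dmax D) sg) => [|y]; first exact: measurable_diffusion.
    have /andP[h1 h2] := diffusion_bound y.
    by rewrite ger0_norm// (le_trans _ h1)// ltW// Dmin_gt0.
  by apply: (sqint_bounded (K := m) sf) => // y; exact: drift_le.
rewrite [RHS](sipC H) ip_emb//; apply: eq_bigr => i _.
rewrite !Rintegral_oo; apply: Rintegral_ae_measurable_r.
  rewrite zext_mul; apply: measurable_funM.
    by have /L2_sqint[] := Ld i.
  by have [] := sqint_shift (off l i) sF.
have e : {ae lam, forall x, 0 < x < l i -> v i x = res f i x /\ drift (x + off l i, t) = u i (x, t)}.
  by apply: ae2 (vf i) (ht i) => x h1 h2 x0l; split; [apply: h1; rewrite /= in_itv|exact: h2].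
apply: ae2 (vg i) e => x h1 h2; rewrite !zextE; case: ifPn => // x0l; have [hf hd] := h2 x0l.
rewrite -[weak_deriv _ (v i) x]/(Dx l v i x) h1 ?/= ?in_itv// hf /F diffusion_on// hd.
by rewrite mulrC.
Qed.

Notation VVl := (VV lam (Na l0) (Nb l0)).
Notation fl := (flux diffusion drift).
Notation soll := (sol lam T diffusion drift (Na l0) (Nb l0)).
Let sep := @steps_separate R.
Let sNa := sqint_Na l0.
Let sNb := sqint_Nb l0.

Let sqint_fl F G : sqint mu2 F -> sqint mu2 G -> sqint mu2 (fl F G).
Proof.
exact: (sqint_flux Dmin_gt0 measurable_diffusion diffusion_bound measurable_drift_line drift_le).
Qed.

Lemma LL2_eq_Dx_res f g : VVl f g -> LL2_eq l (Dx l (res f)) (res g).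
Proof.
by move=> h; apply/(LL2_eq_emb l0); exact: emb_Dx_res_ae.
Qed.

Lemma LL2_dot_res f phi : sqint lam f -> V l phi ->
  LL2_dot l (res f) phi = ip lam f (emb phi).
Proof.
move=> sf Vp; have Lp := V_LL2 Vp; rewrite LL2_dot_emb//; last exact: LL2_res.
by rewrite (sipC H) ip_emb_res// (sipC H).
Qed.

Lemma ip_slice_integrable F w : sqint mu2 F -> sqint lam w ->
  sqint lam (fun t => ip lam (sl F t) w).
Proof.
move=> sF sw; have [iF _] := ip_sl_integrable sF.
have [mF _] := sF; have [mw _] := sw.
have ih : lam.-integrable setT (EFin \o (fun t => ip lam w w * ip lam (sl F t) (sl F t))).
  exact: integrableRZ.
apply: (sqint_ae_le _ ih).
- apply: (@measurable_Rintegral_sl _ _ _ _ R lam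
    (fun z : measurableTypeR R * measurableTypeR R => F z * w z.1)).
  by apply: measurable_funM => //; exact: (measurableT_comp mw measurable_fst).
- by move=> t; rewrite mulr_ge0// (sip_ge0 H).
by apply: aeS (ae_sl_sqint sF) => t st; rewrite mulrC; exact: (sip_CS H).
Qed.

(** [rho] is not known to be jointly measurable in $(x,t)$. Each integral is transferred to [F] and
    [G], whose slices agree with it and with its space derivative at almost every time. *)
Lemma weak_form_eq (rho : R -> edge_fun) F G phi psi : sqint mu2 F -> sqint mu2 G ->
  {ae lam, forall t, 0 < t < T -> LL2_eq l (rho t) (res (sl F t)) /\
     LL2_eq l (Dx l (rho t)) (res (sl G t))} ->
  V l phi -> test_fun 0 T psi ->
  \sum_i - (\int[lam]_(t in `]0, T[)
     ((\int[lam]_(x in `]0, l i[) (rho t i x * phi i x)) * derive1 psi t)) +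
  \int[lam]_(t in `]0, T[) (FPform l D u t (rho t) phi * psi t) =
  - (\int[lam]_t (ip lam (sl F t) (emb phi) * derive1 psi t)) +
  \int[lam]_t (ip lam (sl (fl F G) t) (emb (Dx l phi)) * psi t).
Proof.
move=> sF sG hrho Vp tpsi; have Lp := V_LL2 Vp; have sf := sqint_fl sF sG.
have [dpsi cpsi cpsi' psi_out psi'_out] := test_fun_continuous tpsi.
have [_ [K psiK]] := continuous_support T0 cpsi psi_out.
have [_ [K' psiK']] := continuous_support T0 cpsi' psi'_out.
have sl_z (k : R -> R) (h : R -> R) : (forall x, ~~ (0 < x < T) -> k x = 0) ->
    zext T (fun t => h t * k t) = fun t => h t * k t.
  by move=> k0; apply/funext => t; rewrite zextE; case: ifPn => // /k0 ->; rewrite mulr0.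
have z' : zext T (derive1 psi) = derive1 psi.
  by apply/funext => t; rewrite zextE; case: ifPn => // /psi'_out.
have z0 : zext T psi = psi.
  by apply/funext => t; rewrite zextE; case: ifPn => // /psi_out.
have spsi' : sqint lam (derive1 psi).
  by rewrite -z'; exact: sqint_zext_bounded (continuous_measurable cpsi') psiK'.
have spsi : sqint lam psi.
  by rewrite -z0; exact: sqint_zext_bounded (continuous_measurable cpsi) psiK.
have one i : LL2 l (one_edge i (phi i)) by exact: LL2_one.
pose k i t := ip lam (sl F t) (emb (one_edge i (phi i))).
have ii i : lam.-integrable setT (EFin \o (fun t => k i t * derive1 psi t)).
  by apply: sqint_mul => //; exact: ip_slice_integrable sF (sqint_emb (one i)).
have kE t i : sqint lam (sl F t) ->
    k i t = \int[lam]_(x in `]0, l i[) (res (sl F t) i x * phi i x).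
  move=> st; rewrite /k (sipC H) -ip_emb_res// (sipC H) ip_one//; last exact: LL2_res.
  by rewrite Rintegral_oo zext_mul.
congr (_ + _).
  transitivity (\sum_i - (\int[lam]_t (k i t * derive1 psi t))).
    apply: eq_bigr => i _; congr (- _).
    rewrite (@Rintegral_oo_ae_r _ _ _ (fun t => k i t * derive1 psi t)).
    - by rewrite Rintegral_oo sl_z.
    - by rewrite sl_z//; exact: measurable_of_integrable (ii i).
    apply: ae2 hrho (ae_sl_sqint sF) => t ht st /ht[h1 _]; congr (_ * _); rewrite kE//.
    apply: Rintegral_oo_ae_r.
      by have /L2_sqint sr := LL2_res l st i; have /L2_sqint sp := Lp i;
        rewrite zext_mul2; apply: measurable_funM; [case: sr|case: sp].
    by apply: aeS (h1 i) => x hx x0; congr (_ * _); apply: hx; rewrite /= in_itv.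
  rewrite sumrN; congr (- _); have [_ <-] := integrable_bigsum ii.
  apply: Rintegral_ae_measurable_r.
    apply: measurable_funM; last by case: spsi'.
    by have [] := ip_slice_integrable sF (sqint_V l0 Vp).
  apply: aeS (ae_sl_sqint sF) => t st; rewrite -mulr_suml; congr (_ * _).
  by rewrite -LL2_dot_res//; apply: eq_bigr => i _; rewrite kE.
have sq := ip_slice_integrable sf (sqint_Dx l0 Vp).
rewrite (@Rintegral_oo_ae_r _ _ _ (fun t => ip lam (sl (fl F G) t) (emb (Dx l phi)) * psi t)).
- by rewrite Rintegral_oo sl_z.
- by rewrite sl_z//; apply: measurable_funM; [case: sq|case: spsi].
have h3 := ae_and (ae_sl_sqint sF) (ae_sl_sqint sG).
have h4 := ae_and hrho h3.
apply: ae2 FPform_ip h4 => t hFP [ht [st sg]] t0T; congr (_ * _).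
by have [h1 h2] := ht t0T; rewrite (hFP t0T _ _ _ _ st sg h1 h2 Vp).
Qed.

(** * The weak solution obtained from a solution on the line *)

Section solution.
Variables (rho0 : edge_fun) (rho sigma : R * R -> R).
Hypotheses (Lrho0 : LL2 l rho0) (rs : soll (emb rho0) rho sigma).
Let f := fl rho sigma.
Let sr : sqint mu2 rho. Proof. by case: rs => -[]. Qed.
Let ss : sqint mu2 sigma. Proof. by case: rs => -[]. Qed.
Let sf : sqint mu2 f. Proof. exact: sqint_fl. Qed.
Let s0 : sqint lam (emb rho0). Proof. exact: sqint_emb. Qed.

Definition state (t : R) : edge_fun := res (sl rho t).
Definition state_t (t : R) : edge_fun -> R := dual_dx l (sl f t).

Let vv_ae : {ae lam, forall t, VVl (sl rho t) (sl sigma t)}.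
Proof. by case: rs. Qed.

Lemma state_V_ae : {ae lam, forall t, 0 < t < T -> V l (state t)}.
Proof. by apply: aeS vv_ae => t /VV_V[]. Qed.

(** The approximating points are the restrictions of a dense sequence of [VV]. The majorants are the
    distances computed on the whole line, values between the edges included, which are measurable in
    time. *)
Lemma state_strongly_measurable : strongly_measurable (V l) (HH1norm l) T state.
Proof.
have [p [pV pd]] := VV_separable sNa sNb sep.
pose d k (t : R) : R := Num.sqrt (ip lam (sl rho t - (p k).1) (sl rho t - (p k).1) +
  ip lam (sl sigma t - (p k).2) (sl sigma t - (p k).2)).
apply: (@strongly_measurable_dense _ _ _ _ _ (@HH1norm_ge0 R N l) _ (fun k => res (p k).1) d).
- by move=> k; have [] := VV_V (pV k).
- move=> k; have [[mp1 _] [mp2 _] _] := pV k; have [mr _] := sr; have [ms _] := ss.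
  by apply: measurable_sqrt_comp; apply: measurable_funD; exact: measurable_slice_dist.
- apply: aeS vv_ae => t vt _ k.
  have hv : VVl (sl rho t - (p k).1) (sl sigma t - (p k).2).
    have := VV_lin sNa sNb (-1) (pV k) vt.
    by rewrite !scaleN1r [- _ + _]addrC [- (p k).2 + _]addrC.
  rewrite -[state t - _]/(res (sl rho t - (p k).1)) HH1norm_emb//; last by have [] := VV_V hv.
  rewrite lee_fin -(@ler_pXn2r _ 2) ?nnegrE ?sqrtr_ge0//.
  apply: (le_trans (vnrm_res_le hv)).
  by rewrite /d sqr_sqrtr// addr_ge0// (sip_ge0 H).
- apply: aeS vv_ae => t vt _ eps e0; have [k hk] := pd _ _ (eps ^+ 2) vt (exprn_gt0 2 e0).
  exists k; rewrite -(@ler_pXn2r _ 2) ?nnegrE ?sqrtr_ge0 ?(ltW e0)//.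
  by rewrite sqr_sqrtr ?addr_ge0 ?(sip_ge0 H).
Qed.

Lemma L2V_norm_state : (L2V_norm T l state <= (Num.sqrt (ip mu2 rho rho + ip mu2 sigma sigma))%:E)%E.
Proof.
have [ir <-] := ip_sl_integrable sr; have [is_ <-] := ip_sl_integrable ss.
rewrite -RintegralD//; apply: L2_Bochner_norm_le.
- exact: HH1norm_ge0.
- exact: integrableRD.
- by move=> t; rewrite addr_ge0// (sip_ge0 H).
apply: aeS vv_ae => t vt _; rewrite HH1norm_emb//; last by have [] := VV_V vt.
by rewrite expe2 -EFinM -expr2 lee_fin; exact: vnrm_res_le vt.
Qed.

Lemma state_L2_Bochner : L2_Bochner (V l) (HH1norm l) T state.
Proof.
split; [|exact: state_strongly_measurable|exact: le_lt_trans L2V_norm_state (ltry _)].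
by apply: aeS state_V_ae => t h; rewrite /= in_itv.
Qed.

Lemma state_t_norm : (L2_Bochner_norm (dual_norm l) T state_t <= (Num.sqrt (ip mu2 f f))%:E)%E.
Proof.
have [if_ <-] := ip_sl_integrable sf; apply: L2_Bochner_norm_le => //.
- exact: dual_norm_ge0.
- by move=> t; exact: (sip_ge0 H).
apply: aeS (ae_sl_sqint sf) => t st _.
apply: (@le_trans _ _ ((snrm (ip lam) (sl f t))%:E ^+ 2)%E).
  by rewrite !expe2 lee_pmul ?dual_norm_ge0 ?dual_dx_le.
by rewrite expe2 -EFinM -expr2 lee_fin (snrm_sqr H).
Qed.

Lemma state_t_L2_Bochner : L2_Bochner (Vdual l) (dual_norm l) T state_t.
Proof.
split; last exact: le_lt_trans state_t_norm (ltry _).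
  by apply: aeS (ae_sl_sqint sf) => t st _; exact: dual_dx_Vdual.
have [sst std] := sep.
apply: (@strongly_measurable_dense _ _ _ _ _ (@dual_norm_ge0 R N l l0) _
  (fun k => dual_dx l (@steps R k)) (fun k t => snrm (ip lam) (sl f t - @steps R k))).
- by move=> k; exact: dual_dx_Vdual.
- move=> k; have [mk _] := sst k; have [mf _] := sf.
  by apply: measurable_sqrt_comp; exact: measurable_slice_dist.
- by apply: aeS (ae_sl_sqint sf) => t st _ k; exact: dual_dx_sub.
- apply: aeS (ae_sl_sqint sf) => t st _ eps e0; have [k hk] := std _ (eps ^+ 2) st (exprn_gt0 2 e0).
  by exists k; rewrite -(@ler_pXn2r _ 2) ?nnegrE ?snrm_ge0 ?(ltW e0)// (snrm_sqr H).
Qed.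

Lemma state_t_L2 phi : V l phi -> L2 T (state_t ^~ phi).
Proof.
move=> Vp; apply/L2_sqint; have [mq iq] := ip_slice_integrable sf (sqint_Dx l0 Vp).
apply: (@sqint_le _ _ _ lam _ (fun t => ip lam (sl f t) (emb (Dx l phi)))).
- apply: (measurable_restrictT _ (measurable_itv _)).1; apply: measurable_funTS.
  exact: measurableT_comp.
- by split.
- by move=> t; rewrite zextE; case: ifP => _; rewrite ?normrN ?normr0.
Qed.

(** Identifies $t\mapsto(\rho(t),\varphi)$, for fixed $\varphi$, with an absolutely continuous
    function whose derivative is the pairing with [state_t]: the bridge from the integrated equation
    to derivatives in the sense of distributions. *)
Lemma state_primitive phi : V l phi -> {ae lam, forall t, 0 < t < T ->
  ip lam (sl rho t) (emb phi) =
  ip lam (emb rho0) (emb phi) + primitive (zext T (state_t ^~ phi)) t}.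
Proof.
move=> Vp; have [_ _ _ h] := rs; have sD := sqint_Dx l0 Vp.
apply: aeS (h _ _ (V_VV_Dx l0 Vp)) => t ht /[dup] t0T /ht ->; congr (_ + _).
have [-> _] := ip_sl_tens sf sD (sqint_ind 0 t).
have iq : lam.-integrable setT (EFin \o zext T (state_t ^~ phi)).
  by apply: sqint_zext_integrable; apply/L2_sqint; exact: state_t_L2.
rewrite -mulN1r -RintegralZl; last first.
  by have [_] := ip_sl_tens sf sD (sqint_ind 0 t).
  exact: measurableT.
rewrite /primitive [RHS]Rintegral_mkcond; apply: eq_Rintegral => s _.
rewrite patchE mem_setE in_itv/= zextE indE.
case/andP: t0T => t0 tT; case: (ltP 0 s) => sgt /=; last by rewrite if_same mul0r mulr0.
case: (leP s t) => st /=; last by rewrite mul0r mulr0.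
by rewrite (le_lt_trans st tT) mul1r mulN1r.
Qed.

Lemma state_weak_deriv phi : V l phi ->
  is_weak_deriv T (fun t => ip lam (emb rho0) (emb phi) + primitive (zext T (state_t ^~ phi)) t)
    (state_t ^~ phi).
Proof.
move=> Vp; have Lq := state_t_L2 Vp.
have iq : lam.-integrable setT (EFin \o zext T (state_t ^~ phi)).
  by apply: sqint_zext_integrable; apply/L2_sqint.
have [] // := @primitive_cont_rep R T T0 (fun t => ip lam (emb rho0) (emb phi) +
  primitive (zext T (state_t ^~ phi)) t) _ (ip lam (emb rho0) (emb phi)) Lq.
- apply: (measurable_restrictT _ (measurable_itv _)).1; apply: measurable_funTS.
  by apply: measurable_funD => //; apply: continuous_measurable; exact: primitive_continuous.
- by apply: aeT => t _.
Qed.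

Lemma state_time_deriv : is_time_deriv T l state state_t.
Proof.
split=> [|psi tpsi phi Vp]; first exact: state_t_L2_Bochner.
have [Lq h] := state_weak_deriv Vp.
rewrite /dual_integral.
transitivity (\int[lam]_(t in `]0, T[) ((ip lam (emb rho0) (emb phi) +
    primitive (zext T (state_t ^~ phi)) t) * derive1 psi t)); last first.
  by rewrite (h _ tpsi); congr (- _); apply: eq_Rintegral => t _; rewrite mulrC.
have [dpsi cpsi cpsi' psi_out psi'_out] := test_fun_continuous tpsi.
have iq : lam.-integrable setT (EFin \o zext T (state_t ^~ phi)).
  by apply: sqint_zext_integrable; apply/L2_sqint.
apply: Rintegral_oo_ae_r.
  apply: (measurable_restrictT _ (measurable_itv _)).1; apply: measurable_funTS.
  apply: measurable_funM; last exact: continuous_measurable.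
  by apply: measurable_funD => //; apply: continuous_measurable; exact: primitive_continuous.
apply: ae2 (state_primitive Vp) (ae_sl_sqint sr) => t h1 st /h1 <-.
by rewrite LL2_dot_res// mulrC.
Qed.

Lemma state_weak_form phi psi : V l phi -> test_fun 0 T psi ->
  - (\int[lam]_t (ip lam (sl rho t) (emb phi) * derive1 psi t)) +
  \int[lam]_t (ip lam (sl f t) (emb (Dx l phi)) * psi t) = 0.
Proof.
move=> Vp tpsi; have [Lq h] := state_weak_deriv Vp.
have [dpsi cpsi cpsi' psi_out psi'_out] := test_fun_continuous tpsi.
have oo (k g : R -> R) : (forall x, ~~ (0 < x < T) -> k x = 0) ->
    \int[lam]_t (g t * k t) = \int[lam]_(t in `]0, T[) (g t * k t).
  move=> k0; rewrite Rintegral_oo; congr Rintegral; apply/funext => t; rewrite zextE.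
  by case: ifPn => // /k0 ->; rewrite mulr0.
rewrite !oo//; apply/eqP; rewrite addrC subr_eq0 eq_sym; apply/eqP.
have iq : lam.-integrable setT (EFin \o zext T (state_t ^~ phi)).
  by apply: sqint_zext_integrable; apply/L2_sqint.
rewrite (@Rintegral_oo_ae_r _ _ _ (fun t => (ip lam (emb rho0) (emb phi) +
    primitive (zext T (state_t ^~ phi)) t) * derive1 psi t)); first last.
- by apply: aeS (state_primitive Vp) => t h1 /h1 ->.
- apply: (measurable_restrictT _ (measurable_itv _)).1; apply: measurable_funTS.
  apply: measurable_funM; last exact: continuous_measurable.
  by apply: measurable_funD => //; apply: continuous_measurable; exact: primitive_continuous.
rewrite (h _ tpsi) !Rintegral_oo -mulN1r -RintegralZl//.
  apply: eq_Rintegral => t _; rewrite !zextE; case: ifP => _; last by rewrite mulr0.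
  by rewrite mulN1r /state_t /dual_dx mulNr opprK.
have [_ [K psiK]] := continuous_support T0 cpsi psi_out.
rewrite zext_mul; apply: (integrable_mul_bounded (K := K)) => //.
exact: continuous_measurable.
Qed.

Let A : R := expR (m ^+ 2 / Dmin D * T).
Let E0 : R := ip lam (emb rho0) (emb rho0).

Let energy := energy_estimates T0 Dmin_gt0 measurable_diffusion diffusion_bound
  measurable_drift_line drift_le sNa sNb sep (@V_dense R N l l0) s0 rs.

(** The continuous curve of [energy_estimates] lives on the line; restriction to the edges does not
    increase norms, so its continuity and its bound survive. *)
Lemma state_CL2_rep : exists r, [/\ is_CL2_rep T l state r, LL2_eq l (r 0) rho0 &
  forall t, 0 <= t <= T -> ip lam (emb (r t)) (emb (r t)) <= A * E0].
Proof.
have [r [rT rae rc r0 _]] := energy; exists (fun t => res (r t)).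
have sq t : 0 <= t <= T -> sqint lam (r t) by move=> /rT[].
have [|sr0 _] := rT 0; first by rewrite lexx ltW.
split; last first.
- by move=> t t0T; have [st rt] := rT t t0T; exact: le_trans (ip_emb_res_le l0 st) rt.
- apply/(LL2_eq_emb l0); apply: aeS (snrm0_ae sr0 s0 r0) => y hy.
  by rewrite emb_res//; case: ifPn => // /existsPn h; rewrite emb_out.
split.
- by move=> t; rewrite /= in_itv => t0T; apply: LL2_res; exact: sq.
- move=> t; rewrite /= in_itv/= => t0T.
  have p0 s : (0 <= LL2norm l (res (r s) - res (r t))%R)%E by exact: sqrte_ge0.
  apply/(cvge0P _ p0) => eps e0; have [de de0 hde] := rc t t0T _ (exprn_gt0 2 e0).
  apply/nbhs_ballP; exists de => //= s; rewrite /ball/= distrC => st; rewrite in_itv/= => s0T.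
  have sd : sqint lam (r s - r t) by apply: (sip_sub H); exact: sq.
  rewrite -res_sub LL2norm_emb//; last exact: LL2_res.
  rewrite lee_fin -(@ler_pXn2r _ 2) ?nnegrE ?snrm_ge0 ?(ltW e0)// (snrm_sqr H).
  exact: le_trans (ip_emb_res_le l0 sd) (hde s s0T st).
- have h := ae_and rae (ae_sl_sqint sr).
  apply: aeS h => t [h1 h2]; rewrite /= in_itv/= => t0T.
  have t0T' : 0 <= t <= T by case/andP: t0T => /ltW-> /ltW->.
  apply/(LL2_eq_emb l0); apply: aeS (snrm0_ae (sq t t0T') h2 (h1 t0T)) => y hy.
  by rewrite !emb_res// hy.
Qed.

Lemma state_weak_solution : weak_solution T l D u rho0 state.
Proof.
split.
- by split; [exact: state_L2_Bochner|exists state_t; exact: state_time_deriv].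
- by have [r [h1 h2 _]] := state_CL2_rep; exists r.
move=> phi Vp psi tpsi; rewrite (weak_form_eq sr ss _ Vp tpsi); first exact: state_weak_form.
by apply: aeS vv_ae => t vt _; split; [move=> i; exact: aeT|exact: LL2_eq_Dx_res].
Qed.

(** [Kr] and [Ks] bound the squared norms of [rho] and [sigma] relative to [E0]. The energy controls
    [Dmin D] times the latter, whence the final division in [Ks]. *)
Let Kr : R := T * A.
Let Ks : R := (1 + m ^+ 2 / Dmin D * (T * A)) / Dmin D.

Let Kr0 : 0 <= Kr. Proof. by rewrite mulr_ge0 ?expR_ge0// ltW. Qed.

Let Ks0 : 0 <= Ks.
Proof.
have d0 := ltW Dmin_gt0; rewrite divr_ge0// addr_ge0// mulr_ge0 ?divr_ge0 ?sqr_ge0//.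
Qed.

Let rho_le : ip mu2 rho rho <= Kr * E0.
Proof. by have [r [_ _ _ _ []]] := energy. Qed.

Let sigma_le : ip mu2 sigma sigma <= Ks * E0.
Proof.
have [r [_ _ _ _ [_ h]]] := energy.
by rewrite /Ks mulrAC ler_pdivlMr ?Dmin_gt0// mulrC.
Qed.

Let flux_le : ip mu2 f f <= (2 * Dmax D ^+ 2 * Ks + 2 * m ^+ 2 * Kr) * E0.
Proof.
have hi := integrableRD (integrableRZ (2 * Dmax D ^+ 2) (sqint_mul ss ss))
  (integrableRZ (2 * m ^+ 2) (sqint_mul sr sr)).
apply: (@le_trans _ _ (2 * Dmax D ^+ 2 * ip mu2 sigma sigma + 2 * m ^+ 2 * ip mu2 rho rho)).
  rewrite /ip -!RintegralZl//; [|exact: sqint_mul..].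
  rewrite -RintegralD//; [|by apply: integrableRZ; exact: sqint_mul..].
  apply: le_Rintegral_int hi _ => [|z]; first exact: sqint_mul.
  rewrite /f /flux; have /andP[d1 d2] := diffusion_bound z.1; have u1 := drift_le z.
  have d0 := Dmin_gt0.
  move: (sigma z) (rho z) (diffusion z.1) (drift z) (Dmin D) (Dmax D) m d1 d2 d0 u1.
  move=> s r d w a b c ad db a0; rewrite ler_norml => /andP[h1 h2].
  have d2 : d ^+ 2 <= b ^+ 2 by rewrite ler_pXn2r ?nnegrE//; lra.
  have w2 : w ^+ 2 <= c ^+ 2 by have : 0 <= (c - w) * (c + w) by [apply: mulr_ge0; lra]; rewrite !expr2; lra.
  have h3 : (d * s + w * r) * (d * s + w * r) <= 2 * d ^+ 2 * (s * s) + 2 * w ^+ 2 * (r * r).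
    by have := sqr_ge0 (d * s - w * r); rewrite !expr2; lra.
  apply: (le_trans h3); rewrite lerD// ler_wpM2r ?ler_wpM2l// -expr2 sqr_ge0//.
by rewrite [leRHS]mulrDl; apply: lerD; rewrite -[leRHS]mulrA; apply: ler_wpM2l => //;
  rewrite mulr_ge0// sqr_ge0.
Qed.

Lemma dual_norm_eq F G : Vdual_eq l F G -> dual_norm l F = dual_norm l G.
Proof.
move=> FG; rewrite /dual_norm; congr ereal_sup; apply/seteqP.
by split=> _ [phi [Vp p1] <-]; exists phi => //; rewrite FG.
Qed.

(** By uniqueness the chosen derivative agrees with [state_t] at almost every time, and the dual
    norm of the latter is bounded by the norm of the flux. *)
Lemma time_deriv_norm :
  (L2_Bochner_norm (dual_norm l) T (time_deriv T l state) <= (Num.sqrt (ip mu2 f f))%:E)%E.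
Proof.
have htd : is_time_deriv T l state (time_deriv T l state).
  by apply: (@xgetPex _ (fun _ _ => 0) [set g | is_time_deriv T l state g]); exists state_t; exact: state_time_deriv.
have [if_ <-] := ip_sl_integrable sf; apply: L2_Bochner_norm_le => //.
- exact: dual_norm_ge0.
- by move=> t; exact: (sip_ge0 H).
apply: ae2 (time_deriv_unique T0 l0 htd state_time_deriv) (ae_sl_sqint sf) => t he st t0T.
rewrite (dual_norm_eq (he t0T)).
apply: (@le_trans _ _ ((snrm (ip lam) (sl f t))%:E ^+ 2)%E).
  by rewrite !expe2 lee_pmul ?dual_norm_ge0 ?dual_dx_le.
by rewrite expe2 -EFinM -expr2 lee_fin (snrm_sqr H).
Qed.

Let E0_ge0 : 0 <= E0. Proof. exact: (sip_ge0 H). Qed.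

Lemma state_CL2_norm : (CL2_norm T l state <= (Num.sqrt A * Num.sqrt E0)%:E)%E.
Proof.
have [r [hr _ rA]] := state_CL2_rep; apply: (CL2_norm_le T0 l0 hr) => t t0T.
by rewrite -sqrtrM ?expR_ge0// /snrm ler_wsqrtr// rA.
Qed.

Lemma state_L2V_norm : (L2V_norm T l state <= (Num.sqrt (Kr + Ks) * Num.sqrt E0)%:E)%E.
Proof.
apply: (le_trans L2V_norm_state); rewrite lee_fin -sqrtrM; last exact: addr_ge0.
by rewrite ler_wsqrtr// mulrDl lerD.
Qed.

Lemma state_Wnorm : (Wnorm T l state <=
  (Num.sqrt (Kr + Ks + (2 * Dmax D ^+ 2 * Ks + 2 * m ^+ 2 * Kr)) * Num.sqrt E0)%:E)%E.
Proof.
have K4 : 0 <= 2 * Dmax D ^+ 2 * Ks + 2 * m ^+ 2 * Kr.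
  by rewrite addr_ge0// mulr_ge0// mulr_ge0// sqr_ge0.
have K0 := addr_ge0 (addr_ge0 Kr0 Ks0) K4.
rewrite -sqrtrM//; move: K0; set K := (_ + _ + (_ + _)) => K0.
rewrite /Wnorm -[leRHS]/(sqrte (K * E0)%:E) lee_sqrt; last by rewrite lee_fin mulr_ge0.
have sq (x : \bar R) (y : R) : (0 <= x)%E -> 0 <= y -> (x <= (Num.sqrt y)%:E)%E -> (x ^+ 2 <= y%:E)%E.
  move=> x0 y0 xy; rewrite -[y]sqr_sqrtr// expe2 expr2 EFinM; exact: lee_pmul.
have h1 := sq _ _ (sqrte_ge0 _) (addr_ge0 (sip_ge0 (ip_sip mu2) rho) (sip_ge0 (ip_sip mu2) sigma)) L2V_norm_state.
have h2 := sq _ _ (sqrte_ge0 _) (sip_ge0 (ip_sip mu2) f) time_deriv_norm.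
apply: (le_trans (leeD h1 h2)); rewrite -EFinD lee_fin /K [leRHS]mulrDl lerD//.
by rewrite mulrDl lerD.
Qed.
End solution.

(** * Curves in L2 as functions of two variables *)

Section representation.
Variables (h : R -> R -> R) (N2 : R -> R).
Hypothesis hN : {ae lam, forall t, sqint lam (h t) /\ ip lam (h t) (h t) <= N2 t}.
Hypotheses (iN : lam.-integrable setT (EFin \o N2)) (N_ge0 : forall t, 0 <= N2 t).
Hypothesis hm : forall w, sqint lam w -> exists k : R -> R,
  measurable_fun setT (k : measurableTypeR R -> R) /\ {ae lam, forall t, k t = ip lam (h t) w}.

(** Graph of the functional $F\mapsto\int(h(t),F(t))\,dt$. As [h] is not known to be jointly
    measurable, membership includes an integrable version [k] of the integrand. *)
Let M : set ((R * R -> R) * R) := [set p | sqint mu2 p.1 /\ exists k : R -> R,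
  [/\ lam.-integrable setT (EFin \o k), {ae lam, forall t, k t = ip lam (h t) (sl p.1 t)} &
      p.2 = \int[lam]_t k t]].

Let sqint_root (q : R -> R) : lam.-integrable setT (EFin \o q) -> (forall t, 0 <= q t) ->
  sqint lam (fun t => Num.sqrt (q t)) /\
  ip lam (fun t => Num.sqrt (q t)) (fun t => Num.sqrt (q t)) = \int[lam]_t q t.
Proof.
move=> iq q0; have e t : Num.sqrt (q t) ^+ 2 = q t by exact: sqr_sqrtr.
split; last by apply: eq_Rintegral => t _; rewrite -expr2.
split; first exact: measurable_sqrt_comp (measurable_of_integrable iq).
by rewrite (_ : _ \o _ = EFin \o q)//; apply/funext => t /=; rewrite e.
Qed.

Let M_bound p : M p -> p.2 ^+ 2 <= (\int[lam]_t N2 t) * ip mu2 p.1 p.1.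
Proof.
move=> [sp [k [ik kE ->]]]; have [iq <-] := ip_sl_integrable sp.
have q0 t : 0 <= ip lam (sl p.1 t) (sl p.1 t) by exact: (sip_ge0 H).
have [s1 <-] := sqint_root iN N_ge0; have [s2 <-] := sqint_root iq q0.
have := sip_CS H s1 s2; apply: le_trans.
set I := ip lam _ _; have I0 : 0 <= I by apply: Rintegral_ge0 => t _; rewrite mulr_ge0 ?sqrtr_ge0.
have kI : {ae lam, forall t, `|k t| <= Num.sqrt (N2 t) * Num.sqrt (ip lam (sl p.1 t) (sl p.1 t))}.
  apply: ae2 kE (ae_and hN (ae_sl_sqint sp)) => t -> [[sh hle] st].
  apply: (le_trans (snrm_CS H sh st)); rewrite ler_wpM2r ?snrm_ge0//.
  exact: ler_wsqrtr.
rewrite -[X in X <= _]real_normK ?num_real// ler_pXn2r ?nnegrE//.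
rewrite ler_norml; apply/andP; split.
  rewrite lerNl -mulN1r -RintegralZl//; apply: ae_le_Rintegral; [exact: integrableRZ|exact: sqint_mul|].
  by apply: aeS kI => t; rewrite ler_norml mulN1r lerNl => /andP[].
apply: ae_le_Rintegral => //; first exact: sqint_mul.
by apply: aeS kI => t; rewrite ler_norml => /andP[].
Qed.

(** Cauchy-Schwarz bounds the functional, [N2] dominating the squared norm of [h]. Its Riesz
    representative has the same pairings as [h] with each element of a dense sequence at almost
    every time, so the two agree there. *)
Lemma bochner_represent : exists F, sqint mu2 F /\
  {ae lam, forall t, ip lam (sl F t - h t) (sl F t - h t) = 0}.
Proof.
have [|||||z [sz zM _]] := @riesz_subspace R _ (sqint mu2) (ip mu2) (ip_sip mu2) M
  (\int[lam]_t N2 t) (@ip_complete _ _ R mu2).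
- exact: Rintegral_ge0.
- split; first exact: sqint0.
  exists (cst 0); split; last by rewrite Rintegral_cst// mul0r.
    by rewrite (_ : _ \o _ = cst 0%E)//; exact: integrable0.
  by apply: aeS hN => t [sh _]; rewrite -[sl _ t]/(0 : R -> R) (sip0r H).
- by move=> p [].
- move=> a p q [sp [k [ik kE kp]]] [sq [k' [ik' kE' kq]]]; split; first exact: (sip_comb (ip_sip mu2)).
  exists (fun t => a * k t + k' t); split.
  + by apply: integrableRD => //; exact: integrableRZ.
  + have h1 := ae_and (ae_sl_sqint sp) (ae_sl_sqint sq).
    apply: ae2 (ae_and kE kE') (ae_and hN h1).
    move=> t [-> ->] [[sh _] [h2 h3]] /=.
    have -> : sl (a *: p.1 + q.1) t = a *: sl p.1 t + sl q.1 t by [].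
    by rewrite (sip_linr H).
  + by rewrite RintegralD ?RintegralZl ?kp ?kq//; exact: integrableRZ.
- exact: M_bound.
exists z; split => //; have [ss sd] := sep.
have key w : sqint lam w -> {ae lam, forall t, ip lam (sl z t) w = ip lam (h t) w}.
  move=> sw; have [k [mk kE]] := hm sw.
  have sk : sqint lam k.
    apply: (sqint_ae_le mk (integrableRZ (ip lam w w) iN)).
      by move=> t; rewrite mulr_ge0// (sip_ge0 H).
    apply: ae2 kE hN => t -> [sh hle]; apply: (le_trans (sip_CS H sh sw)).
    by rewrite mulrC ler_wpM2l// (sip_ge0 H).
  have sz' := ip_slice_integrable sz sw.
  have orth a b : a < b -> ip lam ((fun t => ip lam (sl z t) w) - k) (ind a b) = 0.
    move=> ab; have si := sqint_ind a b; rewrite (sip_subl H)//; apply/eqP; rewrite subr_eq0; apply/eqP.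
    have := zM (tens w (ind a b), ip lam k (ind a b)); rewrite /=.
    have [-> _] := ip_sl_tens sz sw si => <-; first by apply: eq_Rintegral => t _; rewrite mulrC.
    split; first exact: sqint_tens.
    exists (fun t => k t * ind a b t); split => //; first exact: sqint_mul.
    apply: ae2 kE hN => t -> [sh _].
    rewrite /ip -RintegralZr//; last exact: sqint_mul.
    by apply: eq_Rintegral => x _; rewrite mulrA.
  apply: ae2 (ip_eq0 (sip_sub H sz' sk) (ind_orth (sip_sub H sz' sk) orth)) kE => t + <-.
  by rewrite -[(_ - k) t]/(ip lam (sl z t) w - k t) => /subr0_eq.
apply: ae2 (ae_nat (fun n => key _ (ss n))) (ae_and hN (ae_sl_sqint sz)).
move=> t ht [[sh _] st]; apply: (separated_orth sep); first exact: (sip_sub H).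
by move=> k; rewrite (sip_subl H)// ht subrr.
Qed.
End representation.

(** Meant for the embedding and for the embedded space derivative. The Lipschitz bound in the norm
    of [V] supplies measurable versions of the norm and of the pairings of [L (rho t)], which
    [bochner_represent] asks for. *)
Lemma V_represent (L : edge_fun -> R -> R) rho :
  (forall v, V l v -> sqint lam (L v)) ->
  (forall v w, V l v -> V l w -> snrm (ip lam) (L v - L w) <= vnrm l (v - w)) ->
  (forall v, V l v -> snrm (ip lam) (L v) <= vnrm l v) ->
  L2_Bochner (V l) (HH1norm l) T rho ->
  exists F, [/\ sqint mu2 F, forall z, ~~ (0 < z.2 <= T) -> F z = 0 &
    {ae lam, forall t, 0 < t < T -> {ae lam, forall y, sl F t y = L (rho t) y}}].
Proof.
move=> sL dL nL [rV rm rn].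
have aeV : {ae lam, forall t, 0 < t < T -> V l (rho t)}.
  by apply: aeS rV => t ht t0; apply: ht; rewrite /= in_itv.
have p0 := @HH1norm_ge0 R N l.
have mz (k : R -> R) : measurable_fun setT (k : measurableTypeR R -> R) ->
    measurable_fun setT (zext T k : measurableTypeR R -> R).
  move=> mk; exact: (measurable_restrictT _ (measurable_itv _)).1 (measurable_funTS mk).
have lip1 v w : V l v -> V l w ->
    (`|snrm (ip lam) (L v) - snrm (ip lam) (L w)|%:E <= 1%:E * HH1norm l (v - w)%R)%E.
  move=> Vv Vw; rewrite mul1e HH1norm_emb//; last by have [] := V_sub l0 Vv Vw.
  by rewrite lee_fin (le_trans _ (dL v w Vv Vw))//; apply: (snrm_dist H); exact: sL.
have [n [mn nE]] := strongly_measurable_lipschitz p0 rm (V_0 l0) (V_add l0) ler01 aeV lip1.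
have sn : sqint lam (zext T n).
  apply: (L2_Bochner_sqint p0 rn ltr01 mn); apply: ae2 nE aeV => t h1 h2 t0T.
  rewrite h1// mul1e HH1norm_emb; [|exact: l0|exact: h2].
  by rewrite lee_fin ger0_norm ?snrm_ge0// nL//; exact: h2.
pose h t : R -> R := if 0 < t < T then L (rho t) else 0.
have [||||F0 [sF0 F0E]] := @bochner_represent h (fun t => zext T n t ^+ 2).
- apply: ae2 nE aeV => t h1 h2; rewrite /h zextE; case: ifP => t0T.
    by split; [apply: sL; exact: h2|rewrite h1// (snrm_sqr H)].
  by split; [exact: sqint0|rewrite (sip0r H) ?expr0n//; exact: sqint0].
- by case: sn.
- by move=> t; exact: sqr_ge0.
- move=> w sw.
  have lip2 v v' : V l v -> V l v' -> (`|ip lam (L v) w - ip lam (L v') w|%:E <=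
      (snrm (ip lam) w)%:E * HH1norm l (v - v')%R)%E.
    move=> Vv Vv'; rewrite HH1norm_emb//; last by have [] := V_sub l0 Vv Vv'.
    have s1 := sL _ Vv; have s2 := sL _ Vv'.
    rewrite -(sip_subl H)// -EFinM lee_fin mulrC.
    apply: (le_trans (snrm_CS H (sip_sub H s1 s2) sw)).
    by rewrite ler_wpM2r ?snrm_ge0// dL.
  have [k [mk kE]] := strongly_measurable_lipschitz p0 rm (V_0 l0) (V_add l0)
    (snrm_ge0 _ _) aeV lip2.
  exists (zext T k); split; first exact: mz.
  apply: aeS kE => t h1; rewrite /h zextE; case: ifP => [/h1//|_].
  by rewrite (sipC H) (sip0r H).
exists (cut T F0); split.
- exact: sqint_cut.
- by move=> z hz; rewrite /cut indE (negbTE hz) mul0r.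
apply: ae2 F0E (ae_and aeV (ae_sl_sqint sF0)) => t e [Vt st] t0T.
have e' : {ae lam, forall y, sl F0 t y = L (rho t) y}.
  by move: e; rewrite /h t0T; apply: snrm0_ae => //; apply: sL; exact: Vt.
apply: aeS e' => y <-; rewrite -[LHS]/(ind 0 T t * F0 (y, t)) ind_in ?mul1r//.
by case/andP: t0T => -> /ltW.
Qed.

(** * Uniqueness *)

Lemma sol_unique r0 F G F' G' : sqint lam r0 -> soll r0 F G -> soll r0 F' G' ->
  {ae lam, forall t, ip lam (sl F t - sl F' t) (sl F t - sl F' t) = 0}.
Proof.
move=> sr0 [[sF sG] z1 v1 e1] [[sF' sG'] z2 v2 e2].
have HQ := ip_sip mu2.
have sd : sqint mu2 (F - F') by exact: (sip_sub HQ).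
have sd' : sqint mu2 (G - G') by exact: (sip_sub HQ).
have fd : fl (F - F') (G - G') = fl F G - fl F' G'.
  apply/funext => z; rewrite -[RHS]/(fl F G z - fl F' G' z) /flux.
  by rewrite -[(G - G') z]/(G z - G' z) -[(F - F') z]/(F z - F' z); ring.
have hs : soll 0 (F - F') (G - G').
  split => //.
  - move=> z hz; have [h1 h2] := z1 z hz; have [h3 h4] := z2 z hz.
    by rewrite -[(F - F') z]/(F z - F' z) -[(G - G') z]/(G z - G' z) h1 h2 h3 h4 subrr.
  - apply: ae2 v1 v2 => t h1 h2; have := VV_lin sNa sNb (-1) h2 h1.
    by rewrite !scaleN1r ![- _ + _]addrC.
  - move=> v w hvw; have [sv sw _] := hvw.
    have h3 := ae_and (ae_sl_sqint sF) (ae_sl_sqint sF').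
    apply: ae2 (ae_and (e1 v w hvw) (e2 v w hvw)) h3 => t [h1 h2] [s1 s2] t0T.
    have stw : sqint mu2 (tens w (ind 0 t)) by apply: sqint_tens => //; exact: sqint_ind.
    have -> : sl (F - F') t = sl F t - sl F' t by [].
    have e0 : ip mu2 (fl (F - F') (G - G')) (tens w (ind 0 t)) =
        ip mu2 (fl F G) (tens w (ind 0 t)) - ip mu2 (fl F' G') (tens w (ind 0 t)).
      by rewrite fd (sip_subl HQ)//; exact: sqint_fl.
    rewrite [X in _ = _ - X]e0 (sip_subl H)// h1// h2// (sipC H 0) (sip0r H)// sub0r.
    have alg (a b c : R) : a - b - (a - c) = - (b - c) by ring.
    exact: alg.
have := rho_bound T0 Dmin_gt0 measurable_diffusion diffusion_bound measurable_drift_line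
  drift_le sNa sNb sep (@V_dense R N l l0) (sqint0 lam) hs.
rewrite (sip0r H) ?mulr0; last exact: sqint0.
move=> d0; have {}d0 : ip mu2 (F - F') (F - F') = 0.
  by apply/eqP; rewrite eq_le d0 (sip_ge0 HQ).
have [md _] := sd.
apply: aeS (ae_sl (ip_eq0 sd d0)) => t ht.
by apply: ip_ae0 => //; exact: (measurable_sl t md).
Qed.

Lemma ip_ae_eq_l f g g' : sqint lam f -> sqint lam g -> sqint lam g' ->
  {ae lam, forall y, g y = g' y} -> ip lam g f = ip lam g' f.
Proof. by move=> sf sg sg' e; rewrite (sipC H) [RHS](sipC H); exact: ip_ae_eq. Qed.

(** The function [w] may be nonzero between the edges, where the embedded derivative of [res v]
    vanishes. The flux vanishes there too, as [f] and [g] do, and on the edges the two derivatives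
    agree. *)
Lemma flux_edges_ip f g t v w : sqint lam f -> sqint lam g -> VVl v w ->
  {ae lam, forall y, f y = emb (res f) y} -> {ae lam, forall y, g y = emb (res g) y} ->
  ip lam (fun y => diffusion y * g y + drift (y, t) * f y) (emb (Dx l (res v))) =
  ip lam (fun y => diffusion y * g y + drift (y, t) * f y) w.
Proof.
move=> sf sg hvw fe ge; set k := fun y => _.
have mdr : measurable_fun setT ((fun y => drift (y, t)) : measurableTypeR R -> R).
  exact: (measurable_sl t measurable_drift_line).
have sk : sqint lam k.
  apply: (sip_add H).
    apply: (sqint_bounded (K := Dmax D) sg) => [|y]; first exact: measurable_diffusion.
    have /andP[h1 h2] := diffusion_bound y.
    by rewrite ger0_norm// (le_trans _ h1)// ltW// Dmin_gt0.
  by apply: (sqint_bounded (K := m) sf) => // y; exact: drift_le.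
have ke : {ae lam, forall y, k y = emb (res k) y}.
  apply: ae2 fe ge => y; rewrite !emb_res// /k; case: ifP => // _ -> ->.
  by rewrite !mulr0 addr0.
have Lk := LL2_res l sk; have se := sqint_emb Lk; have [_ sw _] := hvw.
have sD := sqint_Dx l0 (VV_V hvw).1.
rewrite [LHS](sipC H) [RHS](sipC H) (ip_ae_eq sD sk se ke) (ip_ae_eq sw sk se ke).
by rewrite [LHS](sipC H) [RHS](sipC H) (ip_emb_Dx_res hvw Lk).
Qed.

(** [F] and [G] represent the embedded solution and its space derivative. A test pair of [VV] is
    reduced to its restriction to the edges, because [F] and [G] vanish almost everywhere between
    them, and so does the flux. *)
Lemma weak_solution_sol rho0 rho : LL2 l rho0 -> weak_solution T l D u rho0 rho ->
  exists F G, soll (emb rho0) F G /\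
  {ae lam, forall t, 0 < t < T -> {ae lam, forall y, sl F t y = emb (rho t) y}}.
Proof.
move=> Lrho0 [[hB _] [r hr r0] hweak].
have [F [sF zF FE]] := V_represent (sqint_V l0) (fun v w Vv Vw => (vnrm_sub_emb l0 Vv Vw).1)
  (fun v _ => snrm_emb_le l v) hB.
have [G [sG zG GE]] := @V_represent (fun v => emb (Dx l v)) rho (sqint_Dx l0)
  (fun v w Vv Vw => (vnrm_sub_emb l0 Vv Vw).2) (fun v _ => snrm_Dx_le l v) hB.
exists F, G; split; last exact: FE.
have aeV : {ae lam, forall t, 0 < t < T -> V l (rho t)}.
  by case: hB => rV _ _; apply: aeS rV => t ht t0; apply: ht; rewrite /= in_itv.
have both : {ae lam, forall t, [/\ sqint lam (sl F t), sqint lam (sl G t) & 0 < t < T ->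
   [/\ V l (rho t), {ae lam, forall y, sl F t y = emb (rho t) y} &
       {ae lam, forall y, sl G t y = emb (Dx l (rho t)) y}]]}.
  have h1 := ae_and FE GE.
  have h2 := ae_and (ae_sl_sqint sF) (ae_sl_sqint sG).
  apply: ae2 aeV (ae_and h1 h2) => t Vt [[f1 g1] [f2 g2]].
  by split => // t0T; split; [exact: Vt|exact: f1|exact: g1].
have edges f v : LL2 l v -> {ae lam, forall y, f y = emb v y} ->
    {ae lam, forall y, f y = emb (res f) y}.
  move=> Lv; apply: aeS => y hy; rewrite emb_res//; case: ifPn => // /existsPn hn.
  by rewrite hy emb_out.
have sfl := sqint_fl sF sG.
have tN : {ae lam, forall t, t != T}.
  exists [set T]; split => //; first exact: lebesgue_measure_set1.
  by move=> z /= /negP; rewrite negbK => /eqP.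
split => //; first by move=> z hz; rewrite zF ?zG.
  apply: ae2 both tN => t [st1 st2 h] tT.
  have [t0T|t0T] := boolP (0 < t < T); last first.
    have hz : ~~ (0 < t <= T).
      by apply: contra t0T => /andP[-> h1]; rewrite lt_neqAle tT.
    have VVe f g : f = 0 -> g = 0 -> VVl f g by move=> -> ->; exact: VV0.
    by apply: VVe; apply/funext => y; [exact: zF|exact: zG].
  have [Vt fe ge] := h t0T; have [s1 s2 an] := V_VV_Dx l0 Vt.
  split => // k.
  have e1 := ip_ae_eq_l (sNa k) st1 s1 fe; have e2 := ip_ae_eq_l (sNb k) st2 s2 ge.
  exact: etrans (congr2 +%R e1 e2) (an k).
move=> v w hvw; pose phi := res v; have [Vp dp] := VV_V hvw; have [sv sw _] := hvw.
have sep_ := sqint_V l0 Vp; have sD := sqint_Dx l0 Vp.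
pose k t := ip lam (sl F t) (emb phi); pose q t := - ip lam (sl (fl F G) t) (emb (Dx l phi)).
have sk : sqint lam k by exact: ip_slice_integrable.
have sq : sqint lam q.
  have := sip_scale H (-1) (ip_slice_integrable sfl sD).
  congr (sqint lam _); apply/funext => t.
  by rewrite -[LHS]/(-1 * ip lam (sl (fl F G) t) (emb (Dx l phi))) mulN1r.
have zs (f : R -> R) : sqint lam f -> sqint lam (zext T f).
  move=> sf; have [mf _] := sf.
  apply: (@sqint_le _ _ _ lam _ f) => // [|t].
    exact: (measurable_restrictT _ (measurable_itv _)).1 (measurable_funTS mf).
  by rewrite zextE; case: ifP; rewrite ?normr0.
have ik := sqint_zext_integrable (zs _ sk); have iq := sqint_zext_integrable (zs _ sq).
have hrho : {ae lam, forall t, 0 < t < T -> LL2_eq l (rho t) (res (sl F t)) /\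
    LL2_eq l (Dx l (rho t)) (res (sl G t))}.
  apply: aeS both => t [_ _ h] /h[Vt fe ge].
  have Le v' f : LL2 l v' -> {ae lam, forall y, f y = emb v' y} -> LL2_eq l v' (res f).
    move=> Lv fv; apply/(LL2_eq_emb l0); apply: ae2 fv (edges _ _ Lv fv) => y h1 h2.
    by rewrite -h1.
  by split; apply: Le => //; [exact: V_LL2|exact: is_weak_deriv_LL2 (is_weak_deriv_Dx Vt)].
(* Du Bois-Reymond's lemma in time: the tested equation says that [q] is the weak derivative of [k],
   which is the integrated equation up to a constant. *)
have [|c hc] := weak_deriv_primitive T0 ik iq.
  move=> psi tpsi; have := hweak phi Vp psi tpsi; rewrite (weak_form_eq sF sG hrho Vp tpsi).
  have [_ _ _ psi_out psi'_out] := test_fun_continuous tpsi.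
  move/eqP; rewrite addrC subr_eq0 => /eqP e.
  transitivity (\int[lam]_t (k t * derive1 psi t)).
    apply: eq_Rintegral => t _; rewrite zextE; case: ifPn => // /psi'_out ->.
    by rewrite !mulr0.
  rewrite -e -mulN1r -RintegralZl//.
    apply: eq_Rintegral => t _; rewrite zextE; case: ifPn => [_|/psi_out ->]; last by rewrite !mulr0.
    by rewrite mulN1r /q mulNr opprK.
  have [_ cpsi _ _ _] := test_fun_continuous tpsi.
  have [_ [K psiK]] := continuous_support T0 cpsi psi_out.
  by apply: (integrable_mul_bounded (K := K)) => //; exact: continuous_measurable.
have Lp := V_LL2 Vp; have [Lr _ rae] := hr.
have r0I : `[0, T]%classic (0 : R) by rewrite /= in_itv/= lexx ltW.
(* The constant is read off at time 0: along times tending to 0 the primitive tends to 0, and the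
   continuous representative tends to the initial datum. *)
have c0 : c = ip lam (emb rho0) (emb phi).
  have kr : {ae lam, forall t, 0 < t < T -> c + primitive (zext T q) t = ip lam (emb (r t)) (emb phi)}.
    apply: ae2 both (ae_and hc rae) => t [st _ h] [h1 h2] t0T.
    have [Vt fe _] := h t0T; have tI : `[0, T]%classic t by rewrite /= in_itv/=; case/andP: t0T => /ltW-> /ltW->.
    rewrite -h1// zextE t0T /k (sipC H) [RHS](sipC H).
    rewrite (ip_ae_eq sep_ st (sqint_V l0 Vt) fe); apply/esym; apply: ip_ae_eq => //.
    - by apply: sqint_emb; exact: Lr.
    - exact: sqint_V.
    - by apply/(LL2_eq_emb l0); apply: h2; rewrite /= in_itv.
  have e0 : ip lam (emb rho0) (emb phi) = ip lam (emb (r 0)) (emb phi).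
    rewrite (sipC H) [RHS](sipC H); apply/esym; apply: ip_ae_eq => //.
    - by apply: sqint_emb; exact: Lr.
    - exact: sqint_emb.
    - exact/(LL2_eq_emb l0).
  apply/eqP; rewrite -subr_eq0 e0 -normr_le0; apply/ler_addgt0Pr => eps eps0; rewrite add0r.
  have P1 : 0 < snrm (ip lam) (emb phi) + 1 by rewrite ltr_wpDl// snrm_ge0.
  have t00 : 0 <= (0 : R) <= T by rewrite lexx ltW.
  have [de de0 hde] := CL2_rep_continuous l0 hr t00 (divr_gt0 (divr_gt0 eps0 (ltr0n R 2)) P1).
  have [s_ [sP cs]] := ae_seq T0 t00 kr.
  have cp : primitive (zext T q) (s_ n) @[n --> \oo] --> (0 : R).
    rewrite -(primitive_zext_le0 T q); apply: (cvg_comp s_) cs _; exact: primitive_continuous.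
  move/cvgrPdist_lt : cs => /(_ _ de0)[n0 _ hn0].
  move/cvgrPdist_le : cp => /(_ _ (divr_gt0 eps0 (ltr0n R 2)))[n1 _ hn1].
  have := hn0 (maxn n0 n1) (leq_maxl _ _); have := hn1 (maxn n0 n1) (leq_maxr _ _) => /=.
  have [/andP[] ] := sP (maxn n0 n1); move: (s_ _) => s sgt sT hs.
  rewrite !sub0r !normrN => hp hd.
  have sI : 0 <= s <= T by rewrite !ltW.
  have sI' : `[0, T]%classic s by rewrite /= in_itv.
  have q1 := sqint_emb (Lr s sI'); have q0 := sqint_emb (Lr 0 r0I).
  have -> : c - ip lam (emb (r 0)) (emb phi) =
     ip lam (emb (r s) - emb (r 0)) (emb phi) - primitive (zext T q) s.
    by rewrite (sip_subl H)// -hs; ring.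
  rewrite (le_trans (ler_normB _ _))// [leRHS](splitr eps) lerD//.
  apply: (le_trans (snrm_CS H (sip_sub H q1 q0) sep_)).
  have h5 := hde s sI; rewrite subr0 in h5; have {}h5 := h5 hd.
  apply: (@le_trans _ _ (eps / 2 / (snrm (ip lam) (emb phi) + 1) * snrm (ip lam) (emb phi))).
    by rewrite ler_wpM2r ?snrm_ge0.
  by rewrite mulrAC ler_pdivrMr// ler_wpM2l ?lerDl// divr_ge0// ltW.
apply: (ae2 _ both hc) => t [st _ h] hct t0T; have [Vt fe _] := h t0T.
have kt : ip lam (sl F t) v = k t.
  rewrite /k (sipC H) [RHS](sipC H) (ip_ae_eq sv st (sqint_V l0 Vt) fe).
  rewrite (ip_ae_eq sep_ st (sqint_V l0 Vt) fe) (sipC H) [RHS](sipC H).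
  by rewrite ip_emb_res//; exact: V_LL2.
have rv : ip lam (emb rho0) v = ip lam (emb rho0) (emb phi) by rewrite ip_emb_res.
have := hct t0T; rewrite zextE t0T kt rv => ->; rewrite c0; congr (_ + _).
have [-> iw] := ip_sl_tens sfl sw (sqint_ind 0 t).
rewrite -mulN1r -RintegralZl//; rewrite /primitive Rintegral_mkcond.
case/andP: t0T => t0 tT.
apply/esym; apply: Rintegral_ae_measurable_r.
  exact: (measurable_restrictT _ (measurable_itv _)).1 (measurable_funTS (measurable_of_integrable iq)).
apply: aeS both => s [s1 s2 hs]; rewrite patchE mem_setE in_itv/= zextE indE.
case: (ltP 0 s) => sgt /=; last by rewrite if_same mul0r mulr0.
case: (leP s t) => hst /=; last by rewrite mul0r mulr0.
rewrite (le_lt_trans hst tT) mul1r mulN1r /q; congr (- _).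
have [|Vs fs gs] := hs; first by rewrite sgt (le_lt_trans hst tT).
have := flux_edges_ip s s1 s2 hvw (edges _ _ (V_LL2 Vs) fs)
  (edges _ _ (is_weak_deriv_LL2 (is_weak_deriv_Dx Vs)) gs).
by move->.
Qed.

Lemma weak_solution_unique rho0 F G rho : LL2 l rho0 -> soll (emb rho0) F G ->
  weak_solution T l D u rho0 rho ->
  {ae lam, forall t, 0 < t < T -> LL2_eq l (rho t) (state F t)}.
Proof.
move=> Lrho0 hs hw; have [F' [G' [hs' F'E]]] := weak_solution_sol Lrho0 hw.
have hd := sol_unique (sqint_emb Lrho0) hs' hs.
have [[sF _] _ _ _] := hs; have [[sF' _] _ _ _] := hs'.
have sq := ae_and (ae_sl_sqint sF') (ae_sl_sqint sF).
apply: ae2 (ae_and hd sq) F'E => t [d0 [s1 s2]] e t0T.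
apply/(LL2_eq_emb l0); apply: ae2 (snrm0_ae s1 s2 d0) (e t0T) => y h1 h2.
rewrite /state emb_res//; case: ifPn => [_|/existsPn hn]; first exact: etrans (esym h2) h1.
by rewrite emb_out.
Qed.

Lemma exists_state rho0 : LL2 l rho0 -> exists F G, soll (emb rho0) F G.
Proof.
move=> Lrho0; exact: (exists_sol T0 Dmin_gt0 measurable_diffusion diffusion_bound
  measurable_drift_line drift_le sNa sNb (sqint_emb Lrho0)).
Qed.
End coefficients.

(** * The constant of the estimates *)

Section constant.
Variable R : realType.

(** The estimates come with square roots of the energy constants; $\sqrt x\le(1+x)/2$ replaces each
    of them by its argument. The sum is large enough for both estimates: the factor $1+2m^2$ goes
    with $\|\rho\|^2$ and $1+2d_{\max}^2$ with $\|\sigma\|^2$, the added multiples coming from the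
    flux in the time derivative. *)
Definition fp_const (T dmin dmax m : R) : R :=
  1 + expR (m ^+ 2 / dmin * T) + (1 + 2 * m ^+ 2) * (T * expR (m ^+ 2 / dmin * T)) +
  (1 + 2 * dmax ^+ 2) * ((1 + m ^+ 2 / dmin * (T * expR (m ^+ 2 / dmin * T))) / dmin).

Lemma fp_const_continuous T dmin dmax : continuous (fp_const T dmin dmax).
Proof.
have c2 : continuous (fun m : R => m ^+ 2) by exact: exprn_continuous.
have cd : continuous (fun m : R => m ^+ 2 / dmin).
  by move=> m; apply: cvgM; [exact: c2|exact: cvg_cst].
have ce : continuous (fun m : R => expR (m ^+ 2 / dmin * T)).
  move=> m; apply: (@continuous_comp _ _ _ (fun m : R => m ^+ 2 / dmin * T) expR).
    by apply: cvgM; [exact: cd|exact: cvg_cst].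
  exact: continuous_expR.
have cTe : continuous (fun m : R => T * expR (m ^+ 2 / dmin * T)).
  by move=> m; apply: cvgM; [exact: cvg_cst|exact: ce].
move=> m; apply: cvgD; first apply: cvgD; first apply: cvgD.
- exact: cvg_cst.
- exact: ce.
- apply: cvgM; last exact: cTe.
  by apply: cvgD; [exact: cvg_cst|apply: cvgM; [exact: cvg_cst|exact: c2]].
apply: cvgM; first exact: cvg_cst.
apply: cvgM; last exact: cvg_cst.
by apply: cvgD; [exact: cvg_cst|apply: cvgM; [exact: cd|exact: cTe]].
Qed.

Lemma fp_const_parts (T dmin m : R) : 0 < T -> 0 < dmin ->
  let A := expR (m ^+ 2 / dmin * T) in
  [/\ 0 <= A, 0 <= T * A & 0 <= (1 + m ^+ 2 / dmin * (T * A)) / dmin].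
Proof.
move=> T0 d0 A; have A0 : 0 <= A by exact: expR_ge0.
have TA0 : 0 <= T * A by rewrite mulr_ge0// ltW.
split => //; rewrite divr_ge0 ?(ltW d0)// addr_ge0// mulr_ge0// divr_ge0 ?sqr_ge0//.
exact: ltW.
Qed.

Lemma fp_const_gt0 (T dmin dmax m : R) : 0 < T -> 0 < dmin -> 0 < fp_const T dmin dmax m.
Proof.
move=> T0 d0; have /= [A0 K0 S0] := fp_const_parts m T0 d0; rewrite /fp_const.
have c1 : 0 <= 1 + 2 * m ^+ 2 by rewrite addr_ge0// mulr_ge0// sqr_ge0.
have c2 : 0 <= 1 + 2 * dmax ^+ 2 by rewrite addr_ge0// mulr_ge0// sqr_ge0.
by rewrite -!addrA ltr_wpDr// !addr_ge0// mulr_ge0.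
Qed.

Lemma sqrt_le_mean (x : R) : 0 <= x -> Num.sqrt x <= (1 + x) / 2.
Proof.
move=> x0; have := sqr_ge0 (Num.sqrt x - 1); rewrite sqrrB1 sqr_sqrtr//; lra.
Qed.

Lemma fp_const_CL2 (T dmin dmax m A Ks : R) : 0 < T -> 0 < dmin -> A = expR (m ^+ 2 / dmin * T) ->
  Ks = (1 + m ^+ 2 / dmin * (T * A)) / dmin ->
  Num.sqrt A + Num.sqrt (T * A + Ks) <= fp_const T dmin dmax m.
Proof.
move=> T0 d0 AE KE; have /= [] := fp_const_parts m T0 d0; rewrite /fp_const -AE -KE => A0 K0 S0.
have m2 := sqr_ge0 m; have d2 := sqr_ge0 dmax.
have := mulr_ge0 m2 K0; have := mulr_ge0 d2 S0.
have := sqrt_le_mean A0; have := sqrt_le_mean (addr_ge0 K0 S0).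
move: (Num.sqrt _) (Num.sqrt _) => p q.
move: Ks A (T * A) (m ^+ 2) (dmax ^+ 2) S0 K0 A0 {AE KE m2 d2}.
by move=> s a k b c s0 k0 a0 h1 h2 h3 h4; lra.
Qed.

Lemma fp_const_W (T dmin dmax m A Ks : R) : 0 < T -> 0 < dmin -> A = expR (m ^+ 2 / dmin * T) ->
  Ks = (1 + m ^+ 2 / dmin * (T * A)) / dmin ->
  Num.sqrt (T * A + Ks + (2 * dmax ^+ 2 * Ks + 2 * m ^+ 2 * (T * A))) <= fp_const T dmin dmax m.
Proof.
move=> T0 d0 AE KE; have /= [] := fp_const_parts m T0 d0; rewrite /fp_const -AE -KE => A0 K0 S0.
have m2 := sqr_ge0 m; have d2 := sqr_ge0 dmax.
have h1 := mulr_ge0 m2 K0; have h2 := mulr_ge0 d2 S0.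
have h0 : 0 <= T * A + Ks + (2 * dmax ^+ 2 * Ks + 2 * m ^+ 2 * (T * A)).
  by rewrite !addr_ge0// mulr_ge0// mulr_ge0.
have := sqrt_le_mean h0; move: (Num.sqrt _) => p.
move: Ks A (T * A) (m ^+ 2) (dmax ^+ 2) K0 S0 A0 h1 h2 {AE KE m2 d2 h0}.
by move=> s a k b c k0 s0 a0 h1 h2; lra.
Qed.
End constant.

Theorem theorem3p3 (R : realType) :
  exists C : R -> R -> R -> R -> R,
    (forall T dmin dmax : R, 0 < T -> 0 < dmin -> dmin <= dmax ->
       {within `[0, +oo[, continuous (C T dmin dmax)} /\
       forall m : R, 0 <= m -> 0 < C T dmin dmax m) /\
    forall (N : nat) (T : R) (l D : 'I_N -> R),
      (0 < N)%N -> 0 < T -> (forall i, 0 < l i) -> (forall i, 0 < D i) ->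
    forall (u : 'I_N -> R * R -> R) (rho0 : 'I_N -> R -> R),
      LLinf T l u -> LL2 l rho0 ->
    exists rho : R -> 'I_N -> R -> R,
      [/\ weak_solution T l D u rho0 rho,
          forall rho', weak_solution T l D u rho0 rho' ->
            \forall t \ae @lebesgue_measure R,
              `]0, T[ t -> LL2_eq l (rho' t) (rho t),
          (CL2_norm T l rho + L2V_norm T l rho <=
           (C T (Dmin D) (Dmax D) (fine (LLinf_norm T l u)))%:E *
             LL2norm l rho0)%E &
          (Wnorm T l rho <=
           (C T (Dmin D) (Dmax D) (fine (LLinf_norm T l u)))%:E *
             LL2norm l rho0)%E].
Proof.
exists (@fp_const R); split.
  move=> T dmin dmax T0 d0 _; split; last by move=> m _; exact: fp_const_gt0.
  by apply: continuous_subspaceT; exact: fp_const_continuous.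
move=> N T l D N0 T0 l0 D0 u rho0 Lu Lrho0.
have d0 := Dmin_gt0 N0 D0.
have [F [G hs]] := exists_state N0 T0 l0 D0 Lu Lrho0.
exists (state l F).
rewrite (LL2norm_emb l0 Lrho0) -EFinM -/(drift_bound T l u).
have E0 : 0 <= snrm (ip (@lebesgue_measure R)) (emb l rho0) by exact: snrm_ge0.
split.
- exact: state_weak_solution hs.
- move=> rho' hw; have h := weak_solution_unique N0 T0 D0 Lu Lrho0 hs hw.
  by apply: aeS h => t h; rewrite /= in_itv.
- apply: (le_trans (leeD (state_CL2_norm N0 T0 D0 Lu Lrho0 hs) (state_L2V_norm N0 T0 D0 Lu Lrho0 hs))).
  by rewrite -EFinD lee_fin -mulrDl ler_wpM2r//; exact: fp_const_CL2.
- apply: (le_trans (state_Wnorm N0 T0 D0 Lu Lrho0 hs)).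
  by rewrite lee_fin ler_wpM2r//; exact: fp_const_W.
Qed.
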